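(* Let $d,k\in\mathbb Z_+$, let $(X,\mathcal B(X),\mu)$ be a $\sigma$-finite measure space, and let $\mathcal T=\{(T_1^{t_1})_{t_1\in\mathbb R},\ldots,(T_d^{t_d})_{t_d\in\mathbb R}\}$ be a family of commuting measure-preserving $\mathbb R$-flows on $X$ such that the mapping $X\times\mathbb R^d\ni(x,t_1,\ldots,t_d)\mapsto T_1^{t_1}\cdots T_d^{t_d}x\in X$ is measurable. Let $\mathcal P=\{P_1,\ldots,P_d\}\subset\mathbb R[\mathrm t_1,\ldots,\mathrm t_k]$ be polynomials and let $f\in L^p(X)$ for some $p\in[1,\infty]$. For $M=(M_1,\ldots,M_k)\in\mathbb R_+^k$ set $$\mathcal A_Mf(x)=\mathcal A_{M_1,\ldots,M_k;X,\mathcal T}^{\mathcal P}f(x)=\frac{1}{M_1\cdots M_k}\int_{\prod_{j=1}^k[0,M_j]}f\big(T_1^{P_1(t)}\cdots T_d^{P_d(t)}x\big)\,dt,\qquad x\in X.$$ Then the following hold. (i) (Mean ergodic theorem) If $p\in(1,\infty)$, then the averages $\mathcal A_{M_1,\ldots,M_k}f$ converge in $L^p(X)$ norm as $\min\{M_1,\ldots,M_k\}\to\infty$. (ii) (Pointwise ergodic theorem) If $p\in(1,\infty)$, then the averages $\mathcal A_{M_1,\ldots,M_k}f$ converge pointwise $\mu$-almost everywhere on $X$ as $\min\{M_1,\ldots,M_k\}\to\infty$. (iii) (Maximal ergodic theorem) If $p\in(1,\infty]$, then $$\Big\|\sup_{M_1,\ldots,M_k\in\mathbb R_+}|\mathcal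 A_{M_1,\ldots,M_k}f|\Big\|_{L^p(X)}\lesssim_{p,\deg\mathcal P}\|f\|_{L^p(X)}.$$ (iv) (Uniform oscillation ergodic theorem) If $p\in(1,\infty)$, then $$\sup_{J\in\mathbb Z_+}\ \sup_{I\in\mathfrak S_J(\mathbb R_+^k)}\Big\|O_{I,J}^2\big(\mathcal A_{M}f: M\in\mathbb R_+^k\big)\Big\|_{L^p(X)}\lesssim_{p,\deg\mathcal P}\|f\|_{L^p(X)}.$$ For fixed $d,k$, the implicit constants in (iii) and (iv) may depend on $p$ and $\deg\mathcal P$, but not on the coefficients of the polynomials from $\mathcal P$.
   Context: $\mathbb Z_+=\{1,2,\ldots\}$, $\mathbb R_+=(0,\infty)$. A measure-preserving transformation $T:X\to X$ satisfies $\mu(T^{-1}[E])=\mu(E)$ for every $E\in\mathcal B(X)$. A (measure-preserving) $\mathbb R$-flow $(T^t)_{t\in\mathbb R}$ on $X$ is a collection of measure-preserving transformations with $T^sT^t=T^{s+t}$ for all $s,t\in\mathbb R$ and $T^0=\mathrm{id}$. The flows commute if all the $T_i^{s}$ and $T_j^{t}$ commute. $\deg\mathcal P=\max_j\deg P_j$. By joint measurability, for $\mu$-almost every $x\in X$ the function $M\mapsto\mathcal A_Mf(x)$ is well defined and continuous on $\mathbb R_+^k$. For $x,y\in\mathbb R^k$ write $x\prec y$ if $x_i<y_i$ for every $i\in\{1,\ldots,k\}$. For $J\in\mathbb Z_+$, $\mathfrak S_J(\mathbb R^k_+)$ is the set of all sequences $I=(I_0,I_1,\ldots,I_J)$ in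 $\mathbb R_+^k$ with $I_0\prec I_1\prec\cdots\prec I_J$. For such $I$ and a family $(a_s(x):s\in\mathbb R_+^k)\subset\mathbb C$, the oscillation seminorm is $$O_{I,J}^2(a_s(x):s\in\mathbb R_+^k)=\Big(\sum_{j=1}^J\ \sup_{s\in\mathbb B_j[I]}|a_s(x)-a_{I_{j-1}}(x)|^2\Big)^{1/2},$$ where $\mathbb B_j[I]=[I_{(j-1),1},I_{j,1})\times\cdots\times[I_{(j-1),k},I_{j,k})$ and $I_j=(I_{j,1},\ldots,I_{j,k})$. The notation $A\lesssim_\alpha B$ means $A\le CB$ with a constant $C$ depending on $\alpha$. *)

(* Defs.v *)
From HB Require Import structures.
From mathcomp Require Import all_boot all_order all_algebra.
From mathcomp Require Import all_classical all_reals all_analysis.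
From mathcomp Require Import complex.
(* Not imported: the notations of mpoly clash with those of analysis. *)
From mathcomp Require mpoly.

Set Implicit Arguments.
Unset Strict Implicit.
Unset Printing Implicit Defensive.

Import Order.TTheory GRing.Theory Num.Theory.
Import numFieldNormedType.Exports.
Local Open Scope classical_set_scope.
Local Open Scope ring_scope.
Local Open Scope complex_scope.

(* R^n is n.-tuple R, whose canonical sigma-algebra is the n-fold product of
   the Borel sigma-algebra of R. *)

Section tuple_of_pair.
Context {R : realType} {n : nat}.

Definition tuple_of_pair (xt : measurableTypeR R * n.-tuple R) :
  n.+1.-tuple R := [tuple of xt.1 :: xt.2].

Let measurable_tuple_of_pair : measurable_fun setT tuple_of_pair.
Proof.
apply: (@measurable_cons _ _ _ R fst n snd); last exact: measurable_snd.
exact: (@measurable_fst _ _ (measurableTypeR R) (n.-tuple R)).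
Qed.

HB.instance Definition _ :=
  isMeasurableFun.Build _ _ _ _ tuple_of_pair measurable_tuple_of_pair.

End tuple_of_pair.

Section lebesgue_tuple.
Context {R : realType}.
Local Open Scope ereal_scope.

(* Lebesgue measure on R^n: the n-fold product of Lebesgue measure on R. *)
Fixpoint lebesgue_tuple (n : nat) : set (n.-tuple R) -> \bar R :=
  match n with
  | 0 => \d_([tuple] : 0.-tuple R)
  | m.+1 => pushforward (lebesgue_measure \x @lebesgue_tuple m) tuple_of_pair
  end.

Section step.
Variables (n : nat) (nu : {sigma_finite_measure set (n.-tuple R) -> \bar R}).

Let mu : set (n.+1.-tuple R) -> \bar R :=
  pushforward (lebesgue_measure \x nu) tuple_of_pair.

Let mu0 : mu set0 = 0.
Proof. exact: measure0. Qed.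

Let mu_ge0 A : 0 <= mu A.
Proof. exact: measure_ge0. Qed.

Let mu_additive : semi_sigma_additive mu.
Proof. exact: measure_semi_sigma_additive. Qed.

HB.instance Definition _ := isMeasure.Build _ _ _ mu mu0 mu_ge0 mu_additive.

Let mu_sigma_finite : sigma_finite setT mu.
Proof.
have /sigma_finiteP[F [TF ndF Foo]] := sigma_finiteT (@lebesgue_measure R).
have /sigma_finiteP[G [TG ndG Goo]] := sigma_finiteT nu.
pose g (t : n.+1.-tuple R) : measurableTypeR R * n.-tuple R :=
  (thead t, [tuple of behead t]).
have mg : measurable_fun setT g.
  apply/measurable_fun_pairP; split.
    exact: (@measurable_tnth _ R n.+1 ord0).
  exact: measurable_behead.
have gK xt : g (tuple_of_pair xt) = xt.
  by case: xt => x t; rewrite /g/= theadE; congr pair; exact/val_inj.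
exists (fun i => g @^-1` (F i `*` G i)).
  apply/esym; rewrite -subTset => t _.
  have : [set: measurableTypeR R] (g t).1 by [].
  have : [set: n.-tuple R] (g t).2 by [].
  rewrite TF TG => -[j _ Gj] [i _ Fi]; exists (maxn i j) => //; split.
    by move: Fi; exact/subsetPset/ndF/leq_maxl.
  by move: Gj; exact/subsetPset/ndG/leq_maxr.
move=> i; have [mF Fioo] := Foo i; have [mG Gioo] := Goo i; split.
  by rewrite -[_ @^-1` _]setTI; apply: mg => //; exact: measurableX.
rewrite /mu /pushforward (_ : _ @^-1` _ = F i `*` G i).
  by rewrite product_measure1E// lte_mul_pinfty// ge0_fin_numE.
by apply/funext => xt; rewrite -[in RHS](gK xt).
Qed.

HB.instance Definition _ :=
  Measure_isSigmaFinite.Build _ _ _ mu mu_sigma_finite.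

Lemma lebesgue_tuple_step :
  exists nu' : {sigma_finite_measure set (n.+1.-tuple R) -> \bar R},
    pushforward (lebesgue_measure \x nu) tuple_of_pair = nu'.
Proof. by exists mu. Qed.

End step.

Lemma lebesgue_tupleP n :
  exists nu : {sigma_finite_measure set (n.-tuple R) -> \bar R},
    @lebesgue_tuple n = nu.
Proof.
elim: n => [|n [nu nuE]]; first by exists \d_([tuple] : 0.-tuple R).
by rewrite /= nuE; exact: lebesgue_tuple_step.
Qed.

Section instances.
Variable n : nat.

Let lebesgue_tuple0 : @lebesgue_tuple n set0 = 0.
Proof. by have [nu ->] := lebesgue_tupleP n; exact: measure0. Qed.

Let lebesgue_tuple_ge0 A : 0 <= @lebesgue_tuple n A.
Proof. by have [nu ->] := lebesgue_tupleP n; exact: measure_ge0. Qed.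

Let lebesgue_tuple_additive : semi_sigma_additive (@lebesgue_tuple n).
Proof.
by have [nu ->] := lebesgue_tupleP n; exact: measure_semi_sigma_additive.
Qed.

HB.instance Definition _ := isMeasure.Build _ _ _ (@lebesgue_tuple n)
  lebesgue_tuple0 lebesgue_tuple_ge0 lebesgue_tuple_additive.

Let lebesgue_tuple_sigma_finite : sigma_finite setT (@lebesgue_tuple n).
Proof. by have [nu ->] := lebesgue_tupleP n; exact: sigma_finiteT. Qed.

HB.instance Definition _ := Measure_isSigmaFinite.Build _ _ _
  (@lebesgue_tuple n) lebesgue_tuple_sigma_finite.

End instances.
End lebesgue_tuple.
Arguments lebesgue_tuple R n : clear implicits.

Section vectors.
Context {R : realType}.

Definition pos_orthant k : set (k.-tuple R) :=
  [set M | forall j, 0 < tnth M j].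

Definition cbox k (M : k.-tuple R) : set (k.-tuple R) :=
  [set t | forall j, 0 <= tnth t j <= tnth M j].

(* The filter of the limits as min {M_1, ..., M_k} tends to infinity. *)
Definition min_pinfty k : set_system (k.-tuple R) :=
  [set U | exists A : R, forall M, (forall j, A < tnth M j) -> U M].

Global Instance min_pinfty_filter k : ProperFilter (@min_pinfty k).
Proof.
split.
  by move=> [A /(_ [tuple A + 1 | j < k])]; apply => j; rewrite tnth_mktuple ltrDl.
split; first by exists 0.
- move=> U V [A UA] [B VB]; exists (Num.max A B) => M ABM; split.
    by apply: UA => j; have := ABM j; rewrite gt_max => /andP[].
  by apply: VB => j; have := ABM j; rewrite gt_max => /andP[].
- by move=> U V UV [A UA]; exists A => M /UA/UV.
Qed.

Definition vprec k (x y : k.-tuple R) := forall i, tnth x i < tnth y i.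

(* Sequences of J.+1 points of R^k are indexed by 'I_J.+1; for j : 'I_J, the
   indices j and j.+1 are widen_ord (leqnSn J) j and lift ord0 j. *)
Definition osc_seq J k : set ('I_J.+1 -> k.-tuple R) :=
  [set I | (forall j, pos_orthant (I j)) /\
    forall j : 'I_J, vprec (I (widen_ord (leqnSn J) j)) (I (lift ord0 j))].

Definition hobox k (a b : k.-tuple R) : set (k.-tuple R) :=
  [set s | forall i, tnth a i <= tnth s i < tnth b i].

Definition osc2 J k (I : 'I_J.+1 -> k.-tuple R) (a : k.-tuple R -> R[i]) :
    \bar R :=
  sqrte (\sum_(j < J)
    ereal_sup [set ((Normc.normc (a s - a (I (widen_ord (leqnSn J) j)))) ^+ 2)%:E
              | s in hobox (I (widen_ord (leqnSn J) j)) (I (lift ord0 j))])%E.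

End vectors.
Arguments pos_orthant R k : clear implicits.
Arguments min_pinfty R k : clear implicits.
Arguments osc_seq R J k : clear implicits.

Section complex_functions.
Context {R : realType} d {X : measurableType d}.
Implicit Types (mu : {measure set X -> \bar R}) (f : X -> R[i]).

(* Library integrals and norms are (extended-)real-valued: complex integrals are
   taken componentwise, complex L^p norms are those of the modulus. *)
Definition cintegral mu (D : set X) f : R[i] :=
  (\int[mu]_(x in D) complex.Re (f x)) +i* (\int[mu]_(x in D) complex.Im (f x)).

Definition cLnorm mu (p : \bar R) f : \bar R :=
  'N[mu]_p[(fun x => (Normc.normc (f x))%:E)]%E.

Definition cLfun mu (p : \bar R) f :=
  [/\ measurable_fun setT (fun x => complex.Re (f x)),
      measurable_fun setT (fun x => complex.Im (f x)) &
      (cLnorm mu p f < +oo)%E].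

End complex_functions.

Section flows.
Context {R : realType} disp {X : measurableType disp}.
Implicit Types mu : {measure set X -> \bar R}.

Definition measure_preserving mu (S : X -> X) :=
  measurable_fun setT S /\ forall E, measurable E -> mu (S @^-1` E) = mu E.

Definition measure_preserving_flow mu (T : R -> X -> X) :=
  [/\ forall t, measure_preserving mu (T t),
      forall s t, T s \o T t = T (s + t) & T 0 = id].

Definition flow_comp d (T : 'I_d -> R -> X -> X) (t : 'I_d -> R) : X -> X :=
  \big[(fun f g => f \o g)/id]_(i < d) T i (t i).

Definition commuting_flows mu d (T : 'I_d -> R -> X -> X) :=
  [/\ forall i, measure_preserving_flow mu (T i),
      forall i j s t, T i s \o T j t = T j t \o T i s &
      measurable_fun setT
        (fun xt : X * d.-tuple R => flow_comp T (tnth xt.2) xt.1)].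

(* The total degree; the zero polynomial counts as a constant (degree 0). *)
Definition family_deg d k (P : 'I_d -> mpoly.mpoly k R) : nat :=
  \max_(i < d) \max_(m <- mpoly.msupp (P i)) mpoly.mdeg m.

Definition ergodic_avg d k (T : 'I_d -> R -> X -> X)
    (P : 'I_d -> mpoly.mpoly k R) (f : X -> R[i]) (M : k.-tuple R) (x : X) :
    R[i] :=
  ((\prod_(j < k) tnth M j)^-1)%:C *
  cintegral (lebesgue_tuple R k) (cbox M)
    (fun t => f (flow_comp T (fun i => mpoly.meval (tnth t) (P i)) x)).

End flows.

(* Main.v *)
(* Let L_n be the average over [0, 2^n] along one monomial direction and
  H_n = L_n^* L_n. Averaging the dyadic martingale of f along orbits gives H_n f,
  so the maximal, Littlewood-Paley and oscillation inequalities for finite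
  martingales transfer to H_n, uniformly in the coefficients. Removing the H_n,
  the polynomial average splits into pieces which, by van der Corput differencing,
  decay in L^2 away from the scales of all their monomials; interpolation and
  bootstrapping turn this into square function bounds for 1 < p < oo. A chain visits
  each scale in one run, which gives (iv) for bounded integrable f; the general case
  and (i)-(iii) follow from the majorants so obtained. *)
Require Import Defs.
From HB Require Import structures.
From mathcomp Require Import all_boot all_order all_algebra.
From mathcomp Require Import all_classical all_reals all_analysis.
From mathcomp Require Import measurable_realfun ess_sup_inf complex.
From mathcomp Require mpoly.
From mathcomp Require Import ring lra zify.

Set Implicit Arguments.
Unset Strict Implicit.
Unset Printing Implicit Defensive.

Import Order.TTheory GRing.Theory Num.Theory.
Import numFieldNormedType.Exports.
Local Open Scope classical_set_scope.
Local Open Scope ring_scope.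

(* All constants are fixed before the system and the coefficients, so dilations of the parameters
   can be absorbed in the coefficients. This decouples the problem: every monomial receives its own
   free dyadic scale, and a k-parameter average becomes a member of a family indexed by one integer
   per monomial. The pieces of this family are signed sums in which each monomial is either present
   or replaced by its H, so that they cancel unless f lives near all the scales involved. Real box
   sides are reached from dyadic ones by chaining over binary digits. With I digits in all there are
   2^I positions, which cost 2^(I max(1, p/2)) in the p-th power of the norm, while the differences
   gain 2^(-p I). The surplus is positive exactly because p > 1, but it is attained on thin boxes;
   hence all bounds are proved for boxes of side at least 2^(-i) with a loss 2^(e i), e arbitrary.
   Suprema over uncountably many boxes are never integrated directly: they are dominated at almost
   every point by measurable functions of controlled integral, which can be added and survive limits
   by Fatou's lemma. *)
Tactic Notation "ext" ident(x) := apply/funext => x.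
Tactic Notation "via" uconstr(y) := refine (@le_trans _ _ y _ _ _ _).
Tactic Notation "letr" uconstr(h) := refine (le_trans h _).
Notation mfunT := (measurable_fun setT).

(** * Real inequalities: convexity, Young and Hölder, l^2 norms, interpolation *)

Section real_inequalities.
Context {R : realType}.
Implicit Types (a b c e m p q s t u v w x y z : R).

Lemma le_of_eq x y : x = y -> x <= y.
by move->. Qed.

Lemma powRp a x : 0 <= a -> x != 0 -> a * a `^ (x - 1) = a `^ x.
move=> a0 x0; rewrite -{1}(powRr1 a0) -powRD; last first.
 lra.
by congr (_ `^ _); ring.
Qed.

Lemma young_theta a b t : 0 <= a -> 0 <= b -> 0 < t < 1 ->
 a `^ t * b `^ (1 - t) <= t * a + (1 - t) * b.
move=> a0 b0 /andP[t0 t1].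
have h : 0 < 1 - t by rewrite subr_gt0.
have := @conjugate_powR R (a `^ t) (b `^ (1 - t)) t^-1 (1 - t)^-1
 (powR_ge0 _ _) (powR_ge0 _ _).
rewrite !invr_gt0 !invrK -!powRrM !mulfV ?gt_eqF// !powRr1// => /(_ t0 h).
lra.
Qed.

Lemma young_pow a b p : 1 <= p -> 0 <= a -> 0 <= b ->
 p * (a * b `^ (p - 1)) <= a `^ p + (p - 1) * b `^ p.
rewrite le_eqVlt => /orP[/eqP<- a0 b0|p1 a0 b0].
 by rewrite subrr powRr0 mul0r addr0 powRr1// mul1r mulr1.
have p0 : 0 < p by exact: lt_trans p1.
have := @young_theta (a `^ p) (b `^ p) p^-1 (powR_ge0 _ _) (powR_ge0 _ _).
rewrite invr_gt0 p0 invf_lt1// p1 => /(_ isT).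
rewrite -!powRrM mulfV ?gt_eqF// powRr1//.
have -> : p * (1 - p^-1) = p - 1 by field; rewrite gt_eqF.
rewrite -(ler_pM2l p0) => /le_trans; apply.
rewrite mulrDr mulrA mulfV ?gt_eqF// mul1r lerD2l mulrA.
by have -> : p * (1 - p^-1) = p - 1 by field; rewrite gt_eqF.
Qed.

Lemma young_eps p e : 1 < p -> 0 < e -> exists2 C : R, 0 <= C &
 forall a b, 0 <= a -> 0 <= b -> a * b `^ (p - 1) <= C * a `^ p + e * b `^ p.
move=> p1 e0; have p0 : 0 < p by exact: lt_trans p1.
pose L := 1 + e^-1.
have L0 : 0 < L by rewrite addr_gt0// invr_gt0.
exists (L `^ (p - 1)); first exact: powR_ge0.
move=> a b a0 b0.
have /= := @young_pow (L `^ ((p - 1) / p) * a) (L `^ (- p^-1) * b) p (ltW p1)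
 (mulr_ge0 (powR_ge0 _ _) a0) (mulr_ge0 (powR_ge0 _ _) b0).
rewrite !powRM ?powR_ge0// -!powRrM.
have -> : (p - 1) / p * p = p - 1 by field; rewrite gt_eqF.
have -> : - p^-1 * p = -1 by field; rewrite gt_eqF.
have -> : L `^ ((p - 1) / p) * a * (L `^ (- p^-1 * (p - 1)) * b `^ (p - 1)) =
  a * b `^ (p - 1).
 rewrite mulrACA -powRD; last by rewrite (gt_eqF L0) implybT.
 have -> : (p - 1) / p + - p^-1 * (p - 1) = 0 by ring.
 by rewrite powRr0 mul1r.
move=> h; rewrite -(ler_pM2l p0); letr h; rewrite mulrDr; apply: lerD.
 by rewrite ler_peMl ?mulr_ge0 ?powR_ge0// ltW.
rewrite powR_inv1 ?(ltW L0)// [leLHS]mulrA [leRHS]mulrA; apply: ler_wpM2r; first exact: powR_ge0.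
apply: ler_pM; [by rewrite subr_ge0 ltW|by rewrite invr_ge0 ltW|by rewrite lerBlDr lerDl|].
rewrite -[leRHS]invrK lef_pV2 ?posrE ?invr_gt0// /L; lra.
Qed.

Lemma powR_tangent a m p : 1 <= p -> 0 <= a -> 0 <= m ->
 m `^ p + p * m `^ (p - 1) * (a - m) <= a `^ p.
move=> p1 a0 m0; have := young_pow p1 a0 m0.
have mp := powRp m0 (lt0r_neq0 (lt_le_trans ltr01 p1)).
nra.
Qed.

Lemma powR_tangent_concave a m t : 0 < t <= 1 -> 0 <= a -> 0 < m ->
 a `^ t <= m `^ t + t * m `^ (t - 1) * (a - m).
move=> /andP[t0]; rewrite le_eqVlt => /orP[/eqP-> a0 m0|t1 a0 m0].
 rewrite subrr powRr0 !powRr1; lra.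
have := @young_theta a m t a0 (ltW m0); rewrite t0 t1 => /(_ isT) h.
have mp := powRp (ltW m0) (lt0r_neq0 t0).
have e1 : m `^ (1 - t) * m `^ (t - 1) = 1.
 rewrite -powRD; last by rewrite (gt_eqF m0) implybT.
 by rewrite (_ : 1 - t + (t - 1) = 0) ?powRr0; ring.
have : a `^ t * m `^ (1 - t) * m `^ (t - 1) <= (t * a + (1 - t) * m) * m `^ (t - 1).
 by rewrite ler_wpM2r ?powR_ge0.
rewrite -mulrA e1 mulr1 -mp => /le_trans; apply.
lra.
Qed.

Lemma powR_mono a b p : 0 <= p -> 0 <= a -> a <= b -> a `^ p <= b `^ p.
move=> p0 a0 ab; apply: ge0_ler_powR => //; exact: le_trans ab.
Qed.

Lemma powR_anti a b p : p <= 0 -> 0 < a -> a <= b -> b `^ p <= a `^ p.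
move=> p0 a0 ab; have b0 := lt_le_trans a0 ab.
rewrite -(opprK p) !(powRN _ (- p)) lef_pV2 ?posrE ?powR_gt0//.
apply: powR_mono; [by rewrite oppr_ge0|exact: ltW|by []].
Qed.

(** The tangent inequalities at s and at the midpoint u leave (u^(p-1) - s^(p-1)) (t - s), which
    concavity of x^(p-1) bounds from below; this is where p <= 2 enters. It is the source of the
    square function bound [lp_le2]. *)
Lemma powR_strong_convex p s t : 1 < p <= 2 -> 0 <= s -> 0 <= t ->
 p * (p - 1) / 4 * (t - s) ^+ 2 * (Num.max s t) `^ (p - 2)
 <= t `^ p + (p - 1) * s `^ p - p * (s `^ (p - 1) * t).
move=> /andP[p1 p2] s0 t0; have p0 : 0 < p by exact: lt_trans p1.
pose u := (s + t) / 2.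
have u0 : 0 <= u by rewrite divr_ge0// addr_ge0.
have h1 := powR_tangent (ltW p1) t0 u0.
have h2 := powR_tangent (ltW p1) u0 s0.
have sp := powRp s0 (lt0r_neq0 p0).
have [->|st] := eqVneq s t.
 rewrite subrr expr0n/= mulr0 mul0r -(powRp t0 (lt0r_neq0 p0)).
 lra.
have ha : 0 < p - 1 <= 1 by apply/andP; lra.
have key : (p - 1) * (Num.max s t) `^ (p - 2) * (t - s) ^+ 2 / 2 <=
      (u `^ (p - 1) - s `^ (p - 1)) * (t - s).
 have pp : p - 1 - 1 = p - 2 by ring.
 move: st; rewrite neq_lt => /orP[st|ts].
 - have up : 0 < u by rewrite /u; lra.
  have := powR_tangent_concave ha s0 up; rewrite pp => h.
  have hm : (Num.max s t) `^ (p - 2) <= u `^ (p - 2).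
   apply: powR_anti; [lra|by []|rewrite /u (max_idPr _); lra].
  have : (p - 1) * (Num.max s t) `^ (p - 2) * ((t - s) / 2) <= u `^ (p - 1) - s `^ (p - 1).
   have -> : (t - s) / 2 = u - s by rewrite /u; field.
   have : (p - 1) * Num.max s t `^ (p - 2) * (u - s) <=
    (p - 1) * u `^ (p - 2) * (u - s).
    apply: ler_wpM2r; first by rewrite /u; lra.
    nra.
   lra.
  nra.
 - have sp0 : 0 < s by lra.
  have := powR_tangent_concave ha u0 sp0; rewrite pp => h.
  rewrite (max_idPl (ltW ts)).
  have : (p - 1) * s `^ (p - 2) * ((s - t) / 2) <= s `^ (p - 1) - u `^ (p - 1).
   have -> : (s - t) / 2 = s - u by rewrite /u; field.
   lra.
  nra.
have key2 := ler_wpM2l (ltW p0) key.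
move: h1 h2 key2; rewrite -sp.
have -> : t - u = (t - s) / 2 by rewrite /u; field.
have -> : u - s = (t - s) / 2 by rewrite /u; field.
lra.
Qed.

Lemma doob_young p x y : 1 < p -> 0 <= y -> 0 <= x ->
 (1 - p^-1) * (x `^ p - y `^ p) <= x * (x `^ (p - 1) - y `^ (p - 1)).
move=> p1 y0 x0; have p0 : 0 < p by exact: lt_trans p1.
have := young_pow (ltW p1) x0 y0; rewrite (mulrBr x) (powRp x0 (lt0r_neq0 p0)).
move: (x `^ p) (y `^ p) (x * _) => A B C h.
rewrite -(ler_pM2l p0).
have -> : p * ((1 - p^-1) * (A - B)) = (p - 1) * (A - B) by field; rewrite gt_eqF.
lra.
Qed.

Lemma powR_diff q x y : 1 <= q -> 0 <= y -> 0 <= x ->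
 x `^ q - y `^ q <= q * (x `^ (q - 1) * (x - y)).
by move=> q1 y0 x0; have := powR_tangent q1 y0 x0; lra. Qed.

Lemma powR_add p a b : 0 <= p -> 0 <= a -> 0 <= b ->
 (a + b) `^ p <= 2 `^ p * (a `^ p + b `^ p).
move=> p0 a0 b0.
have h : a + b <= 2 * Num.max a b by rewrite /Num.max; case: ltP; lra.
via ((2 * Num.max a b) `^ p).
 by apply: powR_mono => //; exact: addr_ge0.
rewrite powRM ?le_max ?a0// ler_wpM2l ?powR_ge0//.
by rewrite /Num.max; case: ltP => _; rewrite ?lerDr ?lerDl powR_ge0.
Qed.

Lemma powR_mean I r (w : I -> R) (x : I -> R) p : 1 <= p ->
 (forall i, 0 <= w i) -> (forall i, 0 <= x i) -> \sum_(i <- r) w i = 1 ->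
 (\sum_(i <- r) w i * x i) `^ p <= \sum_(i <- r) w i * x i `^ p.
move=> p1 w0 x0 w1; set m := \sum_(i <- r) _.
have m0 : 0 <= m by apply: sumr_ge0 => i _; exact: mulr_ge0.
have : \sum_(i <- r) w i * (m `^ p + p * m `^ (p - 1) * (x i - m)) <=
  \sum_(i <- r) w i * x i `^ p.
 by apply: ler_sum => i _; apply: ler_wpM2l => //; exact: powR_tangent.
apply: le_trans.
rewrite (eq_bigr (fun i => w i * (m `^ p - p * m `^ (p - 1) * m) +
  (w i * x i) * (p * m `^ (p - 1)))); last by move=> i _; ring.
by rewrite big_split/= -!mulr_suml w1 -/m; apply: le_of_eq; ring.
Qed.

(** The missing mass [1 - (\sum w) / W] is given to an extra index [None] with value 0, so that
    Jensen's inequality for weights of total mass one applies. *)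
Lemma powR_mean_le I r (w : I -> R) (x : I -> R) p W : 1 <= p ->
 0 < W -> (forall i, 0 <= w i) -> (forall i, 0 <= x i) -> \sum_(i <- r) w i <= W ->
 (\sum_(i <- r) w i * x i) `^ p <= W `^ (p - 1) * \sum_(i <- r) w i * x i `^ p.
move=> p1 W0 w0 x0 wW; have p0 := lt_le_trans ltr01 p1.
have h : 0 <= 1 - (\sum_(i <- r) w i) / W by rewrite subr_ge0 ler_pdivrMr// mul1r.
have := @powR_mean (option I) (None :: map Some r)
  (fun o => if o is Some i then w i / W else 1 - (\sum_(i <- r) w i) / W)
  (fun o => if o is Some i then x i else 0) p p1.
rewrite !big_cons !big_map/= powR0 ?gt_eqF// !mulr0 !add0r => H.
have -> : \sum_(i <- r) w i * x i = W * \sum_(i <- r) w i / W * x i.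
 by rewrite mulr_sumr; apply: eq_bigr => i _; field; rewrite gt_eqF.
rewrite powRM ?(ltW W0)//; last by apply: sumr_ge0 => i _; rewrite mulr_ge0// divr_ge0// ltW.
rewrite -(powRp (ltW W0) (lt0r_neq0 p0)) -mulrA mulrCA ler_wpM2l ?powR_ge0//.
have -> : \sum_(i <- r) w i * x i `^ p = W * \sum_(i <- r) w i / W * x i `^ p.
 by rewrite mulr_sumr; apply: eq_bigr => i _; field; rewrite gt_eqF.
apply: ler_wpM2l; first exact: ltW.
apply: H => [[i|]|[i|]|] //; first by rewrite divr_ge0// ltW.
by rewrite -mulr_suml subrK.
Qed.

Definition nrm (J : Type) (r : seq J) (v : J -> R) : R :=
 Num.sqrt (\sum_(i <- r) v i ^+ 2).

Lemma nrm_tnth J r (v : J -> R) :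
 nrm r v = nrm (index_enum 'I_(size r)) (fun i => v (tnth (in_tuple r) i)).
by rewrite /nrm big_tnth. Qed.

Lemma nrm_ge0 J r (v : J -> R) : 0 <= nrm r v.
exact: sqrtr_ge0. Qed.

Lemma nrm_sqr J r (v : J -> R) :
 nrm r v ^+ 2 = \sum_(i <- r) v i ^+ 2.
by rewrite sqr_sqrtr// sumr_ge0// => i _; exact: sqr_ge0. Qed.

Lemma nrm_powR J r (v : J -> R) p :
 nrm r v `^ p = (\sum_(i <- r) v i ^+ 2) `^ (p / 2).
rewrite -nrm_sqr -powR_mulrn ?nrm_ge0// -powRrM; congr (_ `^ _).
by field.
Qed.

Lemma sum_mul_le J r (u v : J -> R) :
 \sum_(i <- r) u i * v i <= nrm r u * nrm r v.
have [h|h] := leP (\sum_(i <- r) u i * v i) 0.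
 by letr h; rewrite mulr_ge0// nrm_ge0.
rewrite -(@ler_pXn2r _ 2) ?nnegrE ?mulr_ge0 ?nrm_ge0 ?(ltW h)//.
rewrite exprMn !nrm_sqr.
set A := \sum_(i <- r) u i ^+ 2; set B := \sum_(i <- r) v i ^+ 2; set C := \sum_(i <- r) _.
have key x y : 0 <= x ^+ 2 * A - 2 * (x * y) * C + y ^+ 2 * B.
 have -> : x ^+ 2 * A - 2 * (x * y) * C + y ^+ 2 * B = \sum_(i <- r) (x * u i - y * v i) ^+ 2.
  rewrite !mulr_sumr -sumrN -!big_split/=; apply: eq_bigr => i _; ring.
 by apply: sumr_ge0 => i _; exact: sqr_ge0.
have A0 : 0 <= A by apply: sumr_ge0 => i _; exact: sqr_ge0.
have [AE|An] := eqVneq A 0.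
 (* With [A = 0] the quadratic form is affine in x with negative slope, and this x makes it
    negative. *)
 exfalso; have := key ((B + 1) / C) 1; rewrite AE.
 have -> : ((B + 1) / C) ^+ 2 * 0 - 2 * ((B + 1) / C * 1) * C + 1 ^+ 2 * B = - B - 2.
  by field; rewrite gt_eqF.
 have B0 : 0 <= B by apply: sumr_ge0 => i _; exact: sqr_ge0.
 lra.
have Ap : 0 < A by rewrite lt_def An.
have := key C A.
nra.
Qed.

Lemma nrm_le J r (u v : J -> R) :
 (forall i, `|u i| <= v i) -> nrm r u <= nrm r v.
move=> h; apply: ler_wsqrtr; apply: ler_sum => i _.
have := h i => hi; rewrite -(real_normK (num_real _)).
by rewrite ler_pXn2r// nnegrE (le_trans _ hi).
Qed.

Lemma nrm_abs J r (u : J -> R) : nrm r (fun i => `|u i|) = nrm r u.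
by congr Num.sqrt; apply: eq_bigr => i _; rewrite real_normK// num_real. Qed.

Lemma nrmD J r (u v : J -> R) :
 nrm r (fun i => u i + v i) <= nrm r u + nrm r v.
rewrite -(@ler_pXn2r _ 2) ?nnegrE ?addr_ge0 ?nrm_ge0//.
rewrite sqrrD !nrm_sqr.
have -> : \sum_(i <- r) (u i + v i) ^+ 2 = \sum_(i <- r) u i ^+ 2 +
  (\sum_(i <- r) u i * v i) *+ 2 + \sum_(i <- r) v i ^+ 2.
 rewrite -mulr_natr mulr_suml -!big_split/=; apply: eq_bigr => i _; ring.
by rewrite lerD2r lerD2l lerMn2r; exact: sum_mul_le.
Qed.

Lemma nrm0 J (r : seq J) : nrm r (fun=> 0) = 0.
by rewrite /nrm big1 ?sqrtr0// => i _; rewrite expr0n. Qed.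

Lemma nrmZ J r c (v : J -> R) : nrm r (fun i => c * v i) = `|c| * nrm r v.
rewrite /nrm (eq_bigr (fun i => c ^+ 2 * v i ^+ 2)); last by move=> i _; rewrite exprMn.
by rewrite -mulr_sumr sqrtrM ?sqr_ge0// sqrtr_sqr.
Qed.

Lemma nrm_sum J I r (s : seq I) (v : I -> J -> R) :
 nrm r (fun j => \sum_(i <- s) v i j) <= \sum_(i <- s) nrm r (v i).
elim: s => [|i s IH]; first by rewrite big_nil (_ : (fun j => _) = fun=> 0) ?nrm0//; ext j; rewrite big_nil.
rewrite big_cons (_ : (fun j => _) = fun j => v i j + \sum_(i <- s) v i j).
 exact: le_trans (nrmD _ _ _) (lerD _ _).
by ext j; rewrite big_cons.
Qed.

(* Pointwise form of the Marcinkiewicz interpolation theorem, [a i] being the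
  size of the image of the part of the function of size about [2 ^ i]. *)
Lemma interp_pow p0 p p1 : 0 < p0 -> p0 < p -> p < p1 ->
 exists2 C : R, 0 < C & forall K (B : R) (a : nat -> R), 0 < B ->
  (forall i, 0 <= a i) ->
  (\sum_(i < K) a i) `^ p <= C * \sum_(i < K)
    (a i `^ p0 * (B * 2 ^+ i) `^ (p - p0) + a i `^ p1 * (B * 2 ^+ i) `^ (p - p1)).
move=> p00 p0p pp1; have pp : 0 < p by exact: lt_trans p0p.
have p10 : 0 < p1 by exact: lt_trans pp1.
(* The two endpoint bounds decay at the rates (p - p0)/p0 above and (p1 - p)/p1 below the critical
   level; [d] is the slower one. *)
pose d := Num.min ((p - p0) / p0) ((p1 - p) / p1).
have d0 : 0 < d by rewrite lt_min !divr_gt0// subr_gt0.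
pose x : R := 2 `^ d.
have x1 : 1 < x.
 rewrite -(powRr0 2) /x /powR gt_eqF// mul0r expR0 -[ltLHS]expR0 ltr_expR mulr_gt0//.
 by rewrite ln_gt0// ltr1n.
pose G := x / (x - 1).
have G0 : 0 < G by rewrite divr_gt0 ?subr_gt0// (lt_trans ltr01).
exists ((2 * G) `^ p); first by rewrite powR_gt0// mulr_gt0.
move=> K B a B0 a0; set S := (X in _ <= _ * X).
have b0 i : 0 < B * 2 ^+ i by rewrite mulr_gt0.
have S1 (i : 'I_K) : a i `^ p0 * (B * 2 ^+ i) `^ (p - p0) <= S.
 rewrite /S (bigD1 i)//= -addrA lerDl addr_ge0 ?mulr_ge0 ?powR_ge0//.
 by apply: sumr_ge0 => j _; rewrite addr_ge0// mulr_ge0// powR_ge0.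
have S2 (i : 'I_K) : a i `^ p1 * (B * 2 ^+ i) `^ (p - p1) <= S.
 rewrite /S (bigD1 i)//= addrAC lerDr addr_ge0 ?mulr_ge0 ?powR_ge0//.
 by apply: sumr_ge0 => j _; rewrite addr_ge0// mulr_ge0// powR_ge0.
have Sge0 : 0 <= S.
 by apply: sumr_ge0 => j _; rewrite addr_ge0// mulr_ge0// powR_ge0.
have [SE|Sn] := eqVneq S 0.
 rewrite SE big1 ?powR0 ?gt_eqF// => i _; apply: contrapT => /eqP ai.
 have aip : 0 < a i by rewrite lt_def ai a0.
 by have := S1 i; rewrite SE leNgt mulr_gt0 ?powR_gt0.
have S0 : 0 < S by rewrite lt_def Sn.
pose h := S `^ p^-1; have h0 : 0 < h by rewrite powR_gt0.
have hp : h `^ p = S by rewrite -powRrM mulVf ?gt_eqF// powRr1.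
pose w := (B / h) `^ d; have w0 : 0 < w by rewrite powR_gt0 ?divr_gt0.
have wx i : w * x ^+ i = (B * 2 ^+ i / h) `^ d.
 rewrite /w -powR_mulrn ?powR_ge0// -powRrM mulrC [d * _]mulrC powRrM.
 rewrite powR_mulrn// -powRM ?divr_ge0 ?ltW//; congr (_ `^ _); ring.
have ai (i : 'I_K) : a i <= h * Num.min (w * x ^+ i) (w * x ^+ i)^-1.
 set z := B * 2 ^+ i / h; have z0 : 0 < z by rewrite divr_gt0.
 have Bz : B * 2 ^+ i = h * z by rewrite [RHS]mulrC divfK// gt_eqF.
 have ah : a i = h * (a i / h) by rewrite [RHS]mulrC divfK// gt_eqF.
 have ah0 : 0 <= a i / h by rewrite divr_ge0// ltW.
 have hq q : (a i / h) `^ q * z `^ (p - q) = a i `^ q * (B * 2 ^+ i) `^ (p - q) / S.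
  have aq : a i `^ q = h `^ q * (a i / h) `^ q by rewrite {1}ah powRM// ltW.
  have bq : (B * 2 ^+ i) `^ (p - q) = h `^ (p - q) * z `^ (p - q) by rewrite Bz powRM// ltW.
  rewrite aq bq.
  have -> : S = h `^ q * h `^ (p - q).
   by rewrite -powRD; [rewrite addrC subrK|rewrite (gt_eqF h0) implybT].
  by field; rewrite !gt_eqF ?powR_gt0.
 have z1 : (a i / h) `^ p0 * z `^ (p - p0) <= 1 by rewrite hq ler_pdivrMr// mul1r.
 have z2 : (a i / h) `^ p1 * z `^ (p - p1) <= 1 by rewrite hq ler_pdivrMr// mul1r.
 rewrite {1}ah ler_pM2l// wx -/z.
 have zq q : 0 < q -> (a i / h) `^ q * z `^ (p - q) <= 1 -> a i / h <= z `^ ((q - p) / q).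
  move=> q0 hq1; have -> : z `^ ((q - p) / q) = (z `^ (q - p)) `^ q^-1 by rewrite -powRrM.
  have e : a i / h = ((a i / h) `^ q) `^ q^-1 by rewrite -powRrM mulfV ?gt_eqF// powRr1.
  rewrite [leLHS]e.
  apply: powR_mono; rewrite ?invr_ge0 ?powR_ge0 ?(ltW q0)//.
  have -> : z `^ (q - p) = 1 / z `^ (p - q) by rewrite -opprB powRN div1r.
  by rewrite (ler_pdivlMr _ _ (powR_gt0 _ z0)).
 have [z1'|z1'] := leP 1 z.
  rewrite (min_idPr _); last first.
   by rewrite -powRN; apply: ler_powR => //; rewrite ge0_cp// ltW.
  letr (zq _ p00 z1); rewrite -powRN; apply: ler_powR => //.
  by rewrite lerNr -mulNr opprB ge_min lexx.
 rewrite (min_idPl _); last first.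
  rewrite -powRN; apply: ger_powR; first by rewrite z0 ltW.
  lra.
 letr (zq _ p10 z2); apply: ger_powR; first by rewrite z0 ltW.
 by rewrite ge_min lexx orbT.
have key : \sum_(i < K) Num.min (w * x ^+ i) (w * x ^+ i)^-1 <= 2 * G.
 have x0 : 0 < x by exact: lt_trans x1.
 have xm : 0 < x - 1 by rewrite subr_gt0.
 have GE : G = 1 + (x - 1)^-1 by rewrite /G; field; rewrite gt_eqF.
 have xm' : 0 < (x - 1)^-1 by rewrite invr_gt0.
 (* [g] is a potential for the induction on the number of terms: [g u] is at least the first term
    plus [g (u * x)], so it dominates the whole two-sided geometric sum started at u. *)
 pose g u := if 1 <= u then G / u else 2 * G - u / (x - 1).
 via (g w); last first.
  rewrite /g; case: ifP => w1.
   by rewrite ler_pdivrMr//; via (2 * G * 1); [lra|rewrite ler_wpM2l// mulr_ge0// ltW].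
  nra.
 move: w w0 {wx ai}; clear -x1 x0 xm GE xm' G0 g.
 elim: K => [w w0|K IH w w0].
  rewrite big_ord0 /g; case: ifP => w1; first by rewrite divr_ge0// ltW.
  nra.
 rewrite big_ord_recl mulr1.
 have := IH (w * x) (mulr_gt0 w0 x0).
 rewrite (eq_bigr (fun i : 'I_K => Num.min (w * x ^+ bump 0 i) (w * x ^+ bump 0 i)^-1)); last first.
  by move=> i _; rewrite -mulrA -exprS.
 move=> h; letr (lerD (lexx _) h); rewrite /g.
 have [w1|w1] := leP 1 w.
  have wx1 : 1 <= w * x by rewrite -[1]mulr1 ler_pM// ltW.
  rewrite wx1 (min_idPr _); last by rewrite (@le_trans _ _ 1)// invf_le1.
  by apply: le_of_eq; rewrite /G; field; rewrite ?gt_eqF.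
 rewrite (min_idPl _); last by rewrite (@le_trans _ _ 1) ?ltW// invf_gt1.
 have wq : w / (x - 1) < (x - 1)^-1 by rewrite -[ltRHS]mul1r ltr_pM2r.
 case: ifP => wx1.
  have : G / (w * x) <= G by rewrite ler_pdivrMr ?mulr_gt0// ler_peMr// ltW.
  lra.
 have -> : w * x / (x - 1) = w + w / (x - 1) by field; rewrite gt_eqF.
 lra.
have -> : (2 * G) `^ p * S = (2 * G * h) `^ p.
 by rewrite [in RHS]powRM ?hp//; [apply: mulr_ge0 => //; exact: ltW|exact: ltW].
apply: powR_mono; [exact: ltW|exact: sumr_ge0|].
letr (ler_sum _ (fun i _ => ai i)).
by rewrite -mulr_sumr mulrC ler_pM2r.
Qed.

Lemma holder_num c a b t : 0 <= a -> 0 <= b -> 0 < t < 1 ->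
 (forall u v, 0 < u -> 0 < v ->
   c <= u `^ t * v `^ (1 - t) * (t * (a / u) + (1 - t) * (b / v))) ->
 c <= a `^ t * b `^ (1 - t).
move=> a0 b0 /andP[t0 t1] H.
have t1' : 0 < 1 - t by rewrite subr_gt0.
have He e : 0 < e -> c <= (a + e) `^ t * (b + e) `^ (1 - t).
 move=> e0; have ae : 0 < a + e by lra.
 have be : 0 < b + e by lra.
 letr (H _ _ ae be); rewrite -[leRHS]mulr1 ler_wpM2l ?mulr_ge0 ?powR_ge0//.
 have h1 : a / (a + e) <= 1 by rewrite ler_pdivrMr// mul1r lerDl ltW.
 have h2 : b / (b + e) <= 1 by rewrite ler_pdivrMr// mul1r lerDl ltW.
 nra.
have [an|ap] := eqVneq a 0; last have [bn|bp] := eqVneq b 0; last first.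
- have a0' : 0 < a by rewrite lt_def ap.
 have b0' : 0 < b by rewrite lt_def bp.
 letr (H _ _ a0' b0'); rewrite !divff//; apply: le_of_eq; ring.
- rewrite bn [0 `^ _]powR0 ?gt_eqF// mulr0; apply/ler_addgt0Pl => d d0; rewrite addr0.
 pose e := Num.min 1 ((d / (a + 1) `^ t) `^ (1 - t)^-1).
 have A0 : 0 < (a + 1) `^ t by rewrite powR_gt0// ltr_wpDl.
 have e0 : 0 < e by rewrite lt_min ltr01 powR_gt0// divr_gt0.
 letr (He _ e0); rewrite bn add0r.
 via ((a + 1) `^ t * (d / (a + 1) `^ t)); last by rewrite mulrC divfK// gt_eqF.
 apply: ler_pM; rewrite ?powR_ge0//.
  by apply: powR_mono; [exact: ltW|by rewrite addr_ge0// ltW|rewrite lerD2l ge_min lexx].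
 rewrite (_ : d / (a + 1) `^ t = ((d / (a + 1) `^ t) `^ (1 - t)^-1) `^ (1 - t)); last first.
  by rewrite -powRrM mulVf ?gt_eqF// powRr1// divr_ge0// ltW.
 by apply: powR_mono; [exact: ltW|exact: ltW|rewrite ge_min lexx orbT].
- rewrite an [0 `^ _]powR0 ?gt_eqF// mul0r; apply/ler_addgt0Pl => d d0; rewrite addr0.
 pose e := Num.min 1 ((d / (b + 1) `^ (1 - t)) `^ t^-1).
 have A0 : 0 < (b + 1) `^ (1 - t) by rewrite powR_gt0// ltr_wpDl.
 have e0 : 0 < e by rewrite lt_min ltr01 powR_gt0// divr_gt0.
 letr (He _ e0); rewrite an add0r mulrC.
 via ((b + 1) `^ (1 - t) * (d / (b + 1) `^ (1 - t))); last by rewrite mulrC divfK// gt_eqF.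
 apply: ler_pM; rewrite ?powR_ge0//.
  by apply: powR_mono; [exact: ltW|by rewrite addr_ge0// ltW|rewrite lerD2l ge_min lexx].
 rewrite (_ : d / (b + 1) `^ (1 - t) = ((d / (b + 1) `^ (1 - t)) `^ t^-1) `^ t); last first.
  by rewrite -powRrM mulVf ?gt_eqF// powRr1// divr_ge0// ltW.
 by apply: powR_mono; [exact: ltW|exact: ltW|rewrite ge_min lexx orbT].
Qed.

Lemma young_split u v t : 0 <= u -> 0 <= v -> 0 < t < 1 ->
 forall x y, 0 < x -> 0 < y ->
 u `^ t * v `^ (1 - t) <= x `^ t * y `^ (1 - t) * (t * (u / x) + (1 - t) * (v / y)).
move=> u0 v0 tt x y x0 y0.
have := @young_theta (u / x) (v / y) t (divr_ge0 u0 (ltW x0)) (divr_ge0 v0 (ltW y0)) tt.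
move=> /(ler_wpM2l (mulr_ge0 (powR_ge0 x t) (powR_ge0 y (1 - t)))).
by rewrite mulrACA -!powRM ?divr_ge0 ?(ltW x0) ?(ltW y0)// ![_ * (_ / _)]mulrC !divfK ?gt_eqF// => /le_trans.
Qed.

End real_inequalities.

Ltac pos := first
 [ by [] | exact: ltW | exact: powR_ge0 | exact: sqr_ge0 | exact: nrm_ge0 | exact: lt0r_neq0
 | apply: mulr_ge0; pos | apply: divr_ge0; pos | apply: addr_ge0; pos | apply: exprn_ge0; pos
 | rewrite invr_ge0; pos | apply: sumr_ge0 => ? _; pos
 | apply: mulr_gt0; pos | apply: divr_gt0; pos | apply: powR_gt0; pos | apply: exprn_gt0; pos
 | rewrite invr_gt0; pos | rewrite subr_ge0; pos | rewrite subr_gt0; pos | apply: addr_gt0; pos | apply: ltr_wpDl; pos | apply: ltr_wpDr; pos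
 | apply: prodr_ge0 => ? _; pos | apply: prodr_gt0 => ? _; pos | apply: lt0r_neq0; pos ].

(** * Conditional expectations on the binary cube *)

Section cube.
Context {R : realType} (N : nat).
Let W := {ffun 'I_N -> bool}.
Implicit Types (f g h : W -> R) (w c : W).

Definition bmix (k : nat) w c : W := [ffun i : 'I_N => if (i < k)%N then w i else c i].

Lemma bmix_id k w c c' : bmix k (bmix k w c) c' = bmix k w c'.
by apply/ffunP => i; rewrite !ffunE; case: (i < k)%N. Qed.

Lemma bmix_le j k w c c' : (j <= k)%N -> bmix k (bmix j w c) c' = bmix j w (bmix k c c').
move=> jk; apply/ffunP => i; rewrite !ffunE; case: ltnP => // ki; case: ltnP => // ij.
by move: (leq_trans ij jk); rewrite ltnNge ki.
Qed.

Lemma bmix_self j k w c : (j <= k)%N -> bmix j (bmix k w c) w = w.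
move=> jk; apply/ffunP => i; rewrite !ffunE; case: ltnP => // ij.
by rewrite (leq_trans ij).
Qed.

Definition bavg f : R := (\sum_w f w) / #|W|%:R.

(** Conditional expectation given the first k bits, obtained by resampling the others. All of c is
    averaged although only its last bits are read, so that the single average [bavg] serves for
    every k. *)
Definition bE (k : nat) f w : R := bavg (fun c => f (bmix k w c)).

Definition bmeas (k : nat) h := forall w c, h (bmix k w c) = h w.

Lemma cardW_gt0 : 0 < #|W|%:R :> R.
by rewrite ltr0n; apply/card_gt0P; exists [ffun=> false]. Qed.

Lemma bavgD f g : bavg (fun w => f w + g w) = bavg f + bavg g.
by rewrite /bavg big_split/= mulrDl. Qed.

Lemma bavgZ a f : bavg (fun w => a * f w) = a * bavg f.
by rewrite /bavg -mulr_sumr mulrA. Qed.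

Lemma bavgB f g : bavg (fun w => f w - g w) = bavg f - bavg g.
by rewrite /bavg sumrB/= mulrBl. Qed.

Lemma bavg_sum J r (F : J -> W -> R) :
 bavg (fun w => \sum_(j <- r) F j w) = \sum_(j <- r) bavg (F j).
by rewrite /bavg exchange_big/= mulr_suml. Qed.

Lemma bavg_le f g : (forall w, f w <= g w) -> bavg f <= bavg g.
by move=> fg; rewrite ler_wpM2r ?ler_sum. Qed.

Lemma bavg_ge0 f : (forall w, 0 <= f w) -> 0 <= bavg f.
by move=> f0; rewrite divr_ge0 ?sumr_ge0. Qed.

Lemma bavg_cst a : bavg (fun=> a) = a.
by rewrite /bavg sumr_const -[a *+ _]mulr_natr mulfK// gt_eqF// cardW_gt0. Qed.

Lemma bavg_mix k f : bavg (fun w => bavg (fun c => f (bmix k w c))) = bavg f.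
rewrite /bavg -mulr_suml pair_big/=.
(* Exchanging the last bits of two independent samples preserves their joint law. *)
pose s u := (bmix k u.1 u.2, bmix k u.2 u.1).
have sK : involutive s.
 by case=> u v; congr (_, _); apply/ffunP => i; rewrite !ffunE; case: (i < k)%N.
rewrite (reindex_inj (inv_inj sK))/=.
rewrite (eq_bigr (fun u : W * W => f u.1)); last first.
 by move=> u _; congr f; apply/ffunP => i; rewrite !ffunE; case: (i < k)%N.
rewrite -(pair_bigA _ (fun u v => f u))/=.
under eq_bigr do rewrite sumr_const -mulr_natr.
by rewrite -mulr_suml mulfK// gt_eqF// cardW_gt0.
Qed.

Lemma bED k f g w : bE k (fun w => f w + g w) w = bE k f w + bE k g w.
exact: bavgD. Qed.
Lemma bEZ k a f w : bE k (fun w => a * f w) w = a * bE k f w.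
exact: bavgZ. Qed.
Lemma bEB k f g w : bE k (fun w => f w - g w) w = bE k f w - bE k g w.
exact: bavgB. Qed.
Lemma bE_le k f g w : (forall w, f w <= g w) -> bE k f w <= bE k g w.
by move=> fg; exact: bavg_le. Qed.
Lemma bE_ge0 k f w : (forall w, 0 <= f w) -> 0 <= bE k f w.
by move=> f0; exact: bavg_ge0. Qed.
Lemma bE_abs k f w : `|bE k f w| <= bE k (fun w => `|f w|) w.
rewrite ler_norml; apply/andP; split; last by apply: bE_le => u; exact: ler_norm.
rewrite -mulN1r -bEZ; apply: bE_le => u; rewrite mulN1r lerNl -normrN; exact: ler_norm.
Qed.
Lemma bE_meas k f : bmeas k (bE k f).
by move=> w c; congr bavg; ext c'; rewrite bmix_id. Qed.
Lemma bmeas_le j k h : (j <= k)%N -> bmeas j h -> bmeas k h.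
by move=> jk hj w c; rewrite -{2}(bmix_self w c jk). Qed.
Lemma bE_pull k h f w : bmeas k h -> bE k (fun w => h w * f w) w = h w * bE k f w.
by move=> hk; rewrite -bavgZ; congr bavg; ext c; rewrite hk. Qed.
Lemma bE_id k h : bmeas k h -> bE k h = h.
move=> hk; ext w; rewrite -[RHS]bavg_cst.
by congr bavg; ext c.
Qed.
Lemma bavgE k f : bavg (bE k f) = bavg f.
exact: bavg_mix. Qed.
Lemma bavg_pull k h f : bmeas k h -> bavg (fun w => h w * f w) = bavg (fun w => h w * bE k f w).
move=> hk; rewrite -(bavgE k); congr bavg; ext w; exact: bE_pull.
Qed.
Lemma bE_tower j k f : (j <= k)%N -> bE j (bE k f) = bE j f.
move=> jk; ext w; rewrite /bE -[RHS](bavg_mix k); congr bavg.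
by ext c; congr bavg; ext c'; rewrite bmix_le.
Qed.
Lemma bE_tower' j k f : (j <= k)%N -> bE k (bE j f) = bE j f.
by move=> jk; apply: bE_id; apply: bmeas_le jk _; exact: bE_meas. Qed.
Lemma bE_last f : bE N f = f.
by apply: bE_id => w c; congr f; apply/ffunP => i; rewrite ffunE ltn_ord.
Qed.

Fixpoint bM (f : W -> R) (k : nat) (w : W) : R :=
 if k is k'.+1 then Num.max (bM f k' w) (bE k f w) else bE 0 f w.

Lemma bM_meas f k : bmeas k (bM f k).
elim: k => [|k IH] => //.
by move=> w c /=; rewrite (bmeas_le (leqnSn k) IH) bE_meas.
Qed.
Lemma bM_ge f j k w : (j <= k)%N -> bE j f w <= bM f k w.
elim: k => [|k IH]; first by rewrite leqn0 => /eqP->.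
by rewrite leq_eqVlt => /orP[/eqP->|/IH h]; rewrite le_max ?lexx ?orbT// h.
Qed.
Lemma bM_ge0 f k w : (forall w, 0 <= f w) -> 0 <= bM f k w.
by move=> f0; apply: le_trans (bM_ge f w (leq0n k)); exact: bE_ge0. Qed.
End cube.
Notation "\E x , F" := (bavg (fun x => F)) (at level 200, x name, F at level 200).

(** * Maximal and square function inequalities for finite martingales *)

Section martingale_inequalities.
Context {R : realType}.
Notation W N := {ffun 'I_N -> bool}.

(** A pathwise argument in place of stopping times: the power p - 1 of the running maximum grows
    only when this maximum equals the current conditional expectation, and the increment is
    measurable at that time, so f may be replaced there by its conditional expectation. Summation
    and Young's inequality finish the proof. *)
Lemma doob p : 1 < p -> exists2 C : R, 0 < C &
 forall N (f : W N -> R), (forall w, 0 <= f w) ->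
  (\E w, bM f N w `^ p) <= C * (\E w, f w `^ p).
move=> p1; have p0 : 0 < p by exact: lt_trans p1.
pose c := 1 - p^-1; have c0 : 0 < c by rewrite subr_gt0 invf_lt1.
have [C C0 HC] := young_eps p1 (divr_gt0 c0 (ltr0n R 2)).
exists (2 / c * (C + 1)); first by rewrite mulr_gt0 ?divr_gt0// ltr_wpDl.
move=> N f f0.
have key k : c * (\E w, bM f k w `^ p) <= (\E w, bM f k w `^ (p - 1) * f w).
 elim: k => [|k IH].
  rewrite (bavg_pull (k := 0)); last first.
   by [].
  rewrite -bavgZ; apply: bavg_le => w /=; rewrite mulrC [leRHS]mulrC.
  have h : 0 <= bE 0 f w by exact: bE_ge0.
  rewrite powRp ?gt_eqF// ler_piMr ?powR_ge0// gerBl invr_ge0 ltW//.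
 have h1 : (\E w, (bM f k.+1 w `^ (p - 1) - bM f k w `^ (p - 1)) * f w) =
   (\E w, (bM f k.+1 w `^ (p - 1) - bM f k w `^ (p - 1)) * bE k.+1 f w).
  apply: bavg_pull => w c'; congr (_ `^ _ - _ `^ _); first exact: bM_meas.
  exact: bmeas_le (leqnSn k) (@bM_meas _ _ f k) _ _.
 have h2 : (\E w, c * (bM f k.+1 w `^ p - bM f k w `^ p)) <=
   (\E w, (bM f k.+1 w `^ (p - 1) - bM f k w `^ (p - 1)) * bE k.+1 f w).
  apply: bavg_le => w.
  have := doob_young p1 (bM_ge0 k w f0) (bM_ge0 k.+1 w f0) => /le_trans; apply.
  rewrite mulrC /=; case: (leP (bM f k w)) => // h.
  lra.
 have h3 : (\E w, bM f k.+1 w `^ (p - 1) * f w) =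
   (\E w, bM f k w `^ (p - 1) * f w) +
   (\E w, (bM f k.+1 w `^ (p - 1) - bM f k w `^ (p - 1)) * f w).
  by rewrite -bavgD; congr bavg; ext w; ring.
 move: h2; rewrite bavgZ bavgB; lra.
have := key N; set A := (\E w, bM f N w `^ p).
have h4 : (\E w, bM f N w `^ (p - 1) * f w) <= C * (\E w, f w `^ p) + c / 2 * A.
 rewrite -!bavgZ -bavgD; apply: bavg_le => w; rewrite mulrC.
 by apply: HC => //; exact: bM_ge0.
have F0 : 0 <= (\E w, f w `^ p) by apply: bavg_ge0 => w; exact: powR_ge0.
move=> h5; have h6 : A <= 2 / c * (C * bavg (fun w : W N => f w `^ p)).
 by rewrite mulrAC ler_pdivlMr; lra.
letr h6; rewrite -!mulrA ler_wpM2l// ler_wpM2l ?invr_ge0 ?(ltW c0)//.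
lra.
Qed.

(* [A] is an increasing process whose future increments are conditionally
  dominated by [Z]. *)
Lemma garsia q : 1 < q -> exists2 C : R, 0 < C &
 forall N n t A (Z : W N -> R),
  (forall w, 0 <= Z w) -> (forall w, A 0%N w = 0) ->
  (forall k, bmeas (t k) (A k.+1)) -> {homo t : i j / (i <= j)%N} ->
  (forall k w, A k w <= A k.+1 w) ->
  (forall k h, (k < n)%N -> (forall w, 0 <= h w) -> bmeas (t k) h ->
    (\E w, h w * (A n w - A k w)) <= (\E w, h w * Z w)) ->
  (\E w, A n w `^ q) <= C * (\E w, Z w `^ q).
move=> q1; have q0 : 0 < q by exact: lt_trans q1.
have qi : 0 < q^-1 by rewrite invr_gt0.
have [C C0 HC] := young_eps q1 (divr_gt0 qi (ltr0n R 2)).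
exists (2 * q * (C + 1)); first by apply: mulr_gt0; [exact: mulr_gt0|exact: ltr_wpDl].
move=> N n t A Z Z0 A0 Am tm Ai HZ.
have Age0 k w : 0 <= A k w by elim: k => [|k IH]; rewrite ?A0// (le_trans IH).
pose B k w := A k w `^ (q - 1).
have B0 w : B 0%N w = 0 by rewrite /B A0 powR0// subr_eq0 gt_eqF.
have Bi k w : B k w <= B k.+1 w by apply: powR_mono; rewrite ?subr_ge0 ?(ltW q1).
(* Abel summation: replacing A_n by the remaining growth A_n - A_k in the sum against the increments
   of A^(q-1) costs, by Young's inequality, only the fraction 1 - 1/q of A_n^q. *)
have h1 w : q^-1 * A n w `^ q <= \sum_(k < n) (B k.+1 w - B k w) * (A n w - A k w).
 have e1 : \sum_(k < n) (B k.+1 w - B k w) * (A n w - A k w) =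
   A n w `^ q - \sum_(k < n) A k w * (B k.+1 w - B k w).
  rewrite (eq_bigr (fun k : 'I_n => A n w * (B k.+1 w - B k w) - A k w * (B k.+1 w - B k w))); last by move=> k _; ring.
  rewrite sumrB -mulr_sumr; congr (_ - _).
  have := @telescope_sumr _ 0 n (B^~ w) (leq0n _); rewrite big_mkord => ->.
  by rewrite B0 subr0 powRp// gt_eqF.
 have : \sum_(k < n) A k w * (B k.+1 w - B k w) <= \sum_(k < n) (1 - q^-1) * (A k.+1 w `^ q - A k w `^ q).
  apply: ler_sum => k _.
  have := @young_pow _ (A k w) (A k.+1 w) q (ltW q1) (Age0 _ _) (Age0 _ _).
  rewrite -/(B _ _) => h.
  have e2 : A k w * B k w = A k w `^ q by rewrite powRp// gt_eqF.
  rewrite mulrBr e2 -(ler_pM2l q0).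
  have -> : q * ((1 - q^-1) * (A k.+1 w `^ q - A k w `^ q)) = (q - 1) * (A k.+1 w `^ q - A k w `^ q).
   by field; rewrite gt_eqF.
  lra.
 rewrite -mulr_sumr; have := @telescope_sumr _ 0 n (fun k => A k w `^ q) (leq0n _).
 by rewrite big_mkord => ->; rewrite A0 powR0; lra.
have h2 : q^-1 * (\E w, A n w `^ q) <= (\E w, B n w * Z w).
 rewrite -bavgZ; letr (bavg_le h1); rewrite bavg_sum.
 have -> : (\E w, B n w * Z w) = \sum_(k < n) (\E w, (B k.+1 w - B k w) * Z w).
  rewrite -bavg_sum; congr bavg; ext w; rewrite -mulr_suml.
  have := @telescope_sumr _ 0 n (B^~ w) (leq0n _); rewrite big_mkord => ->.
  by rewrite B0 subr0.
 apply: ler_sum => k _; apply: HZ => // [w|w c]; first by rewrite subr_ge0.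
 congr (_ `^ _ - _ `^ _); first exact: Am.
 case: nat_of_ord => [|k']; first by rewrite !A0.
 exact: (bmeas_le (tm _ _ (leqnSn k'))).
have h3 : (\E w, B n w * Z w) <= C * (\E w, Z w `^ q) + q^-1 / 2 * (\E w, A n w `^ q).
 rewrite -!bavgZ -bavgD; apply: bavg_le => w; rewrite mulrC.
 exact: HC.
have F0 : 0 <= (\E w, Z w `^ q) by apply: bavg_ge0 => w; exact: powR_ge0.
set X := (\E w, A n w `^ q) in h2 h3 *.
have h4 : q^-1 * X <= 2 * (C * (\E w, Z w `^ q)) by lra.
rewrite mulrC ler_pdivrMr// in h4; letr h4; rewrite mulrDr mulr1 mulrDl.
nra.
Qed.

(** If the maximum up to n is reached before time k, the left side is at most 0; otherwise it is
    reached at a time j >= k, where h is measurable and can be pulled inside the conditional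
    expectation. For k = 0 there is no earlier maximum, hence the default 0. *)
Lemma bM_sqrt N (G h : W N -> R) k n w : (forall w, 0 <= G w) -> (forall w, 0 <= h w) ->
 bmeas k h -> (k <= n)%N ->
 h w * (bM G n w ^+ 2 - (if k is k'.+1 then bM G k' w else 0) ^+ 2) <=
 bM (fun w => Num.sqrt (h w) * G w) n w ^+ 2.
move=> G0 h0 hk kn.
set m := if k is _.+1 then _ else _.
have m0 : 0 <= m by rewrite /m; case: (k) => // k'; exact: bM_ge0.
have Gh0 u : 0 <= Num.sqrt (h u) * G u by rewrite mulr_ge0.
have key : bM G n w <= m \/ Num.sqrt (h w) * bM G n w <= bM (fun w => Num.sqrt (h w) * G w) n w.
 have pull j : (k <= j)%N -> Num.sqrt (h w) * bE j G w = bE j (fun w => Num.sqrt (h w) * G w) w.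
  move=> kj; rewrite bE_pull//; apply: (bmeas_le kj) => u c; congr Num.sqrt; exact: hk.
 elim: n kn => [|n IH].
  by right; rewrite pull.
 rewrite leq_eqVlt => /orP[/eqP kE|kn].
  rewrite /m kE /=; case: (leP (bM G n w)) => [h1|/ltW h1]; last by left.
  by right; rewrite pull ?kE// le_max lexx orbT.
 rewrite /=; case: (leP (bM G n w)) => [h1|h1].
  by right; rewrite pull ?(ltnW kn)// le_max lexx orbT.
 by case: (IH kn) => [h2|h2]; [left|right; rewrite le_max h2].
have MG0 : 0 <= bM G n w by exact: bM_ge0.
case: key => [h1|h1].
 via 0; last exact: sqr_ge0.
 by rewrite mulr_ge0_le0// subr_le0 ler_pXn2r.
via (h w * bM G n w ^+ 2).
 by rewrite ler_wpM2l// gerBl sqr_ge0.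
rewrite -{1}(sqr_sqrtr (h0 w)) -exprMn ler_pXn2r// nnegrE ?mulr_ge0 ?sqrtr_ge0//.
exact: bM_ge0.
Qed.

(** A Fefferman-Stein inequality. For p > 2 the sum of the squared running maxima is an increasing
    process, and Doob's L^2 inequality applied to the functions [Num.sqrt (h w) * G j w] supplies
    the hypothesis of [garsia]. *)
Lemma fs_ge2 (p : R) : 2 <= p -> exists2 C : R, 0 < C &
 forall N J r (G : J -> W N -> R), (forall j w, 0 <= G j w) ->
  (\E w, nrm r (fun j => bM (G j) N w) `^ p) <=
  C * (\E w, nrm r (fun j => G j w) `^ p).
have [C2 C20 H2] := @doob 2 (ltr_nat R 1 2 : 1 < 2).
have H2' N J r (G : J -> W N -> R) : (forall j w, 0 <= G j w) ->
  (\E w, \sum_(j <- r) bM (G j) N w ^+ 2) <= (\E w, C2 * \sum_(j <- r) G j w ^+ 2).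
 move=> G0; rewrite bavgZ !bavg_sum mulr_sumr; apply: ler_sum => j _.
 have := H2 N (G j) (G0 j); congr (_ <= _ * _); congr bavg; ext w.
  by rewrite powR_mulrn//; exact: bM_ge0.
 by rewrite powR_mulrn.
rewrite le_eqVlt => /orP[/eqP<-|p2].
 exists C2 => // N J r G G0; rewrite -bavgZ; have H := H2' N J r G G0.
 have nE (v : J -> R) : nrm r v `^ 2 = \sum_(j <- r) v j ^+ 2.
  by rewrite nrm_powR divff// powRr1// sumr_ge0// => j _; exact: sqr_ge0.
 under eq_fun do rewrite nE.
 by under [X in _ <= bavg X]eq_fun do rewrite nE.
have q1 : 1 < p / 2 by rewrite ltr_pdivlMr// mul1r.
have [C C0 HC] := garsia q1.
exists (C * C2 `^ (p / 2)); first by rewrite mulr_gt0// powR_gt0.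
move=> N J r G G0.
pose A k w : R := if k is k'.+1 then \sum_(j <- r) bM (G j) k' w ^+ 2 else 0.
have := HC N N.+1 id A (fun w => C2 * \sum_(j <- r) G j w ^+ 2).
have -> : (\E w, A N.+1 w `^ (p / 2)) = (\E w, nrm r (fun j => bM (G j) N w) `^ p).
 by congr bavg; ext w; rewrite nrm_powR.
have S0 w : 0 <= \sum_(j <- r) G j w ^+ 2 by apply: sumr_ge0 => j _; exact: sqr_ge0.
have -> : (\E w, (C2 * \sum_(j <- r) G j w ^+ 2) `^ (p / 2)) = C2 `^ (p / 2) * (\E w, nrm r (fun j => G j w) `^ p).
 by rewrite -bavgZ; congr bavg; ext w; rewrite nrm_powR powRM// ltW.
rewrite mulrA; apply => //.
- by move=> w; rewrite mulr_ge0// ltW.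
- by move=> k w c; apply: eq_bigr => j _; congr (_ ^+ 2); exact: bM_meas.
- move=> [|k] w /=; first by apply: sumr_ge0 => j _; exact: sqr_ge0.
 by apply: ler_sum => j _; rewrite ler_pXn2r ?nnegrE ?le_max ?lexx ?bM_ge0.
- move=> k h kN h0 hk.
 via (\E w, \sum_(j <- r) bM (fun w => Num.sqrt (h w) * G j w) N w ^+ 2).
  apply: bavg_le => w; rewrite /A.
  have -> : (if k is k'.+1 then \sum_(j <- r) bM (G j) k' w ^+ 2 else 0) =
   \sum_(j <- r) (if k is k'.+1 then bM (G j) k' w else 0) ^+ 2.
   by case: (k) => //; rewrite big1// => j _; rewrite expr0n.
  by rewrite -sumrB mulr_sumr; apply: ler_sum => j _; apply: bM_sqrt.
 have Gh0 j w : 0 <= Num.sqrt (h w) * G j w by rewrite mulr_ge0.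
 letr (H2' N J r _ Gh0); apply: bavg_le => w.
 rewrite mulrCA ler_wpM2l ?(ltW C20)// mulr_sumr; apply: ler_sum => j _.
 by rewrite exprMn sqr_sqrtr.
Qed.

Lemma holder_bE N k (h S : W N -> R) t w : 0 < t < 1 -> (forall w, 0 <= h w) -> (forall w, 0 <= S w) ->
 bE k (fun w => h w `^ t * S w `^ (1 - t)) w <= bE k h w `^ t * bE k S w `^ (1 - t).
move=> t01 h0 S0; apply: holder_num => //; try exact: bE_ge0.
move=> u v u0 v0.
have : bE k (fun w => h w `^ t * S w `^ (1 - t)) w <=
 bE k (fun w => u `^ t * v `^ (1 - t) * (t / u * h w + (1 - t) / v * S w)) w.
 apply: bE_le => w'; letr (young_split (h0 w') (S0 w') t01 u0 v0).
 lra.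
rewrite bEZ bED !bEZ => /le_trans; apply; apply: le_of_eq; ring.
Qed.

Lemma bM_ub N (f : W N -> R) k w X : (forall j, (j <= k)%N -> bE j f w <= X) ->
 bM f k w <= X.
elim: k => [|k IH] H /=; first exact: H.
by rewrite ge_max H// IH// => j jk; apply: H; exact: leqW.
Qed.

(** Each [G j] is factored as h_j^(p/2) S^(1 - p/2), with S the l^2 norm and the sum of the h_j^p at
    most S^p. Hölder's inequality inside the conditional expectations separates the factors, and
    each of them is controlled by the scalar inequality [doob]. *)
Lemma fs_lt2 p : 1 < p < 2 -> exists2 C : R, 0 < C &
 forall N J r (G : J -> W N -> R), (forall j w, 0 <= G j w) ->
  (\E w, nrm r (fun j => bM (G j) N w) `^ p) <=
  C * (\E w, nrm r (fun j => G j w) `^ p).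
move=> /andP[p1 p2]; have p0 : 0 < p by exact: lt_trans p1.
have [C C0 HC] := doob p1.
pose t := p / 2; have t01 : 0 < t < 1 by rewrite divr_gt0//= ltr_pdivrMr// mul1r.
have /andP[t0 t1] := t01; have t1' : 0 < 1 - t by rewrite subr_gt0.
exists C => // N J r G G0.
(* With a finite index type, [S w = 0] forces every single [G j w] to vanish. *)
under eq_fun do rewrite nrm_tnth.
under [X in _ <= _ * bavg X]eq_fun do rewrite nrm_tnth.
suff H n (G' : 'I_n -> W N -> R) : (forall j w, 0 <= G' j w) ->
 (\E w, nrm (index_enum 'I_n) (fun j => bM (G' j) N w) `^ p) <=
  C * (\E w, nrm (index_enum 'I_n) (fun j => G' j w) `^ p).
 exact: (H _ (fun i => G (tnth _ i))).
move: G' => {G0}G G0.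
pose S w := nrm (index_enum 'I_n) (fun j => G j w).
have S0 w : 0 <= S w by exact: nrm_ge0.
pose h j w := G j w `^ (2 / p) * S w `^ (- (2 - p) / p).
have h0 j w : 0 <= h j w by rewrite mulr_ge0// powR_ge0.
have ep : - (2 - p) / p != 0 by rewrite mulf_eq0 oppr_eq0 invr_eq0 subr_eq0 (gt_eqF p2) gt_eqF.
have GS j w : S w = 0 -> G j w = 0.
 move=> Sw; apply/eqP; rewrite -sqrf_eq0; apply/eqP.
 have : \sum_j G j w ^+ 2 = 0 by rewrite -nrm_sqr -/(S w) Sw expr0n.
 by move/psumr_eq0P; apply => // i _; exact: sqr_ge0.
have hG j : G j = fun w => h j w `^ t * S w `^ (1 - t).
 ext w; have [Sw|Sw] := eqVneq (S w) 0.
  by rewrite GS// Sw [0 `^ (1 - t)]powR0 ?mulr0// gt_eqF.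
 rewrite powRM ?powR_ge0// -!powRrM -mulrA -powRD; last by rewrite Sw implybT.
 have -> : 2 / p * t = 1 by rewrite /t; field; rewrite gt_eqF.
 have -> : - (2 - p) / p * t + (1 - t) = 0 by rewrite /t; field; rewrite gt_eqF.
 by rewrite powRr0 mulr1 powRr1.
have hS w : \sum_j h j w `^ p <= S w `^ p.
 have [Sw|Sw] := eqVneq (S w) 0.
  rewrite /h Sw big1 ?powR_ge0// => j _; rewrite powR0// mulr0 powR0// gt_eqF//.
 rewrite (eq_bigr (fun j => G j w ^+ 2 * S w `^ (p - 2))); last first.
  move=> j _; rewrite powRM ?powR_ge0// -!powRrM -powR_mulrn//; congr (_ `^ _ * _ `^ _); field; rewrite gt_eqF//.
 rewrite -mulr_suml -nrm_sqr -/(S w) -powR_mulrn// -powRD; last by rewrite Sw implybT.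
 by apply: le_of_eq; congr (_ `^ _); ring.
have main w : nrm (index_enum 'I_n) (fun j => bM (G j) N w) `^ p <=
  t * \sum_j bM (h j) N w `^ p + (1 - t) * bM S N w `^ p.
 have b1 j : bM (G j) N w ^+ 2 <= bM (h j) N w `^ p * bM S N w `^ (2 - p).
  have : bM (G j) N w <= bM (h j) N w `^ t * bM S N w `^ (1 - t).
   apply: bM_ub => k kN; rewrite hG; letr (holder_bE k w t01 (h0 j) S0).
   by apply: ler_pM; rewrite ?powR_ge0//; apply: powR_mono; rewrite ?(ltW t0) ?(ltW t1') ?bM_ge ?bE_ge0.
  rewrite -(@ler_pXn2r _ 2) ?nnegrE ?mulr_ge0 ?powR_ge0 ?bM_ge0// => /le_trans; apply.
  rewrite exprMn -!powR_mulrn ?powR_ge0// -!powRrM; apply: le_of_eq.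
  by congr (_ `^ _ * _ `^ _); rewrite /t; field.
 rewrite nrm_powR -/t; via ((\sum_j bM (h j) N w `^ p * bM S N w `^ (2 - p)) `^ t).
  by apply: powR_mono; [exact: ltW|apply: sumr_ge0 => j _; exact: sqr_ge0|exact: ler_sum].
 rewrite -mulr_suml powRM ?powR_ge0//; last by apply: sumr_ge0 => j _; exact: powR_ge0.
 have -> : (bM S N w `^ (2 - p)) `^ t = (bM S N w `^ p) `^ (1 - t).
  by rewrite -!powRrM; congr (_ `^ _); rewrite /t; field.
 by apply: young_theta => //; rewrite ?powR_ge0//; apply: sumr_ge0 => j _; exact: powR_ge0.
letr (bavg_le main); rewrite bavgD !bavgZ bavg_sum.
have a1 : \sum_j (\E w, bM (h j) N w `^ p) <= C * (\E w, S w `^ p).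
 via (\sum_j C * (\E w, h j w `^ p)).
  by apply: ler_sum => j _; exact: HC.
 by rewrite -mulr_sumr -bavg_sum ler_wpM2l ?(ltW C0)//; exact: bavg_le.
have a2 := HC _ _ S0.
letr (lerD (ler_wpM2l (ltW t0) a1) (ler_wpM2l (ltW t1') a2)).
by apply: le_of_eq; ring.
Qed.

Lemma fs_max p : 1 < p -> exists2 C : R, 0 < C &
 forall N J r (G : J -> W N -> R), (forall j w, 0 <= G j w) ->
  (\E w, nrm r (fun j => bM (G j) N w) `^ p) <=
  C * (\E w, nrm r (fun j => G j w) `^ p).
move=> p1; have [p2|p2] := ltP p 2; last exact: fs_ge2.
by apply: fs_lt2; rewrite p1.
Qed.

Lemma bE_orth N J r (G : J -> W N -> R) a b h : (a <= b)%N ->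
 bmeas a h ->
 (\E w, h w * \sum_(j <- r) (bE b (G j) w - bE a (G j) w) ^+ 2) =
 (\E w, h w * \sum_(j <- r) (bE b (G j) w ^+ 2 - bE a (G j) w ^+ 2)).
move=> ab ha; under eq_fun do rewrite mulr_sumr.
under [in RHS]eq_fun do rewrite mulr_sumr.
rewrite !bavg_sum; apply: eq_bigr => j _; apply/eqP; rewrite -subr_eq0 -bavgB.
rewrite [X in bavg X](_ : _ = fun w => - (2 * ((h w * bE a (G j) w) * (bE b (G j) w - bE a (G j) w)))); last first.
 by ext w; ring.
under eq_fun do rewrite -mulN1r.
rewrite !bavgZ (bavg_pull (k := a)); last by move=> w c; rewrite ha bE_meas.
have -> : (fun w => h w * bE a (G j) w * bE a (fun w => bE b (G j) w - bE a (G j) w) w) = fun=> 0.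
 by ext w; rewrite bEB bE_tower// bE_tower// subrr mulr0.
by rewrite bavg_cst !mulr0.
Qed.

Lemma nrm_bE N J r (G : J -> W N -> R) k w :
 nrm r (fun j => bE k (G j) w) <= bE k (fun w => nrm r (fun j => G j w)) w.
set u := fun j => bE k (G j) w.
have [/eqP u0|un] := eqVneq (nrm r u) 0.
 by rewrite (eqP u0); apply: bE_ge0 => w'; exact: nrm_ge0.
have up : 0 < nrm r u by rewrite lt_def un nrm_ge0.
rewrite -(ler_pM2l up) -expr2 nrm_sqr.
rewrite (_ : \sum_(j <- r) u j ^+ 2 = bE k (fun w' => \sum_(j <- r) u j * G j w') w); last first.
 rewrite /bE bavg_sum; apply: eq_bigr => j _; by rewrite bavgZ.
rewrite -bEZ; apply: bE_le => w'; exact: sum_mul_le.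
Qed.

(** [garsia] is applied to the accumulated squared differences. After time k the next jump is at
    most 4 M, and by orthogonality all later ones contribute at most M in mean; hence the 5 in the
    constant. *)
Lemma lp_ge2 (p : R) : 2 < p -> exists2 C : R, 0 < C &
 forall N J r (G : J -> W N -> R) n t,
  {homo t : i j / (i <= j)%N} -> (forall i, (t i <= N)%N) ->
  (\E w, (\sum_(i < n) \sum_(j <- r) (bE (t i.+1) (G j) w - bE (t i) (G j) w) ^+ 2) `^ (p / 2))
  <= C * (\E w, nrm r (fun j => G j w) `^ p).
move=> p2; have q1 : 1 < p / 2 by rewrite ltr_pdivlMr// mul1r.
have p1 : 1 < p by apply: lt_trans p2; rewrite ltr1n.
have [C C0 HC] := garsia q1.
have [D D0 HD] := fs_max p1.
exists (C * (5 `^ (p / 2) * D)); first by rewrite !mulr_gt0.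
move=> N J r G n t tm tN.
pose d i w := \sum_(j <- r) (bE (t i.+1) (G j) w - bE (t i) (G j) w) ^+ 2.
have d0 i w : 0 <= d i w by apply: sumr_ge0 => j _; exact: sqr_ge0.
pose A k w := \sum_(i < k) d i w.
pose M w := \sum_(j <- r) bM (fun w => `|G j w|) N w ^+ 2.
have M0 w : 0 <= M w by apply: sumr_ge0 => j _; exact: sqr_ge0.
have EM k j w : (k <= N)%N -> `|bE k (G j) w| <= bM (fun w => `|G j w|) N w.
 by move=> kN; letr (bE_abs _ _ _); exact: bM_ge.
have EM2 k w : (k <= N)%N -> \sum_(j <- r) bE k (G j) w ^+ 2 <= M w.
 move=> kN; apply: ler_sum => j _; rewrite -(real_normK (num_real _)).
 by rewrite ler_pXn2r ?nnegrE ?bM_ge0// EM.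
via (C * (\E w, (5 * M w) `^ (p / 2))); last first.
 rewrite -mulrA ler_wpM2l ?(ltW C0)//.
 rewrite [X in bavg X](_ : _ = fun w => 5 `^ (p / 2) * nrm r (fun j => bM (fun w => `|G j w|) N w) `^ p); last first.
  by ext w; rewrite powRM// nrm_powR.
 rewrite bavgZ -mulrA ler_wpM2l ?powR_ge0//.
 have := HD N J r (fun j w => `|G j w|) (fun _ _ => normr_ge0 _) => /le_trans; apply.
 by under eq_fun do rewrite nrm_abs.
apply: (HC N n (fun k => t k.+1) A) => //.
- by move=> w; rewrite mulr_ge0.
- by move=> w; rewrite /A big_ord0.
- move=> k w c; apply: eq_bigr => i _; apply: eq_bigr => j _.
 have ik : (i <= k)%N by rewrite -ltnS.
 by congr ((_ - _) ^+ 2); apply: (bmeas_le _ (@bE_meas _ _ _ _)); apply: tm => //; exact: leqW.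
- by move=> i j ij; apply: tm.
- by move=> k w; rewrite /A big_ord_recr/= lerDl.
- move=> k h kn h0 hk.
 have e1 w : A n w - A k w = d k w + \sum_(k.+1 <= i < n) d i w.
  rewrite /A -!(big_mkord xpredT (fun i => d i w)) (@big_cat_nat _ _ _ k)//=; last exact: ltnW.
  by rewrite addrC addrK big_ltn.
 have e2 : (\E w, h w * \sum_(k.+1 <= i < n) d i w) <= (\E w, h w * M w).
  under eq_fun do rewrite mulr_sumr.
  rewrite bavg_sum.
  rewrite (eq_big_nat _ _ (F2 := fun i => (\E w, h w * \sum_(j <- r) (bE (t i.+1) (G j) w ^+ 2)) -
    (\E w, h w * \sum_(j <- r) (bE (t i) (G j) w ^+ 2)))); last first.
   move=> i /andP[ki _]; rewrite bE_orth ?tm//; last by apply: bmeas_le hk; exact: tm.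
   rewrite -bavgB; congr bavg; ext w; rewrite -mulrBr; by rewrite sumrB.
  rewrite telescope_sumr//; via (\E w, h w * \sum_(j <- r) bE (t n) (G j) w ^+ 2).
   rewrite gerBl; apply: bavg_ge0 => w; rewrite mulr_ge0// sumr_ge0// => j _; exact: sqr_ge0.
  by apply: bavg_le => w; rewrite ler_wpM2l// EM2.
 have e3 w : d k w <= 4 * M w.
  rewrite mulr_sumr; apply: ler_sum => j _.
  have := EM _ j w (tN k.+1); have := EM _ j w (tN k).
  set x := bE _ _ _; set y := bE _ _ _; set m := bM _ _ _ => hx hy.
  have hxy : `|y - x| <= 2 * m by letr (ler_normB _ _); lra.
  rewrite -(real_normK (num_real _)) (_ : 4 * m ^+ 2 = (2 * m) ^+ 2); last by ring.
  by rewrite ler_pXn2r ?nnegrE// (le_trans _ hxy).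
 under eq_fun do rewrite e1 mulrDr.
 rewrite bavgD.
 have : (\E w, h w * d k w) <= (\E w, 4 * (h w * M w)).
  by apply: bavg_le => w; rewrite mulrCA ler_wpM2l.
 rewrite [X in _ -> _ <= bavg X](_ : _ = fun w => 5 * (h w * M w)); last by ext w; ring.
 rewrite !bavgZ; lra.
Qed.

(** A lower bound for the Bregman divergence of the p-th power of the l^2 norm. Writing the inner
    product as s t minus a nonnegative defect reduces it to the scalar [powR_strong_convex]. *)
Lemma bregman (J : Type) (r : seq J) (a m : J -> R) (p : R) : 1 < p <= 2 ->
 p * (p - 1) / 4 * (\sum_(j <- r) (a j - m j) ^+ 2 * (Num.max (nrm r m) (nrm r a)) `^ (p - 2)) <=
 nrm r a `^ p - nrm r m `^ p - p * (nrm r m `^ (p - 2) * \sum_(j <- r) m j * (a j - m j)).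
move=> p12; have /andP[p1 p2] := p12; have p0 : 0 < p by exact: lt_trans p1.
set s := nrm r m; set t := nrm r a.
have s0 : 0 <= s by exact: nrm_ge0.
have t0 : 0 <= t by exact: nrm_ge0.
pose z := \sum_(j <- r) m j * a j.
have zst : z <= s * t by exact: sum_mul_le.
have -> : \sum_(j <- r) m j * (a j - m j) = z - s ^+ 2.
 by rewrite nrm_sqr -sumrB; apply: eq_bigr => j _; ring.
rewrite -mulr_suml.
have -> : \sum_(j <- r) (a j - m j) ^+ 2 = t ^+ 2 + s ^+ 2 - 2 * z.
 rewrite !nrm_sqr mulr_sumr -sumrN -!big_split/=; apply: eq_bigr => j _; ring.
have := powR_strong_convex p12 s0 t0.
set Mx := _ `^ (p - 2).
have sp : s `^ (p - 2) * s ^+ 2 = s `^ p.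
 have [->|sn] := eqVneq s 0; first by rewrite expr0n/= mulr0 powR0// gt_eqF.
 by rewrite -powR_mulrn// -powRD ?sn ?implybT//; congr (_ `^ _); ring.
have sp1 : s `^ (p - 2) * s = s `^ (p - 1).
 have [->|sn] := eqVneq s 0; first by rewrite mulr0 powR0// subr_eq0 gt_eqF.
 by rewrite -{2}(powRr1 s0) -powRD ?sn ?implybT//; congr (_ `^ _); ring.
have Mxs : s != 0 -> Mx <= s `^ (p - 2).
 move=> sn; apply: powR_anti; [lra|by rewrite lt_def sn|by rewrite le_max lexx].
have Mx0 : 0 <= Mx by exact: powR_ge0.
have hz : 0 <= s * t - z by rewrite subr_ge0.
have [sE|sn] := eqVneq s 0.
 have zE : z <= 0 by move: zst; rewrite sE mul0r.
 have z0 : z = 0.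
  apply/eqP; rewrite eq_le zE/= -oppr_le0 -sumrN.
  rewrite (eq_bigr (fun j => (- m j) * a j)); last by move=> j _; rewrite mulNr.
  letr (sum_mul_le _ _ _).
  have -> : nrm r (fun i => - m i) = s by congr Num.sqrt; apply: eq_bigr => j _; rewrite sqrrN.
  nra.
 have p0' : p != 0 by rewrite gt_eqF.
 have p1' : p - 1 != 0 by rewrite subr_eq0 gt_eqF.
 rewrite z0 sE expr0n/= (powR0 p0') (powR0 p1').
 by rewrite !subr0 !mul0r !mulr0 !subr0 !addr0 mulrA.
have := Mxs sn; rewrite -sp -sp1; set u := s `^ (p - 2); set v := t `^ p => h1 h2.
have h3 : p * (p - 1) / 4 * 2 * Mx * (s * t - z) <= p * u * (s * t - z).
 apply: ler_wpM2r => //; via (p * Mx).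
  apply: ler_wpM2r => //; nra.
 nra.
nra.
Qed.

(** The Bregman divergences between consecutive conditional expectations are summed: the linear term
    has mean zero and the main terms telescope, which bounds the squared differences with weight
    M^(p-2). Young's inequality and the maximal inequality for M remove the weight. *)
Lemma lp_le2 p : 1 < p <= 2 -> exists2 C : R, 0 < C &
 forall N J r (G : J -> W N -> R) n t,
  {homo t : i j / (i <= j)%N} -> (forall i, (t i <= N)%N) ->
  (\E w, (\sum_(i < n) \sum_(j <- r) (bE (t i.+1) (G j) w - bE (t i) (G j) w) ^+ 2) `^ (p / 2))
  <= C * (\E w, nrm r (fun j => G j w) `^ p).
move=> p12; have /andP[p1 p2] := p12; have p0 : 0 < p by exact: lt_trans p1.
have [D D0 HD] := doob p1.
pose c := p * (p - 1) / 4; have c0 : 0 < c by rewrite divr_gt0// mulr_gt0// subr_gt0.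
exists ((p / 2 * c^-1 + 1) * D).
 by rewrite mulr_gt0// addr_gt0// mulr_gt0 ?divr_gt0// invr_gt0.
move=> N J r G n t tm tN.
pose d i w := \sum_(j <- r) (bE (t i.+1) (G j) w - bE (t i) (G j) w) ^+ 2.
have d0 i w : 0 <= d i w by apply: sumr_ge0 => j _; exact: sqr_ge0.
pose S0 w := nrm r (fun j => G j w).
have S00 w : 0 <= S0 w by exact: nrm_ge0.
pose M := bM S0 N.
pose F i w := nrm r (fun j => bE (t i) (G j) w).
have F0 i w : 0 <= F i w by exact: nrm_ge0.
have FM i w : F i w <= M w by letr (nrm_bE _ _ _ _); exact: bM_ge.
have step i : c * (\E w, d i w * M w `^ (p - 2)) <= (\E w, F i.+1 w `^ p) - (\E w, F i w `^ p).
 have lin : (\E w, F i w `^ (p - 2) * \sum_(j <- r) bE (t i) (G j) w * (bE (t i.+1) (G j) w - bE (t i) (G j) w)) = 0.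
  under eq_fun do rewrite mulr_sumr.
  rewrite bavg_sum big1// => j _; under eq_fun do rewrite mulrA.
  rewrite (bavg_pull (k := t i)); last first.
   move=> w c'; have -> : F i (bmix (t i) w c') = F i w.
    by congr nrm; ext j'; rewrite bE_meas.
   by rewrite bE_meas.
  have -> : bE (t i) (fun w => bE (t i.+1) (G j) w - bE (t i) (G j) w) = fun=> 0.
   by ext w; rewrite bEB bE_tower ?tm// bE_tower// subrr.
  by under eq_fun do rewrite mulr0; rewrite bavg_cst.
 have : (\E w, c * (d i w * M w `^ (p - 2))) <=
   (\E w, (F i.+1 w `^ p - F i w `^ p) - p * (F i w `^ (p - 2) * \sum_(j <- r) bE (t i) (G j) w * (bE (t i.+1) (G j) w - bE (t i) (G j) w))).
  apply: bavg_le => w.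
  have := bregman r (fun j => bE (t i.+1) (G j) w) (fun j => bE (t i) (G j) w) p12.
  rewrite -/(F _ _) -/(F _ _) -mulr_suml -/(d i w) -/c; apply: le_trans.
  rewrite ler_wpM2l ?(ltW c0)//.
  have [mx|mx] := eqVneq (Num.max (F i w) (F i.+1 w)) 0.
   have F1 : F i w = 0 by apply/eqP; rewrite eq_le F0 -mx le_max lexx.
   have F2 : F i.+1 w = 0 by apply/eqP; rewrite eq_le F0 -mx le_max lexx orbT.
   have -> : d i w = 0; last by rewrite !mul0r.
   rewrite /d -nrm_sqr; have : nrm r (fun j => bE (t i.+1) (G j) w - bE (t i) (G j) w) <= 0.
    letr (nrmD r (fun j => bE (t _) (G j) w) (fun j => - bE (t i) (G j) w)).
    have -> : nrm r (fun j => - bE (t i) (G j) w) = F i w.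
     by congr Num.sqrt; apply: eq_bigr => j _; rewrite sqrrN.
    by rewrite -/(F _ _) F1 F2.
   by move=> h; rewrite (_ : nrm _ _ = 0) ?expr0n//; apply/eqP; rewrite eq_le h nrm_ge0.
  apply: ler_wpM2l => //; apply: powR_anti; [lra| |by rewrite ge_max !FM].
  by rewrite lt_def mx le_max F0.
 by rewrite !bavgB !bavgZ lin !mulr0 subr0.
have sum1 : c * (\E w, (\sum_(i < n) d i w) * M w `^ (p - 2)) <= (\E w, M w `^ p).
 under eq_fun do rewrite mulr_suml.
 rewrite bavg_sum mulr_sumr.
 via (\sum_(i < n) ((\E w, F i.+1 w `^ p) - (\E w, F i w `^ p))).
  exact: ler_sum => i _.
 have := @telescope_sumr _ 0 n (fun i => (\E w, F i w `^ p)) (leq0n _).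
 rewrite big_mkord => ->; via (\E w, F n w `^ p).
  by rewrite gerBl bavg_ge0// => w; exact: powR_ge0.
 by apply: bavg_le => w; apply: powR_mono => //; exact: ltW.
have main w : (\sum_(i < n) d i w) `^ (p / 2) <= p / 2 * ((\sum_(i < n) d i w) * M w `^ (p - 2)) + M w `^ p.
 set S := \sum_(i < n) d i w; have Sg : 0 <= S by apply: sumr_ge0 => i _.
 have [p2E|p2n] := eqVneq p 2.
  by rewrite p2E divff// powRr1// subrr powRr0 mulr1 mul1r lerDl powR_ge0.
 have t01 : 0 < p / 2 < 1 by rewrite divr_gt0//= ltr_pdivrMr// mul1r lt_neqAle p2n.
 have [Mz|Mn] := eqVneq (M w) 0.
  have -> : S = 0.
   apply: big1 => i _; apply/eqP; rewrite eq_le d0 andbT.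
   rewrite /d -nrm_sqr; have : nrm r (fun j => bE (t i.+1) (G j) w - bE (t i) (G j) w) <= 0.
    letr (nrmD r (fun j => bE (t _) (G j) w) (fun j => - bE (t i) (G j) w)).
    have -> : nrm r (fun j => - bE (t i) (G j) w) = F i w.
     by congr Num.sqrt; apply: eq_bigr => j _; rewrite sqrrN.
    rewrite -/(F _ w); have := FM i w; have := FM i.+1 w; lra.
   by move=> h; rewrite (_ : nrm _ _ = 0) ?expr0n//; apply/eqP; rewrite eq_le h nrm_ge0.
  by rewrite mul0r mulr0 add0r powR0 ?powR_ge0// gt_eqF// divr_gt0.
 have := @young_theta _ (S * M w `^ (p - 2)) (M w `^ p) (p / 2) (mulr_ge0 Sg (powR_ge0 _ _)) (powR_ge0 _ _) t01.
 rewrite powRM ?powR_ge0// -!powRrM -mulrA -powRD; last by rewrite Mn implybT.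
 have -> : (p - 2) * (p / 2) + p * (1 - p / 2) = 0 by field.
 rewrite powRr0 mulr1 => /le_trans; apply; rewrite lerD2l ler_piMl ?powR_ge0//.
 lra.
letr (bavg_le main); rewrite bavgD bavgZ.
have h1 : (\E w, (\sum_(i < n) d i w) * M w `^ (p - 2)) <= c^-1 * (\E w, M w `^ p).
 by rewrite mulrC ler_pdivlMr// mulrC.
have h2 : (\E w, M w `^ p) <= D * (\E w, S0 w `^ p) by exact: HD.
have p20 : 0 <= p / 2 by rewrite divr_ge0// ltW.
via ((p / 2 * c^-1 + 1) * (\E w, M w `^ p)).
 nra.
rewrite -(mulrA (_ + 1)); apply: ler_wpM2l => //.
by rewrite addr_ge0// mulr_ge0// invr_ge0 ltW.
Qed.

(** The maximal function is taken of the difference between the two ends of each block because, for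
    a time m inside the block, the deviation from the start of the block is the conditional
    expectation at time m of that difference. *)
Lemma mart_osc p : 1 < p -> exists2 C : R, 0 < C &
 forall N J r (G : J -> W N -> R) n t,
  {homo t : i j / (i <= j)%N} -> (forall i, (t i <= N)%N) ->
  (\E w, nrm [seq (i, j) | i <- index_enum 'I_n, j <- r]
   (fun u => bM (fun w' => `|bE (t u.1.+1) (G u.2) w' - bE (t u.1) (G u.2) w'|) N w) `^ p)
  <= C * (\E w, nrm r (fun j => G j w) `^ p).
move=> p1; have [D D0 HD] := fs_max p1.
have [E E0 HE] : exists2 C : R, 0 < C &
 forall N J r (G : J -> W N -> R) n t,
  {homo t : i j / (i <= j)%N} -> (forall i, (t i <= N)%N) ->
  (\E w, (\sum_(i < n) \sum_(j <- r) (bE (t i.+1) (G j) w - bE (t i) (G j) w) ^+ 2) `^ (p / 2))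
  <= C * (\E w, nrm r (fun j => G j w) `^ p).
 by have [p2|p2] := leP p 2; [apply: lp_le2; rewrite p1|exact: lp_ge2].
exists (D * E); first exact: mulr_gt0.
move=> N J r G n t tm tN; rewrite -mulrA.
have := HE N J r G n t tm tN => /(ler_wpM2l (ltW D0)); apply: le_trans.
have := HD N _ [seq (i, j) | i <- index_enum 'I_n, j <- r] (fun u w' => `|bE (t u.1.+1) (G u.2) w' - bE (t u.1) (G u.2) w'|).
move=> /(_ (fun _ _ => normr_ge0 _)) /le_trans; apply.
rewrite ler_wpM2l ?(ltW D0)//; apply: bavg_le => w; rewrite nrm_abs nrm_powR.
by rewrite big_allpairs.
Qed.

End martingale_inequalities.

(** * Averages over boxes: affine substitutions, splitting, Fubini *)

Section affine_map.
Context {R : realType} (a b : R).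

Definition affR (t : measurableTypeR R) : measurableTypeR R := (a * t + b)%R.

Let measurable_affR : mfunT affR.
exact: measurable_funD => //. Qed.

HB.instance Definition _ := isMeasurableFun.Build _ _ _ _ affR measurable_affR.

End affine_map.

Section box_averages.
Context {R : realType}.

Lemma lebesgue_affine (a b : R) (G : R -> \bar R) : 0 < a ->
 mfunT G -> (forall t, 0 <= G t)%E ->
 (\int[lebesgue_measure]_t G t = a%:E * \int[lebesgue_measure]_t G (a * t + b)%R)%E.
move=> a0 mG G0.
have maff : mfunT (affR a b) by [].
pose pf : {measure set (measurableTypeR R) -> \bar R} :=
 measure_function_pushforward__canonical__measure_function_Measure (@lebesgue_measure R) maff.
pose nu : {measure set (measurableTypeR R) -> \bar R} := mscale (NngNum (ltW a0)) pf.
have mi : forall A, measurable A -> lebesgue_measure A = nu A.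
 apply: lebesgue_measure_unique => _ [[x y] /= xy <-].
 rewrite /mscale/= /pushforward.
 have -> : affR a b @^-1` `]x, y]%classic = `](x - b) / a, (y - b) / a]%classic.
  apply/seteqP; split => t; rewrite /= !in_itv/= ltr_pdivrMr// ler_pdivlMr// ltrBlDr lerBrDr mulrC//.
 rewrite !lebesgue_measure_itv/= !lte_fin ltr_pM2r ?invr_gt0// ltrD2r.
 case: ifPn => _; last by rewrite mule0.
 by congr (_%:E); field; rewrite gt_eqF.
rewrite (eq_measure_integral nu); last by move=> A mA _; exact: mi.
rewrite ge0_integral_mscale//; congr (_ * _)%E.
by rewrite ge0_integral_pushforward.
Qed.

Lemma lebesgue_tupleS k (F : k.+1.-tuple R -> \bar R) :
 mfunT F -> (forall t, 0 <= F t)%E ->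
 (\int[lebesgue_tuple R k.+1]_t F t =
  \int[lebesgue_measure]_x \int[lebesgue_tuple R k]_t F [tuple of x :: t])%E.
move=> mF F0.
have mt : mfunT (@tuple_of_pair R k) by [].
have := @ge0_integral_pushforward _ _ _ _ R _ mt (lebesgue_measure \x lebesgue_tuple R k)%E setT F measurableT.
rewrite preimage_setT => /(_ _ _)-> //.
exact: @fubini_tonelli1 _ _ _ _ R lebesgue_measure (lebesgue_tuple R k) (F \o tuple_of_pair) (measurableT_comp mF mt) (fun=> F0 _).
Qed.

Definition affmap k (al be : 'I_k -> R) (t : k.-tuple R) : k.-tuple R :=
 [tuple al l * tnth t l + be l | l < k].

Lemma measurable_affmap k (al be : 'I_k -> R) : mfunT (affmap al be).
apply/measurable_fun_tnthP => l; rewrite (_ : _ \o _ = fun t => al l * tnth t l + be l).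
 by apply: measurable_funD => //; apply: measurable_funM => //; exact: measurable_tnth.
by apply/funext => t /=; rewrite tnth_mktuple.
Qed.

Lemma lebesgue_tuple_affine k (al be : 'I_k -> R) (F : k.-tuple R -> \bar R) :
 (forall l, 0 < al l) -> mfunT F -> (forall t, 0 <= F t)%E ->
 (\int[lebesgue_tuple R k]_t F t =
  (\prod_l al l)%:E * \int[lebesgue_tuple R k]_t F (affmap al be t))%E.
elim: k al be F => [|k IH] al be F al0 mF F0.
 rewrite big_ord0 mul1e; apply: eq_integral => t _; congr F.
 by apply: eq_from_tnth => -[].
have mFa : mfunT (F \o affmap al be).
 by apply: measurableT_comp => //; exact: measurable_affmap.
rewrite !lebesgue_tupleS//.
have mcons : mfunT (fun xt : measurableTypeR R * k.-tuple R => [tuple of xt.1 :: xt.2]).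
 by have := @measurable_funPT _ _ _ _ (@tuple_of_pair R k).
have mF2 : mfunT (fun xt : measurableTypeR R * k.-tuple R => F [tuple of xt.1 :: xt.2]).
 exact: measurableT_comp.
pose G x := (\int[lebesgue_tuple R k]_t F [tuple of x :: t])%E.
have G0 x : (0 <= G x)%E by apply: integral_ge0 => t _.
have mG : mfunT G by apply: (measurable_fun_fubini_tonelli_F _ mF2) => -[].
rewrite (lebesgue_affine (be ord0) (al0 ord0))// big_ord_recl EFinM -muleA; congr (_ * _)%E.
rewrite -ge0_integralZl//.
- apply: eq_integral => x _; rewrite (IH (fun l => al (lift ord0 l)) (fun l => be (lift ord0 l)))//.
  congr (_ * _)%E; apply: eq_integral => t _; congr F.
  apply: eq_from_tnth => l; rewrite tnth_mktuple; case: (unliftP ord0 l) => [j ->|->].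
   by rewrite !tnthS tnth_mktuple.
  by [].
 apply: measurableT_comp => //; apply: measurable_cons => //.
- have := @measurable_fun_fubini_tonelli_F _ _ (measurableTypeR R) (k.-tuple R) R (lebesgue_tuple R k) (fun xt : measurableTypeR R * k.-tuple R => F (affmap al be [tuple of xt.1 :: xt.2])).
 apply => //; first exact: measurableT_comp mFa _.
- by move=> x _; apply: integral_ge0.
- by rewrite lee_fin prodr_ge0// => l _; exact: ltW.
Qed.

Definition hb k (a b : 'I_k -> R) : set (k.-tuple R) :=
 [set t | forall l, a l <= tnth t l < b l].

Lemma measurable_hb k (a b : 'I_k -> R) : measurable (hb a b).
have -> : hb a b = \bigcap_(l in [set: 'I_k]) ((@tnth k R)^~ l @^-1` `[a l, b l[).
 apply/seteqP; split => t /=; first by move=> h l _; exact: h.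
 by move=> h l; have := h l I.
apply: fin_bigcap_measurable => // l _; rewrite -[X in measurable X]setTI.
exact: measurable_tnth.
Qed.

Lemma lebesgue_hb k a b : (forall l, a l <= b l) ->
 lebesgue_tuple R k (hb a b) = (\prod_l (b l - a l))%:E.
elim: k a b => [|k IH] a b ab.
 rewrite big_ord0 /= diracE; have -> : [tuple] \in hb a b by rewrite inE => -[].
 by [].
rewrite /= /pushforward.
have -> : tuple_of_pair @^-1` hb a b = (`[a ord0, b ord0[%classic : set (measurableTypeR R)) `*`
   hb (fun l => a (lift ord0 l)) (fun l => b (lift ord0 l)).
 apply/seteqP; split => -[x t]/=.
  move=> h; split; first by rewrite in_itv/=.
  by move=> l; have := h (lift ord0 l); rewrite tnthS.
 move=> [h1 h2] l; case: (unliftP ord0 l) => [j ->|->]; first by rewrite tnthS.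
 by [].
rewrite product_measure1E//; last exact: measurable_hb.
rewrite [X in (_ * X)%E](IH (fun l => a (lift ord0 l)) (fun l => b (lift ord0 l)))//= lebesgue_measure_itv/= big_ord_recl EFinM lte_fin; congr (_ * _)%E.
have := ab ord0; rewrite le_eqVlt => /orP[/eqP ->|->//]; first by rewrite ltxx subrr.
Qed.

Lemma measurable_tuple_affine k al be (F : k.-tuple R -> R) :
 mfunT F -> mfunT (fun t => F (affmap al be t)).
by move=> mF; apply: measurableT_comp => //; exact: measurable_affmap. Qed.

Definition Bt k (F : k.-tuple R -> R) :=
 mfunT F /\ exists M, forall t, `|F t| <= M.

Definition vol k (a b : 'I_k -> R) : R := \prod_l (b l - a l).

Definition av k (a b : 'I_k -> R) (F : k.-tuple R -> R) : R :=
 (vol a b)^-1 * \int[lebesgue_tuple R k]_(t in hb a b) F t.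

Definition lt_box k (a b : 'I_k -> R) := forall l, a l < b l.

Lemma vol_gt0 k (a b : 'I_k -> R) : lt_box a b -> 0 < vol a b.
by move=> ab; apply: prodr_gt0 => l _; rewrite subr_gt0. Qed.

Lemma Bt_integrable k a b F : lt_box a b -> Bt F ->
 (lebesgue_tuple R k).-integrable (hb a b) (EFin \o F).
move=> ab [mF [M FM]]; apply: measurable_bounded_integrable.
- exact: measurable_hb.
- have h : lebesgue_tuple R k (hb a b) = _ := lebesgue_hb (fun l => ltW (ab l)).
 by rewrite [X in (X < _)%E]h ltry.
- exact: measurable_funTS.
- by exists M; split; [exact: num_real|move=> y My t _; exact: le_trans (FM t) (ltW My)].
Qed.

Section av.
Variables (k : nat) (a b : 'I_k -> R).
Hypothesis ab : lt_box a b.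
Let mhb := measurable_hb a b.

Lemma avD F G : Bt F -> Bt G -> av a b (fun t => F t + G t) = av a b F + av a b G.
by move=> bF bG; rewrite /av RintegralD ?mulrDr//; exact: Bt_integrable. Qed.

Lemma avZ c F : Bt F -> av a b (fun t => c * F t) = c * av a b F.
by move=> bF; rewrite /av (RintegralZl c mhb (Bt_integrable ab bF)) mulrCA. Qed.

Lemma av_cst c : av a b (fun=> c) = c.
have h : lebesgue_tuple R k (hb a b) = _ := lebesgue_hb (fun l => ltW (ab l)).
rewrite /av (Rintegral_cst _ mhb) [X in fine X]h/= -/(vol a b).
by rewrite mulrC mulfK// gt_eqF// vol_gt0.
Qed.

Lemma av_le F G : Bt F -> Bt G -> (forall t, hb a b t -> F t <= G t) -> av a b F <= av a b G.
move=> bF bG FG; rewrite ler_wpM2l ?invr_ge0 ?(ltW (vol_gt0 ab))//.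
by apply: le_Rintegral => //; exact: Bt_integrable.
Qed.

Lemma av_ge0 F : (forall t, hb a b t -> 0 <= F t) -> 0 <= av a b F.
move=> F0; rewrite mulr_ge0 ?invr_ge0 ?(ltW (vol_gt0 ab))//.
exact: Rintegral_ge0.
Qed.

Lemma av_eq F G : (forall t, hb a b t -> F t = G t) -> av a b F = av a b G.
by move=> FG; congr (_ * _); apply: eq_Rintegral => t; rewrite inE; exact: FG. Qed.

Lemma av_affine (al be : 'I_k -> R) F : (forall l, 0 < al l) -> Bt F ->
 av a b (fun t => F (affmap al be t)) =
 av (fun l => al l * a l + be l) (fun l => al l * b l + be l) F.
move=> al0 bF; have mF := bF.1; rewrite /av.
have -> : vol (fun l => al l * a l + be l) (fun l => al l * b l + be l) = \prod_l al l * vol a b.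
 by rewrite -big_split/=; apply: eq_bigr => l _; ring.
have p0 : 0 < \prod_l al l by exact: prodr_gt0.
set A' := hb (fun l => al l * a l + be l) (fun l => al l * b l + be l).
have hbE t : (affmap al be t \in A') = (t \in hb a b).
 apply/idP/idP; rewrite !inE => h l.
  have := h l; rewrite tnth_mktuple lerD2r ltrD2r ler_pM2l// ltr_pM2l//.
 by rewrite tnth_mktuple lerD2r ltrD2r ler_pM2l// ltr_pM2l.
have key (H : k.-tuple R -> \bar R) : mfunT H -> (forall t, 0 <= H t)%E ->
  (\int[lebesgue_tuple R k]_(t in A') H t = (\prod_l al l)%:E * \int[lebesgue_tuple R k]_(t in hb a b) H (affmap al be t))%E.
 move=> mH H0; rewrite integral_mkcond (lebesgue_tuple_affine be al0); last 2 first.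
 - by apply/(measurable_restrictT _ (measurable_hb _ _)); exact: measurable_funTS.
 - by move=> t; rewrite erestrict_ge0.
 by congr (_ * _)%E; rewrite [RHS]integral_mkcond; apply: eq_integral => t _; rewrite !patchE hbE.
rewrite /Rintegral integralE [in RHS]integralE.
rewrite (key (fun t => ((EFin \o F)^\+ t)%E)); last 2 first.
- by apply: measurable_funepos; exact/measurable_EFinP.
- by [].
rewrite (key (fun t => ((EFin \o F)^\- t)%E)); last 2 first.
- by apply: measurable_funeneg; exact/measurable_EFinP.
- by [].
have bF' : Bt (fun t => F (affmap al be t)).
 by split; [exact: measurable_tuple_affine|case: bF => _ [M FM]; exists M => t].
have iF := Bt_integrable ab bF'.
have f1 := integrable_pos_fin_num mhb iF.
have f2 := integrable_neg_fin_num mhb iF.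
set A := (\int[_]_(t in hb a b) (EFin \o F)^\+ (affmap al be t))%E.
set B := (\int[_]_(t in hb a b) (EFin \o F)^\- (affmap al be t))%E.
transitivity ((vol a b)^-1 * fine (A - B)).
 by congr (_ * fine (_ - _)); apply: eq_integral => t _; rewrite ?funeposE ?funenegE.
have fA : A \is a fin_num.
 by move: f1; congr (_ \is a fin_num); apply: eq_integral => t _; rewrite !funeposE.
have fB : B \is a fin_num.
 by move: f2; congr (_ \is a fin_num); apply: eq_integral => t _; rewrite !funenegE.
rewrite -(fineK fA) -(fineK fB) /=.
by field; rewrite !gt_eqF// vol_gt0.
Qed.

End av.

Definition upd k (f : 'I_k -> R) (l : 'I_k) (c : R) : 'I_k -> R :=
 fun i => if i == l then c else f i.

Lemma updE k (f : 'I_k -> R) l c : upd f l c l = c.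
by rewrite /upd eqxx. Qed.

Lemma upd_neq k (f : 'I_k -> R) l c i : i != l -> upd f l c i = f i.
by rewrite /upd => /negbTE->. Qed.

Lemma vol_upd k (a b : 'I_k -> R) l : vol a b = (b l - a l) * \prod_(i | i != l) (b i - a i).
by rewrite /vol (bigD1 l). Qed.

Lemma lt_box_updl k (a b : 'I_k -> R) l c : lt_box a b -> c < b l -> lt_box (upd a l c) b.
by move=> ab cb i; rewrite /upd; case: eqP => [->|_]//. Qed.

Lemma lt_box_updr k (a b : 'I_k -> R) l c : lt_box a b -> a l < c -> lt_box a (upd b l c).
by move=> ab cb i; rewrite /upd; case: eqP => [->|_]//. Qed.

Lemma av_split k (a b : 'I_k -> R) l c F : lt_box a b -> a l < c < b l -> Bt F ->
 (b l - a l) * av a b F =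
 (c - a l) * av a (upd b l c) F + (b l - c) * av (upd a l c) b F.
move=> ab /andP[ac cb] bF.
have e1 : \prod_(i | i != l) (upd b l c i - a i) = \prod_(i | i != l) (b i - a i).
 by apply: eq_bigr => i il; rewrite upd_neq.
have e2 : \prod_(i | i != l) (b i - upd a l c i) = \prod_(i | i != l) (b i - a i).
 by apply: eq_bigr => i il; rewrite upd_neq.
rewrite /av (vol_upd a b l) (vol_upd a _ l) (vol_upd _ b l) !updE e1 e2.
have d1 : b l - a l != 0 by rewrite subr_eq0 gt_eqF.
have d2 : c - a l != 0 by rewrite subr_eq0 gt_eqF.
have d3 : b l - c != 0 by rewrite subr_eq0 gt_eqF.
rewrite !invfM !mulrA !divff// -mulrDr; congr (_ * _).
have hU : hb a b = hb a (upd b l c) `|` hb (upd a l c) b.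
 apply/seteqP; split => t.
  move=> h; have [tc|tc] := ltP (tnth t l) c; [left|right] => i; rewrite /upd; case: eqP => [->|_]//.
   by rewrite tc andbT; have /andP[] := h l.
  by rewrite tc; have /andP[] := h l.
 move=> [h|h] i; have := h i; rewrite /upd; case: eqP => [->|_]// /andP[h1 h2].
  lra.
 lra.
rewrite [in LHS]hU Rintegral_setU//; try exact: measurable_hb.
 by rewrite -hU; exact: Bt_integrable.
apply/disj_setPS => t [h1 h2]; have := h1 l; have := h2 l; rewrite !updE => /andP[h _] /andP[_ h'].
lra.
Qed.

Definition shiftt k (l : 'I_k) (tau : R) (t : k.-tuple R) : k.-tuple R :=
 affmap (fun=> 1) (fun i => if i == l then tau else 0) t.

Lemma tnth_shiftt k l i tau (t : k.-tuple R) :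
 tnth (shiftt l tau t) i = if i == l then tnth t i + tau else tnth t i.
by rewrite tnth_mktuple mul1r; case: eqP => _; rewrite ?addr0. Qed.

(** A shift by less than the side length changes the box only by two slabs of thickness tau; the
    prefactor is their relative volume and gives the smallness used in differencing. *)
Lemma av_shift k (a b : 'I_k -> R) l tau F : lt_box a b -> 0 < tau < b l - a l -> Bt F ->
 av a b (fun t => F (shiftt l tau t)) - av a b F =
 tau / (b l - a l) * (av (upd a l (b l)) (upd b l (b l + tau)) F - av a (upd b l (a l + tau)) F).
move=> ab /andP[t0 tb] bF.
have d : b l - a l != 0 by rewrite subr_eq0 gt_eqF.
rewrite av_affine//.
pose a1 := upd a l (a l + tau); pose b1 := upd b l (b l + tau).
rewrite (_ : (fun i => 1 * a i + _) = a1); last first.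
 by ext i; rewrite /a1 /upd mul1r; case: eqP => [->|_]//; rewrite addr0.
rewrite (_ : (fun i => 1 * b i + _) = b1); last first.
 by ext i; rewrite /b1 /upd mul1r; case: eqP => [->|_]//; rewrite addr0.
have ab1 : lt_box a b1 by apply: lt_box_updr => //; lra.
have h1 : a l < b l < b1 l by rewrite /b1 updE; lra.
have h2 : a l < a l + tau < b1 l by rewrite /b1 updE; lra.
have := av_split ab1 h1 bF; have := av_split ab1 h2 bF.
have -> : upd b1 l (b l) = b by ext i; rewrite /b1 /upd; case: eqVneq => [->|].
have -> : upd b1 l (a l + tau) = upd b l (a l + tau) by ext i; rewrite /b1 /upd; case: (i == l).
rewrite -/a1 /b1 updE -/b1 => -> e.
move: e; set x1 := av a1 b1 F; set x2 := av a (upd b l _) F; set x3 := av (upd a l _) _ F.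
set x4 := av a b F => e.
apply: (mulfI d); rewrite [RHS](_ : _ = tau * (x3 - x2)); last by field.
lra.
Qed.

Lemma Rint_EFin d (X : measurableType d) (mu : {measure set X -> \bar R}) D f :
 measurable D -> mu.-integrable D (EFin \o f) ->
 (\int[mu]_(x in D) f x)%:E = (\int[mu]_(x in D) (f x)%:E)%E.
by move=> mD fi; rewrite fineK//; exact: integrable_fin_num. Qed.

Section fubini.
Context d (X : measurableType d) (mu : {sigma_finite_measure set X -> \bar R}).
Variables (k : nat) (a b : 'I_k -> R) (G : X * k.-tuple R -> R) (M K : R).
Hypotheses (ab : lt_box a b) (mG : mfunT G)
 (GM : forall u, `|G u| <= M)
 (GK : forall t, (\int[mu]_x `|(G (x, t))%:E| <= K%:E)%E).

Let H (u : X * k.-tuple R) : R := G u * \1_(hb a b) u.2.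

Let mI : mfunT (\1_(hb a b) : k.-tuple R -> R).
by apply: measurable_indic; exact: measurable_hb. Qed.

Let mH : mfunT H.
by apply: measurable_funM => //; exact: measurableT_comp mI (@measurable_snd _ _ X (k.-tuple R)).
Qed.

Lemma av_slice x : Bt (fun t => G (x, t)).
split; last by exists M.
exact: measurableT_comp.
Qed.

Lemma measurable_slice t : mfunT (fun x => G (x, t)).
exact: measurableT_comp. Qed.

Lemma integrable_slice t : mu.-integrable setT (EFin \o (fun x => G (x, t))).
apply/integrableP; split; first by apply/measurable_EFinP; exact: measurable_slice.
exact: le_lt_trans (GK t) (ltry _).
Qed.

Let HE x : (\int[lebesgue_tuple R k]_t (H (x, t))%:E = \int[lebesgue_tuple R k]_(t in hb a b) (G (x, t))%:E)%E.
rewrite [RHS]integral_mkcond; apply: eq_integral => t _; rewrite /H/= patchE indicE.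
by case: ifPn => h; rewrite ?mulr1 ?mulr0.
Qed.

Let iH : (mu \x lebesgue_tuple R k)%E.-integrable setT (EFin \o H).
apply/integrable21ltyP; first exact/measurable_EFinP.
have K0 : (0 <= K%:E)%E by apply: le_trans (GK (nseq_tuple k 0)); exact: integral_ge0.
apply: (@le_lt_trans _ _ (\int[lebesgue_tuple R k]_t (K * \1_(hb a b) t)%:E)%E).
 apply: ge0_le_integral => //.
 - by move=> t _; exact: integral_ge0.
 - apply: (@measurable_fun_fubini_tonelli_G _ _ X (k.-tuple R) R mu (fun u => `|(H u)%:E|%E)) => //.
  by apply/measurableT_comp => //; exact/measurable_EFinP.
 - by apply/measurable_EFinP; apply: measurable_funM => //.
 move=> t _; rewrite /H/= indicE; case: (t \in _); rewrite ?mulr1 ?mulr0.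
  by under eq_integral do rewrite mulr1; exact: GK.
 by under eq_integral do rewrite mulr0 normr0; rewrite integral0.
under eq_integral do rewrite EFinM.
rewrite ge0_integralZl//.
- rewrite integral_indic ?setIT//; last exact: measurable_hb.
 have h : lebesgue_tuple R k (hb a b) = _ := lebesgue_hb (fun l => ltW (ab l)).
 by rewrite [X in (_ * X)%E]h ltry.
- by apply/measurable_EFinP.
Qed.

Let F x : R := \int[lebesgue_tuple R k]_(t in hb a b) G (x, t).

Let FE x : (F x)%:E = (\int[lebesgue_tuple R k]_t (H (x, t))%:E)%E.
by rewrite Rint_EFin//; [exact: measurable_hb|exact: Bt_integrable ab (av_slice x)]. Qed.

Let iF : mu.-integrable setT (EFin \o F).
have := integrable_fubini_F iH.
by apply: eq_integrable => // x _; rewrite /fubini_F/=.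
Qed.

Lemma av_integrable : mu.-integrable setT (EFin \o (fun x => av a b (fun t => G (x, t)))).
have := integrableZl measurableT (vol a b)^-1 iF.
by [].
Qed.

Lemma Bt_int : Bt (fun t => \int[mu]_x G (x, t)).
split.
 have -> : (fun t => \int[mu]_x G (x, t)) = fine \o (fun t => (\int[mu]_x (EFin \o G)^\+ (x, t) - \int[mu]_x (EFin \o G)^\- (x, t))%E).
  ext t; rewrite /Rintegral integralE; congr (fine (_ - _)); apply: eq_integral => x _; by rewrite ?funeposE ?funenegE.
 have mGE : mfunT (EFin \o G) by exact/measurable_EFinP.
 apply: measurableT_comp; first exact: fine_measurable.
 apply: emeasurable_funB.
  by apply: measurable_fun_fubini_tonelli_G => //; exact: measurable_funepos.
 by apply: measurable_fun_fubini_tonelli_G => //; exact: measurable_funeneg.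
exists K => t; apply: (le_trans (le_normr_Rintegral _ _)) => //; first exact: integrable_slice.
rewrite -lee_fin Rint_EFin//; last exact: integrable_abse (integrable_slice t).
exact: GK.
Qed.

Lemma av_fubini : \int[mu]_x av a b (fun t => G (x, t)) = av a b (fun t => \int[mu]_x G (x, t)).
transitivity (\int[mu]_x ((vol a b)^-1 * F x)) => //.
rewrite RintegralZl//; congr (_ * _).
apply: EFin_inj; rewrite Rint_EFin//.
rewrite (Rint_EFin (measurable_hb a b)); last exact: Bt_integrable ab Bt_int.
under eq_integral do rewrite FE.
rewrite (Fubini iH) [RHS]integral_mkcond; apply: eq_integral => t _; rewrite patchE.
case: ifPn => h.
 rewrite Rint_EFin//; last exact: integrable_slice.
 by apply: eq_integral => x _; rewrite /H/= indicE h mulr1.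
by rewrite integral0_eq// => x _; rewrite /H/= indicE (negbTE h) mulr0.
Qed.

End fubini.
End box_averages.

(** * Actions of R^d, function classes and Markov operators *)

Record dsys (R : realType) (d : nat) := DSys {
 sdisp : measure_display;
 sX : measurableType sdisp;
 smu : {sigma_finite_measure set sX -> \bar R};
 sT : ('I_d -> R) -> sX -> sX;
 sT_meas : mfunT (fun xt : sX * d.-tuple R => sT (tnth xt.2) xt.1);
 sT_pres : forall v E, measurable E -> smu (sT v @^-1` E) = smu E;
 sTD : forall v w x, sT v (sT w x) = sT (fun i => v i + w i) x;
 sT0 : forall x, sT (fun=> 0) x = x }.

Section functions.
Context {R : realType} {d : nat} (s : dsys R d).
Notation X := (sX s).
Notation mu := (smu s).
Implicit Types (f g : X -> R) (p : R).

Definition Bm f := mfunT f /\ exists M, forall x, `|f x| <= M.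
(** The working class until the final passage to the limit: bounded integrable functions lie in
    every L^p with p >= 1 and are stable under products and powers, so integrals can be real-valued
    without further integrability arguments. *)
Definition B1 f := Bm f /\ mu.-integrable setT (EFin \o f).
Definition II f : R := \int[mu]_x f x.

Lemma Bm_cst c : Bm (fun=> c).
by split; [by []|exists `|c|]. Qed.

Lemma BmD f g : Bm f -> Bm g -> Bm (fun x => f x + g x).
move=> [mf [M fM]] [mg [N gN]]; split; first exact: measurable_funD.
by exists (M + N) => x; letr (ler_normD _ _); exact: lerD.
Qed.

Lemma BmM f g : Bm f -> Bm g -> Bm (fun x => f x * g x).
move=> [mf [M fM]] [mg [N gN]]; split; first exact: measurable_funM.
by exists (M * N) => x; rewrite normrM; apply: ler_pM.
Qed.

Lemma BmZ c f : Bm f -> Bm (fun x => c * f x).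
by apply: BmM => //; exact: Bm_cst. Qed.

Lemma BmB f g : Bm f -> Bm g -> Bm (fun x => f x - g x).
move=> bf bg; have := BmD bf (BmZ (-1) bg).
by congr Bm; ext x; rewrite mulN1r.
Qed.

Lemma BmX f n : Bm f -> Bm (fun x => f x ^+ n).
move=> bf; elim: n => [|n IH]; first exact: Bm_cst.
by have := BmM bf IH; congr Bm; ext x; rewrite exprS.
Qed.

Lemma Bm_norm f : Bm f -> Bm (fun x => `|f x|).
move=> [mf [M fM]]; split; first exact: measurableT_comp.
by exists M => x; rewrite normr_id.
Qed.

Lemma Bm_pow f p : 0 <= p -> (forall x, 0 <= f x) -> Bm f -> Bm (fun x => f x `^ p).
move=> p0 f0 [mf [M fM]]; split; first exact: (measurableT_comp (measurable_powR p)).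
exists (M `^ p) => x; rewrite ger0_norm ?powR_ge0//; apply: powR_mono => //.
by rewrite -(ger0_norm (f0 x)).
Qed.

Lemma Bm_max f g : Bm f -> Bm g -> Bm (fun x => Num.max (f x) (g x)).
move=> [mf [M fM]] [mg [N gN]]; split; first exact: measurable_maxr.
exists (Num.max M N) => x; rewrite le_max; have [_|_] := leP (f x) (g x).
 by rewrite gN orbT.
by rewrite fM.
Qed.

Lemma Bm_sum J r (F : J -> X -> R) : (forall j, Bm (F j)) ->
 Bm (fun x => \sum_(j <- r) F j x).
move=> bF; elim: r => [|j r IH].
 by under eq_fun do rewrite big_nil; exact: Bm_cst.
by under eq_fun do rewrite big_cons; exact: BmD.
Qed.

Lemma Bm_nrm J r (F : J -> X -> R) : (forall j, Bm (F j)) ->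
 Bm (fun x => nrm r (F^~ x)).
move=> bF; rewrite (_ : (fun x => _) = fun x => (\sum_(j <- r) F j x ^+ 2) `^ 2^-1).
 apply: Bm_pow; rewrite ?invr_ge0//.
  by move=> x; pos.
 by apply: Bm_sum => j; exact: BmX.
ext x; rewrite powR12_sqrt//.
pos.
Qed.

Lemma Bm_cut f g c : Bm f -> Bm g -> Bm (fun x => if c <= g x then f x else 0).
move=> [mf [M fM]] [mg _]; split.
 by apply: measurable_fun_ifT => //; apply: measurable_fun_ler => //.
exists M => x; case: ifP => // _; rewrite normr0; exact: le_trans (fM x).
Qed.

Lemma B1_Bm f : B1 f -> Bm f. Proof. by case. Qed.

Lemma B1_dom f g : Bm f -> B1 g -> (forall x, `|f x| <= g x) -> B1 f.
move=> bf [bg ig] fg; split => //; apply: le_integrable ig => //.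
 by apply/measurable_EFinP; case: bf.
by move=> x _ /=; letr (fg x); exact: ler_norm.
Qed.

Lemma B1_0 : B1 (fun=> 0).
by split; [exact: Bm_cst|exact: integrable0]. Qed.

Lemma B1D f g : B1 f -> B1 g -> B1 (fun x => f x + g x).
by move=> [bf f1] [bg g1]; split; [exact: BmD|exact: integrableD _ f1 g1]. Qed.

Lemma B1Z c f : B1 f -> B1 (fun x => c * f x).
by move=> [bf f1]; split; [exact: BmZ|exact: (integrableZl _ c f1)]. Qed.

Lemma B1B f g : B1 f -> B1 g -> B1 (fun x => f x - g x).
move=> bf bg; have := B1D bf (B1Z (-1) bg).
by congr B1; ext x; rewrite mulN1r.
Qed.

Lemma B1_norm f : B1 f -> B1 (fun x => `|f x|).
by move=> [bf f1]; split; [exact: Bm_norm|exact: integrable_abse f1]. Qed.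

Lemma B1M f g : B1 f -> Bm g -> B1 (fun x => f x * g x).
move=> bf bg; have [_ [M gM]] := bg.
apply: (B1_dom (BmM (B1_Bm bf) bg) (B1Z M (B1_norm bf))) => x.
by rewrite normrM mulrC ler_wpM2r.
Qed.

Lemma B1_sum J r (F : J -> X -> R) : (forall j, B1 (F j)) ->
 B1 (fun x => \sum_(j <- r) F j x).
move=> bF; elim: r => [|j r IH].
 by under eq_fun do rewrite big_nil; exact: B1_0.
by under eq_fun do rewrite big_cons; exact: B1D.
Qed.

Lemma B1_max f g : B1 f -> B1 g -> B1 (fun x => Num.max (f x) (g x)).
move=> bf bg; apply: (B1_dom (Bm_max (B1_Bm bf) (B1_Bm bg)) (B1D (B1_norm bf) (B1_norm bg))) => x.
by rewrite /Num.max; case: ifP => _; rewrite ?lerDl ?lerDr.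
Qed.

Lemma nrm_le_sum J r (v : J -> R) : nrm r v <= \sum_(j <- r) `|v j|.
have := nrm_sum [:: tt] r (fun j _ => v j).
elim: r => [|j r IH _]; first by rewrite !big_nil /nrm big_nil sqrtr0.
rewrite big_cons; apply: le_trans (lerD (lexx _) (IH _)); last first.
 exact: le_trans (nrm_sum _ _ _).
have v0 : 0 <= nrm r v by exact: nrm_ge0.
rewrite -(@ler_pXn2r _ 2) ?nnegrE ?nrm_ge0 ?addr_ge0// nrm_sqr big_cons -nrm_sqr.
rewrite sqrrD real_normK ?num_real// addrAC lerDl mulrn_wge0// mulr_ge0//.
Qed.

Lemma B1_nrm J r (F : J -> X -> R) : (forall j, B1 (F j)) ->
 B1 (fun x => nrm r (F^~ x)).
move=> bF; apply: (B1_dom (Bm_nrm r (fun j => B1_Bm (bF j))) (B1_sum r (fun j => B1_norm (bF j)))) => x.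
by rewrite ger0_norm ?nrm_ge0//; exact: nrm_le_sum.
Qed.

Lemma B1_pow f p : 1 <= p -> (forall x, 0 <= f x) -> B1 f -> B1 (fun x => f x `^ p).
move=> p1 f0 bf; have [[_ [M fM]] _] := bf.
have p0 : 0 <= p by exact: le_trans p1.
apply: (B1_dom (Bm_pow p0 f0 (B1_Bm bf)) (B1Z (M `^ (p - 1)) bf)) => x.
rewrite ger0_norm ?powR_ge0// -(powRp (f0 x)); last by rewrite gt_eqF// (lt_le_trans ltr01).
rewrite mulrC ler_wpM2r//; apply: powR_mono; rewrite ?subr_ge0//.
by rewrite -(ger0_norm (f0 x)).
Qed.

Lemma B1X f n : B1 f -> B1 (fun x => f x ^+ n.+1).
move=> bf; under eq_fun do rewrite exprS; apply: B1M => //; apply: BmX; exact: B1_Bm.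
Qed.

Lemma B1_cut f g c : B1 f -> Bm g -> B1 (fun x => if c <= g x then f x else 0).
move=> bf bg; apply: (B1_dom (Bm_cut _ (B1_Bm bf) bg) (B1_norm bf)) => x.
by case: ifP => _; rewrite ?normr0.
Qed.

Lemma II_le f g : B1 f -> B1 g -> (forall x, f x <= g x) -> II f <= II g.
by move=> [_ f1] [_ g1] fg; apply: le_Rintegral => // x _. Qed.

Lemma IID f g : B1 f -> B1 g -> II (fun x => f x + g x) = II f + II g.
by move=> [_ f1] [_ g1]; rewrite /II RintegralD. Qed.

Lemma IIB f g : B1 f -> B1 g -> II (fun x => f x - g x) = II f - II g.
by move=> [_ f1] [_ g1]; rewrite /II RintegralB. Qed.

Lemma IIZ c f : B1 f -> II (fun x => c * f x) = c * II f.
by move=> [_ f1]; rewrite /II RintegralZl. Qed.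

Lemma II_ge0 f : (forall x, 0 <= f x) -> 0 <= II f.
by move=> f0; apply: Rintegral_ge0. Qed.

Lemma II0 : II (fun=> 0) = 0.
have := IIZ 0 B1_0; under eq_fun do rewrite mul0r.
lra.
Qed.

Lemma II_sum J r (F : J -> X -> R) : (forall j, B1 (F j)) ->
 II (fun x => \sum_(j <- r) F j x) = \sum_(j <- r) II (F j).
move=> bF; elim: r => [|j r IH].
 by under eq_fun do rewrite big_nil; rewrite II0 big_nil.
under eq_fun do rewrite big_cons; rewrite IID ?IH ?big_cons//; exact: B1_sum.
Qed.

Lemma II_fin f : B1 f -> (II f)%:E = (\int[mu]_x (f x)%:E)%E.
by move=> [_ f1]; rewrite Rint_EFin. Qed.

Definition n2 f := Num.sqrt (II (fun x => f x ^+ 2)).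

Lemma n2_ge0 f : 0 <= n2 f. Proof. exact: sqrtr_ge0. Qed.

Lemma n2_sqr f : n2 f ^+ 2 = II (fun x => f x ^+ 2).
by rewrite sqr_sqrtr// II_ge0// => x; pos. Qed.

Lemma II_CS f g : B1 f -> B1 g -> II (fun x => f x * g x) <= n2 f * n2 g.
move=> bf bg.
have [h|h] := leP (II (fun x => f x * g x)) 0.
 by letr h; rewrite mulr_ge0// n2_ge0.
rewrite -(@ler_pXn2r _ 2) ?nnegrE ?mulr_ge0 ?n2_ge0 ?(ltW h)//.
rewrite exprMn !n2_sqr.
set A := II (fun x => f x ^+ 2); set B := II (fun x => g x ^+ 2); set C := II (fun x => f x * g x).
have bff := B1X 1 bf; have bgg := B1X 1 bg; have bfg := B1M bf (B1_Bm bg).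
have key x y : 0 <= x ^+ 2 * A - 2 * (x * y) * C + y ^+ 2 * B.
 have -> : x ^+ 2 * A - 2 * (x * y) * C + y ^+ 2 * B = II (fun u => (x * f u - y * g u) ^+ 2).
  rewrite (_ : (fun u => (x * f u - y * g u) ^+ 2) =
    fun u => (x ^+ 2 * f u ^+ 2 - 2 * (x * y) * (f u * g u)) + y ^+ 2 * g u ^+ 2); last by ext u; ring.
  rewrite IID ?IIB ?IIZ//; [exact: B1Z|exact: B1Z| |exact: B1Z].
  by apply: B1B; exact: B1Z.
 by apply: II_ge0 => u; pos.
have A0 : 0 <= A by apply: II_ge0 => i; pos.
have B0 : 0 <= B by apply: II_ge0 => i; pos.
have [AE|An] := eqVneq A 0.
 exfalso; have := key ((B + 1) / C) 1; rewrite AE.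
 have -> : ((B + 1) / C) ^+ 2 * 0 - 2 * ((B + 1) / C * 1) * C + 1 ^+ 2 * B = - B - 2.
  by field; rewrite gt_eqF.
 lra.
have Ap : 0 < A by rewrite lt_def An.
have := key C A.
nra.
Qed.

Lemma n2D f g : B1 f -> B1 g -> n2 (fun x => f x + g x) <= n2 f + n2 g.
move=> bf bg; rewrite -(@ler_pXn2r _ 2) ?nnegrE ?addr_ge0 ?n2_ge0//.
have bff := B1X 1 bf; have bgg := B1X 1 bg; have bfg := B1M bf (B1_Bm bg).
rewrite sqrrD !n2_sqr.
rewrite (_ : (fun x => (f x + g x) ^+ 2) = fun x => (f x ^+ 2 + 2 * (f x * g x)) + g x ^+ 2); last by ext x; ring.
rewrite ?IID ?IIZ//; [|exact: B1Z|by apply: B1D => //; exact: B1Z].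
by have := II_CS bf bg; lra.
Qed.

Lemma n2Z c f : B1 f -> n2 (fun x => c * f x) = `|c| * n2 f.
move=> bf; rewrite /n2; under eq_fun do rewrite exprMn.
rewrite IIZ; last exact: B1X 1 bf.
by rewrite sqrtrM ?sqr_ge0// sqrtr_sqr.
Qed.

Lemma n2B f g : B1 f -> B1 g -> n2 (fun x => f x - g x) <= n2 f + n2 g.
move=> bf bg; have := n2D bf (B1Z (-1) bg); rewrite n2Z// normrN1 mul1r.
by congr (_ <= _); congr n2; ext x; rewrite mulN1r.
Qed.

Lemma n2_sum J r (F : J -> X -> R) : (forall j, B1 (F j)) ->
 n2 (fun x => \sum_(j <- r) F j x) <= \sum_(j <- r) n2 (F j).
move=> bF; elim: r => [|j r IH].
 under eq_fun do rewrite big_nil; rewrite big_nil /n2.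
 by under eq_fun do rewrite expr0n/=; rewrite II0 sqrtr0.
under eq_fun do rewrite big_cons; rewrite big_cons.
by apply: (le_trans (n2D _ _)) => //; [exact: B1_sum|rewrite lerD2l].
Qed.

(** The properties common to all averages used below. Jensen, Cauchy-Schwarz and Hölder inequalities
    and contractivity in L^2 follow from them alone, also for compositions such as H. *)
Record markov (A : (X -> R) -> X -> R) : Prop := Markov {
 mk_Bm : forall f, Bm f -> Bm (A f);
 mk_B1 : forall f, B1 f -> B1 (A f);
 mkD : forall f g, Bm f -> Bm g -> forall x, A (fun x => f x + g x) x = A f x + A g x;
 mkZ : forall c f, Bm f -> forall x, A (fun x => c * f x) x = c * A f x;
 mk_ge0 : forall f, Bm f -> (forall x, 0 <= f x) -> forall x, 0 <= A f x;
 mk_cst : forall c x, A (fun=> c) x = c;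
 mkI : forall f, B1 f -> II (A f) = II f }.

Section markov_lemmas.
Variables (A : (X -> R) -> X -> R) (mA : markov A).

Lemma mkB f g x : Bm f -> Bm g -> A (fun x => f x - g x) x = A f x - A g x.
move=> bf bg; rewrite -mulN1r -(mkZ mA _ bg) -(mkD mA bf (BmZ _ bg)).
by congr A; ext y; rewrite mulN1r.
Qed.

Lemma mk_le f g x : Bm f -> Bm g -> (forall x, f x <= g x) -> A f x <= A g x.
move=> bf bg fg; rewrite -subr_ge0 -mkB//; apply: (mk_ge0 mA); first exact: BmB.
by move=> y; rewrite subr_ge0.
Qed.

Lemma mk_sum J r (F : J -> X -> R) x : (forall j, Bm (F j)) ->
 A (fun x => \sum_(j <- r) F j x) x = \sum_(j <- r) A (F j) x.
move=> bF; elim: r => [|j r IH].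
 by under eq_fun do rewrite big_nil; rewrite (mk_cst mA) big_nil.
by under eq_fun do rewrite big_cons; rewrite mkD ?IH ?big_cons//; exact: Bm_sum.
Qed.

Lemma mk_abs f x : Bm f -> `|A f x| <= A (fun x => `|f x|) x.
move=> bf; have ba := Bm_norm bf; rewrite ler_norml; apply/andP; split.
 rewrite -mulN1r -mkZ//; apply: mk_le => //; first exact: BmZ.
 by move=> y; rewrite mulN1r lerNl -normrN ler_norm.
by apply: mk_le => // y; exact: ler_norm.
Qed.

Lemma mk_nrm J r (F : J -> X -> R) x : (forall j, Bm (F j)) ->
 nrm r (fun j => A (F j) x) <= A (fun x => nrm r (F^~ x)) x.
move=> bF; set u := fun j => A (F j) x.
have bn := Bm_nrm r bF.
have [/eqP u0|un] := eqVneq (nrm r u) 0.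
 by rewrite (eqP u0); apply: mk_ge0 => // y; pos.
have up : 0 < nrm r u by rewrite lt_def un nrm_ge0.
rewrite -(ler_pM2l up) -expr2 nrm_sqr.
rewrite (_ : \sum_(j <- r) u j ^+ 2 = A (fun y => \sum_(j <- r) u j * F j y) x); last first.
 rewrite mk_sum; last by move=> j; exact: BmZ.
 by apply: eq_bigr => j _; rewrite mkZ.
rewrite -mkZ//; apply: mk_le; first by apply: Bm_sum => j; exact: BmZ.
 exact: BmZ.
by move=> y; exact: sum_mul_le.
Qed.

Lemma mk_pow f p x : 1 <= p -> Bm f -> (forall x, 0 <= f x) -> A f x `^ p <= A (fun x => f x `^ p) x.
move=> p1 bf f0; have p0 : 0 <= p by exact: le_trans p1.
have bp := Bm_pow p0 f0 bf; set m := A f x.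
have m0 : 0 <= m by exact: mk_ge0.
have bl : Bm (fun y => p * m `^ (p - 1) * (f y - m)) by apply: BmZ; apply: BmB => //; exact: Bm_cst.
have : A (fun y => m `^ p + p * m `^ (p - 1) * (f y - m)) x <= A (fun y => f y `^ p) x.
 by apply: mk_le => // [|y]; [apply: BmD => //; exact: Bm_cst|exact: powR_tangent].
rewrite mkD ?mkZ ?mkB ?mk_cst//; try exact: Bm_cst; last by apply: BmB => //; exact: Bm_cst.
by rewrite subrr mulr0 addr0.
Qed.

Lemma mk_sqr f x : Bm f -> A f x ^+ 2 <= A (fun x => f x ^+ 2) x.
move=> bf; set m := A f x.
have : A (fun y => - m ^+ 2 + 2 * m * f y) x <= A (fun y => f y ^+ 2) x.
 apply: mk_le; [by apply: BmD; [exact: Bm_cst|exact: BmZ]|exact: BmX|move=> y].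
 by have := sqr_ge0 (f y - m); lra.
rewrite mkD ?mkZ ?mk_cst//; [|exact: Bm_cst|exact: BmZ].
by rewrite -/m; lra.
Qed.

Lemma mk_holder h S t x : 0 < t < 1 -> Bm h -> Bm S -> (forall x, 0 <= h x) -> (forall x, 0 <= S x) ->
 A (fun x => h x `^ t * S x `^ (1 - t)) x <= A h x `^ t * A S x `^ (1 - t).
move=> t01 bh bS h0 S0; have /andP[t0 t1] := t01.
apply: holder_num => //; try exact: mk_ge0.
move=> u v u0 v0.
have b1 : Bm (fun y => t / u * h y + (1 - t) / v * S y) by apply: BmD; exact: BmZ.
have : A (fun x => h x `^ t * S x `^ (1 - t)) x <=
 A (fun y => u `^ t * v `^ (1 - t) * (t / u * h y + (1 - t) / v * S y)) x.
 apply: mk_le; [|exact: BmZ|].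
  by apply: BmM; apply: Bm_pow; rewrite ?subr_ge0 ?ltW.
 move=> y; letr (young_split (h0 y) (S0 y) t01 u0 v0).
 lra.
rewrite mkZ// mkD ?mkZ//; try exact: BmZ.
lra.
Qed.

Lemma mk_n2 f : B1 f -> n2 (A f) <= n2 f.
move=> bf; apply: ler_wsqrtr.
have b2 := B1X 1 bf; rewrite -(mkI mA b2).
apply: II_le; [exact: B1X 1 (mk_B1 mA bf)|exact: mk_B1|].
by move=> x; exact: mk_sqr (B1_Bm bf).
Qed.
End markov_lemmas.

Lemma markov_comp A B : markov A -> markov B -> markov (fun f => A (B f)).
move=> mA mB; split.
- by move=> f bf; exact: (mk_Bm mA (mk_Bm mB bf)).
- by move=> f bf; exact: (mk_B1 mA (mk_B1 mB bf)).
- move=> f g bf bg x; rewrite -(mkD mA (mk_Bm mB bf) (mk_Bm mB bg)).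
 by congr A; ext y; rewrite mkD.
- move=> c f bf x; rewrite -(mkZ mA _ (mk_Bm mB bf)).
 by congr A; ext y; rewrite mkZ.
- by move=> f bf f0 x; apply: (mk_ge0 mA (mk_Bm mB bf)) => y; exact: mk_ge0.
- move=> c x; rewrite -[RHS](mk_cst mA c x); congr A; ext y.
 exact: mk_cst.
- by move=> f bf; rewrite (mkI mA (mk_B1 mB bf)) mkI.
Qed.

End functions.
Notation "\I x , F" := (II (fun x => F)) (at level 200, x name, F at level 200).

(** * Averages along orbits and the commutative algebra they generate *)

Section operators.
Context {R : realType} {d : nat} (s : dsys R d).
Notation X := (sX s).
Notation mu := (smu s).
Implicit Types (f g : X -> R).

Definition mp k (p : k.-tuple R -> 'I_d -> R) := forall i, mfunT (p^~ i).

Lemma sT_joint k p : mp p ->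
 mfunT (fun xt : X * k.-tuple R => sT (p xt.2) xt.1).
move=> hp.
have -> : (fun xt : X * k.-tuple R => sT (p xt.2) xt.1) =
 (fun xt => sT (tnth xt.2) xt.1) \o (fun xt : X * k.-tuple R => (xt.1, [tuple p xt.2 i | i < d])).
 apply/funext => -[x t] /=; congr sT; ext i; by rewrite tnth_mktuple.
apply: measurableT_comp; first exact: sT_meas.
apply/measurable_fun_pairP; split => /=; first exact: measurable_fst.
rewrite (_ : _ \o _ = (fun t => [tuple p t i | i < d]) \o snd)//.
apply: measurableT_comp => //.
apply/measurable_fun_tnthP => i; rewrite (_ : _ \o _ = (p^~ i))//.
by apply/funext => t /=; rewrite tnth_mktuple.
Qed.

Lemma measurable_sT v : mfunT (@sT R d s v).
have h : mp (fun _ : 0.-tuple R => v) by [].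
exact: measurableT_comp (sT_joint h) (@pair2_measurable _ _ X (0.-tuple R) [tuple]).
Qed.

Lemma sTC v w x : sT v (sT w x) = sT w (sT v x :> X).
by rewrite !sTD; congr sT; ext i; rewrite addrC. Qed.

Lemma sTK v x : sT (fun i => - v i) (sT v x) = x :> X.
by rewrite sTD -[RHS]sT0; congr sT; ext i; rewrite addNr.
Qed.

Lemma Bm_T v f : Bm f -> Bm (fun x => f (sT v x)).
move=> [mf [M fM]]; split; last by exists M.
by apply: (measurableT_comp mf); exact: measurable_sT.
Qed.

Lemma ge0_int_T v (f : X -> \bar R) : mfunT f -> (forall x, (0 <= f x)%E) ->
 (\int[mu]_x f (sT v x) = \int[mu]_x f x)%E.
move=> mf f0; have mT := measurable_sT v.
have e := ge0_integral_pushforward mT mu measurableT mf (fun x _ => f0 x).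
transitivity (\int[pushforward mu (sT v)]_y f y)%E => //.
exact: (@eq_measure_integral _ X R setT mu
 (measure_function_pushforward__canonical__measure_function_Measure mu mT) f (fun A mA _ => sT_pres v mA)).
Qed.

Lemma B1_T v f : B1 f -> B1 (fun x => f (sT v x)).
move=> [bf /integrableP[mf fi]]; split; first exact: Bm_T.
apply/integrableP; split; first by apply/measurable_EFinP; have [] := Bm_T v bf.
by rewrite (ge0_int_T v (f := fun x => `|(f x)%:E|%E))//; apply: measurableT_comp.
Qed.

Lemma II_T v f : B1 f -> (\I x, f (sT v x)) = II f.
move=> bf; apply: EFin_inj; rewrite (II_fin bf) (II_fin (B1_T v bf)).
have [bm _] := bf; have mf : mfunT (EFin \o f) by apply/measurable_EFinP; case: bm.
rewrite integralE [RHS]integralE; congr (_ - _)%E.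
 rewrite -[RHS](ge0_int_T v (f := (EFin \o f)^\+%E))//; last exact: measurable_funepos.
 by apply: eq_integral => x _; rewrite !funeposE.
rewrite -[RHS](ge0_int_T v (f := (EFin \o f)^\-%E))//; last exact: measurable_funeneg.
by apply: eq_integral => x _; rewrite !funenegE.
Qed.

Definition Av k (a b : 'I_k -> R) (p : k.-tuple R -> 'I_d -> R) f (x : X) : R :=
 av a b (fun t => f (sT (p t) x)).

Lemma Bm_joint k p f : mp p -> Bm f ->
 mfunT (fun xt : X * k.-tuple R => f (sT (p xt.2) xt.1)).
by move=> hp [mf _]; apply: (measurableT_comp mf); exact: sT_joint. Qed.

Lemma Bt_slice k (p : k.-tuple R -> 'I_d -> R) f x : mp p -> Bm f ->
 Bt (fun t => f (sT (p t) x)).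
move=> hp bf; have [_ [M fM]] := bf.
exact: (av_slice (Bm_joint hp bf)).
Qed.

Section Av.
Variables (k : nat) (a b : 'I_k -> R) (p : k.-tuple R -> 'I_d -> R).
Hypotheses (ab : lt_box a b) (hp : mp p).

Lemma av_bound F M : Bt F -> (forall t, `|F t| <= M) -> `|av a b F| <= M.
move=> bF FM.
have bc c : Bt (fun _ : k.-tuple R => c) by split; [by []|exists `|c|].
rewrite ler_norml; apply/andP; split.
 rewrite -(av_cst ab (- M)); apply: av_le => // t _.
 by have := FM t; rewrite ler_norml => /andP[].
rewrite -[leRHS](av_cst ab); apply: av_le => // t _.
by have := FM t; rewrite ler_norml => /andP[].
Qed.

Lemma Av_Bm f : Bm f -> Bm (Av a b p f).
move=> bf; have [_ [M fM]] := bf; split; last first.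
 by exists M => x; apply: av_bound => [|t] => //; exact: Bt_slice.
apply: measurable_funM; first exact: measurable_cst.
have mG := Bm_joint hp bf.
pose H u : R := f (sT (p u.2) u.1) * \1_(hb a b) u.2.
have mI : mfunT (\1_(hb a b) : k.-tuple R -> R).
 by apply: measurable_indic; exact: measurable_hb.
have mH : mfunT H.
 by apply: measurable_funM => //; exact: measurableT_comp mI (@measurable_snd _ _ X (k.-tuple R)).
have mHE : mfunT (EFin \o H) by exact/measurable_EFinP.
have -> : (fun x => \int[lebesgue_tuple R k]_(t in hb a b) f (sT (p t) x)) =
 fine \o (fun x => (\int[lebesgue_tuple R k]_t (EFin \o H)^\+ (x, t) - \int[lebesgue_tuple R k]_t (EFin \o H)^\- (x, t))%E).
 ext x; rewrite /Rintegral integral_mkcond integralE; congr (fine (_ - _)); apply: eq_integral => t _.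
  rewrite !funeposE patchE /H/= indicE.
  by case: ifPn => h; rewrite ?mulr1 ?mulr0.
 rewrite !funenegE patchE /H/= indicE.
 by case: ifPn => h; rewrite ?mulr1 ?mulr0.
apply: measurableT_comp; first exact: fine_measurable.
apply: emeasurable_funB.
 by apply: measurable_fun_fubini_tonelli_F => //; exact: measurable_funepos.
by apply: measurable_fun_fubini_tonelli_F => //; exact: measurable_funeneg.
Qed.

Lemma int_abs_T f v : B1 f -> (\int[mu]_x `|(f (sT v x))%:E| <= (\I x, `|f x|)%:E)%E.
move=> bf; rewrite (II_fin (B1_norm bf)).
rewrite (ge0_int_T v (f := fun x => `|(f x)%:E|%E))//.
by apply: measurableT_comp => //; apply/measurable_EFinP; case: bf => -[].
Qed.

Lemma Av_B1 f : B1 f -> B1 (Av a b p f).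
move=> bf; have [bm _] := bf; have [_ [M fM]] := bm; split; first exact: Av_Bm.
exact: av_integrable ab (Bm_joint hp bm) (fun u => fM _) (fun t => int_abs_T (p t) bf).
Qed.

Lemma AvI f : B1 f -> II (Av a b p f) = II f.
move=> bf; have [bm _] := bf; have [_ [M fM]] := bm.
have h := av_fubini ab (Bm_joint hp bm) (fun u => fM _) (fun t => int_abs_T (p t) bf).
rewrite {1}/II h -[RHS](av_cst ab); apply: av_eq => t _; exact: (II_T (p t)).
Qed.

Lemma Av_markov : markov (Av a b p).
split.
- exact: Av_Bm.
- exact: Av_B1.
- by move=> f g bf bg x; rewrite /Av avD//; exact: Bt_slice.
- by move=> c f bf x; rewrite /Av avZ//; exact: Bt_slice.
- by move=> f bf f0 x; apply: av_ge0.
- by move=> c x; rewrite /Av av_cst.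
- exact: AvI.
Qed.

Lemma Av_T v f x : Av a b p (fun y => f (sT v y)) x = Av a b p f (sT v x).
by apply: av_eq => t _; rewrite sTC. Qed.

(** Jensen's inequality in t, integrated over x. G is a general function of (x, t), not just f along
    an orbit, because the bound is also applied to differences of two orbits and to means of several
    averages. *)
Lemma Av_le_bound (G : X * k.-tuple R -> R) (M K : R) : mfunT G -> (forall u, `|G u| <= M) ->
 (forall t, (\int[mu]_x `|(G (x, t))%:E| <= K%:E)%E) ->
 Bt (fun t => (\I x, G (x, t) ^+ 2)) /\
 (\I x, av a b (fun t => G (x, t)) ^+ 2) <= av a b (fun t => (\I x, G (x, t) ^+ 2)).
move=> mG GM GK.
have M0 : 0 <= M by apply: le_trans (GM (point, nseq_tuple k 0)).
have mG2 : mfunT (fun u => G u ^+ 2) by exact: measurable_funX.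
have GM2 u : `|G u ^+ 2| <= M ^+ 2 by rewrite normrX; apply: lerXn2r.
have GK2 t : (\int[mu]_x `|(G (x, t) ^+ 2)%:E| <= (M * K)%:E)%E.
 apply: (@le_trans _ _ (\int[mu]_x (M%:E * `|(G (x, t))%:E|))%E).
  apply: ge0_le_integral => //.
  - apply: measurableT_comp => //; apply/measurable_EFinP; apply: measurable_funX; exact: measurable_slice.
  - apply: emeasurable_funM => //; apply: measurableT_comp => //; apply/measurable_EFinP; exact: measurable_slice.
  - by move=> x _; rewrite lee_fin normrX ler_wpM2r.
 rewrite ge0_integralZl//; last by apply: measurableT_comp => //; apply/measurable_EFinP; exact: measurable_slice.
 by rewrite EFinM lee_wpmul2l.
split; first exact: Bt_int mG2 GK2.
rewrite -(av_fubini ab mG2 GM2 GK2).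
have b1 : B1 (fun x => av a b (fun t => G (x, t))).
 have i1 := av_integrable ab mG GM GK.
 split => //; split.
  by apply/measurable_EFinP; case/integrableP: i1.
 by exists M => x; apply: av_bound => //; exact: av_slice.
have b2 : B1 (fun x => av a b (fun t => G (x, t) ^+ 2)).
 have i1 := av_integrable ab mG2 GM2 GK2.
 split => //; split.
  by apply/measurable_EFinP; case/integrableP: i1.
 by exists (M ^+ 2) => x; apply: av_bound => //; exact: (av_slice mG2).
apply: II_le => //; first exact: B1X.
move=> x; set m := av a b (fun t => G (x, t)).
have s1 := av_slice mG GM x; have s2 := av_slice mG2 GM2 x.
have c1 : Bt (fun _ : k.-tuple R => m ^+ 2) by split; [by []|exists `|m ^+ 2|].
have bl : Bt (fun t => 2 * m * G (x, t)).
 split; first by apply: measurable_funM => //; case: s1.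
 by exists (`|2 * m| * M) => t; rewrite normrM ler_wpM2l.
have : 0 <= av a b (fun t => (G (x, t) ^+ 2 + m ^+ 2) - 2 * m * G (x, t)).
 by apply: av_ge0 => // t _; have := sqr_ge0 (G (x, t) - m); lra.
have -> : (fun t => (G (x, t) ^+ 2 + m ^+ 2) - 2 * m * G (x, t)) =
 fun t => (G (x, t) ^+ 2 + m ^+ 2) + (-1) * (2 * m * G (x, t)) by ext t; ring.
have c2 : Bt (fun t => G (x, t) ^+ 2 + m ^+ 2).
 split; first by apply: measurable_funD => //; case: s2.
 exists (M ^+ 2 + `|m ^+ 2|) => t; letr (ler_normD _ _); rewrite lerD2r; exact: GM2 (x, t).
have c3 : Bt (fun t => -1 * (2 * m * G (x, t))).
 split; first by apply: measurable_funM => //; case: bl.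
 by exists (`|2 * m| * M) => t; rewrite mulN1r normrN normrM ler_wpM2l.
rewrite (avD ab c2 c3) (avD ab s2 c1) (avZ ab _ bl) (avZ ab _ s1) av_cst//.
by rewrite -/m => h; lra.
Qed.
End Av.

(** Both sides average f over the product of the two boxes, and the order of the translations does
    not matter. The indicator in [G] lets Fubini's theorem be applied with the whole parameter space
    as first factor. *)
Lemma Av_com k k' (a b : 'I_k -> R) (a' b' : 'I_k' -> R) p q f :
 lt_box a b -> lt_box a' b' -> mp p -> mp q -> Bm f ->
 Av a b p (Av a' b' q f) = Av a' b' q (Av a b p f).
move=> ab ab' hp hq bf; ext x; have [mf [M fM]] := bf.
pose G u := f (sT (p u.2) (sT (q u.1) x)) * \1_(hb a' b') u.1.
have mI : mfunT (\1_(hb a' b') : k'.-tuple R -> R).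
 by apply: measurable_indic; exact: measurable_hb.
have mG : mfunT G.
 apply: measurable_funM; last exact: measurableT_comp mI (@measurable_fst _ _ (k'.-tuple R) (k.-tuple R)).
 have -> : (fun u : k'.-tuple R * k.-tuple R => f (sT (p u.2) (sT (q u.1) x))) =
  (fun xt : X * k.-tuple R => f (sT (p xt.2) xt.1)) \o (fun u => (sT (q u.1) x, u.2)) by [].
 apply: (measurableT_comp (Bm_joint hp bf)).
 apply/measurable_fun_pairP; split => /=; last exact: measurable_snd.
 rewrite (_ : _ \o _ = (fun t => sT (q t) x) \o fst)//.
 apply: measurableT_comp => //.
 exact: measurableT_comp (sT_joint hq) (@pair1_measurable _ _ X (k'.-tuple R) x).
have GM u : `|G u| <= M.
 rewrite normrM indicE; case: (_ \in _); rewrite ?normr1 ?mulr1// normr0 mulr0.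
 exact: le_trans (fM x).
have GK t : (\int[lebesgue_tuple R k']_u `|(G (u, t))%:E| <= (M * vol a' b')%:E)%E.
 have h : lebesgue_tuple R k' (hb a' b') = _ := lebesgue_hb (fun l => ltW (ab' l)).
 have M0 : 0 <= M := le_trans (normr_ge0 _) (fM x).
 apply: (@le_trans _ _ (\int[lebesgue_tuple R k']_u (M%:E * (\1_(hb a' b') u)%:E))%E).
  apply: ge0_le_integral => //.
  - by apply: measurableT_comp => //; apply/measurable_EFinP; exact: measurable_slice.
  - by apply: emeasurable_funM => //; apply/measurable_EFinP.
  - move=> u _; rewrite lee_fin /G/= normrM indicE.
   by case: (_ \in _); rewrite ?normr1 ?mulr1// normr0 !mulr0.
 rewrite ge0_integralZl//; last by apply/measurable_EFinP.
 rewrite integral_indic ?setIT//; last exact: measurable_hb.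
 by rewrite [X in (_ * X)%E]h.
have F := av_fubini ab mG GM GK.
transitivity (av a b (fun t => av a' b' (fun u => G (u, t)))).
 apply: av_eq => t _; apply: av_eq => u ut; rewrite /G/= indicE mem_set// mulr1; congr f; exact: sTC.
transitivity (av a' b' (fun u => av a b (fun t => G (u, t)))); last first.
 by apply: av_eq => u ut; apply: av_eq => t _; rewrite /G/= indicE mem_set// mulr1.
have e u : av a b (fun t => G (u, t)) = av a b (fun t => f (sT (p t) (sT (q u) x))) * \1_(hb a' b') u.
 rewrite /G/=; rewrite mulrC -avZ//; last exact: Bt_slice.
 by apply: av_eq => t _; rewrite mulrC.
have Fc (H : k'.-tuple R -> R) : \int[lebesgue_tuple R k']_u (H u * \1_(hb a' b') u) = \int[lebesgue_tuple R k']_(u in hb a' b') H u.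
 rewrite /Rintegral [in RHS]integral_mkcond; congr fine; apply: eq_integral => u _.
 by rewrite patchE indicE; case: ifPn; rewrite ?mulr1 ?mulr0.
have Fd t : av a' b' (fun u => G (u, t)) = (vol a' b')^-1 * \int[lebesgue_tuple R k']_u G (u, t).
 rewrite /av -Fc; congr (_ * _); apply: eq_Rintegral => u _.
 by rewrite /G/= indicE; case: (u \in _); rewrite ?mulr1 ?mulr0.
under av_eq do rewrite Fd.
have Fe : av a' b' (fun u => av a b (fun t => G (u, t))) = (vol a' b')^-1 * \int[lebesgue_tuple R k']_u av a b (fun t => G (u, t)).
 rewrite /av -Fc; congr (_ * _); apply: eq_Rintegral => u _.
 by rewrite -/(av a b _) e indicE; case: (u \in _); rewrite ?mulr1 ?mulr0.
rewrite Fe F avZ//; exact: Bt_int mG GK.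
Qed.

(** For each t the adjoint of an invertible measure-preserving translation is its inverse; Fubini's
    theorem integrates this over t. *)
Lemma Av_adj k (a b : 'I_k -> R) p f g : lt_box a b -> mp p -> B1 f -> Bm g ->
 (\I x, Av a b p f x * g x) = (\I x, f x * Av a b (fun t i => - p t i) g x).
move=> ab hp bf bg; have [bm _] := bf; have [_ [M fM]] := bm; have [_ [N gN]] := bg.
have hn : mp (fun t i => - p t i) by move=> i; exact: measurable_funN.
have mG : mfunT (fun u : X * k.-tuple R => f (sT (p u.2) u.1) * g u.1).
 apply: measurable_funM; first exact: Bm_joint hp bm.
 exact: measurableT_comp bg.1 measurable_fst.
have mG' : mfunT (fun u : X * k.-tuple R => f u.1 * g (sT (fun i => - p u.2 i) u.1)).
 apply: measurable_funM; last exact: Bm_joint hn bg.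
 exact: measurableT_comp bm.1 measurable_fst.
have K1 (h1 h2 : X -> R) (L : R) : B1 h1 -> (forall x, `|h2 x| <= L) -> Bm h2 -> (\int[mu]_x `|(h1 x * h2 x)%:E| <= (L * (\I x, `|h1 x|))%:E)%E.
 move=> b1 hL b2.
 rewrite -(IIZ L (B1_norm b1)) -(II_fin (B1_norm (B1M b1 b2))) lee_fin.
 apply: II_le; [exact: B1_norm (B1M b1 b2)|exact: B1Z (B1_norm b1)|].
 by move=> x; rewrite normrM mulrC ler_wpM2r.
have G1 u : `|f (sT (p u.2) u.1) * g u.1| <= M * N by rewrite normrM; apply: ler_pM.
have G2 u : `|f u.1 * g (sT (fun i => - p u.2 i) u.1)| <= M * N by rewrite normrM; apply: ler_pM.
have H1 t : (\int[mu]_x `|(f (sT (p t) x) * g x)%:E| <= (N * (\I x, `|f x|))%:E)%E.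
 by letr (K1 _ _ N (B1_T _ bf) gN bg); rewrite (II_T _ (B1_norm bf)).
have H2 t : (\int[mu]_x `|(f x * g (sT (fun i => - p t i) x))%:E| <= (N * (\I x, `|f x|))%:E)%E.
 exact: K1 _ _ N bf (fun x => gN _) (Bm_T _ bg).
have F1 := av_fubini ab mG G1 H1.
have F2 := av_fubini ab mG' G2 H2.
transitivity (\int[mu]_x av a b (fun t => f (sT (p t) x) * g x)).
 congr II; ext x; rewrite mulrC -avZ//; last exact: Bt_slice.
 by apply: av_eq => t _; rewrite mulrC.
transitivity (\int[mu]_x av a b (fun t => f x * g (sT (fun i => - p t i) x))); last first.
 by congr II; ext x; rewrite avZ//; exact: Bt_slice.
rewrite F1 F2; apply: av_eq => t _ /=.
have := II_T (p t) (B1M bf (Bm_T (fun i => - p t i) bg)).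
by rewrite /II => <-; congr Rintegral; ext x; rewrite sTK.
Qed.

(** The predicate lets linearity, commutation and preservation of the function classes be proved
    once, by induction; every operator built from averages can then be moved past any other. *)
Inductive alg : ((X -> R) -> X -> R) -> Prop :=
| alg_av k (a b : 'I_k -> R) p : lt_box a b -> mp p -> alg (Av a b p)
| alg_comp A B : alg A -> alg B -> alg (fun f => A (B f))
| alg_add A B : alg A -> alg B -> alg (fun f x => A f x + B f x)
| alg_scale c A : alg A -> alg (fun f x => c * A f x)
| alg_id : alg (fun f => f).

Lemma alg_Bm A f : alg A -> Bm f -> Bm (A f).
move=> aA; elim: aA f => [k a b p ab hp|B C _ hB _ hC|B C _ hB _ hC|c B _ hB|] f bf //.
- exact: Av_Bm.
- exact/hB/hC.
- by apply: BmD; [exact: hB|exact: hC].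
- by apply: BmZ; exact: hB.
Qed.

Lemma alg_B1 A f : alg A -> B1 f -> B1 (A f).
move=> aA; elim: aA f => [k a b p ab hp|B C _ hB _ hC|B C _ hB _ hC|c B _ hB|] f bf //.
- exact: Av_B1.
- exact/hB/hC.
- by apply: B1D; [exact: hB|exact: hC].
- by apply: B1Z; exact: hB.
Qed.

Lemma algD A f g : alg A -> Bm f -> Bm g -> A (fun x => f x + g x) = fun x => A f x + A g x.
move=> aA; elim: aA f g => [k a b p ab hp|B C aB hB aC hC|B C _ hB _ hC|c B _ hB|] f g bf bg //.
- by ext x; rewrite (mkD (Av_markov ab hp)).
- by rewrite hC// hB//; exact: alg_Bm.
- by ext x; rewrite hB// hC// addrACA.
- by ext x; rewrite hB// mulrDr.
Qed.

Lemma algZ A c f : alg A -> Bm f -> A (fun x => c * f x) = fun x => c * A f x.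
move=> aA; elim: aA c f => [k a b p ab hp|B C aB hB aC hC|B C _ hB _ hC|e B _ hB|] c f bf //.
- by ext x; rewrite (mkZ (Av_markov ab hp)).
- by rewrite hC// hB//; exact: alg_Bm.
- by ext x; rewrite hB// hC// mulrDr.
- by ext x; rewrite hB// mulrCA.
Qed.

Lemma algN A f : alg A -> Bm f -> A (fun x => - f x) = fun x => - A f x.
move=> aA bf; rewrite (_ : (fun x => - f x) = fun x => -1 * f x); last by ext x; rewrite mulN1r.
by rewrite algZ//; ext x; rewrite mulN1r.
Qed.

Lemma algB A f g : alg A -> Bm f -> Bm g -> A (fun x => f x - g x) = fun x => A f x - A g x.
move=> aA bf bg; rewrite algD ?algN//.
by have := BmZ (-1) bg; congr Bm; ext x; rewrite mulN1r.
Qed.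

Lemma alg_sum A J r (F : J -> X -> R) : alg A -> (forall j, Bm (F j)) ->
 A (fun x => \sum_(j <- r) F j x) = fun x => \sum_(j <- r) A (F j) x.
move=> aA bF; ext x; elim: r => [|j r IH].
 rewrite big_nil; under eq_fun do rewrite big_nil.
 by have := algZ 0 aA (Bm_cst s 0); under eq_fun do rewrite mul0r; move=> ->; rewrite mul0r.
rewrite big_cons -IH; under eq_fun do rewrite big_cons.
by rewrite algD//; exact: Bm_sum.
Qed.

Lemma alg_com A B f : alg A -> alg B -> Bm f -> A (B f) = B (A f).
move=> aA aB; elim: aA f => [k a b p ab hp|A1 A2 a1 h1 a2 h2|A1 A2 a1 h1 a2 h2|c A1 a1 h1|] f bf //.
- elim: aB f bf => [k' a' b' p' ab' hp'|B1 B2 b1 h1 b2 h2|B1 B2 b1 h1 b2 h2|c B1 b1 h1|] f bf //.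
 + exact: Av_com.
 + by rewrite h1 ?h2//; exact: alg_Bm.
 + by rewrite (algD (alg_av ab hp)) ?h1 ?h2//; exact: alg_Bm.
 + by rewrite (algZ _ (alg_av ab hp)) ?h1//; exact: alg_Bm.
- by rewrite h2// h1//; exact: alg_Bm.
- by rewrite h1// h2// algD//; exact: alg_Bm.
- by rewrite h1// algZ//; exact: alg_Bm.
Qed.

Lemma alg_sub A B : alg A -> alg B -> alg (fun f x => A f x - B f x).
move=> aA aB; have := alg_add aA (alg_scale (-1) aB).
by congr alg; ext f; ext x; rewrite mulN1r.
Qed.

(** A translation is the average over a box of dimension zero, so it needs no constructor of its
    own. *)
Lemma alg_T v : alg (fun f x => f (sT v x)).
have ab : lt_box (fun _ : 'I_0 => 0) (fun=> 1 : R) by [].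
have hp : mp (fun _ : 0.-tuple R => v) by [].
have := alg_av ab hp; congr alg; ext f; ext x.
by rewrite /Av av_cst.
Qed.

Definition adjoint (A A' : (X -> R) -> X -> R) :=
 forall f g, B1 f -> B1 g -> (\I x, A f x * g x) = (\I x, f x * A' g x).

Definition nb (A : (X -> R) -> X -> R) (c : R) := forall f, B1 f -> n2 (A f) <= c * n2 f.

Lemma adjoint_comp A A' B B' : alg A -> alg B -> alg A' -> alg B' -> adjoint A A' -> adjoint B B' ->
 adjoint (fun f => A (B f)) (fun f => B' (A' f)).
move=> aA aB aA' aB' hA hB f g bf bg.
by rewrite hA ?hB//; exact: alg_B1.
Qed.

Lemma adjoint_av k (a b : 'I_k -> R) p : lt_box a b -> mp p -> adjoint (Av a b p) (Av a b (fun t i => - p t i)).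
by move=> ab hp f g bf bg; apply: Av_adj => //; exact: B1_Bm. Qed.

Lemma adjoint_sym A A' : alg A -> alg A' -> adjoint A A' -> adjoint A' A.
move=> aA aA' h f g bf bg.
by under eq_fun do rewrite mulrC; rewrite -h//; under eq_fun do rewrite mulrC.
Qed.

Lemma nb_av k (a b : 'I_k -> R) p : lt_box a b -> mp p -> nb (Av a b p) 1.
by move=> ab hp f bf; rewrite mul1r; apply: mk_n2 => //; exact: Av_markov. Qed.

End operators.

(** * Dyadic averages and transference from the binary cube *)

Section bits.
Context {R : realType}.
Notation W N := {ffun 'I_N -> bool}.

Lemma bavg_pow N (h : W N -> R) p : 1 <= p -> (forall w, 0 <= h w) -> bavg h `^ p <= (\E w, h w `^ p).
move=> p1 h0; have W0 := cardW_gt0 (R := R) N.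
have e (g : W N -> R) : bavg g = \sum_w (#|{ffun 'I_N -> bool}|%:R)^-1 * g w.
 by rewrite /bavg mulrC mulr_sumr.
rewrite !e; apply: powR_mean => //.
by rewrite sumr_const -[_ *+ _]mulr_natr mulVf// gt_eqF.
Qed.

Lemma bavg_nrm N J r (h : J -> W N -> R) :
 nrm r (fun j => bavg (h j)) <= (\E w, nrm r (h^~ w)).
rewrite (_ : (fun j => bavg (h j)) = fun j => (#|{ffun 'I_N -> bool}|%:R)^-1 * \sum_w h j w); last by ext j; rewrite mulrC.
rewrite nrmZ ger0_norm ?(ltW W0)// mulrC ler_wpM2r ?(ltW W0)//.
exact: nrm_sum r (index_enum _) (fun w j => h j w).
Qed.

Lemma bavg_bit N (i : 'I_N) (A B : R) : bavg (fun w : W N => if w i then A else B) = (A + B) / 2.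
pose fl (w : W N) : W N := [ffun j => if j == i then ~~ w j else w j].
have flK : involutive fl.
 by move=> w; apply/ffunP => j; rewrite !ffunE; case: eqP => // _; rewrite negbK.
have e : bavg (fun w : W N => if w i then A else B) = bavg (fun w : W N => if w i then B else A).
 congr (_ / _); rewrite (reindex_inj (inv_inj flK)); apply: eq_bigr => w _.
 by rewrite ffunE eqxx; case: (w i).
have : bavg (fun w : W N => (if w i then A else B) + (if w i then B else A)) = A + B.
 rewrite (_ : (fun w : W N => _) = fun=> A + B) ?bavg_cst//.
 by ext w; case: (w i); rewrite addrC.
by rewrite bavgD -e => <-; field.
Qed.

(** Earlier bits carry larger weights: fixing the first k bits determines the position up to a
    dyadic interval of length 2^(n0 + N - k). *)
Definition bwt (n0 : int) N (i : 'I_N) : R := 2 ^ (n0 + (N - i.+1)%N%:Z).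

Definition bsum (n0 : int) N (k : nat) (w : W N) : R :=
 \sum_(i < N | (i < k)%N) (if w i then bwt n0 i else 0).

Lemma bsumS n0 N (i : 'I_N) w c :
 bsum n0 i.+1 (bmix i w c) = bsum n0 i w + (if c i then bwt n0 i else 0).
rewrite /bsum (bigD1 i)/= => //.
rewrite addrC !ffunE ltnn; congr (_ + _).
apply: eq_big => [j|j]; first by rewrite [RHS]ltn_neqAle andbC.
rewrite ltnS => /andP[ji nij]; have ji' : (j < i)%N by rewrite ltn_neqAle nij.
by rewrite ffunE ji'.
Qed.
End bits.

Section dyadic_averages.
Context {R : realType} {d : nat} (s : dsys R d).
Notation X := (sX s).
Notation mu := (smu s).
Notation W N := {ffun 'I_N -> bool}.
Implicit Types (f g : X -> R) (c : 'I_d -> R).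

Definition ray c (t : 1.-tuple R) : 'I_d -> R := fun i => tnth t ord0 * c i.

Definition Lop c (n : int) : (X -> R) -> X -> R :=
 Av (fun _ : 'I_1 => 0) (fun=> 2 ^ n) (ray c).

Definition Hop c (n : int) f : X -> R := Lop (fun i => - c i) n (Lop c n f).

Lemma mp_ray c : mp (ray c).
by move=> i; apply: measurable_funM => //; exact: measurable_tnth. Qed.

Lemma lt_box_dyadic n : lt_box (fun _ : 'I_1 => 0 : R) (fun=> 2 ^ n).
by move=> l; exact: exprz_gt0. Qed.

Lemma alg_L c n : alg (Lop c n).
by apply: alg_av; [exact: lt_box_dyadic|exact: mp_ray]. Qed.

Lemma markov_L c n : markov (Lop c n).
by apply: Av_markov; [exact: lt_box_dyadic|exact: mp_ray]. Qed.

Lemma alg_H c n : alg (Hop c n).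
exact: alg_comp (alg_L _ n) (alg_L c n). Qed.

Lemma markov_H c n : markov (Hop c n).
exact: markov_comp (markov_L _ n) (markov_L c n). Qed.

Lemma adjoint_L c n : adjoint (Lop c n) (Lop (fun i => - c i) n).
have := adjoint_av (s := s) (lt_box_dyadic n) (@mp_ray c); congr adjoint.
ext f; ext x; apply: av_eq => t _; congr (f (sT _ x)).
by ext i; rewrite /ray mulrN.
Qed.

Lemma adjoint_H c n : adjoint (Hop c n) (Hop c n).
have aN := adjoint_sym (alg_L c n) (alg_L _ n) (@adjoint_L c n).
exact: adjoint_comp (alg_L _ n) (alg_L c n) (alg_L c n) (alg_L _ n) aN (@adjoint_L c n).
Qed.

Lemma Lop_T c n v f x : Lop c n (fun y => f (sT v y)) x = Lop c n f (sT v x).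
exact: Av_T. Qed.

Lemma Lop_double c (n : int) f x : Bm f ->
 Lop c (n + 1) f x = (Lop c n f x + Lop c n f (sT (fun i => 2 ^ n * c i) x)) / 2.
move=> bf; have b2 := Bt_slice x (@mp_ray c) bf.
have e2 : (2 : R) ^ (n + 1) = 2 * 2 ^ n by rewrite exprzDr 1?mulrC// unitfE.
have p0 : 0 < (2 : R) ^ n by exact: exprz_gt0.
have h : 0 < (2 : R) ^ n < 2 ^ (n + 1) by apply/andP; lra.
have := @av_split R 1 (fun=> 0) (fun=> 2 ^ (n + 1)) ord0 (2 ^ n) _ (lt_box_dyadic _) h b2.
rewrite !subr0 (_ : upd (fun=> 2 ^ (n + 1)) ord0 (2 ^ n) = fun _ : 'I_1 => 2 ^ n); last first.
 by ext i; rewrite /upd ord1.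
rewrite (_ : upd (fun=> 0) ord0 (2 ^ n) = fun _ : 'I_1 => 2 ^ n); last first.
 by ext i; rewrite /upd ord1.
have := @av_affine R 1 (fun=> 0) (fun=> 2 ^ n) (lt_box_dyadic n) (fun=> 1) (fun=> 2 ^ n) _ (fun=> ltr01) b2.
under [in X in _ = X -> _]eq_fun do rewrite mulr0 add0r.
have -> : (fun=> 1 * 2 ^ n + 2 ^ n) = (fun _ : 'I_1 => (2 : R) ^ (n + 1)).
 by ext i; rewrite e2; ring.
move=> <- H; rewrite /Lop /Av.
have nz : 2 ^ (n + 1) != 0 :> R by rewrite gt_eqF// exprz_gt0.
apply: (mulfI nz).
rewrite H e2.
have -> : av (fun _ : 'I_1 => 0) (fun=> 2 ^ n) (fun t => f (sT (ray c (affmap (fun=> 1) (fun=> 2 ^ n) t)) x)) =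
 av (fun _ : 'I_1 => 0) (fun=> 2 ^ n) (fun t => f (sT (ray c t) (sT (fun i => 2 ^ n * c i) x))).
 apply: av_eq => t _; rewrite sTD; congr (f (sT _ x)); ext i.
 by rewrite /ray tnth_mktuple mul1r mulrDl.
by field.
Qed.

(** Averaging over one more bit doubles the length of the average ([Lop_double]), so downward
    induction on k turns a conditional expectation into a coarser average started at the known part
    of the position. *)
Lemma bE_L c n0 N k f x (w : W N) : Bm f -> (k <= N)%N ->
 bE k (fun w' => Lop c n0 f (sT (fun i => bsum n0 N w' * c i) x)) w =
 Lop c (n0 + (N - k)%:Z) f (sT (fun i => bsum n0 k w * c i) x).
move=> bf; move: {2}(N - k)%N (erefl (N - k)%N) => j.
elim: j k w => [|j IH] k w e kN.
 have -> : k = N by apply/eqP; rewrite eqn_leq kN -subn_eq0 e.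
 by rewrite bE_last subnn addr0.
have kN' : (k < N)%N by rewrite -subn_gt0 e.
rewrite -(bE_tower _ (leqnSn k)).
have e1 : (N - k.+1)%N = j by rewrite subnS e.
rewrite (_ : bE k.+1 _ = fun w' => Lop c (n0 + j%:Z) f (sT (fun i => bsum n0 k.+1 w' * c i) x)); last first.
 by ext w'; rewrite IH// e1.
rewrite /bE; pose i0 := Ordinal kN'.
rewrite (_ : (fun c0 : W N => _) = fun c0 : W N => if c0 i0 then
  Lop c (n0 + j%:Z) f (sT (fun i => 2 ^ (n0 + j%:Z) * c i) (sT (fun i => bsum n0 k w * c i) x)) else
  Lop c (n0 + j%:Z) f (sT (fun i => bsum n0 k w * c i) x)); last first.
 ext c0; rewrite (bsumS n0 i0) /bwt /= e1; case: (c0 i0).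
  by rewrite sTD; congr (Lop _ _ _ (sT _ x)); ext i; rewrite mulrDl addrC.
 by rewrite addr0.
rewrite bavg_bit e (_ : Posz j.+1 = j%:Z + 1); last by rewrite -addn1.
rewrite  addrA Lop_double//.
lra.
Qed.

(* Averaging the martingale of f along the orbit over the starting point yields H f. *)
Lemma Hop_transfer c (n0 : int) N k f x : Bm f -> (k <= N)%N ->
 Hop c (n0 + (N - k)%:Z) f x =
 Lop (fun i => - c i) n0 (fun y => bavg (fun w : W N =>
  bE k (fun w' => Lop c n0 f (sT (fun i => bsum n0 N w' * c i) (sT (fun i => - (bsum n0 N w * c i)) y))) w)) x.
move=> bf kN; set g := Lop c (n0 + (N - k)%:Z) f.
have bg : Bm g by exact: (mk_Bm (markov_L c _)).
pose w0 : W N := [ffun=> false].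
have b0 : bsum n0 k w0 = 0 :> R by rewrite /bsum big1// => i _; rewrite ffunE.
have := bE_L (fun i => - c i) n0 x w0 bg kN.
rewrite /Hop -/g b0 => h.
rewrite (_ : (fun i => 0 * - c i) = fun=> 0) in h; last by ext i; rewrite mul0r.
rewrite sT0 in h; rewrite -h /bE.
have aL := alg_L (fun i => - c i) n0.
have Lsum (F : W N -> X -> R) : (forall w, Bm (F w)) ->
  Lop (fun i => - c i) n0 (fun y => bavg (F^~ y)) x = (\E w, Lop (fun i => - c i) n0 (F w) x).
 move=> bF; rewrite (_ : (fun y => _) = fun y => #|{ffun 'I_N -> bool}|%:R^-1 * \sum_w F w y); last first.
  by ext y; rewrite mulrC.
 rewrite (algZ _ aL); last exact: Bm_sum.
 by rewrite alg_sum// mulrC.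
have e : (fun y => bavg (fun w : W N => bavg (fun c0 : W N =>
  Lop c n0 f (sT (fun i => bsum n0 N (bmix k w c0) * c i) (sT (fun i => - (bsum n0 N w * c i)) y))))) =
 (fun y => bavg (fun w : W N => g (sT (fun i => (bsum n0 k w - bsum n0 N w) * c i) y))).
 ext y; congr bavg; ext w.
 rewrite -[LHS]/(bE k (fun w' => Lop c n0 f (sT (fun i => bsum n0 N w' * c i) (sT (fun i => - (bsum n0 N w * c i)) y))) w).
 rewrite bE_L// sTD; congr (g (sT _ y)); ext i; ring.
rewrite e Lsum; last by move=> w; exact: Bm_T.
congr bavg; ext w; rewrite Lop_T; congr (Lop _ _ _ (sT _ x)).
ext i; rewrite mulrN -mulNr; congr (_ * _); rewrite -[RHS]opprB; congr (- _).
rewrite /bsum [in RHS](bigID (fun i : 'I_N => (i < k)%N))/=.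
rewrite [in LHS](bigID (fun i : 'I_N => (i < k)%N))/=.
rewrite big1 ?add0r; last first.
 by move=> j /andP[_ jk]; rewrite ffunE jk ffunE.
rewrite [X in _ = X + _ - _](eq_bigl (fun i : 'I_N => (i < k)%N)); last by move=> j; rewrite ltn_ord.
rewrite addrC addKr; apply: eq_bigr => j /andP[_ jk]; by rewrite ffunE (negbTE jk).
Qed.

Definition orb c n0 N f (y : X) (w : W N) : R :=
 Lop c n0 f (sT (fun i => bsum n0 N w * c i) y).

(** While [orb] lifts f to a function on the cube, [trf] brings a function on the cube back to X,
    undoing the displacement of the position w before averaging over w. The outer average in the
    reversed direction is the adjoint factor of H at the finest scale. *)
Definition trf c n0 N (Y : X -> W N -> R) : X -> R :=
 Lop (fun i => - c i) n0 (fun y => (\E w, Y (sT (fun i => - (bsum n0 N w * c i)) y) w)).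

Lemma B1_bavg N (Y : W N -> X -> R) : (forall w, B1 (Y w)) -> B1 (fun y => bavg (Y^~ y)).
move=> bY; rewrite (_ : (fun y => _) = fun y => #|{ffun 'I_N -> bool}|%:R^-1 * \sum_w Y w y); last first.
 by ext y; rewrite mulrC.
by apply: B1Z; exact: B1_sum.
Qed.

Lemma II_bavg N (Y : W N -> X -> R) : (forall w, B1 (Y w)) ->
 (\I y, bavg (Y^~ y)) = (\E w, II (Y w)).
move=> bY; rewrite (_ : (fun y => _) = fun y => #|{ffun 'I_N -> bool}|%:R^-1 * \sum_w Y w y); last first.
 by ext y; rewrite mulrC.
rewrite IIZ; last exact: B1_sum.
by rewrite II_sum// mulrC.
Qed.

Lemma B1_trf c n0 N (Y : X -> W N -> R) : (forall w, B1 (Y^~ w)) -> B1 (trf c n0 Y).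
move=> bY; apply: (mk_B1 (markov_L _ n0)).
by apply: (B1_bavg (Y := fun w y => Y (sT (fun i => - (bsum n0 N w * c i)) y) w)) => w; exact: B1_T (bY w).
Qed.

(** Jensen's inequality for both averages, then invariance of the measure under each translation. No
    constant is lost, which keeps the martingale bounds uniform in c and N. *)
Lemma trf_bound c n0 N J r (Y : J -> X -> W N -> R) p : 1 <= p ->
 (forall u w, B1 (fun y => Y u y w)) ->
 (\I x, nrm r (fun u => trf c n0 (Y u) x) `^ p) <=
 (\I y, (\E w, nrm r (fun u => Y u y w) `^ p)).
move=> p1 bY; have p0 : 0 <= p by exact: le_trans p1.
pose v (w : W N) := fun i => - (bsum n0 N w * c i).
have bYv u w : B1 (fun y => Y u (sT (v w) y) w) by exact: B1_T (bY u w).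
pose Z y := (\E w, nrm r (fun u => Y u (sT (v w) y) w)).
have bn w : B1 (fun y => nrm r (fun u => Y u (sT (v w) y) w)) by exact: B1_nrm.
have bZ : B1 Z by exact: B1_bavg.
have Z0 y : 0 <= Z y by apply: bavg_ge0 => w; pos.
have mL := markov_L (fun i => - c i) n0.
have bnp w : B1 (fun y => nrm r (fun u => Y u (sT (v w) y) w) `^ p).
 by apply: B1_pow => // y; pos.
have bZp : B1 (fun y => Z y `^ p) by exact: B1_pow.
via (II (Lop (fun i => - c i) n0 (fun y => Z y `^ p))).
 apply: II_le; [|exact: mk_B1 mL _ bZp|].
  by apply: B1_pow => //; [move=> y; pos|apply: B1_nrm => u; exact: B1_trf].
 move=> x; apply: le_trans (mk_pow mL x p1 (B1_Bm bZ) Z0).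
 apply: powR_mono => //; first pos.
 letr (mk_nrm mL r x _).
  by move=> u; apply: B1_Bm; exact: B1_bavg (bYv u).
 apply: (mk_le mL) => [||y]; [|exact: B1_Bm|exact: bavg_nrm].
 by apply: Bm_nrm => u; apply: B1_Bm; exact: B1_bavg (bYv u).
rewrite (mkI mL bZp).
via (\I y, (\E w, nrm r (fun u => Y u (sT (v w) y) w) `^ p)).
 by apply: II_le => //; [exact: B1_bavg|move=> y; apply: bavg_pow => // w; pos].
have bnq w : B1 (fun y => nrm r (fun u => Y u y w) `^ p).
 by apply: B1_pow => //; [move=> y; pos|exact: B1_nrm].
rewrite (II_bavg bnp) (II_bavg bnq).
apply: bavg_le => w; exact: le_of_eq (II_T _ _).
Qed.

Lemma B1_orb c n0 N f (w : W N) : B1 f -> B1 (fun y => orb c n0 f y w).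
by move=> bf; apply: B1_T; exact: mk_B1 (markov_L c n0) _ bf. Qed.

Lemma orb_bound c n0 N J r (f : J -> X -> R) p : 1 <= p ->
 (forall j, B1 (f j)) ->
 (\I y, bavg (fun w : W N => nrm r (fun j => orb c n0 (f j) y w) `^ p)) <=
 (\I x, nrm r (f^~ x) `^ p).
move=> p1 bf; have p0 : 0 <= p by exact: le_trans p1.
have mL := markov_L c n0.
have bL j := mk_B1 mL (bf j).
have bn : B1 (fun y => nrm r (fun j => Lop c n0 (f j) y) `^ p).
 by apply: B1_pow => //; [move=> y; pos|exact: B1_nrm].
have bN : B1 (fun x => nrm r (f^~ x)) by exact: B1_nrm.
have bNp : B1 (fun x => nrm r (f^~ x) `^ p) by apply: B1_pow => // y; pos.
rewrite (II_bavg (Y := fun w y => nrm r (fun j => orb c n0 (f j) y w) `^ p)); last first.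
 by move=> w; exact: B1_T _ bn.
rewrite (_ : (fun w => _) = fun=> (\I y, nrm r (fun j => Lop c n0 (f j) y) `^ p)); last first.
 by ext w; exact: II_T.
rewrite bavg_cst -(mkI mL bNp); apply: II_le => //; first exact: mk_B1 mL _ bNp.
move=> x; apply: le_trans (mk_pow mL x p1 (B1_Bm bN) _); last by move=> y; pos.
apply: powR_mono => //; first pos.
exact: (mk_nrm mL r x (fun j => B1_Bm (bf j))).
Qed.

Lemma B1_bE N k (F : X -> W N -> R) w : (forall w, B1 (F^~ w)) -> B1 (fun y => bE k (F y) w).
by move=> bF; apply: (B1_bavg (Y := fun w' y => F y (bmix k w w'))). Qed.

Lemma B1_bM N k (F : X -> W N -> R) w : (forall w, B1 (F^~ w)) -> B1 (fun y => bM (F y) k w).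
move=> bF; elim: k => [|k IH]; first exact: B1_bE.
by apply: B1_max => //; exact: B1_bE.
Qed.

Lemma H_trf c (n0 : int) N k f x : Bm f -> (k <= N)%N ->
 Hop c (n0 + (N - k)%:Z) f x = trf c n0 (fun y => bE k (orb c n0 (N := N) f y)) x.
exact: Hop_transfer. Qed.

Lemma trf_le c n0 N (Y Z : X -> W N -> R) x : (forall w, B1 (Y^~ w)) -> (forall w, B1 (Z^~ w)) ->
 (forall y w, Y y w <= Z y w) -> trf c n0 Y x <= trf c n0 Z x.
move=> bY bZ YZ; apply: (mk_le (markov_L _ n0)).
- by apply: B1_Bm; apply: (B1_bavg (Y := fun w y => Y (sT (fun i => - (bsum n0 N w * c i)) y) w)) => w; exact: B1_T (bY w).
- by apply: B1_Bm; apply: (B1_bavg (Y := fun w y => Z (sT (fun i => - (bsum n0 N w * c i)) y) w)) => w; exact: B1_T (bZ w).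
- by move=> y; apply: bavg_le => w.
Qed.

Lemma trfB c n0 N (Y Z : X -> W N -> R) x : (forall w, B1 (Y^~ w)) -> (forall w, B1 (Z^~ w)) ->
 trf c n0 (fun y w => Y y w - Z y w) x = trf c n0 Y x - trf c n0 Z x.
move=> bY bZ; rewrite /trf -(mkB (markov_L _ n0)).
- by congr (Lop _ _ _ x); ext y; rewrite bavgB.
- by apply: B1_Bm; apply: (B1_bavg (Y := fun w y => Y (sT (fun i => - (bsum n0 N w * c i)) y) w)) => w; exact: B1_T (bY w).
- by apply: B1_Bm; apply: (B1_bavg (Y := fun w y => Z (sT (fun i => - (bsum n0 N w * c i)) y) w)) => w; exact: B1_T (bZ w).
Qed.

Lemma trf_abs c n0 N (Y Z : X -> W N -> R) x : (forall w, B1 (Y^~ w)) -> (forall w, B1 (Z^~ w)) ->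
 (forall y w, `|Y y w| <= Z y w) -> `|trf c n0 Y x| <= trf c n0 Z x.
move=> bY bZ YZ; rewrite ler_norml; apply/andP; split; last first.
 by apply: trf_le => // y w; exact: le_trans (ler_norm _) (YZ y w).
have b0 w : B1 ((fun (_ : X) (_ : W N) => 0 : R)^~ w) by exact: B1_0.
have e : trf c n0 (fun _ (_ : W N) => 0) x = 0.
 rewrite -[RHS](mk_cst (markov_L (fun i => - c i) n0) 0 x).
 by congr (Lop _ _ _ x); rewrite bavg_cst.
rewrite -[leLHS]add0r -{1}e -trfB//; apply: trf_le => //.
 by move=> w; exact: B1B (b0 w) (bZ w).
by move=> y w; rewrite sub0r lerNl; apply: le_trans (YZ y w); rewrite -normrN ler_norm.
Qed.
End dyadic_averages.

(** * Maximal and oscillation inequalities for the operators H *)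

Section dyadic_inequalities.
Context {R : realType}.

Lemma nrm_rev n J r (v : 'I_n * J -> R) :
 nrm [seq (i, j) | i <- index_enum 'I_n, j <- r] (fun u => v (rev_ord u.1, u.2)) =
 nrm [seq (i, j) | i <- index_enum 'I_n, j <- r] v.
rewrite /nrm !big_allpairs_dep/=; congr Num.sqrt.
rewrite (reindex_inj rev_ord_inj)/=; apply: eq_bigr => i _; apply: eq_bigr => j _.
by rewrite rev_ordK.
Qed.

Lemma nrm_rev2 n J r (v : 'I_n * J -> R) p :
 nrm [seq (i, j) | i <- index_enum 'I_n, j <- r] (fun u => 2 * v (rev_ord u.1, u.2)) `^ p =
 2 `^ p * nrm [seq (i, j) | i <- index_enum 'I_n, j <- r] v `^ p.
by rewrite nrmZ nrm_rev ger0_norm// powRM// nrm_ge0. Qed.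
Notation W N := {ffun 'I_N -> bool}.

Lemma H_max p : 1 < p -> exists2 C : R, 0 < C &
 forall d (s : dsys R d) c (n0 : int) N J r f,
 (forall j, B1 (f j)) ->
 exists G : J -> sX s -> R,
 [/\ forall j, B1 (G j),
   forall j k x, (k <= N)%N -> `|Hop c (n0 + k%:Z) (f j) x| <= G j x &
   (\I x, nrm r (G^~ x) `^ p) <= C * (\I x, nrm r (f^~ x) `^ p)].
move=> p1; have [C C0 HC] := @fs_max R p p1; exists C => // d s c n0 N J r f bf.
have p1' := ltW p1; have p0 : 0 <= p by exact: le_trans p1'.
pose Y j y : W N -> R := bM (fun w => `|orb c n0 (f j) y w|) N.
have bo j (w : W N) : B1 (fun y => `|orb c n0 (f j) y w|) by apply: B1_norm; exact: B1_orb.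
have bY j w : B1 (fun y => Y j y w) by exact: B1_bM.
exists (fun j => trf c n0 (Y j)); split; first by move=> j; exact: B1_trf.
 move=> j k x kN; rewrite -{1}(subKn kN) H_trf ?leq_subr//; last exact: B1_Bm.
 apply: trf_abs => //; first by move=> w; apply: B1_bE => w'; exact: B1_orb.
 move=> y w; letr (bE_abs _ _ _).
 by apply: bM_ge; rewrite leq_subr.
letr (trf_bound c n0 r p1' bY).
via (C * (\I y, bavg (fun w : W N => nrm r (fun j => orb c n0 (f j) y w) `^ p))); last first.
 by rewrite ler_wpM2l ?(ltW C0)//; exact: orb_bound.
have bq (Z : J -> W N -> sX s -> R) : (forall j w, B1 (Z j w)) -> B1 (fun y => (\E w, nrm r (fun j => Z j w y) `^ p)).
 move=> bZ; apply: (B1_bavg (Y := fun w y => nrm r (fun j => Z j w y) `^ p)) => w.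
 by apply: B1_pow => //; [move=> y; pos|exact: B1_nrm].
rewrite -IIZ; last by apply: bq => j w; exact: B1_orb.
apply: II_le; [exact: bq|apply: B1Z; apply: bq => j w; exact: B1_orb|].
move=> y; apply: (le_trans (HC N J r (fun j w => `|orb c n0 (f j) y w|) _)) => //.
by rewrite ler_wpM2l ?(ltW C0)//; apply: bavg_le => w; rewrite nrm_abs.
Qed.

(** A larger scale means fewer known bits, so the blocks are traversed backwards ([t'] and [rv]).
    The martingale bound compares with the coarse end of a block, while the oscillation is measured
    from its fine end; passing through the coarse end costs the factor 2. *)
Lemma H_osc p : 1 < p -> exists2 C : R, 0 < C &
 forall d (s : dsys R d) c (n0 : int) N J r f n t,
 (forall j, B1 (f j)) -> {homo t : i j / (i <= j)%N} -> (forall i, (t i <= N)%N) ->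
 exists G : 'I_n * J -> sX s -> R,
 [/\ forall u, B1 (G u),
   forall (i : 'I_n) j k x, (t i <= k <= t i.+1)%N ->
    `|Hop c (n0 + k%:Z) (f j) x - Hop c (n0 + (t i)%:Z) (f j) x| <= G (i, j) x &
   (\I x, nrm [seq (i, j) | i <- index_enum 'I_n, j <- r] (G^~ x) `^ p) <=
    C * (\I x, nrm r (f^~ x) `^ p)].
move=> p1; have [C C0 HC] := @mart_osc R p p1; exists (2 `^ p * C); first pos.
move=> d s c n0 N J r f n t bf th tN.
have p1' := ltW p1; have p0 : 0 <= p by exact: le_trans p1'.
pose t' i := (N - t (n - i))%N.
have th' : {homo t' : i j / (i <= j)%N} by move=> i j ij; apply: leq_sub2l; apply: th; exact: leq_sub2l.
have tN' i : (t' i <= N)%N by exact: leq_subr.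
pose O j y : W N -> R := orb c n0 (f j) y.
pose D (u : 'I_n * J) y w := `|bE (t' u.1.+1) (O u.2 y) w - bE (t' u.1) (O u.2 y) w|.
pose Y u y : W N -> R := bM (D u y) N.
have bO j w : B1 (fun y => O j y w) by exact: B1_orb.
have bD u w : B1 (fun y => D u y w) by apply: B1_norm; apply: B1B; apply: B1_bE => w'.
have bY u w : B1 (fun y => Y u y w) by exact: B1_bM.
pose L := [seq (i, j) | i <- index_enum 'I_n, j <- r].
pose G0 u := trf c n0 (Y u).
pose rv (u : 'I_n * J) := (rev_ord u.1, u.2).
exists (fun u x => 2 * G0 (rv u) x); split; first by move=> u; apply: B1Z; exact: B1_trf.
 move=> i j k x /andP[tk kt].
 have key m : (t i <= m <= t i.+1)%N ->
   `|Hop c (n0 + m%:Z) (f j) x - Hop c (n0 + (t i.+1)%:Z) (f j) x| <= G0 (rv (i, j)) x.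
  move=> /andP[tm mt]; have mN := leq_trans mt (tN _).
  rewrite -{1}(subKn mN) -{1}(subKn (tN _)) !H_trf ?leq_subr//; try exact: B1_Bm.
  rewrite -trfB; try by move=> w; apply: B1_bE => w'; exact: bO.
  apply: trf_abs => //; first by move=> w; apply: B1B; apply: B1_bE => w'; exact: bO.
  move=> y w; rewrite -/(O j y).
  have e1 : t' (rv (i, j)).1 = (N - t i.+1)%N by rewrite /t'/= subKn.
  have e2 : t' (rv (i, j)).1.+1 = (N - t i)%N.
   by rewrite /t'/= subnSK// subKn// ltnW.
  have l1 : (N - t i.+1 <= N - m)%N by exact: leq_sub2l.
  have l2 : (N - m <= N - t i)%N by exact: leq_sub2l.
  rewrite -(bE_tower _ l2) -(bE_tower' _ l1).
  apply: le_trans (bM_ge _ _ (leq_subr m N)).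
  rewrite -bEB; letr (bE_abs _ _ _); apply: bE_le => w'.
  by rewrite /D e1 e2.
 have := key k; rewrite tk kt => /(_ isT) h1.
 have := key (t i); rewrite leqnn (leq_trans tk kt) => /(_ isT) h2.
 apply: (le_trans _ (_ : G0 (rv _) x + G0 (rv _) x <= _)); last by apply: le_of_eq; ring.
 rewrite distrC in h2; apply: le_trans (lerD h1 h2).
 by apply: le_trans (ler_normD _ _); rewrite addrA subrK.
have e x : nrm L (fun u => 2 * G0 (rv u) x) `^ p = 2 `^ p * nrm L (fun u => G0 u x) `^ p.
 exact: nrm_rev2.
rewrite (_ : (fun x => _) = fun x => 2 `^ p * nrm L (fun u => G0 u x) `^ p); last by ext x.
rewrite IIZ; last first.
 by apply: B1_pow => //; [move=> y; pos|apply: B1_nrm => u; exact: B1_trf].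
rewrite -mulrA ler_wpM2l ?powR_ge0//.
letr (trf_bound c n0 L p1' bY).
via (C * (\I y, bavg (fun w : W N => nrm r (fun j => orb c n0 (f j) y w) `^ p))); last first.
 by rewrite ler_wpM2l ?(ltW C0)//; exact: orb_bound.
have bq J' r' (Z : J' -> W N -> sX s -> R) : (forall j w, B1 (Z j w)) -> B1 (fun y => (\E w, nrm r' (fun j => Z j w y) `^ p)).
 move=> bZ; apply: (B1_bavg (Y := fun w y => nrm r' (fun j => Z j w y) `^ p)) => w.
 by apply: B1_pow => //; [move=> y; pos|exact: B1_nrm].
rewrite -IIZ; last by apply: bq => j w; exact: B1_orb.
apply: II_le; [exact: bq|apply: B1Z; apply: bq => j w; exact: B1_orb|].
move=> y; exact: HC N J r (fun j w => O j y w) n t' th' tN'.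
Qed.
End dyadic_inequalities.

(** * Vector-valued bounds from maximal bounds, and interpolation *)

Section interpolation.
Context {R : realType}.

Lemma powRD_pos (x a b : R) : 0 < x -> x `^ (a + b) = x `^ a * x `^ b.
by move=> x0; rewrite powRD// (gt_eqF x0) implybT. Qed.

(** Dominated convergence as the threshold dl tends to 0. Where dl <= f, negative powers of f are
    bounded; what remains of f is negligible. *)
Lemma small_cut d (s : dsys R d) (f : sX s -> R) e : B1 f -> (forall x, 0 <= f x) -> 0 < e ->
 exists2 dl : R, 0 < dl & (\I x, if dl <= f x then 0 else f x) <= e.
move=> bf f0 e0; pose F n x := if n.+1%:R^-1 <= f x then 0 else f x.
have bF n : B1 (F n).
 have h : B1 (fun x => f x - (if n.+1%:R^-1 <= f x then f x else 0)).
  by apply: B1B => //; apply: B1_cut => //; exact: B1_Bm.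
 by move: h; congr B1; ext x; rewrite /F; case: ifP; rewrite ?subrr ?subr0.
have mF n : mfunT (EFin \o F n) by apply/measurable_EFinP; case: (bF n) => -[].
have cv x : [set: sX s] x -> (EFin \o F n) x @[n --> \oo] --> (EFin \o (fun=> 0)) x.
 move=> _; have [fx0|fxn] := eqVneq (f x) 0.
  have -> : (fun n => (EFin \o F n) x) = fun=> 0.
   by ext n; rewrite /F/= fx0; case: ifP.
  exact: cvg_cst.
 have fp : 0 < f x by rewrite lt_def fxn f0.
 apply: cvg_near_cst; near=> n; rewrite /F/=.
 have -> // : n.+1%:R^-1 <= f x.
 rewrite invf_ple ?posrE ?ltr0Sn//; apply: ltW; apply: (@le_lt_trans _ _ n%:R); last by rewrite ltr_nat.
 by near: n; exact: nbhs_infty_ger.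
have fin x : [set: sX s] x -> (EFin \o f) x \is a fin_num by [].
have h := dominated_cvg (mu := smu s) measurableT mF cv fin bf.2.
have /fine_cvgP[_ {}h] : (\int[smu s]_x (EFin \o F n) x)%E @[n --> \oo] --> 0%:E.
 have -> : 0%:E = (\int[smu s]_x (EFin \o (fun=> 0%R)) x)%E by rewrite integral0.
 by apply: h => n x _ /=; rewrite lee_fin ger0_norm /F; case: ifP.
move/cvgrPdist_le : h => /(_ e e0)[N _ /(_ N (leqnn N))].
rewrite sub0r normrN => /(le_trans (ler_norm _)) h.
by exists N.+1%:R^-1.
Unshelve. all: by end_near.
Qed.

Lemma mk_CS d (s : dsys R d) A (h u v : sX s -> R) x : markov A ->
 Bm h -> Bm u -> Bm v -> (forall y, 0 <= u y) -> (forall y, 0 <= v y) ->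
 (forall y, h y ^+ 2 = u y * v y) -> A h x ^+ 2 <= A u x * A v x.
move=> mA bh bu bv u0 v0 huv.
have a0 : 0 <= A u x by exact: mk_ge0.
have b0 : 0 <= A v x by exact: mk_ge0.
have t01 : 0 < (2^-1 : R) < 1 by apply/andP; lra.
have e : 1 - 2^-1 = 2^-1 :> R by field.
have := mk_holder mA x t01 bu bv u0 v0; rewrite e.
rewrite !powR12_sqrt// -sqrtrM//.
have -> : (fun y => u y `^ 2^-1 * v y `^ 2^-1) = fun y => `|h y|.
 by ext y; rewrite !powR12_sqrt// -sqrtrM// -huv sqrtr_sqr.
move=> k; rewrite -(sqr_sqrtr (mulr_ge0 a0 b0)) -(real_normK (num_real _)).
apply: lerXn2r; rewrite ?nnegrE ?sqrtr_ge0//.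
exact: le_trans (mk_abs mA x bh) k.
Qed.

(** The supremum over j is encoded by a common majorant. Nonnegative f suffice, since the operators
    to which this is applied are positive. *)
Definition maxb d (s : dsys R d) (J : Type) (A : J -> (sX s -> R) -> sX s -> R) (q C : R) :=
 forall f, B1 f -> (forall x, 0 <= f x) -> exists G : sX s -> R,
 [/\ B1 G, forall x, 0 <= G x, forall j x, A j f x <= G x & (\I x, G x `^ q) <= C * (\I x, f x `^ q)].

Definition fsb d (s : dsys R d) (J : Type) (r : seq J) (A : J -> (sX s -> R) -> sX s -> R) (p C : R) :=
 forall g : J -> sX s -> R, (forall j, B1 (g j)) ->
 (\I x, nrm r (fun j => A j (g j) x) `^ p) <= C * (\I x, nrm r (g^~ x) `^ p).

Lemma B1_nrmp d (s : dsys R d) J r (F : J -> sX s -> R) p : 1 <= p ->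
 (forall j, B1 (F j)) -> B1 (fun x => nrm r (F^~ x) `^ p).
by move=> p1 bF; apply: B1_pow => //; [move=> x; pos|exact: B1_nrm]. Qed.

Lemma cut_pow d (s : dsys R d) (f : sX s -> R) p e : 1 <= p -> B1 f -> (forall x, 0 <= f x) -> 0 < e ->
 exists2 dl : R, 0 < dl & (\I x, (if dl <= f x then 0 else f x) `^ p) <= e.
move=> p1 bf f0 e0; have p0 : 0 <= p by exact: le_trans p1.
have bp := B1_pow p1 f0 bf.
have pp : 0 < p by exact: lt_le_trans p1.
have [dl dl0 h] := small_cut bp (fun x => powR_ge0 (f x) p) e0.
exists (dl `^ p^-1); first pos.
apply: le_trans h; apply: le_of_eq; congr II; ext x.
have -> : (dl `^ p^-1 <= f x) = (dl <= f x `^ p).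
 rewrite -[in RHS](_ : (dl `^ p^-1) `^ p = dl); last by rewrite -powRrM mulVf ?gt_eqF// powRr1// ltW.
 apply/idP/idP => [h|]; first by apply: powR_mono => //; pos.
 by apply: contraTT; rewrite -!ltNge => h; apply: gt0_ltr_powR; rewrite ?nnegrE ?powR_ge0.
by case: ifP => // _; rewrite powR0 ?gt_eqF.
Qed.

Lemma sum_pow_nrm J r (v : J -> R) p : 0 <= p ->
 \sum_(j <- r) `|v j| `^ p <= (size r)%:R * nrm r v `^ p.
move=> p0; elim: r => [|j r IH]; first by rewrite big_nil mul0r.
have n0 i : 0 <= v i ^+ 2 by exact: sqr_ge0.
have s0 : 0 <= \sum_(i <- r) v i ^+ 2 by exact: sumr_ge0.
have h1 : `|v j| <= nrm (j :: r) v by rewrite /nrm big_cons -sqrtr_sqr; apply: ler_wsqrtr; rewrite lerDl.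
have h2 : nrm r v <= nrm (j :: r) v by rewrite /nrm big_cons; apply: ler_wsqrtr; rewrite lerDr.
rewrite big_cons /= -addn1 natrD mulrDl mul1r addrC; apply: lerD; last exact: powR_mono.
letr IH; rewrite ler_wpM2l//; apply: powR_mono => //; pos.
Qed.

(** The constant grows with the number of operators; the estimate serves to keep a part of
    arbitrarily small norm small. *)
Lemma fs_crude d (s : dsys R d) J r (A : J -> (sX s -> R) -> sX s -> R) p : 1 <= p ->
 (forall j, markov (A j)) -> fsb r A p (((size r)%:R + 1) `^ p).
move=> p1 mA g bg; have p0 : 0 <= p by exact: le_trans p1.
have pn : p != 0 by rewrite gt_eqF// (lt_le_trans ltr01).
have sK : (size r)%:R <= (size r)%:R + 1 :> R by rewrite lerDl.
have K0 : 0 < (size r)%:R + 1 :> R by [].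
move: ((size r)%:R + 1) sK K0 => K sK K0.
have bAg j : B1 (A j (g j)) by exact: mk_B1 (mA j) _ (bg j).
have sp (h : J -> sX s -> R) : (forall j, B1 (h j)) -> forall j, B1 (fun x => `|h j x| `^ p).
 by move=> bh j; apply: B1_pow => //; exact: B1_norm.
have h2 x : nrm r (fun j => A j (g j) x) `^ p <= K `^ (p - 1) * \sum_(j <- r) `|A j (g j) x| `^ p.
 via ((\sum_(j <- r) 1 * `|A j (g j) x|) `^ p).
  apply: powR_mono => //; first pos.
  by under eq_bigr do rewrite mul1r; exact: nrm_le_sum.
 apply: (le_trans (@powR_mean_le R _ r (fun=> 1) (fun j => `|A j (g j) x|) p K p1 K0 _ _ _)) => //.
  by rewrite big_const_seq iter_addr_0.
 by under [in leLHS]eq_bigr do rewrite mul1r.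
have bs : B1 (fun x => \sum_(j <- r) `|A j (g j) x| `^ p) by apply: B1_sum; exact: sp.
have bn : B1 (fun x => nrm r (g^~ x) `^ p) by exact: B1_nrmp.
via (K `^ (p - 1) * (\I x, \sum_(j <- r) `|A j (g j) x| `^ p)).
 by rewrite -(IIZ _ bs); apply: II_le h2; [exact: B1_nrmp|exact: B1Z].
have -> : K `^ p = K `^ (p - 1) * K by rewrite mulrC powRp// ltW.
rewrite -mulrA; apply: ler_wpM2l; first pos.
rewrite II_sum; last exact: sp.
via (\sum_(j <- r) (\I x, `|g j x| `^ p)).
 apply: ler_sum => j _; rewrite -(mkI (mA j) (sp _ bg j)).
 apply: II_le; [exact: sp _ bAg j|exact: mk_B1 _ (sp _ bg j)|move=> x].
 apply: le_trans (mk_pow (mA j) x p1 (B1_Bm (B1_norm (bg j))) (fun y => normr_ge0 _)).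
 apply: powR_mono => //; exact: mk_abs _ x (B1_Bm _).
rewrite -II_sum; last exact: sp.
rewrite -IIZ//; apply: II_le; [by apply: B1_sum; exact: sp|exact: B1Z|move=> x].
letr (sum_pow_nrm r _ p0).
by rewrite ler_wpM2r ?powR_ge0.
Qed.

(* [(A_j g_j)^2 <= A_j (G^(2-p)) * A_j (g_j^2 G^(p-2))] with [G] the square function of [g]. *)
Lemma fs_single_lt2 (q C : R) d (s : dsys R d) J r (A : J -> (sX s -> R) -> sX s -> R) :
 1 < q -> 0 < C -> (forall j, markov (A j)) -> maxb A q C ->
 fsb r A (2 * q / (q + 1)) (2 `^ (2 * q / (q + 1)) * (C + 1)).
move=> q1 C0; set p := 2 * q / (q + 1).
have q0 : 0 < q by lra.
have qp0 : 0 < q + 1 by lra.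
have p1 : 1 < p by rewrite ltr_pdivlMr; lra.
have p2 : p < 2 by rewrite ltr_pdivrMr; lra.
have t01 : 0 < 1 - p / 2 < 1 by apply/andP; lra.
have hp0 : 0 <= p / 2 by lra.
have hp1 : p / 2 <= 1 by lra.
have hq1 : 1 - p / 2 <= 1 by lra.
have pq : (2 - p) * q = p by rewrite /p; field; rewrite gt_eqF.
have p1' := ltW p1; have p0 : 0 <= p by lra.
have [r1 r2 r3] : [/\ 0 <= 2 - p, 1 - p <= 0 & p - 2 <= 0] by split; lra.
move=> mA hM g bg; set G := fun x => nrm r (g^~ x).
have G0 x : 0 <= G x by exact: nrm_ge0.
have bG : B1 G by exact: B1_nrm.
have bGp : B1 (fun x => G x `^ p) by exact: B1_nrmp.
have IG0 : 0 <= (\I x, G x `^ p) by apply: II_ge0 => x; pos.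
have bA h : (forall j, B1 (h j)) -> forall j, B1 (A j (h j)).
 by move=> bh j; exact: mk_B1 (mA j) _ (bh j).
set K := (size r)%:R + 1 : R.
have K0 : 0 < K by rewrite ltr_wpDl.
apply/ler_addgt0Pr => e e0.
(* The threshold is chosen after the number of operators is known, so that the crude constant
   [K ^ p] is beaten on the part where [G < dl]. *)
have e10 : 0 < e / (2 `^ p * K `^ p) by rewrite divr_gt0 ?mulr_gt0 ?powR_gt0.
have [dl dl0 hdl] := cut_pow p1' bG G0 e10.
pose g1 j x := if dl <= G x then g j x else 0.
pose g2 j x := if dl <= G x then 0 else g j x.
have bg1 j : B1 (g1 j) by apply: B1_cut => //; exact: B1_Bm.
have bg2 j : B1 (g2 j).
 by have := B1B (bg j) (bg1 j); congr B1; ext x; rewrite /g1 /g2; case: ifP; rewrite ?subrr ?subr0.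
pose u x := if dl <= G x then G x `^ (2 - p) else 0.
pose v j x := if dl <= G x then g j x ^+ 2 * G x `^ (p - 2) else 0.
have u0 x : 0 <= u x by rewrite /u; case: ifP => // _; pos.
have v0 j x : 0 <= v j x by rewrite /v; case: ifP => // _; rewrite mulr_ge0 ?sqr_ge0 ?powR_ge0.
have bu : B1 u.
 apply: (B1_dom _ (B1Z (dl `^ (1 - p)) bG)).
  exact: Bm_cut _ (Bm_pow r1 G0 (B1_Bm bG)) (B1_Bm bG).
 move=> x; rewrite ger0_norm// /u; case: ifP => [dG|_]; last by rewrite mulr_ge0 ?powR_ge0.
 have Gp : 0 < G x by exact: lt_le_trans dG.
 rewrite (_ : 2 - p = 1 + (1 - p)); last by ring.
 rewrite (powRD_pos _ _ Gp) powRr1//.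
 rewrite mulrC ler_wpM2r//; exact: powR_anti r2 dl0 dG.
have bgg j : B1 (fun x => g j x ^+ 2) by exact: B1X.
have bv j : B1 (v j).
 apply: (B1_dom _ (B1Z (dl `^ (p - 2)) (bgg j))).
  pose w x := Num.max dl (G x) `^ (p - 2).
  have mw : Bm w.
   split.
    by apply: (measurableT_comp (measurable_powR _)); apply: measurable_maxr => //; case: bG => -[].
   exists (dl `^ (p - 2)) => x; rewrite ger0_norm ?powR_ge0//; apply: powR_anti r3 dl0 _.
   by rewrite le_max lexx.
  have := Bm_cut dl (BmM (B1_Bm (bgg j)) mw) (B1_Bm bG).
  congr Bm; ext x; rewrite /v; case: ifP => // dG; congr (_ * _ `^ _).
  by apply/max_idPr.
 move=> x; rewrite ger0_norm// /v; case: ifP => [dG|_]; last by rewrite mulr_ge0 ?powR_ge0 ?sqr_ge0.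
 rewrite mulrC ler_wpM2r ?sqr_ge0//; exact: powR_anti r3 dl0 dG.
have guv j x : g1 j x ^+ 2 = u x * v j x.
 rewrite /g1 /u /v; case: ifP => dG => //.
 have Gp : 0 < G x by exact: lt_le_trans dG.
 rewrite mulrCA -powRD_pos//.
 by rewrite (_ : 2 - p + (p - 2) = 0) ?powRr0; ring.
have [M [bM M0 MA IM]] := hM u bu u0.
have IM' : (\I x, M x `^ q) <= C * (\I x, G x `^ p).
 letr IM; apply: (ler_wpM2l (ltW C0)); apply: (II_le (B1_pow (ltW q1) u0 bu) bGp).
 move=> x; rewrite /u; have [dG|dG] := leP dl (G x).
  by rewrite -powRrM pq.
 by rewrite powR0 ?powR_ge0// gt_eqF.
pose Q x := \sum_(j <- r) A j (v j) x.
have bAv := bA v bv.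
have bQ : B1 Q by exact: B1_sum.
have Q0 x : 0 <= Q x by apply: sumr_ge0 => j _; apply: mk_ge0 => //; exact: B1_Bm.
have IQ : II Q <= (\I x, G x `^ p).
 rewrite II_sum//; under eq_bigr do rewrite (mkI (mA _) (bv _)).
 rewrite -II_sum//; apply: II_le => //; first exact: B1_sum.
 move=> x; rewrite /v; have [dG|_] := leP dl (G x); last by rewrite big1// powR_ge0.
 have Gp : 0 < G x by exact: lt_le_trans dG.
 rewrite -mulr_suml -nrm_sqr -/(G x) -powR_mulrn// -powRD_pos//.
 by rewrite (_ : 2%:R + (p - 2) = p)//; ring.
have bMq : B1 (fun x => M x `^ q) by exact: (B1_pow (ltW q1)).
have h1 x : nrm r (fun j => A j (g1 j) x) `^ p <= M x `^ q + Q x.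
 have e1 : nrm r (fun j => A j (g1 j) x) ^+ 2 <= M x * Q x.
  rewrite nrm_sqr mulr_sumr; apply: ler_sum => j _.
  have b1 := B1_Bm (bg1 j); have b2 := B1_Bm bu; have b3 := B1_Bm (bv j).
  letr (mk_CS x (mA j) b1 b2 b3 u0 (v0 j) (guv j)).
  by rewrite ler_wpM2r//; apply: mk_ge0.
 have -> : nrm r (fun j => A j (g1 j) x) `^ p = (nrm r (fun j => A j (g1 j) x) ^+ 2) `^ (p / 2).
  by rewrite -powR_mulrn ?nrm_ge0// -powRrM; congr (_ `^ _); field.
 via ((M x * Q x) `^ (p / 2)).
  by apply: powR_mono; rewrite ?sqr_ge0.
 rewrite powRM//.
 have -> : M x `^ (p / 2) = (M x `^ q) `^ (1 - p / 2).
  by rewrite -powRrM; congr (_ `^ _); rewrite /p; field; rewrite gt_eqF.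
 have := young_split (powR_ge0 (M x) q) (Q0 x) t01 ltr01 ltr01.
 rewrite !powR1 !mul1r !divr1 (_ : 1 - (1 - p / 2) = p / 2); last by ring.
 move=> /le_trans; apply; apply: lerD; by rewrite ler_piMl ?powR_ge0.
pose G2 x := if dl <= G x then 0 else G x.
have bA2 := bA _ bg2.
have I2 : (\I x, nrm r (fun j => A j (g2 j) x) `^ p) <= K `^ p * (\I x, G2 x `^ p).
 have hc := fs_crude r p1' mA bg2.
 letr hc; apply: (ler_wpM2l (powR_ge0 _ _)); apply: le_of_eq.
 congr II; ext x; congr (_ `^ _); rewrite /G2 /g2; case: ifP => // _.
 exact: nrm0.
via (2 `^ p * ((\I x, nrm r (fun j => A j (g1 j) x) `^ p) + (\I x, nrm r (fun j => A j (g2 j) x) `^ p))).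
 rewrite -IID; [|by apply: B1_nrmp => //; exact: bA|exact: B1_nrmp].
 have bD : B1 (fun x => nrm r (fun j => A j (g1 j) x) `^ p + nrm r (fun j => A j (g2 j) x) `^ p).
  by apply: B1D; [apply: B1_nrmp => //; exact: bA|exact: B1_nrmp].
 rewrite -IIZ//; apply: II_le; [by apply: B1_nrmp => //; exact: bA|exact: B1Z|move=> x].
 apply: le_trans (powR_add p0 (nrm_ge0 _ _) (nrm_ge0 _ _)).
 apply: powR_mono => //; first pos.
 apply: le_trans (nrmD _ _ _); apply: le_of_eq; congr nrm; ext j.
 rewrite -(mkD (mA j) (B1_Bm (bg1 j)) (B1_Bm (bg2 j))); congr A; ext y.
 by rewrite /g1 /g2; case: ifP; rewrite ?addr0 ?add0r.
rewrite -mulrA; via (2 `^ p * ((C + 1) * (\I x, G x `^ p) + K `^ p * (e / (2 `^ p * K `^ p)))).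
 rewrite ler_wpM2l ?powR_ge0//; apply: lerD; last first.
  by letr I2; rewrite ler_wpM2l ?powR_ge0.
 via ((\I x, M x `^ q) + II Q).
  by rewrite -(IID bMq bQ); apply: II_le h1; [apply: B1_nrmp p1' _; exact: bA|exact: B1D].
 by rewrite mulrDl mul1r; exact: lerD IM' IQ.
apply: le_of_eq; field.
by rewrite !gt_eqF ?powR_gt0.
Qed.

(* Duality against [h = (sum (A_j g_j)^2)^(p/2-1)], the adjoints being controlled by a maximal function. *)
Lemma fs_single_ge4 (p : R) : 4 <= p -> exists2 K : R, 0 < K &
 forall C d (s : dsys R d) J r (A A' : J -> (sX s -> R) -> sX s -> R), 1 <= C ->
 (forall j, markov (A j)) -> (forall j, markov (A' j)) -> (forall j, adjoint (A j) (A' j)) -> maxb A' (p / (p - 2)) C -> fsb r A p (K * C `^ (p / 2 - 1)).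
move=> p4; set q := p / (p - 2).
have p20 : 0 < p - 2 by lra.
have P1 : 1 < p / 2 by lra.
have P2 : 0 <= p / 2 - 1 by lra.
have qp : q^-1 * (p / 2) = p / 2 - 1 by rewrite /q; field; rewrite !gt_eqF//; lra.
(* Young's inequality with weight 1/2, later divided by C, leaves half of the left side, which is
   absorbed. *)
have e0 : 0 < 2^-1 :> R by rewrite invr_gt0.
have [K K0 HK] := young_eps P1 e0.
exists (2 * (K + 1)); first lra.
move=> C d s J r A A' C1 mA mA' adj hM g bg.
have C0 : 0 < C by exact: lt_le_trans C1.
have C2 : 0 <= (2 * C)^-1 by rewrite invr_ge0 mulr_ge0// ltW.
have p1 : 1 <= p by lra.
have p0 : 0 <= p by lra.
have q1 : 1 <= q by rewrite /q ler_pdivlMr//; lra.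
pose G x := nrm r (g^~ x); pose S x := nrm r (fun j => A j (g j) x).
have bAg j : B1 (A j (g j)) by exact: mk_B1 (mA j) _ (bg j).
have bG : B1 G by exact: B1_nrm.
have bS : B1 S by exact: B1_nrm.
have G0 x : 0 <= G x by exact: nrm_ge0.
have S0 x : 0 <= S x by exact: nrm_ge0.
pose h x := S x `^ (p - 2).
have bh : B1 h by apply: B1_pow => //; lra.
have h0 x : 0 <= h x by exact: powR_ge0.
have [M [bM M0 MA IM]] := hM h bh h0.
have bSp : B1 (fun x => S x `^ p) by exact: B1_pow.
have bGp : B1 (fun x => G x `^ p) by exact: B1_pow.
have bMq : B1 (fun x => M x `^ q) by exact: B1_pow.
have bgg j : B1 (fun x => g j x ^+ 2) by exact: (B1X 1).
have bAgg j : B1 (A j (fun x => g j x ^+ 2)) by exact: mk_B1 (mA j) _ (bgg j).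
have ISp : (\I x, S x `^ p) <= (\I x, G x ^+ 2 * M x).
 via (\I x, \sum_(j <- r) A j (fun x => g j x ^+ 2) x * h x).
  apply: II_le => //; first by apply: B1_sum => j; apply: B1M => //; exact: B1_Bm.
  move=> x; rewrite -mulr_suml.
  have -> : S x `^ p = S x ^+ 2 * h x.
   have [->|Sn] := eqVneq (S x) 0; first by rewrite expr0n/= mul0r powR0// gt_eqF//; lra.
   have Sp : 0 < S x by rewrite lt_def Sn S0.
   by rewrite /h -powR_mulrn// -(powRD_pos _ _ Sp); congr (_ `^ _); ring.
  rewrite ler_wpM2r// nrm_sqr; apply: ler_sum => j _.
  exact: (mk_sqr (mA j) x (B1_Bm (bg j))).
 rewrite II_sum; last by move=> j; apply: B1M => //; exact: B1_Bm.
 rewrite (eq_bigr (fun j => (\I x, g j x ^+ 2 * A' j h x))); last by move=> j _; exact: adj.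
 have bX j : B1 (fun x => g j x ^+ 2 * M x) by apply: B1M => //; exact: B1_Bm.
 via (\sum_(j <- r) (\I x, g j x ^+ 2 * M x)).
  apply: ler_sum => j _; apply: II_le => //.
   by apply: B1M => //; apply: B1_Bm; exact: mk_B1 (mA' j) _ bh.
  by move=> x; rewrite ler_wpM2l ?sqr_ge0.
 rewrite -II_sum//; apply: le_of_eq; congr II; ext x.
 by rewrite -mulr_suml nrm_sqr.
pose Cp := C `^ (p / 2 - 1); pose lam := C `^ q^-1.
have q0 : 0 < q by exact: lt_le_trans q1.
have lam0 : 0 < lam by exact: powR_gt0.
have lamq : lam `^ q = C by rewrite -powRrM mulVf ?gt_eqF// powRr1// ltW.
have lamp : lam `^ (p / 2) = Cp.
 by rewrite -powRrM qp.
have IY : (\I x, G x ^+ 2 * M x) <= K * Cp * (\I x, G x `^ p) + (2 * C)^-1 * (\I x, M x `^ q).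
 rewrite -!IIZ// -IID; [|exact: B1Z|exact: B1Z].
 apply: II_le; [by apply: B1M; [exact: (B1X 1)|exact: B1_Bm]|by apply: B1D; exact: B1Z|move=> x].
 have ml0 : 0 <= M x / lam by rewrite divr_ge0// ltW.
 have := HK (lam * G x ^+ 2) ((M x / lam) `^ (2 / (p - 2))) (mulr_ge0 (ltW lam0) (sqr_ge0 _)) (powR_ge0 _ _).
 have E1 : (lam * G x ^+ 2) `^ (p / 2) = Cp * G x `^ p.
  rewrite (powRM _ (ltW lam0) (sqr_ge0 _)) lamp -(powR_mulrn 2 (G0 x)) -powRrM.
  by congr (_ * _ `^ _); field.
 have E2 : ((M x / lam) `^ (2 / (p - 2))) `^ (p / 2 - 1) = M x / lam.
  rewrite -powRrM (_ : 2 / (p - 2) * (p / 2 - 1) = 1) ?powRr1//.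
  by field; rewrite gt_eqF.
 have E3 : ((M x / lam) `^ (2 / (p - 2))) `^ (p / 2) = M x `^ q / C.
  rewrite -powRrM (_ : 2 / (p - 2) * (p / 2) = q); last by rewrite /q; field; rewrite gt_eqF.
  rewrite -[X in _ = X / _](_ : (M x / lam * lam) `^ q = _); last by rewrite divfK// gt_eqF.
  by rewrite (powRM _ ml0 (ltW lam0)) lamq mulfK// gt_eqF.
 rewrite E1 E2 E3 (_ : lam * G x ^+ 2 * (M x / lam) = G x ^+ 2 * M x); last by field; rewrite gt_eqF.
 by rewrite invfM -!mulrA [C^-1 * _]mulrC.
have Ihq : (\I x, h x `^ q) = (\I x, S x `^ p).
 congr II; ext x; rewrite -powRrM; congr (_ `^ _); rewrite /q; field; pos.
rewrite Ihq in IM.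
set IS := (\I x, S x `^ p) in ISp IM *; set IG := (\I x, G x `^ p) in IY *.
have IG0 : 0 <= IG by apply: II_ge0 => x; exact: powR_ge0.
have Cp1 : 1 <= Cp by rewrite -(powRr0 C) (ler_powR C1 P2).
have : IS <= K * Cp * IG + (2 * C)^-1 * (C * IS).
 letr ISp; letr IY; exact: lerD (lexx _) (ler_wpM2l C2 IM).
have -> : (2 * C)^-1 * (C * IS) = IS / 2 by field; rewrite gt_eqF.
have -> : 2 * (K + 1) * C `^ (p / 2 - 1) * IG = 2 * (K * Cp * IG) + 2 * (Cp * IG) by rewrite -/Cp; ring.
have CI : 0 <= Cp * IG by rewrite mulr_ge0// (le_trans ler01).
rewrite -/S; clear -CI; lra.
Qed.
End interpolation.

Section marcinkiewicz.
Context {R : realType}.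

Definition sqb d (s : dsys R d) (J : Type) (r : seq J) (T : J -> (sX s -> R) -> sX s -> R) (p C : R) :=
 forall f, B1 f -> (\I x, nrm r (fun j => T j f x) `^ p) <= C * (\I x, `|f x| `^ p).

Lemma sum_levels (x dl : R) K (g : R -> R) : 0 < dl -> 0 <= x -> x < dl * 2 ^+ K ->
 \sum_(i < K) (if dl * 2 ^+ i <= x < dl * 2 ^+ i.+1 then g x else 0) = if dl <= x then g x else 0.
move=> dl0 x0; elim: K => [|K IH] xK.
 by rewrite mulr1 in xK; rewrite big_ord0 leNgt xK.
rewrite big_ord_recr /= xK andbT.
have [h|h] := leP (dl * 2 ^+ K) x; last by rewrite IH// addr0.
rewrite big1 ?add0r.
 by rewrite (le_trans _ h)// ler_peMr ?(ltW dl0)// exprn_ege1// ler1n.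
move=> i _; case: ifP => // /andP[_ xi]; exfalso; move: (le_lt_trans h xi).
rewrite ltr_pM2l// ltr_eXn2l ?ltr1n// ltnS => iK; by have := ltn_ord i; rewrite ltnNge iK.
Qed.

(** The function is cut at the levels dl 2^i, and [interp_pow] is applied at each point to the
    images of the pieces. The parameter [lam] shifts the comparison level against the size of f, so
    that a small constant at one end yields a small constant at p. *)
Lemma marcinkiewicz p0 p p1 : 1 <= p0 -> p0 < p -> p < p1 -> exists2 C : R, 0 < C &
 forall d (s : dsys R d) J r (T : J -> (sX s -> R) -> sX s -> R) A0 A1 lam,
 (forall j, alg (T j)) -> 0 <= A0 -> 0 <= A1 -> 0 < lam -> sqb r T p0 A0 -> sqb r T p1 A1 ->
 sqb r T p (C * (A0 * lam `^ (p - p0) + A1 * lam `^ (p - p1))).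
move=> hp0 p0p pp1.
have p00 : 0 < p0 by exact: lt_le_trans hp0.
have p_0 : 0 < p by exact: lt_trans p0p.
have p_1 : 1 <= p by exact: ltW (le_lt_trans _ p0p).
have p1_1 : 1 <= p1 by exact: ltW (le_lt_trans _ pp1).
have p1_0 : 0 < p1 by exact: lt_le_trans p1_1.
have [C C0 HC] := interp_pow p00 p0p pp1.
pose W := 1 + 2 `^ (p1 - p) : R.
have W0 : 0 < W by rewrite ltr_wpDr.
exists (2 `^ p * (C * W)); first pos.
move=> d s J r T A0 A1 lam aT A00 A10 lam0 H0 H1 f bf.
have baf := B1_norm bf; have [[mf [M fM]] _] := bf.
have bTf g j : B1 g -> B1 (T j g) by move=> bg; exact: alg_B1.
have bN g q : 1 <= q -> B1 g -> B1 (fun x => nrm r (fun j => T j g x) `^ q).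
 by move=> q1 bg; apply: B1_nrmp => // j; exact: bTf.
have bP (g : sX s -> R) q : 1 <= q -> B1 g -> B1 (fun x => `|g x| `^ q).
 by move=> q1 bg; apply: B1_pow => //; exact: B1_norm.
apply/ler_addgt0Pr => e e0.
pose M' := `|M| + 1 : R.
have M'0 : 0 < M' by rewrite ltr_wpDl.
have fM' x : `|f x| <= M' by letr (fM x); letr (ler_norm M); rewrite lerDl.
pose E := A0 * M' `^ (p0 - 1) + A1 * M' `^ (p1 - 1) : R.
have E0 : 0 <= E by rewrite addr_ge0// mulr_ge0// powR_ge0.
have e1 : 0 < e / (2 `^ p * (E + 1)) by rewrite divr_gt0// mulr_gt0 ?powR_gt0// ltr_wpDl.
have [dl dl0 hdl] := small_cut baf (fun x => normr_ge0 _) e1.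
have [K MK] : exists K, M' < dl * 2 ^+ K.
 exists (Num.bound (M' / dl)); rewrite mulrC -ltr_pdivrMr//.
 apply: (lt_le_trans (archi_boundP (ltW (divr_gt0 M'0 dl0)))).
 by rewrite -natrX ler_nat ltnW// ltn_expl.
pose fi i x := if dl * 2 ^+ i <= `|f x| < dl * 2 ^+ i.+1 then f x else 0.
pose fr x := if dl <= `|f x| then 0 else f x.
have bcut a : B1 (fun x => if a <= `|f x| then f x else 0) by apply: B1_cut => //; exact: B1_Bm.
have bfi i : B1 (fi i).
 have := B1B (bcut (dl * 2 ^+ i)) (bcut (dl * 2 ^+ i.+1)); congr B1; ext x.
 rewrite /fi ltNge; have [h|h] := leP (dl * 2 ^+ i.+1) `|f x|; last by rewrite andbT subr0.
 rewrite (le_trans _ h) ?subrr// ler_wpM2l ?(ltW dl0)// ler_eXn2l ?ltr1n//.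
have bfr : B1 fr.
 have := B1B bf (bcut dl); congr B1; ext x; rewrite /fr.
 by case: ifP; rewrite ?subrr ?subr0.
have fdec : f = fun x => (\sum_(i < K) fi i x) + fr x.
 ext x; have := @sum_levels `|f x| dl K (fun=> f x) dl0 (normr_ge0 _) (le_lt_trans (fM' x) MK).
 by rewrite /fr => ->; case: ifP; rewrite ?addr0 ?add0r.
pose a i x := nrm r (fun j => T j (fi i) x).
pose b x := nrm r (fun j => T j fr x).
have bound x : nrm r (fun j => T j f x) <= \sum_(i < K) a i x + b x.
 have -> : (fun j => T j f x) = fun j => \sum_(i <- index_enum 'I_K) T j (fi i) x + T j fr x.
  ext j; rewrite {1}fdec (algD (aT j)); last exact: B1_Bm.
   by rewrite (alg_sum _ (aT j) (F := fun (i : 'I_K) => fi i))// => i; exact: B1_Bm.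
  by apply: Bm_sum => i; exact: B1_Bm.
 letr (nrmD _ _ _); rewrite lerD2r.
 exact: nrm_sum r (index_enum 'I_K) (fun i j => T j (fi i) x).
have a0 i x : 0 <= a i x by exact: nrm_ge0.
have b0 x : 0 <= b x by exact: nrm_ge0.
have B0 : 0 < lam * dl by exact: mulr_gt0.
pose m i := lam * dl * 2 ^+ i.
have bai i q : 1 <= q -> B1 (fun x => a i x `^ q) by move=> q1; exact: bN.
pose S x := \sum_(i < K) (a i x `^ p0 * m i `^ (p - p0) + a i x `^ p1 * m i `^ (p - p1)).
have bSi (i : 'I_K) : B1 (fun x => a i x `^ p0 * m i `^ (p - p0) + a i x `^ p1 * m i `^ (p - p1)).
 have := B1D (B1Z (m i `^ (p - p0)) (bai i p0 hp0)) (B1Z (m i `^ (p - p1)) (bai i p1 p1_1)).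
 by congr B1; ext x; rewrite [_ * a i x `^ _]mulrC [_ * a i x `^ p1]mulrC.
have bS : B1 S by exact: B1_sum.
have bb q : 1 <= q -> B1 (fun x => b x `^ q) by move=> q1; exact: bN.
have st1 : (\I x, nrm r (fun j => T j f x) `^ p) <= 2 `^ p * (C * II S + (\I x, b x `^ p)).
 rewrite -(IIZ C bS) -(IID (B1Z C bS) (bb p p_1)).
 have bD := B1D (B1Z C bS) (bb p p_1).
 rewrite -(IIZ _ bD); apply: (II_le (bN _ _ p_1 bf) (B1Z _ bD)) => x.
 have s0 : 0 <= \sum_(i < K) a i x by apply: sumr_ge0.
 via ((\sum_(i < K) a i x + b x) `^ p).
  by apply: powR_mono; [pos|pos|by []].
 letr (powR_add (ltW p_0) s0 (b0 x)); apply: (ler_wpM2l (powR_ge0 _ _)).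
 rewrite lerD2r; exact: HC K (lam * dl) (fun i => a i x) B0 (a0^~ x).
(* The part below dl: each endpoint bound is at most a constant times its L^1 norm, and dl was
   chosen to make that norm small. *)
have stb : (\I x, b x `^ p) <= E * (\I x, `|fr x|).
 have hb : (\I x, b x `^ p) <= (\I x, b x `^ p0) + (\I x, b x `^ p1).
  rewrite -(IID (bb p0 hp0) (bb p1 p1_1)); apply: (II_le (bb p p_1) (B1D (bb p0 hp0) (bb p1 p1_1))) => x.
  have [h|h] := leP (b x) 1.
   have [->|bn] := eqVneq (b x) 0; first by rewrite !powR0 ?gt_eqF.
   have bp : 0 < b x by rewrite lt_def bn b0.
   via (b x `^ p0); last by rewrite lerDl powR_ge0.
   by apply: ger_powR; rewrite ?bp ?h//; pos.
  via (b x `^ p1); last by rewrite lerDr powR_ge0.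
  by apply: ler_powR; pos.
 have hq q : 1 <= q -> (\I x, `|fr x| `^ q) <= M' `^ (q - 1) * (\I x, `|fr x|).
  move=> q1; rewrite -(IIZ _ (B1_norm bfr)); apply: (II_le (bP _ _ q1 bfr) (B1Z _ (B1_norm bfr))) => x.
  have q0 : q != 0 by rewrite gt_eqF// (lt_le_trans ltr01).
  rewrite -(powRp (normr_ge0 _) q0) mulrC; apply: ler_wpM2r => //.
  apply: powR_mono; rewrite ?subr_ge0// /fr; case: ifP => _; rewrite ?normr0 ?(ltW M'0)//.
 letr hb; rewrite mulrDl; apply: lerD.
  letr (H0 _ bfr); rewrite -mulrA; apply: ler_wpM2l => //; exact: hq.
 letr (H1 _ bfr); rewrite -mulrA; apply: ler_wpM2l => //; exact: hq.
have stS : II S <= W * (A0 * lam `^ (p - p0) + A1 * lam `^ (p - p1)) * (\I x, `|f x| `^ p).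
 set U := A0 * lam `^ (p - p0) + A1 * lam `^ (p - p1).
 have U1 : 0 <= A0 * lam `^ (p - p0) by rewrite mulr_ge0// powR_ge0.
 have U2 : 0 <= A1 * lam `^ (p - p1) by rewrite mulr_ge0// powR_ge0.
 have one (i : 'I_K) : (\I x, a i x `^ p0 * m i `^ (p - p0) + a i x `^ p1 * m i `^ (p - p1)) <=
   W * U * (\I x, `|fi i x| `^ p).
  have mE q : m i `^ q = lam `^ q * (dl * 2 ^+ i) `^ q.
   have h0 : 0 <= dl * 2 ^+ i by apply: mulr_ge0 => //; pos.
   by rewrite /m -mulrA; exact: powRM _ (ltW _) h0.
  have l0 : 0 < dl * 2 ^+ i by rewrite mulr_gt0.
  have -> : (\I x, a i x `^ p0 * m i `^ (p - p0) + a i x `^ p1 * m i `^ (p - p1)) =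
    m i `^ (p - p0) * (\I x, a i x `^ p0) + m i `^ (p - p1) * (\I x, a i x `^ p1).
   rewrite -(IIZ _ (bai i p0 hp0)) -(IIZ _ (bai i p1 p1_1)) -IID; [|exact: B1Z (bai i p0 _)|exact: B1Z (bai i p1 p1_1)].
   by congr II; ext x; congr (_ + _); rewrite mulrC.
  have I1 : (dl * 2 ^+ i) `^ (p - p0) * (\I x, `|fi i x| `^ p0) <= W * (\I x, `|fi i x| `^ p).
   rewrite -(IIZ _ (bP _ _ hp0 (bfi i))) -(IIZ _ (bP _ _ p_1 (bfi i))).
   apply: (II_le (B1Z _ (bP _ _ hp0 (bfi i))) (B1Z _ (bP _ _ p_1 (bfi i)))) => x.
   rewrite /fi; case: ifP => [/andP[h _]|_]; last by rewrite normr0 !powR0 ?gt_eqF// !mulr0.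
   have fp : 0 < `|f x| by exact: lt_le_trans h.
   rewrite [X in _ <= _ * X](_ : _ = `|f x| `^ (p - p0) * `|f x| `^ p0); last by rewrite -powRD_pos//; congr (_ `^ _); ring.
   rewrite mulrA; apply: (ler_wpM2r (powR_ge0 _ _)).
   via (1 * `|f x| `^ (p - p0)).
    by rewrite mul1r; apply: powR_mono; rewrite ?subr_ge0 ?(ltW p0p)// ltW.
   by apply: (ler_wpM2r (powR_ge0 _ _)); rewrite lerDl.
  have I2 : (dl * 2 ^+ i) `^ (p - p1) * (\I x, `|fi i x| `^ p1) <= W * (\I x, `|fi i x| `^ p).
   rewrite -(IIZ _ (bP _ _ p1_1 (bfi i))) -(IIZ _ (bP _ _ p_1 (bfi i))).
   apply: (II_le (B1Z _ (bP _ _ p1_1 (bfi i))) (B1Z _ (bP _ _ p_1 (bfi i)))) => x.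
   rewrite /fi; case: ifP => [/andP[h h']|_]; last by rewrite normr0 !powR0 ?gt_eqF// !mulr0.
   have fp : 0 < `|f x| by exact: lt_le_trans h.
   rewrite [X in _ * X <= _](_ : _ = `|f x| `^ (p1 - p) * `|f x| `^ p); last by rewrite -powRD_pos//; congr (_ `^ _); ring.
   rewrite mulrA; apply: (ler_wpM2r (powR_ge0 _ _)).
   have h2 : `|f x| `^ (p1 - p) <= 2 `^ (p1 - p) * (dl * 2 ^+ i) `^ (p1 - p).
    rewrite -powRM ?(ltW l0)//; apply: powR_mono; rewrite ?subr_ge0 ?(ltW pp1)//.
    by apply: ltW; move: h'; rewrite exprS mulrCA.
   letr (ler_wpM2l (powR_ge0 _ _) h2).
   rewrite mulrCA -powRD_pos// (_ : p - p1 + (p1 - p) = 0); last by ring.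
   by rewrite powRr0 mulr1 lerDr.
  have J1 := H0 _ (bfi i); have J2 := H1 _ (bfi i).
  rewrite !mE [W * U]mulrC mulrDl mulrDl; apply: lerD.
   letr (ler_wpM2l (mulr_ge0 (powR_ge0 _ _) (powR_ge0 _ _)) J1).
   rewrite (_ : lam `^ (p - p0) * (dl * 2 ^+ i) `^ (p - p0) * (A0 * (\I x, `|fi i x| `^ p0)) =
    A0 * lam `^ (p - p0) * ((dl * 2 ^+ i) `^ (p - p0) * (\I x, `|fi i x| `^ p0))); last by ring.
   by rewrite -[leRHS]mulrA; apply: ler_wpM2l.
  letr (ler_wpM2l (mulr_ge0 (powR_ge0 _ _) (powR_ge0 _ _)) J2).
  rewrite (_ : lam `^ (p - p1) * (dl * 2 ^+ i) `^ (p - p1) * (A1 * (\I x, `|fi i x| `^ p1)) =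
   A1 * lam `^ (p - p1) * ((dl * 2 ^+ i) `^ (p - p1) * (\I x, `|fi i x| `^ p1))); last by ring.
  by rewrite -[leRHS]mulrA; apply: ler_wpM2l.
 rewrite (II_sum _ bSi); letr (ler_sum _ (fun i _ => one i)).
 rewrite -mulr_sumr; apply: ler_wpM2l; first by rewrite mulr_ge0 ?addr_ge0.
 have bfp (i : 'I_K) : B1 (fun x => `|fi i x| `^ p) by exact: bP.
 rewrite -(II_sum _ bfp); apply: (II_le (B1_sum _ bfp) (bP _ _ p_1 bf)) => x.
 have := @sum_levels `|f x| dl K (fun=> `|f x| `^ p) dl0 (normr_ge0 _) (le_lt_trans (fM' x) MK).
 rewrite (eq_bigr (fun i : 'I_K => `|fi i x| `^ p)); last first.
  by move=> i _; rewrite /fi; case: ifP => // _; rewrite normr0 powR0// gt_eqF.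
 by move=> ->; case: ifP => // _.
letr st1; rewrite mulrDr; apply: lerD.
 rewrite -!mulrA; apply: (ler_wpM2l (powR_ge0 _ _)); apply: (ler_wpM2l (ltW C0)).
 by move: stS; rewrite -mulrA.
have hfr : (\I x, `|fr x|) <= e / (2 `^ p * (E + 1)).
 apply: le_trans hdl; apply: le_of_eq; congr II; ext x; rewrite /fr; case: ifP => //.
 by rewrite normr0.
letr (ler_wpM2l (powR_ge0 _ _) (le_trans stb (ler_wpM2l E0 hfr))).
have E10 : 0 < E + 1 by rewrite ltr_wpDl.
have -> : 2 `^ p * (E * (e / (2 `^ p * (E + 1)))) = e * (E / (E + 1)).
 by field; rewrite !gt_eqF.
by rewrite ler_piMr ?(ltW e0)// ler_pdivrMr// mul1r lerDl.
Qed.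
End marcinkiewicz.

(** * Van der Corput differencing *)

Section van_der_corput.
Context {R : realType}.

Lemma vdc_exponent K n i : (K * (2 * n + i) + (3 * n + i) <= (2 * K + 3) * (n + i))%N.
nia. Qed.

Lemma avg_const J (x : R) : (0 < J)%N -> J%:R^-1 * \sum_(j < J) x = x.
by move=> J0; rewrite sumr_const card_ord -[x *+ J]mulr_natl mulKf// pnatr_eq0 -lt0n. Qed.

(** Finite differences in place of derivatives: differencing along [ls] with arbitrary steps leaves
    c times the product of the steps. The condition passes directly to the differenced polynomials
    that the van der Corput argument produces. *)
Fixpoint Lead k (ls : seq 'I_k) (c : R) (q : k.-tuple R -> R) : Prop :=
 if ls is l :: ls' then forall tau, Lead ls' (tau * c) (fun t => q (shiftt l tau t) - q t)
 else forall t, q t = c.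

Lemma shiftt_comm k (l l' : 'I_k) (u v : R) t : shiftt l u (shiftt l' v t) = shiftt l' v (shiftt l u t).
apply: eq_from_tnth => i; rewrite !tnth_shiftt.
by do 2 case: eqP => // _; rewrite addrAC.
Qed.

Lemma shifttD k (l : 'I_k) (u v : R) t : shiftt l u (shiftt l v t) = shiftt l (v + u) t.
by apply: eq_from_tnth => i; rewrite !tnth_shiftt; case: eqP => // _; rewrite addrA. Qed.

Lemma shiftt0 k l (t : k.-tuple R) : shiftt l 0 t = t.
by apply: eq_from_tnth => i; rewrite !tnth_shiftt; case: eqP => // _; rewrite addr0. Qed.

Lemma Lead_shift k (ls : seq 'I_k) c q l u : Lead ls c q -> Lead ls c (fun t => q (shiftt l u t)).
elim: ls c q => [|l' ls IH] c q /= => //.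
move=> h tau; have := IH _ _ (h tau); congr Lead; ext t.
by rewrite shiftt_comm.
Qed.

Lemma measurable_shiftt k (l : 'I_k) (u : R) : mfunT (shiftt l u).
exact: measurable_affmap. Qed.

Section with_system.
Context {d : nat} (s : dsys R d).
Notation X := (sX s).
Notation mu := (smu s).
Implicit Types f : X -> R.

Lemma mp_shift k (p : k.-tuple R -> 'I_d -> R) l u : mp p -> mp (fun t => p (shiftt l u t)).
by move=> hp i; apply: (measurableT_comp (hp i)); exact: measurable_shiftt. Qed.

Lemma mp_sub k (p q : k.-tuple R -> 'I_d -> R) : mp p -> mp q -> mp (fun t i => p t i - q t i).
by move=> hp hq i; apply: measurable_funB. Qed.

Lemma n2_Av k (a b : 'I_k -> R) p f : lt_box a b -> mp p -> B1 f -> n2 (Av a b p f) <= n2 f.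
by move=> ab hp bf; have := @nb_av R d s k a b p ab hp f bf; rewrite mul1r. Qed.

Lemma n2_eq f g : f =1 g -> n2 f = n2 g.
by move=> fg; congr n2; apply/funext. Qed.

Lemma n2_T f v : B1 f -> n2 (fun x => f (sT v x)) = n2 f.
by move=> bf; rewrite /n2 -(II_T v (B1X 1 bf)). Qed.

Lemma n2_shift k (a b : 'I_k -> R) p l tau f : lt_box a b -> mp p -> B1 f -> 0 <= tau < b l - a l ->
 n2 (fun x => Av a b p f x - Av a b (fun t => p (shiftt l tau t)) f x) <= 2 * (tau / (b l - a l)) * n2 f.
move=> ab hp bf /andP[t0 tb].
have d0 : 0 < b l - a l by exact: le_lt_trans tb.
have bAv a' b' : lt_box a' b' -> B1 (Av (s := s) a' b' p f) by move=> ab'; exact: Av_B1.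
have [tau0|taun] := eqVneq tau 0.
 rewrite tau0 mul0r mulr0 mul0r; rewrite (@n2_eq _ (fun x => 0 * f x)); last first.
  by move=> x; rewrite mul0r; under [X in _ - X]av_eq do rewrite shiftt0; rewrite subrr.
 by rewrite n2Z// normr0 mul0r.
have tp : 0 < tau < b l - a l by rewrite lt_def taun t0.
have h1 : lt_box (upd a l (b l)) (upd b l (b l + tau)).
 move=> i; rewrite /upd; case: eqP => _ => //.
 lra.
have h2 : lt_box a (upd b l (a l + tau)).
 by apply: lt_box_updr => //; rewrite ltrDl; case/andP: tp.
rewrite (@n2_eq _ (fun x => (- (tau / (b l - a l))) * (Av (upd a l (b l)) (upd b l (b l + tau)) p f x - Av a (upd b l (a l + tau)) p f x))); last first.
 move=> x; have := av_shift ab tp (Bt_slice x hp (B1_Bm bf)).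
 by rewrite mulNr => <-; rewrite opprB.
rewrite n2Z; last by apply: B1B; exact: bAv.
rewrite normrN ger0_norm; last pos.
rewrite (_ : 2 * (tau / (b l - a l)) * n2 f = tau / (b l - a l) * (2 * n2 f)); last by ring.
have q0 : 0 <= tau / (b l - a l) by rewrite divr_ge0// ltW.
apply: (ler_wpM2l q0).
letr (n2B (bAv _ _ h1) (bAv _ _ h2)).
by rewrite mulr_natl; apply: lerD; exact: n2_Av.
Qed.

Lemma corr_fubini k (a b : 'I_k -> R) q f : lt_box a b -> mp q -> B1 f ->
 Bt (fun t => (\I x, f x * f (sT (q t) x : X))) /\
 av a b (fun t => (\I x, f x * f (sT (q t) x : X))) = (\I x, f x * Av a b q f x).
move=> ab hq bf; have [bm _] := bf; have [_ [M fM]] := bm.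
have mG : mfunT (fun u : X * k.-tuple R => f u.1 * f (sT (q u.2) u.1)).
 apply: measurable_funM; last exact: Bm_joint hq bm.
 exact: measurableT_comp bm.1 measurable_fst.
have GM u : `|f u.1 * f (sT (q u.2) u.1)| <= M * M by rewrite normrM; apply: ler_pM.
have GK t : (\int[mu]_x `|(f x * f (sT (q t) x))%:E| <= (M * (\I x, `|f x|))%:E)%E.
 have bfT := Bm_T (q t) bm.
 rewrite -(IIZ M (B1_norm bf)) -(II_fin (B1_norm (B1M bf bfT))) lee_fin.
 apply: II_le; [exact: B1_norm (B1M bf _)|exact: B1Z (B1_norm bf)|].
 by move=> x; rewrite normrM mulrC ler_wpM2r.
split; first exact: Bt_int mG GK.
have := av_fubini ab mG GM GK; rewrite -/(II _) => <-.
congr Rintegral; ext x.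
by rewrite -avZ//; exact: Bt_slice.
Qed.

Lemma av_sum k a b J r (F : J -> k.-tuple R -> R) : lt_box a b ->
 (forall j, Bt (F j)) -> Bt (fun t => \sum_(j <- r) F j t) /\
 av a b (fun t => \sum_(j <- r) F j t) = \sum_(j <- r) av a b (F j).
move=> ab bF; elim: r => [|j r [bI IH]].
 split; first by under eq_fun do rewrite big_nil; split => //; exists 0 => t; rewrite normr0.
 by under [LHS]av_eq do rewrite big_nil; rewrite av_cst// big_nil.
have -> : (fun t => \sum_(j0 <- j :: r) F j0 t) = fun t => F j t + \sum_(j <- r) F j t.
 by ext t; rewrite big_cons.
split; last by rewrite avD// IH big_cons.
have [m1 [M1 B1']] := bF j; have [m2 [M2 B2]] := bI.
split; first exact: measurable_funD.
by exists (M1 + M2) => t; letr (ler_normD _ _); exact: lerD.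
Qed.

Lemma sT_move f g v w : B1 f -> B1 g -> (\I x, f (sT v x) * g (sT w x : X)) = (\I x, f x * g (sT (fun i => w i - v i) x)).
move=> bf bg; rewrite -(II_T v (B1M bf (B1_Bm (B1_T _ bg)))).
congr II; ext x; rewrite sTD; congr (_ * g (sT _ x)).
by ext i; rewrite subrK.
Qed.

(* Jensen in t followed by the expansion of the square: the correlations see only p_j' - p_j. *)
Lemma vdc_square k a b J (p : 'I_J -> k.-tuple R -> 'I_d -> R) f E :
 lt_box a b -> (forall j, mp (p j)) -> B1 f -> 0 <= E ->
 (forall j j', j != j' -> n2 (Av a b (fun t i => p j' t i - p j t i) f) <= E) ->
 n2 (fun x => J%:R^-1 * \sum_(j < J) Av a b (p j) f x) ^+ 2 <= J%:R^-1 * n2 f ^+ 2 + n2 f * E.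
move=> ab hp bf E0 hE; have [bm _] := bf; have [_ [M fM]] := bm.
have [J0|Jn] := posnP J.
 by subst J; rewrite invr0 (@n2_eq _ (fun x => 0 * f x)) ?n2Z ?normr0 ?mul0r ?expr0n/= ?add0r ?mulr_ge0 ?n2_ge0// => x; rewrite !mul0r.
have J0 : 0 < J%:R :> R by rewrite ltr0n.
pose G u := J%:R^-1 * \sum_(j < J) f (sT (p j u.2) u.1).
have mG : mfunT G.
 apply: measurable_funM => //.
 by apply: measurable_sum => j; exact: Bm_joint (hp j) bm.
have GM u : `|G u| <= M.
 rewrite normrM ger0_norm ?ler0n// mulrC ler_pdivrMr//.
 letr (ler_norm_sum _ _ _); letr (ler_sum _ (fun i _ => fM _)).
 by rewrite sumr_const card_ord mulr_natr.
have bfT j t := B1_T (p j t) bf.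
have bG t : B1 (fun x => G (x, t)) by apply: B1Z; apply: B1_sum => j; exact: bfT.
have GK t : (\int[mu]_x `|(G (x, t))%:E| <= (\I x, `|f x|)%:E)%E.
 rewrite -(II_fin (B1_norm (bG t))) lee_fin.
 via (\I x, J%:R^-1 * \sum_(j < J) `|f (sT (p j t) x)|).
  apply: II_le; [exact: B1_norm|by apply: B1Z; apply: B1_sum => j; exact: B1_norm|move=> x].
  by rewrite normrM ger0_norm ?ler0n// ler_wpM2l ?invr_ge0//; exact: ler_norm_sum.
 rewrite IIZ; last by apply: B1_sum => j; exact: B1_norm.
 rewrite II_sum; last by move=> j; exact: B1_norm.
 under eq_bigr do rewrite (II_T _ (B1_norm bf)).
 by rewrite avg_const.
rewrite n2_sqr.
have -> : (fun x => (J%:R^-1 * \sum_(j < J) Av a b (p j) f x) ^+ 2) = fun x => av a b (fun t => G (x, t)) ^+ 2.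
 ext x; congr (_ ^+ 2); rewrite /G/=.
 have [bS eS] := av_sum (index_enum _) ab (fun j => Bt_slice x (hp j) bm).
 by rewrite avZ// eS.
apply: (le_trans (Av_le_bound ab mG GM GK).2).
pose cr u t := (\I x, f x * f (sT (fun i => p u.2 t i - p u.1 t i) x)).
have crP u := corr_fubini ab (mp_sub (hp u.2) (hp u.1)) bf.
pose L := [seq (j, j') | j <- index_enum 'I_J, j' <- index_enum 'I_J].
have eG t : (\I x, G (x, t) ^+ 2) = J%:R^-1 ^+ 2 * \sum_(u <- L) cr u t.
 have bff u : B1 (fun x => f (sT (p u.1 t) x) * f (sT (p u.2 t) x)) by apply: B1M => //; exact: B1_Bm.
 rewrite (eq_bigr (fun u => (\I x, f (sT (p u.1 t) x) * f (sT (p u.2 t) x)))); last first.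
  by move=> u _; rewrite sT_move.
 rewrite -II_sum// -IIZ; last exact: B1_sum.
 congr II; ext x; rewrite exprMn; congr (_ * _).
 by rewrite big_allpairs_dep expr2 mulr_suml; apply: eq_bigr => j _; rewrite mulr_sumr.
under av_eq do rewrite eG.
have [bS eS] := av_sum L ab (fun u => (crP u).1).
rewrite avZ// eS.
have bound u : av a b (cr u) <= (if u.1 == u.2 then n2 f ^+ 2 else 0) + n2 f * E.
 case: eqP => [e|/eqP ne].
  rewrite (_ : cr u = fun=> n2 f ^+ 2); last first.
   ext t; rewrite n2_sqr; congr II; ext x.
   congr (_ * f _); rewrite -[RHS]sT0; congr sT; ext i.
   by rewrite e subrr.
  by rewrite av_cst// lerDl mulr_ge0// n2_ge0.
 rewrite (crP u).2 add0r; have bA : B1 (Av a b (fun t i => p u.2 t i - p u.1 t i) f) by apply: Av_B1 => //; exact: mp_sub.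
 by letr (II_CS bf bA); rewrite ler_wpM2l ?n2_ge0//; exact: hE.
via (J%:R^-1 ^+ 2 * \sum_(u <- L) ((if u.1 == u.2 then n2 f ^+ 2 else 0) + n2 f * E)).
 by rewrite ler_wpM2l ?sqr_ge0//; apply: ler_sum => u _; exact: bound.
rewrite big_allpairs_dep/=.
rewrite (eq_bigr (fun=> n2 f ^+ 2 + J%:R * (n2 f * E))); last first.
 move=> j _; rewrite big_split/= sumr_const card_ord -[(n2 f * E) *+ J]mulr_natl (bigD1 j)//= eqxx big1 ?addr0//.
 by move=> j' /negbTE; rewrite eq_sym => ->.
rewrite sumr_const card_ord -[(_ + _) *+ J]mulr_natl.
apply: le_of_eq; field; pos.
Qed.

(** Near invariance is smallness of the average of F = f - f o T^(h c). Averaging over J shifts of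
    the box costs 2^(-n), and [vdc_square] leaves 1/J and correlations along differenced
    polynomials. The latter are small by [IH], which is used with 2 n because a square root is
    taken. *)
Lemma vdc_step k l a b c p n i K h f C :
 lt_box a b -> (forall l, 2 ^- i <= b l - a l) -> mp p -> B1 f -> 0 <= C ->
 (forall (q : k.-tuple R -> 'I_d -> R) tau e, mp q ->
   (exists u, q = fun t j => p (shiftt l (u + tau) t) j - p (shiftt l u t) j) -> `|e| <= 2 ^- (K * (2 * n + i)) ->
   n2 (fun x => Av a b q f x - Av a b q f (sT (fun j => e * (tau * c j)) x)) <= C * 2 ^- (2 * n) * n2 f) ->
 `|h| <= 2 ^- ((2 * K + 3) * (n + i)) ->
 n2 (fun x => Av a b p f x - Av a b p f (sT (fun j => h * c j) x)) <= (8 + 2 * C) * 2 ^- n * n2 f.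
move=> ab sd hp bf C0 IH hh.
pose F x := f x - f (sT (fun j => h * c j) x).
have bF : B1 F by apply: B1B => //; exact: B1_T.
have nF : n2 F <= 2 * n2 f.
 by letr (n2B bf (B1_T _ bf)); rewrite n2_T//; lra.
have AF q : mp q -> Av a b q F = fun x => Av (s := s) a b q f x - Av a b q f (sT (fun j => h * c j) x).
 move=> hq; rewrite (algB (alg_av s ab hq) (B1_Bm bf) (B1_Bm (B1_T _ bf))).
 by ext x; rewrite Av_T.
rewrite -(AF _ hp).
(* J = 4^n makes the diagonal term 2^(-2 n), matching [IH]; tau is such that all J steps together
   move the box by 2^(-n) 2^(-i), where 2^(-i) bounds the sides from below. *)
pose J := (4 ^ n)%N; pose tau := 2 ^- (3 * n + i) : R.
have tau0 : 0 < tau by rewrite invr_gt0.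
have Jr : J%:R = 2 ^+ (2 * n) :> R by rewrite natrX exprM; congr (_ ^+ n); rewrite -natrX.
have J0 : 0 < J%:R :> R by rewrite Jr.
have Jt : J%:R * tau = 2 ^- n * 2 ^- i.
 rewrite Jr /tau (_ : (3 * n + i = 2 * n + (n + i))%N); last by lia.
 by rewrite !exprD; field; rewrite !gt_eqF.
have i0 : 0 < 2 ^- i :> R by [].
have n0 : 0 < 2 ^- n :> R by [].
have n1 : 2 ^- n <= 1 :> R by rewrite invf_le1// exprn_ege1// ler1n.
pose pj (j : 'I_J) t := p (shiftt l (j%:R * tau) t).
have hpj j : mp (pj j) by exact: mp_shift.
have jt (j : 'I_J) : 0 <= j%:R * tau < b l - a l.
 rewrite mulr_ge0 ?(ltW tau0)//=; apply: (@lt_le_trans _ _ (J%:R * tau)).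
  by rewrite ltr_pM2r// ltr_nat.
 by apply: le_trans (sd l); rewrite Jt ler_piMl.
have bAp : B1 (Av (s := s) a b p F) by exact: Av_B1.
have bAj j : B1 (Av (s := s) a b (pj j) F) by exact: Av_B1.
have bD j : B1 (fun x => Av a b p F x - Av a b (pj j) F x) by exact: B1B.
pose V x := J%:R^-1 * \sum_(j < J) Av a b (pj j) F x.
have bV : B1 V by apply: B1Z; exact: B1_sum.
have st1 : n2 (fun x => Av a b p F x - V x) <= 4 * 2 ^- n * n2 f.
 rewrite (@n2_eq _ (fun x => J%:R^-1 * \sum_(j < J) (Av a b p F x - Av a b (pj j) F x))); last first.
  by move=> x; rewrite sumrB mulrBr avg_const// -(ltr0n R).
 rewrite n2Z; last exact: B1_sum.
 rewrite ger0_norm ?(ltW J0)//.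
 via (J%:R^-1 * \sum_(j < J) 2 * 2 ^- n * n2 F).
  rewrite ler_wpM2l ?(ltW J0)//; letr (n2_sum _ bD); apply: ler_sum => j _.
  letr (n2_shift ab hp bF (jt j)); rewrite ler_wpM2r ?n2_ge0// ler_wpM2l//.
  have bl0 : 0 < b l - a l by exact: lt_le_trans i0 (sd l).
  rewrite ler_pdivrMr//; via (J%:R * tau).
   by rewrite ler_wpM2r ?(ltW tau0)// ler_nat ltnW.
  by rewrite Jt ler_wpM2l.
 rewrite avg_const; last by rewrite -(ltr0n R).
 nra.
have st2 : n2 V ^+ 2 <= J%:R^-1 * n2 F ^+ 2 + n2 F * (C * 2 ^- (2 * n) * n2 f).
 apply: vdc_square => //; first by rewrite !mulr_ge0 ?n2_ge0.
 move=> j j' ne; pose u := (j'%:R - j%:R) * tau.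
 have u0 : tau <= `|u|.
  rewrite normrM (gtr0_norm tau0) ler_peMl ?(ltW tau0)//.
  have e0 : j'%:Z - j%:Z != 0 by rewrite subr_eq0; apply: contra ne => /eqP[] /val_inj ->.
  have -> : j'%:R - j%:R = (j'%:Z - j%:Z)%:~R :> R by rewrite intrB.
  by rewrite -intr_norm ler1z -gtz0_ge1 normr_gt0.
 have un : u != 0 by rewrite -normr_gt0 (lt_le_trans tau0).
 have hq := mp_sub (hpj j') (hpj j).
 rewrite (AF _ hq).
 have -> : (fun j0 => h * c j0) = (fun j0 => h / u * (u * c j0)).
  by ext j0; field.
 apply: IH => //.
  exists (j%:R * tau); ext t; ext m; rewrite /u; congr (p (shiftt l _ t) m - _).
  by ring.
 rewrite normrM normfV ler_pdivrMr ?normr_gt0//.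
 letr hh; via (2 ^- (K * (2 * n + i)) * tau); last first.
  by rewrite ler_wpM2l.
 by rewrite -invfM -exprD lef_pV2 ?posrE// ler_eXn2l ?ltr1n// vdc_exponent.
have Jinv : J%:R^-1 = 2 ^- n * 2 ^- n :> R by rewrite Jr mulnC exprM invfM.
have st3 : n2 V <= (4 + 2 * C) * 2 ^- n * n2 f.
 have nf0 := n2_ge0 f; have nF0 := n2_ge0 F.
 have r0 : 0 <= (4 + 2 * C) * 2 ^- n * n2 f by rewrite !mulr_ge0 ?(ltW n0)//; lra.
 rewrite -(@ler_pXn2r _ 2) ?nnegrE ?n2_ge0//; letr st2.
 rewrite Jinv (_ : 2 ^- (2 * n) = 2 ^- n * 2 ^- n); last by rewrite mulnC exprM invfM.
 move: (2 ^- n) n0 => z z0; have z0' := ltW z0.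
 have h1 : n2 F ^+ 2 <= 4 * n2 f ^+ 2.
  have -> : 4 * n2 f ^+ 2 = (2 * n2 f) ^+ 2 by ring.
  by apply: lerXn2r; rewrite ?nnegrE// mulr_ge0.
 via (z * z * (4 * n2 f ^+ 2) + 2 * n2 f * (C * (z * z) * n2 f)).
  apply: lerD; first by rewrite ler_wpM2l// mulr_ge0.
  by rewrite ler_wpM2r// !mulr_ge0.
 have -> : z * z * (4 * n2 f ^+ 2) + 2 * n2 f * (C * (z * z) * n2 f) = (4 + 2 * C) * (z ^+ 2 * n2 f ^+ 2) by ring.
 nra.
rewrite (@n2_eq _ (fun x => (Av a b p F x - V x) + V x)); last by move=> x; rewrite subrK.
letr (n2D (B1B bAp bV) bV); letr (lerD st1 st3).
by apply: le_of_eq; ring.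
Qed.
End with_system.

Definition leadv d k (ls : seq 'I_k) (c : 'I_d -> R) (p : k.-tuple R -> 'I_d -> R) :=
 forall i, Lead ls (c i) (fun t => p t i).

(** Induction on the number of differences. With a single one, a shift of the parameter in direction
    l by u adds u c to p, so the translation is a shift of the box. The exponent passes from K to 2
    K + 3 because n is doubled and a step of size at least 2^(-(3 n + i)) is divided out. *)
Lemma vdc k l ls : exists K, exists2 C : R, 0 <= C &
 forall d (s : dsys R d) (a b : 'I_k -> R) c p n i h (f : sX s -> R),
 lt_box a b -> (forall l, 2 ^- i <= b l - a l) -> mp p -> leadv (l :: ls) c p -> B1 f ->
 `|h| <= 2 ^- (K * (n + i)) ->
 n2 (fun x => Av a b p f x - Av a b p f (sT (fun j => h * c j) x)) <= C * 2 ^- n * n2 f.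
elim: ls l => [|l' ls IH] l.
 exists 2%N, 2 => // d s a b c p n i h f ab sd hp lp bf hh.
 have nf0 := n2_ge0 f.
 have [n0|np] := posnP n.
  rewrite n0 invr1 mulr1.
  letr (n2B (Av_B1 ab hp bf) (B1_T _ (Av_B1 ab hp bf))).
  by rewrite n2_T; [have := n2_Av ab hp bf; lra|exact: Av_B1].
 have key (u : R) q : mp q -> leadv [:: l] c q -> 0 <= u -> u <= 2 ^- (2 * (n + i)) ->
  n2 (fun x => Av a b q f x - Av a b q f (sT (fun j => u * c j) x)) <= 2 * 2 ^- n * n2 f.
  move=> hq lq u0 hu.
  have i0 : 0 < 2 ^- i :> R by [].
  have bl0 : 0 < b l - a l by exact: lt_le_trans i0 (sd l).
  have ui : u < 2 ^- i.
   apply: (le_lt_trans hu); rewrite ltf_pV2 ?posrE// ltr_eXn2l ?ltr1n; lia.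
  have ub : 0 <= u < b l - a l by rewrite u0/=; exact: lt_le_trans ui (sd l).
  rewrite (@n2_eq _ _ _ (fun x => Av a b q f x - Av a b (fun t => q (shiftt l u t)) f x)); last first.
   move=> x; congr (_ - _); apply: av_eq => t _; rewrite sTD; congr (f (sT _ x)).
   by ext j; have /= h' := lq j u t; rewrite -h' addrC subrK.
  letr (n2_shift ab hq bf ub); rewrite ler_wpM2r// ler_wpM2l//.
  rewrite ler_pdivrMr//; letr hu.
  via (2 ^- n * 2 ^- i); last by rewrite ler_wpM2l.
  rewrite -invfM -exprD lef_pV2 ?posrE// ler_eXn2l ?ltr1n//; lia.
 have [h0|h0] := leP 0 h; first by apply: key => //; rewrite -(ger0_norm h0).
 have bg : B1 (Av a b p f) by exact: Av_B1.
 have hn : `|h| = - h by rewrite ltr0_norm.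
 have h1 : 0 <= - h by rewrite oppr_ge0 ltW.
 have := key (- h) p hp lp h1; rewrite -hn => /(_ hh).
 have bD := B1B bg (B1_T (fun j => `|h| * c j) bg).
 rewrite -(n2_T (fun j => h * c j) bD) => /(le_trans _); apply.
 rewrite (@n2_eq _ _ _ (fun x => -1 * (Av a b p f (sT (fun j => h * c j) x) - Av a b p f (sT (fun j => `|h| * c j) (sT (fun j => h * c j) x))))).
  by rewrite n2Z ?normrN1 ?mul1r//; exact: B1_T _ bD.
 move=> x; rewrite sTD (_ : (fun i0 => `|h| * c i0 + h * c i0) = fun=> 0) ?sT0; first by ring.
 by ext j; rewrite hn; ring.
have [K [C C0 HC]] := IH l'.
exists (2 * K + 3)%N, (8 + 2 * C); first pos.
move=> d s a b c p n i h f ab sd hp lp bf hh.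
apply: (@vdc_step _ s _ l a b c p n i K h f C) => // q tau e hq [u qE] he.
apply: HC => // j; rewrite qE.
have lj : Lead (l' :: ls) (tau * c j) (fun t => p (shiftt l _ t) j - p t j) := lp j tau.
have := Lead_shift l u lj; congr Lead; ext t.
by rewrite shifttD.
Qed.
End van_der_corput.

(** * Leading differences of monomials *)

Section lead_monomials.
Context {R : realType}.

Fixpoint lead1 (m : nat) (al : R) (q : R -> R) : Prop :=
 if m is m'.+1 then forall tau, lead1 m' (tau * al) (fun x => q (x + tau) - q x)
 else forall x, q x = al.

Lemma lead1D m al be q r : lead1 m al q -> lead1 m be r -> lead1 m (al + be) (fun x => q x + r x).
elim: m al be q r => [|m IH] al be q r /=; first by move=> h1 h2 x; rewrite h1 h2.
move=> h1 h2 tau; rewrite mulrDr; have := IH _ _ _ _ (h1 tau) (h2 tau); congr lead1.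
by ext x; ring.
Qed.

Lemma lead1Z m al c q : lead1 m al q -> lead1 m (c * al) (fun x => c * q x).
elim: m al q => [|m IH] al q /=; first by move=> h x; rewrite h.
move=> h tau; rewrite mulrCA; have := IH _ _ (h tau); congr lead1.
by ext x; ring.
Qed.

Lemma lead1_shift m al u q : lead1 m al q -> lead1 m al (fun x => q (x + u)).
elim: m al q => [|m IH] al q /= => //.
move=> h tau; have := IH _ _ (h tau); congr lead1.
by ext x; rewrite addrAC.
Qed.

(** The product rule for differences: the increment of x q(x) is x (q(x + tau) - q(x)) + tau q(x +
    tau). The induction hypothesis covers the first summand, and the second already has the right
    order. *)
Lemma lead1_X m al q : lead1 m al q -> lead1 m.+1 (m.+1%:R * al) (fun x => x * q x).
elim: m al q => [|m IH] al q; first by move=> h tau x; rewrite !h; ring.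
move=> h tau.
have h1 := IH _ _ (h tau).
have h2 := lead1Z tau (lead1_shift tau h).
have := lead1D h1 h2.
rewrite (_ : m.+1%:R * (tau * al) + tau * al = tau * (m.+2%:R * al)); last by rewrite -natr1; ring.
by congr lead1; ext x; ring.
Qed.

Lemma lead1_exp m : lead1 m (m`!)%:R (fun x => x ^+ m).
elim: m => [|m IH] => //.
by rewrite natrM; have := lead1_X IH; congr lead1; ext x; rewrite exprS.
Qed.

Lemma lead1S m al q : lead1 m al q -> lead1 m.+1 0 q.
elim: m al q => [|m IH] al q /=; first by move=> h tau x; rewrite !h subrr mulr0.
by move=> h tau tau'; have := IH _ _ (h tau) tau'; rewrite !mulr0.
Qed.

Lemma lead1_low m b : (b < m)%N -> lead1 m 0 (fun x => x ^+ b).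
elim: m => // m IH; rewrite ltnS leq_eqVlt => /orP[/eqP->|/IH]; last exact: lead1S.
exact: lead1S (lead1_exp m).
Qed.

Lemma LeadD k (ls : seq 'I_k) (c c' : R) q q' : Lead ls c q -> Lead ls c' q' -> Lead ls (c + c') (fun t => q t + q' t).
elim: ls c c' q q' => [|l ls IH] c c' q q' /=; first by move=> h h' t; rewrite h h'.
move=> h h' tau; rewrite mulrDr; have := IH _ _ _ _ (h tau) (h' tau); congr Lead.
by ext t; ring.
Qed.

Lemma LeadZ k (ls : seq 'I_k) (c e : R) q : Lead ls c q -> Lead ls (c * e) (fun t => q t * e).
elim: ls c q => [|l ls IH] c q /=; first by move=> h t; rewrite h.
move=> h tau; rewrite mulrA; have := IH _ _ (h tau); congr Lead.
by ext t; ring.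
Qed.

Lemma Lead0 k (ls : seq 'I_k) : Lead ls (0 : R) (fun=> 0).
by elim: ls => [|l ls IH]//= tau; rewrite mulr0; rewrite subrr. Qed.

Lemma Lead_sum k (ls : seq 'I_k) J r (P : pred J) (c : J -> R) q :
 (forall j, P j -> Lead ls (c j) (q j)) -> Lead ls (\sum_(j <- r | P j) c j) (fun t => \sum_(j <- r | P j) q j t).
move=> h; elim: r => [|j r IH].
 by rewrite big_nil; under eq_fun do rewrite big_nil; exact: Lead0.
have -> : (fun t => \sum_(j0 <- j :: r | P j0) q j0 t) =
 (fun t => if P j then q j t + \sum_(j <- r | P j) q j t else \sum_(j <- r | P j) q j t).
 by ext t; rewrite big_cons.
by rewrite big_cons; case: ifPn => // Pj; apply: LeadD => //; exact: h.
Qed.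

Lemma tensor_diff k (q : 'I_k -> R -> R) l0 tau t :
 \prod_l q l (tnth (shiftt l0 tau t) l) - \prod_l q l (tnth t l) =
 \prod_l (if l == l0 then q l (tnth t l + tau) - q l (tnth t l) else q l (tnth t l)).
rewrite (bigD1 l0)//= [X in _ - X](bigD1 l0)//= [RHS](bigD1 l0)//= tnth_shiftt eqxx.
have -> : \prod_(i < k | i != l0) q i (tnth (shiftt l0 tau t) i) = \prod_(i < k | i != l0) q i (tnth t i).
 by apply: eq_bigr => i /negbTE ne; rewrite tnth_shiftt ne.
have -> : \prod_(i < k | i != l0) (if i == l0 then q i (tnth t i + tau) - q i (tnth t i) else q i (tnth t i)) =
  \prod_(i < k | i != l0) q i (tnth t i).
 by apply: eq_bigr => i /negbTE ->.
lra.
Qed.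

Lemma Lead_tensor k (ls : seq 'I_k) (q : 'I_k -> R -> R) (al : 'I_k -> R) :
 (forall l, lead1 (count_mem l ls) (al l) (q l)) -> Lead ls (\prod_l al l) (fun t => \prod_l q l (tnth t l)).
elim: ls q al => [|l0 ls IH] q al h /=; first by move=> t; apply: eq_bigr => l _; exact: h.
move=> tau; pose q' l := if l == l0 then fun x => q l (x + tau) - q l x else q l.
pose al' l := if l == l0 then tau * al l else al l.
have h' l : lead1 (count_mem l ls) (al' l) (q' l).
 have := h l; rewrite /= /q' /al' eq_sym; case: eqP => [->|_] /=; last by [].
 by [].
have := IH _ _ h'.
rewrite [X in Lead _ X](_ : _ = tau * \prod_l al l).
 congr Lead; ext t; rewrite tensor_diff; apply: eq_bigr => l _.
 by rewrite /q'; case: eqP.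
rewrite (bigD1 l0)//= [in RHS](bigD1 l0)//= /al' eqxx mulrA; congr (_ * _).
by apply: eq_bigr => i /negbTE ->.
Qed.

Lemma Lead_tensor0 k (ls : seq 'I_k) (q : 'I_k -> R -> R) l0 :
 lead1 (count_mem l0 ls) 0 (q l0) -> Lead ls 0 (fun t => \prod_l q l (tnth t l)).
elim: ls q => [|l1 ls IH] q h /=; first by move=> t; rewrite (bigD1 l0)//= h mul0r.
move=> tau; rewrite mulr0; pose q' l := if l == l1 then fun x => q l (x + tau) - q l x else q l.
have h' : lead1 (count_mem l0 ls) 0 (q' l0).
 by move: h; rewrite /= /q' eq_sym; case: eqP => [_|_] //= /(_ tau); rewrite mulr0.
have := IH _ h'; congr Lead; ext t; rewrite tensor_diff; apply: eq_bigr => l _.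
by rewrite /q'; case: eqP.
Qed.

Notation Ix k n := {ffun 'I_k -> 'I_n.+1}.

Definition mono k n (g : Ix k n) (t : k.-tuple R) : R := \prod_l tnth t l ^+ g l.

Definition mdeg k n (g : Ix k n) : nat := (\sum_l g l)%N.

Definition mlist k n (g : Ix k n) : seq 'I_k := flatten [seq nseq (g l) l | l <- enum 'I_k].

Lemma count_mlist k n (g : Ix k n) l : count_mem l (mlist g) = g l.
rewrite count_flatten -map_comp sumnE big_map big_enum/= (bigD1 l)//= big1 ?addn0.
 by rewrite count_nseq /= eqxx mul1n.
by move=> i ne; rewrite count_nseq /= (negbTE ne).
Qed.

Lemma mdeg_lt k n (b g : Ix k n) : (mdeg b <= mdeg g)%N -> b != g -> exists l, (b l < g l)%N.
move=> dbg ne; apply/existsP; apply: contraNT ne; rewrite negb_exists => /forallP h.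
have h' l : (g l <= b l)%N by rewrite leqNgt.
have : (\sum_l (b l - g l) == 0)%N by rewrite sumnB.
rewrite sum_nat_eq0 => /forallP h2; apply/eqP/ffunP => l; apply/val_inj/eqP.
by rewrite eqn_leq h' andbT; exact: h2.
Qed.

Definition mfact k n (g : Ix k n) : R := \prod_l ((g l)`!)%:R.

Lemma mfact_ge1 k n (g : Ix k n) : 1 <= mfact g.
rewrite /mfact; elim/big_ind: _ => //; last by move=> l _; rewrite ler1n fact_gt0.
by move=> x y x1 y1; rewrite -[1]mulr1; apply: ler_pM.
Qed.

(** A monomial other than g whose degree is at most that of g has a smaller exponent than g in some
    variable, and is killed by differencing that variable once too often. So g alone survives
    differencing along its own variables. *)
Lemma Lead_mono k n (g b : Ix k n) : (mdeg b <= mdeg g)%N ->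
 Lead (mlist g) (if b == g then mfact g else 0) (mono b).
move=> dbg; case: eqP => [->|/eqP ne].
 have := @Lead_tensor k (mlist g) (fun l x => x ^+ g l) (fun l => ((g l)`!)%:R); apply => l.
 by rewrite count_mlist; exact: lead1_exp.
have [l hl] := mdeg_lt dbg ne.
by apply: (@Lead_tensor0 _ _ (fun l x => x ^+ b l) l); rewrite count_mlist; exact: lead1_low.
Qed.

Lemma Lead_cst k (l : 'I_k) ls (c : R) : Lead (l :: ls) 0 (fun=> c).
by move=> tau; rewrite mulr0; have := Lead0 ls; rewrite subrr. Qed.

(** The set F of monomials present is a parameter because the proof compares averages with and
    without a given monomial. *)
Definition mpol d k n (F : {set Ix k n}) (c : Ix k n -> 'I_d -> R) (t : k.-tuple R) (i : 'I_d) : R :=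
 \sum_(g in F) mono g t * c g i.

Lemma measurable_mono k n (g : Ix k n) : mfunT (mono g).
by apply: measurable_prod => l _; apply: measurable_funX; exact: measurable_tnth.
Qed.

Lemma mp_mpol d k n F (c : Ix k n -> 'I_d -> R) : mp (mpol F c).
move=> i; rewrite (_ : (mpol F c)^~ i = fun t => \sum_g (if g \in F then c g i else 0) * mono g t).
 by apply: measurable_sum => g; apply: measurable_funM => //; exact: measurable_mono.
ext t; rewrite /mpol big_mkcond; apply: eq_bigr => g _.
by case: ifP; rewrite ?mul0r// mulrC.
Qed.

End lead_monomials.
Notation mpolT c := (mpol finset.setT c).
Notation Ix k n := {ffun 'I_k -> 'I_n.+1}.
Notation coef R k n d := (Ix k n -> 'I_d -> R).

(** * Decay: averages are almost invariant along each of their monomials *)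

Section freezing.
Context {R : realType}.

Section with_system.
Context {d : nat} (s : dsys R d).
Notation X := (sX s).
Implicit Types (f g : X -> R) (c : 'I_d -> R).

Lemma n2_T_sym g v : B1 g -> n2 (fun x => g x - g (sT v x : X)) = n2 (fun x => g x - g (sT (fun i => - v i) x)).
move=> bg; have bD := B1B bg (B1_T (fun i => - v i) bg).
rewrite -[RHS](n2_T v bD) (@n2_eq _ _ _ _ (fun x => -1 * (g (sT v x) - g (sT (fun i => - v i) (sT v x))))).
 by rewrite n2Z ?normrN1 ?mul1r//; exact: (B1_T v bD).
by move=> x; rewrite sTK; ring.
Qed.

Lemma L_close c e g M : B1 g -> 0 <= M -> (forall h, 0 <= h <= 2 ^ e -> n2 (fun x => g x - g (sT (fun i => h * c i) x)) <= M) ->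
 n2 (fun x => g x - Lop c e g x) <= M.
move=> bg M0 hM; have [bm _] := bg; have [_ [B gB]] := bm.
have ab := lt_box_dyadic (R := R) e; have hp := @mp_ray R d c.
have bT t := B1_T (ray c t) bg.
have mG : mfunT (fun u : X * 1.-tuple R => g u.1 - g (sT (ray c u.2) u.1)).
 apply: measurable_funB; last exact: Bm_joint hp bm.
 exact: measurableT_comp bm.1 measurable_fst.
have GM u : `|g u.1 - g (sT (ray c u.2) u.1)| <= B + B.
 by letr (ler_normB _ _); exact: lerD.
have GK t : (\int[smu s]_x `|(g x - g (sT (ray c t) x))%:E| <= (2 * (\I x, `|g x|))%:E)%E.
 have bD := B1B bg (bT t).
 rewrite -(II_fin (B1_norm bD)) lee_fin.
 via (\I x, `|g x| + `|g (sT (ray c t) x)|).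
  apply: II_le; [exact: B1_norm|exact: B1D (B1_norm bg) (B1_norm _)|move=> x; exact: ler_normB].
 rewrite (IID (B1_norm bg) (B1_norm (bT t))) (II_T _ (B1_norm bg)).
 lra.
rewrite -(@ler_pXn2r _ 2) ?nnegrE ?n2_ge0// n2_sqr.
have -> : (fun x => (g x - Lop c e g x) ^+ 2) = (fun x => av (fun _ : 'I_1 => 0) (fun=> 2 ^ e) (fun t => g x - g (sT (ray c t) x)) ^+ 2).
 ext x; congr (_ ^+ 2).
 have bc : Bt (fun _ : 1.-tuple R => g x) by split; [by []|exists `|g x|].
 have bs := Bt_slice x hp bm.
 have bs' : Bt (fun t => -1 * g (sT (ray c t) x)).
  have [m1 [C1 h1]] := bs; split; first exact: measurable_funM => //.
  by exists C1 => t; rewrite mulN1r normrN.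
 under [RHS]av_eq do rewrite -mulN1r.
 by rewrite (avD ab bc bs') (avZ ab _ bs) av_cst// mulN1r.
have [bI h0] := Av_le_bound ab mG GM GK; letr h0.
have bc : Bt (fun _ : 1.-tuple R => M ^+ 2) by split; [by []|exists `|M ^+ 2|].
rewrite -[leRHS](av_cst ab); apply: av_le => // t ht.
rewrite -n2_sqr; apply: lerXn2r; rewrite ?nnegrE ?n2_ge0//.
have /andP[h1 h2] := ht ord0.
have h3 : 0 <= tnth t ord0 <= 2 ^ e by apply/andP; split => //; pos.
exact: hM h3.
Qed.

Lemma L_lip c e g u : B1 g ->
 n2 (fun x => Lop c e g x - Lop c e g (sT (fun i => u * c i) x)) <= 2 * (`|u| / 2 ^ e) * n2 g.
move=> bg; have e0 : 0 < (2 : R) ^ e by exact: exprz_gt0.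
have bL : B1 (Lop c e g) by exact: (mk_B1 (markov_L s c e)).
wlog u0 : u / 0 <= u.
 move=> H; have [h|h] := leP 0 u; first exact: H.
 rewrite n2_T_sym// -normrN (@n2_eq _ _ _ _ (fun x => Lop c e g x - Lop c e g (sT (fun i => - u * c i) x))); last first.
  by move=> x; congr (_ - Lop _ _ _ (sT _ x)); ext i; rewrite mulNr.
 by apply: H; rewrite oppr_ge0 ltW.
rewrite ger0_norm//.
have [h|h] := leP (2 ^ e) u.
 letr (n2B bL (B1_T _ bL)); rewrite n2_T//.
 have hL : n2 (Lop c e g) <= n2 g by exact: (mk_n2 (markov_L s c e)).
 via (2 * n2 g); first by rewrite mulr_natl; exact: lerD.
 by rewrite ler_wpM2r ?n2_ge0// ler_peMr// ler_pdivlMr// mul1r.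
have ub : 0 <= u < (fun=> 2 ^ e : R) (ord0 : 'I_1) - (fun=> 0) (ord0 : 'I_1) by rewrite u0 subr0.
have := @n2_shift R d s 1 (fun=> 0) (fun=> 2 ^ e) (ray c) ord0 u g (lt_box_dyadic e) (@mp_ray R d c) bg ub.
rewrite subr0 => /(le_trans _); apply; apply: le_of_eq; apply: n2_eq => x; congr (_ - _).
apply: av_eq => t _; rewrite sTD; congr (g (sT _ x)); ext i.
by rewrite /ray tnth_shiftt mulrDl.
Qed.

End with_system.

(** Bisection, one direction after another: a side longer than eta >= 2 dl can be halved without
    falling below dl. The property only has to survive the gluing of two halves. *)
Lemma split_boxes k (Q : ('I_k -> R) -> ('I_k -> R) -> Prop) A B (dl eta : R) :
 0 < dl -> 2 * dl <= eta ->
 (forall a b l, lt_box a b -> Q a (upd b l ((a l + b l) / 2)) -> Q (upd a l ((a l + b l) / 2)) b -> Q a b) ->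
 (forall a b, lt_box a b -> (forall l, A l <= a l) -> (forall l, b l <= B l) -> (forall l, dl <= b l - a l <= eta) -> Q a b) ->
 lt_box A B -> (forall l, dl <= B l - A l) -> Q A B.
move=> dl0 hde mid small AB sd.
have eta0 : 0 < eta by lra.
suff H (ls : seq 'I_k) : forall a b, lt_box a b -> (forall l, A l <= a l) -> (forall l, b l <= B l) -> (forall l, dl <= b l - a l) ->
  (forall l, l \notin ls -> b l - a l <= eta) -> Q a b.
 by apply: (H (enum 'I_k)) => // l; rewrite mem_enum.
elim: ls => [|l ls IH] a b ab Aa bB sab hs.
 by apply: small => // l; rewrite sab hs.
have [m hm] : exists m, b l - a l <= 2 ^+ m * eta.
 exists (Num.bound ((b l - a l) / eta)); rewrite -ler_pdivrMr//.
 have h0 : 0 <= (b l - a l) / eta by rewrite divr_ge0 ?subr_ge0// ltW.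
 apply: ltW; apply: (lt_le_trans (archi_boundP h0)).
 by rewrite -natrX ler_nat ltnW// ltn_expl.
elim: m a b ab Aa bB sab hs hm => [|m IHm] a b ab Aa bB sab hs hm.
 apply: IH => // l' nl'; have [->|ne] := eqVneq l' l; first by rewrite mul1r in hm.
 by apply: hs; rewrite negb_or ne.
have [h|h] := leP (b l - a l) eta.
 apply: IH => // l' nl'; have [->//|ne] := eqVneq l' l.
 by apply: hs; rewrite negb_or ne.
set c := (a l + b l) / 2.
have c1 : c - a l = (b l - a l) / 2 by rewrite /c; field.
have c2 : b l - c = (b l - a l) / 2 by rewrite /c; field.
have ac : a l < c by rewrite -subr_gt0; lra.
have cb : c < b l by rewrite -subr_gt0; lra.
rewrite exprS in hm.
apply: (mid a b l) => //; apply: IHm.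
- exact: lt_box_updr.
- by [].
- by move=> i; rewrite /upd; case: eqP => [->|_] //; apply: ltW; apply: lt_le_trans (bB l).
- by move=> i; rewrite /upd; case: eqP => [->|_] //; lra.
- move=> i ni; rewrite /upd; case: eqP => [e|_]; last exact: hs.
 by move: ni; rewrite e inE eqxx.
- by rewrite updE; lra.
- exact: lt_box_updl.
- by move=> i; rewrite /upd; case: eqP => [->|_] //; apply: le_trans (Aa l) (ltW ac).
- by [].
- by move=> i; rewrite /upd; case: eqP => [->|_] //; lra.
- move=> i ni; rewrite /upd; case: eqP => [e|_]; last exact: hs.
 by move: ni; rewrite e inE eqxx.
- by rewrite updE; lra.
Qed.

Lemma mono_lip k n : exists2 C : R, 0 <= C & forall (g : Ix k n) (t u : k.-tuple R) eta, 0 <= eta ->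
 (forall l, 0 <= tnth t l <= 2) -> (forall l, 0 <= tnth u l <= 2) -> (forall l, `|tnth t l - tnth u l| <= eta) ->
 `|mono g t - mono g u| <= C * eta.
pose lip (q : k.-tuple R -> R) B C := forall (t u : k.-tuple R) eta,
 (forall l, 0 <= tnth t l <= 2) -> (forall l, 0 <= tnth u l <= 2) -> (forall l, `|tnth t l - tnth u l| <= eta) ->
 `|q t| <= B /\ `|q t - q u| <= C * eta.
have lipM q r B C B' C' : 0 <= B -> 0 <= C -> 0 <= B' -> 0 <= C' -> lip q B C -> lip r B' C' -> lip (fun t => q t * r t) (B * B') (B * C' + C * B').
 move=> B0 C0 B'0 C'0 h1 h2 t u eta ht hu htu.
 have [q1 q2] := h1 t u eta ht hu htu; have [r1 r2] := h2 t u eta ht hu htu.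
 have [r3 _] := h2 u t eta hu ht (fun l => le_trans (le_of_eq (distrC _ _)) (htu l)).
 split; first by rewrite normrM; apply: ler_pM.
 rewrite (_ : q t * r t - q u * r u = q t * (r t - r u) + (q t - q u) * r u); last by ring.
 letr (ler_normD _ _); rewrite !normrM mulrDl; apply: lerD.
  by rewrite -mulrA; apply: ler_pM.
 by rewrite mulrAC; apply: ler_pM.
have ex (g : Ix k n) : exists B C, [/\ 0 <= B, 0 <= C & lip (mono g) B C].
 rewrite /mono; elim: index_enum => [|l r [B [C [B0 C0 h]]]].
  exists 1, 0; split => // t u eta _ _ _; rewrite !big_nil subrr normr0 mul0r normr1; by split.
 have [B' [C' [B'0 C'0 h']]] : exists B C, [/\ 0 <= B, 0 <= C & lip (fun t => tnth t l ^+ g l) B C].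
  elim: (nat_of_ord (g l)) => [|m [B' [C' [B'0 C'0 h']]]].
   exists 1, 0; split => // t u eta _ _ _; rewrite !expr0 subrr normr0 mul0r normr1; by split.
  exists (2 * B'), (2 * C' + 1 * B'); split; rewrite ?addr_ge0 ?mulr_ge0//.
  have -> : (fun t : k.-tuple R => tnth t l ^+ m.+1) = fun t => tnth t l * tnth t l ^+ m.
   by ext t; rewrite exprS.
  apply: lipM => // t u eta ht hu htu; split; last by rewrite mul1r.
  by have /andP[h1 h2] := ht l; rewrite ger0_norm.
 exists (B' * B), (B' * C + C' * B); split; rewrite ?addr_ge0 ?mulr_ge0//.
 have -> : (fun t : k.-tuple R => \prod_(i <- l :: r) tnth t i ^+ g i) = fun t => tnth t l ^+ g l * \prod_(i <- r) tnth t i ^+ g i.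
  by ext t; rewrite big_cons.
 exact: lipM.
have [F hF] := choice ex; have [G hG] := choice hF.
exists (\sum_g G g); first by apply: sumr_ge0 => g _; have [] := hG g.
move=> g t u eta eta0 ht hu htu; have [_ _ h] := hG g; have [_ h1] := h t u eta ht hu htu.
letr h1; rewrite ler_wpM2r//.
rewrite (bigD1 g)//= lerDl; apply: sumr_ge0 => i _; by have [] := hG i.
Qed.
End freezing.

Section decay.
Context {R : realType}.

Section with_system.
Context {d : nat} (s : dsys R d).
Notation X := (sX s).
Implicit Types (f g : X -> R) (c : 'I_d -> R).

Lemma Av_close k (a b : 'I_k -> R) p q f M : lt_box a b -> mp p -> mp q -> B1 f -> 0 <= M ->
 (forall t, hb a b t -> n2 (fun x => f x - f (sT (fun i => q t i - p t i) x : X)) <= M) ->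
 n2 (fun x => Av a b p f x - Av a b q f x) <= M.
move=> ab hp hq bf M0 hM; have [bm _] := bf; have [_ [B fB]] := bm.
have bp t := B1_T (p t) bf; have bq t := B1_T (q t) bf.
have mG : mfunT (fun u : X * k.-tuple R => f (sT (p u.2) u.1) - f (sT (q u.2) u.1)).
 by apply: measurable_funB; [exact: (Bm_joint hp)|exact: (Bm_joint hq)].
have GM u : `|f (sT (p u.2) u.1) - f (sT (q u.2) u.1)| <= B + B.
 by letr (ler_normB _ _); exact: lerD.
have GK t : (\int[smu s]_x `|(f (sT (p t) x) - f (sT (q t) x))%:E| <= (2 * (\I x, `|f x|))%:E)%E.
 have bD := B1B (bp t) (bq t).
 rewrite -(II_fin (B1_norm bD)) lee_fin.
 via (\I x, `|f (sT (p t) x)| + `|f (sT (q t) x)|).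
  apply: II_le; [exact: B1_norm|exact: B1D (B1_norm _) (B1_norm _)|move=> x; exact: ler_normB].
 rewrite (IID (B1_norm (bp t)) (B1_norm (bq t))) (II_T _ (B1_norm bf)) (II_T _ (B1_norm bf)).
 lra.
rewrite -(@ler_pXn2r _ 2) ?nnegrE ?n2_ge0// n2_sqr.
have -> : (fun x => (Av a b p f x - Av a b q f x) ^+ 2) = (fun x => av a b (fun t => f (sT (p t) x) - f (sT (q t) x)) ^+ 2).
 ext x; congr (_ ^+ 2).
 have bs := Bt_slice x hp bm; have bs1 := Bt_slice x hq bm.
 have bs' : Bt (fun t => -1 * f (sT (q t) x)).
  have [m1 [C1 h1]] := bs1; split; first exact: measurable_funM => //.
  by exists C1 => t; rewrite mulN1r normrN.
 under [RHS]av_eq do rewrite -mulN1r.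
 by rewrite (avD ab bs bs') (avZ ab _ bs1) mulN1r.
have [bI h0] := Av_le_bound ab mG GM GK; letr h0.
have bc : Bt (fun _ : k.-tuple R => M ^+ 2) by split; [by []|exists `|M ^+ 2|].
rewrite -[leRHS](av_cst ab); apply: av_le => // t ht.
rewrite -n2_sqr; apply: lerXn2r; rewrite ?nnegrE ?n2_ge0//.
apply: le_trans (hM t ht); apply: le_of_eq.
have bD := B1B bf (B1_T (fun i => q t i - p t i) bf).
rewrite -(n2_T (p t) bD); apply: n2_eq => x /=; congr (_ - f _).
by rewrite sTD; congr sT; ext i; rewrite subrK.
Qed.

Lemma Av_mid k (a b : 'I_k -> R) p l f x : lt_box a b -> mp p -> Bm f ->
 Av a b p f x = 2^-1 * (Av a (upd b l ((a l + b l) / 2)) p f x + Av (upd a l ((a l + b l) / 2)) b p f x).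
move=> ab hp bf; set c := (a l + b l) / 2; have abl := ab l.
have c1 : c - a l = (b l - a l) / 2 by rewrite /c; field.
have c2 : b l - c = (b l - a l) / 2 by rewrite /c; field.
have b0 : 0 < b l - a l by rewrite subr_gt0.
have h : a l < c < b l by rewrite -subr_gt0 c1 -[c < b l]subr_gt0 c2 divr_gt0.
have := av_split ab h (Bt_slice x hp bf); rewrite c1 c2 => e.
apply: (mulfI (lt0r_neq0 b0)); rewrite -/(Av a b p f x) in e.
by rewrite [LHS]e /Av; field.
Qed.

Definition inv_defect (v : 'I_d -> R) f := n2 (fun x => f x - f (sT v x : X)).

Lemma inv_defect_tri v f g : B1 f -> B1 g ->
 inv_defect v f <= inv_defect v g + 2 * n2 (fun x => f x - g x).
move=> bf bg; have bD := B1B bf bg; have bDT := B1_T v bD; have bgT := B1B bg (B1_T v bg).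
rewrite /inv_defect (@n2_eq _ _ _ _ (fun x => (g x - g (sT v x)) + ((f x - g x) - (f (sT v x) - g (sT v x))))); last first.
 by move=> x; ring.
letr (n2D bgT (B1B bD bDT)); rewrite lerD2l.
by letr (n2B bD bDT); rewrite (n2_T v bD) mulr_natl.
Qed.

Lemma inv_defect_mid k (a b : 'I_k -> R) p v f M l : lt_box a b -> mp p -> B1 f ->
 inv_defect v (Av a (upd b l ((a l + b l) / 2)) p f) <= M ->
 inv_defect v (Av (upd a l ((a l + b l) / 2)) b p f) <= M -> inv_defect v (Av a b p f) <= M.
move=> ab hp bf; have /midf_lt[ac cb] := ab l.
have B1a := Av_B1 (s := s) (lt_box_updr ab ac) hp bf.
have B1b := Av_B1 (s := s) (lt_box_updl ab cb) hp bf.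
have D1 := B1B B1a (B1_T v B1a); have D2 := B1B B1b (B1_T v B1b).
rewrite {3}/inv_defect (@n2_eq _ _ _ _ (fun x => 2^-1 * ((Av a (upd b l ((a l + b l) / 2)) p f x - Av a (upd b l ((a l + b l) / 2)) p f (sT v x)) + (Av (upd a l ((a l + b l) / 2)) b p f x - Av (upd a l ((a l + b l) / 2)) b p f (sT v x))))); last first.
 by move=> x; rewrite !(Av_mid l _ ab hp (B1_Bm bf)); ring.
move=> h1 h2; rewrite n2Z; last exact: B1D.
rewrite ger0_norm ?invr_ge0//; via (2^-1 * (M + M)); last by apply: le_of_eq; field.
have h0 : 0 <= 2^-1 :> R by [].
exact: (ler_wpM2l h0 (le_trans (n2D D1 D2) (lerD h1 h2))).
Qed.

Lemma inv_defect_sum I r u (c : I -> 'I_d -> R) f : B1 f ->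
 inv_defect (fun i => \sum_(j <- r) u j * c j i) f <= \sum_(j <- r) inv_defect (fun i => u j * c j i) f.
move=> bf; elim: r => [|j r IH].
 rewrite big_nil /inv_defect (@n2_eq _ _ _ _ (fun x => 0 * f x)); first by rewrite n2Z// normr0 mul0r.
 by move=> x; rewrite mul0r (_ : (fun i => _) = fun=> 0) ?sT0 ?subrr//; ext i; rewrite big_nil.
rewrite big_cons; set w := (fun i => \sum_(j <- r) u j * c j i) in IH *.
have b1 := B1B bf (B1_T w bf); have b2 := B1B bf (B1_T (fun i => u j * c j i) bf).
have b3 := B1_T w b2.
rewrite /inv_defect (@n2_eq _ _ _ _ (fun x => (f x - f (sT w x)) + (f (sT w x) - f (sT (fun i => u j * c j i) (sT w x))))); last first.
 move=> x; rewrite sTD addrA subrK; congr (_ - f (sT _ x)); ext i; by rewrite big_cons.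
letr (n2D b1 b3); rewrite addrC; apply: lerD => //.
by rewrite (n2_T w b2).
Qed.

Lemma inv_defect_le2 v f : B1 f -> inv_defect v f <= 2 * n2 f.
by move=> bf; letr (n2B bf (B1_T v bf)); rewrite (n2_T v bf) mulr_natl. Qed.

Definition smooth (I : Type) (r : seq I) (c : I -> 'I_d -> R) (e : int) f : X -> R :=
 foldr (fun j g => Lop (c j) e g) f r.

Lemma smooth_B1 I r (c : I -> 'I_d -> R) e f : B1 f -> B1 (smooth (I := I) r c e f).
by move=> bf; elim: r => //= j r IH; exact: (mk_B1 (markov_L s _ e)). Qed.

Lemma smooth_n2 I r (c : I -> 'I_d -> R) e f : B1 f -> n2 (smooth (I := I) r c e f) <= n2 f.
move=> bf; elim: r => //= j r IH.
exact: (le_trans (mk_n2 (markov_L s _ e) (smooth_B1 r c e bf))).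
Qed.

(** The average in direction j is Lipschitz along that direction, and the averages applied after it
    commute with translations and contract L^2. *)
Lemma smooth_lip (I : eqType) (r : seq I) (c : I -> 'I_d -> R) e f j u : B1 f -> j \in r ->
 inv_defect (fun i => u * c j i) (smooth r c e f) <= 2 * (`|u| / 2 ^ e) * n2 f.
move=> bf; elim: r => //= j0 r IH; have bS := smooth_B1 r c e bf.
have k0 : 0 <= 2 * (`|u| / 2 ^ e) by rewrite mulr_ge0// divr_ge0// exprz_ge0.
rewrite inE; have [->|ne] /= := eqVneq j j0.
 move=> _; letr (L_lip _ e u bS); apply: (ler_wpM2l k0); exact: smooth_n2.
move=> jr; apply: le_trans (IH jr).
have aL := alg_L s (c j0) e.
have bT := B1_T (fun i => u * c j i) bS.
rewrite /inv_defect (@n2_eq _ _ _ _ (Lop (c j0) e (fun x => smooth r c e f x - smooth r c e f (sT (fun i => u * c j i) x)))); last first.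
 by move=> x; rewrite (algB aL (B1_Bm bS) (B1_Bm bT)) Lop_T.
exact: (mk_n2 (markov_L s _ e) (B1B bS bT)).
Qed.

(** A commutes with the averages, so every smoothing step may be applied to an output of A, which is
    nearly invariant by assumption. *)
Lemma smooth_close (I : eqType) (r : seq I) (c : I -> 'I_d -> R) e f A M : alg A -> B1 f -> 0 <= M ->
 (forall j g h, j \in r -> B1 g -> 0 <= h <= 2 ^ e -> inv_defect (fun i => h * c j i) (A g) <= M * n2 g) ->
 n2 (fun x => A f x - A (smooth r c e f) x) <= (size r)%:R * M * n2 f.
move=> aA bf M0; elim: r => [|j r IH] hM /=.
 rewrite (@n2_eq _ _ _ _ (fun x => 0 * f x)); first by rewrite n2Z// normr0 !mul0r.
 by move=> x; rewrite subrr mul0r.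
have bS := smooth_B1 r c e bf; set S := smooth r c e f in IH bS *.
have bAf := alg_B1 aA bf; have bAS := alg_B1 aA bS.
have aL := alg_L s (c j) e; have bLS := alg_B1 aL bAS.
have nS : n2 S <= n2 f by exact: smooth_n2.
rewrite (@n2_eq _ _ _ _ (fun x => (A f x - A S x) + (A S x - Lop (c j) e (A S) x))); last first.
 by move=> x; rewrite (alg_com aA aL (B1_Bm bS)); ring.
letr (n2D (B1B bAf bAS) (B1B bAS bLS)).
rewrite -[(size r).+1]addn1 natrD !mulrDl mul1r; apply: lerD.
 by apply: IH => j' g h jr; apply: hM; rewrite inE jr orbT.
apply: L_close => //; first by rewrite mulr_ge0// n2_ge0.
move=> h hh; have := hM j S h; rewrite inE eqxx => /(_ isT bS hh) /le_trans; apply.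
nra.
Qed.

End with_system.

(** The average over F is almost invariant along the coefficient of g, whatever other monomials F
    contains. Thin boxes are allowed at the expense of smaller h, and K and C depend neither on the
    system nor on the coefficients nor on F. *)
Definition Dec k n (g : Ix k n) (K : nat) (C : R) := forall d (s : dsys R d) (F : {set Ix k n}) c (a b : 'I_k -> R) (m i : nat) h f,
 g \in F -> lt_box a b -> (forall l, 0 <= a l) -> (forall l, b l <= 2) -> (forall l, 2 ^- i <= b l - a l) ->
 B1 f -> `|h| <= 2 ^- (K * (m + i)) ->
 inv_defect (fun j => h * c g j) (Av (s := s) a b (mpol F c) f) <= C * 2 ^- m * n2 f.

Lemma pow2N_le m n : (n <= m)%N -> 2 ^- m <= 2 ^- n :> R.
by rewrite lef_pV2 ?posrE ?exprn_gt0// ler_eXn2l ?ltr1n. Qed.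

Lemma Dec_mono k n (g : Ix k n) K C K' C' : (K <= K')%N -> C <= C' -> Dec g K C -> Dec g K' C'.
move=> KK CC H d s F c a b m i h f gF ab a0 b2 sd bf hh.
letr (H d s F c a b m i h f gF ab a0 b2 sd bf _).
 by letr hh; apply: pow2N_le; rewrite leq_mul2r KK orbT.
by rewrite ler_wpM2r ?n2_ge0// ler_wpM2r.
Qed.

Lemma freeze_exponent K1 K2 m i : (0 < m)%N ->
 (K2 * (m + (K1 * (m + i) + m + i + 1)) <= K2 * (K1 + 3) * (m + i))%N.
by nia. Qed.

(* The monomials above [mdeg g] are already controlled: smooth [f] along them and freeze them on small boxes. *)
Lemma decay_step k n (g : Ix k n) K1 C1 : (0 < mdeg g)%N -> 0 <= C1 ->
 (forall g' : Ix k n, (mdeg g < mdeg g')%N -> Dec g' K1 C1) -> exists K, exists2 C : R, 0 <= C & Dec g K C.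
move=> g0 C10 hi; case El : (mlist g) => [|l ls].
 exfalso; move: g0; rewrite lt0n => /eqP; apply; apply: big1 => l _.
 by rewrite -count_mlist El.
have [K2 [C2 C20 H2]] := @vdc R k l ls.
have [Lp Lp0 HL] := @mono_lip R k n.
pose N := #|{: Ix k n}|%:R : R.
exists (K2 * (K1 + 3))%N, (2 + (2 * (N * C1) + (2 * (N * (2 * Lp)) + C2))).
 pos.
move=> d s F c a b m i h f gF ab a0 b2 sd bf hh.
have hp := mp_mpol F c; set p := mpol F c in hp *.
have aA := alg_av s ab hp; have bA := Av_B1 ab hp bf.
have nf0 := n2_ge0 f.
have p2 j : 0 < 2 ^- j :> R by [].
have [m0|mp0] := posnP m.
 rewrite m0 invr1 mulr1; letr (inv_defect_le2 _ bA).
 via (2 * n2 f); first by rewrite ler_wpM2l// n2_Av.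
 by rewrite ler_wpM2r// lerDl !addr_ge0 ?mulr_ge0.
pose r := [seq g' <- enum F | (mdeg g < mdeg g')%N].
(* The scale up to which [hi] gives invariance along the monomials of higher degree; smoothing f
   along each of them at this scale costs C1 2^(-m). *)
pose e := - (K1 * (m + i))%:Z : int.
have eE : 2 ^ e = 2 ^- (K1 * (m + i)) :> R by rewrite -exprnN.
have sr : (size r)%:R <= N.
 rewrite ler_nat (leq_trans (size_subseq (filter_subseq _ _)))//.
 by rewrite -cardE max_card.
pose f' := smooth r c e f.
have bf' : B1 f' by exact: smooth_B1.
have nf' : n2 f' <= n2 f by exact: smooth_n2.
have inr g' : g' \in r -> g' \in F /\ (mdeg g < mdeg g')%N.
 by rewrite mem_filter mem_enum => /andP[].
have C1m : 0 <= C1 * 2 ^- m by rewrite mulr_ge0.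
have st1 : n2 (fun x => Av a b p f x - Av a b p f' x) <= N * (C1 * 2 ^- m) * n2 f.
 via ((size r)%:R * (C1 * 2 ^- m) * n2 f); last first.
  by rewrite ler_wpM2r// ler_wpM2r.
 apply: smooth_close => // g' f1 h' /inr[g'F g'g] bf1 /andP[h'0 h'e].
 apply: hi => //; by rewrite ger0_norm// -eE.
(* On a box of side eta the higher monomials displace the orbit by at most a multiple of 2^(-m)
   times the smoothing scale. [i'] leaves room for the last halving and for original sides shorter
   than eta. *)
pose eta := 2 ^- (K1 * (m + i) + m) : R.
pose i' := (K1 * (m + i) + m + i + 1)%N.
have eta_e : eta / 2 ^ e = 2 ^- m by rewrite /eta eE exprD; field; rewrite !expf_neq0.
have eta0 : 0 < eta by exact: p2.
pose M3 := N * (2 * (Lp * 2 ^- m) * n2 f).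
have M30 : 0 <= M3 by rewrite !mulr_ge0.
pose M5 := 2 * M3 + C2 * 2 ^- m * n2 f.
pose v := fun j => h * c g j.
have small a' b' : lt_box a' b' -> (forall l, a l <= a' l) -> (forall l, b' l <= b l) -> (forall l, 2 ^- i' <= b' l - a' l <= eta) ->
  inv_defect v (Av a' b' p f') <= M5.
 move=> ab' aa bb sd'.
 pose ta := [tuple a' l | l < k].
 (* The monomials of degree above that of g are frozen at the corner of the small box; in what
    remains, differencing along the variables of g isolates its coefficient, up to the factor
    [mfact g]. *)
 pose q t j := \sum_(g' in F | (mdeg g' <= mdeg g)%N) mono g' t * c g' j + \sum_(g' in F | ~~ (mdeg g' <= mdeg g)%N) mono g' ta * c g' j.
 have hq : mp q.
  move=> j; apply: measurable_funD => //.
  rewrite (_ : (fun t => _) = (mpol [set g' in F | (mdeg g' <= mdeg g)%N] c)^~ j); first exact: mp_mpol.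
  by ext t; apply: eq_bigl => g'; rewrite !inE.
 have bp' := Av_B1 (s := s) ab' hp bf'; have bq' := Av_B1 (s := s) ab' hq bf'.
 have cl : n2 (fun x => Av a' b' p f' x - Av a' b' q f' x) <= M3.
  apply: Av_close => // t ht.
  have -> : (fun j => q t j - p t j) = (fun j => \sum_(g' <- r) (mono g' ta - mono g' t) * c g' j).
   ext j; rewrite /q big_filter [X in _ - X](bigID (fun g' => (mdeg g' <= mdeg g)%N))/=.
   rewrite opprD addrACA subrr add0r -sumrB big_enum_cond/=.
   by apply: eq_big => [g'|g' _]; rewrite ?mulrBl// ltnNge.
  letr (inv_defect_sum r _ c bf').
  via (\sum_(g' <- r) 2 * (Lp * 2 ^- m) * n2 f); last first.
   rewrite big_const_seq iter_addr_0 -[_ *+ _]mulr_natl ler_wpM2r// !mulr_ge0//.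
  rewrite big_seq [leRHS]big_seq; apply: ler_sum => g' gr.
  letr (smooth_lip c e _ bf gr); rewrite ler_wpM2r// ler_wpM2l//.
  rewrite -eta_e mulrA ler_wpM2r ?invr_ge0 ?exprz_ge0//.
  apply: HL => [|l0|l0|l0]; first pos.
  - rewrite tnth_mktuple (le_trans (a0 l0) (aa l0))/=.
   by letr (ltW (ab' l0)); apply: le_trans.
  - have /andP[h1 h2] := ht l0; apply/andP; split.
    by letr (a0 l0); apply: le_trans.
   by letr (ltW h2); apply: le_trans.
  - rewrite tnth_mktuple distrC; have /andP[h1 h2] := ht l0; have /andP[_ h3] := sd' l0.
   by rewrite ger0_norm ?subr_ge0//; apply: le_trans h3; rewrite lerD2r ltW.
 have lq : leadv (l :: ls) (fun j => mfact g * c g j) q.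
  move=> j; rewrite -El -[X in Lead _ X _]addr0; apply: LeadD; last by rewrite El; exact: Lead_cst.
  have -> : mfact g * c g j = \sum_(g' in F | (mdeg g' <= mdeg g)%N) (if g' == g then mfact g else 0) * c g' j.
   rewrite (bigD1 g) ?gF ?leqnn//= eqxx big1 ?addr0// => g' /andP[_ /negbTE ->].
   ring.
  apply: Lead_sum => g' /andP[_ dg']; apply: LeadZ; exact: Lead_mono.
 have mf1 := mfact_ge1 (R := R) g; have mf0 : 0 < mfact g :> R by exact: lt_le_trans mf1.
 have := H2 d s a' b' (fun j => mfact g * c g j) q m i' (h / mfact g) f' ab' (fun l => (andP (sd' l)).1) hq lq bf'.
 have -> : (fun j => h / mfact g * (mfact g * c g j)) = v.
  by ext j; rewrite /v; field; rewrite gt_eqF.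
 have hh' : `|h / mfact g| <= 2 ^- (K2 * (m + i')).
  rewrite normrM (ger0_norm (x := (mfact g)^-1)) ?invr_ge0 ?(ltW mf0)//.
  via `|h|; first by rewrite ler_piMr// invf_le1.
  by letr hh; apply: pow2N_le; exact: freeze_exponent.
 move=> /(_ hh'); rewrite -/(inv_defect v _) => hdef.
 letr (inv_defect_tri v bp' bq'); rewrite addrC; apply: lerD; first by rewrite ler_wpM2l.
 by letr hdef; rewrite ler_wpM2l// mulr_ge0.
have mid a' b' l' ab' := @inv_defect_mid d s k a' b' p v f' M5 l' ab' hp bf'.
have st5 : inv_defect v (Av a b p f') <= M5.
 apply: (@split_boxes R k (fun a b => inv_defect v (Av a b p f') <= M5) a b (2 ^- i') eta) => //.
  rewrite /eta /i' ?addn1 exprS invfM mulVKf//.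
  by apply: pow2N_le; rewrite leq_addr.
 move=> l'; apply: le_trans (sd l'); apply: pow2N_le; by rewrite /i' -addnA addnC -addnA leq_addr.
have bA' := Av_B1 (s := s) ab hp bf'.
letr (inv_defect_tri v bA bA').
letr (lerD st5 (ler_wpM2l (ler0n R 2) st1)).
have -> : (2 + (2 * (N * C1) + (2 * (N * (2 * Lp)) + C2))) * 2 ^- m * n2 f =
 (2 * (N * (2 * (Lp * 2 ^- m) * n2 f)) + C2 * 2 ^- m * n2 f + 2 * (N * (C1 * 2 ^- m) * n2 f)) + 2 * 2 ^- m * n2 f by ring.
by rewrite lerDl !mulr_ge0.
Qed.

(** Descending induction on the degree, which is at most k n. The constants for the finitely many
    multi-indices are summed to make them uniform. *)
Lemma decay k n : exists K, exists2 C : R, 0 <= C & forall g : Ix k n, (0 < mdeg g)%N -> Dec g K C.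
suff H D : exists K, exists2 C : R, 0 <= C & forall g : Ix k n, (k * n < mdeg g + D)%N -> (0 < mdeg g)%N -> Dec g K C.
 have [K [C C0 HC]] := H (k * n).+1; exists K, C => // g g0; apply: HC => //; lia.
elim: D => [|D [K1 [C1 C10 H1]]].
 exists 0, 0 => // g; rewrite addn0 => gk; exfalso; move: gk; rewrite ltnNge /mdeg => /negP; apply.
 apply: (@leq_trans (\sum_(l < k) n)); last by rewrite sum_nat_const card_ord.
 by apply: leq_sum => l _; rewrite -ltnS.
have ex (g : Ix k n) : exists KC : nat * R, 0 <= KC.2 /\ ((k * n < mdeg g + D.+1)%N -> (0 < mdeg g)%N -> Dec g KC.1 KC.2).
 have [h|h] := boolP ((k * n < mdeg g + D.+1)%N && (0 < mdeg g)%N); last first.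
  by exists (0, 0); split => // h1 h2; rewrite h1 h2 in h.
 have /andP[h1 h2] := h.
 have [|K [C C0 HC]] := @decay_step k n g K1 C1 h2 C10; last by exists (K, C).
 by move=> g' gg'; apply: H1; lia.
have [F hF] := choice ex.
exists (\sum_g (F g).1)%N, (\sum_g (F g).2).
 by apply: sumr_ge0 => g _; have [] := hF g.
move=> g h1 h2; have [_ /(_ h1 h2)] := hF g; apply: Dec_mono.
 by rewrite (bigD1 g)//= leq_addr.
rewrite (bigD1 g)//= lerDl; apply: sumr_ge0 => g' _; by have [] := hF g'.
Qed.

End decay.

(** * The pieces [sg] and their decay in L^2 *)

Section sigma.
Context {R : realType} {k n d : nat} (s : dsys R d) (c : coef R k n d) (n0 : int) (N : nat) (a b : 'I_k -> R).
Notation X := (sX s).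
Notation J := {ffun Ix k n -> 'I_N.+1}.
Implicit Types (f : X -> R) (g : Ix k n) (j : J) (F : {set Ix k n}) (S : seq (Ix k n)).
Hypotheses (ab : lt_box a b).

(** Each monomial has its own scale, independent of the others. Actual averages realise only the
    scale vectors that come from a dilation of the variables, but uniformity in the coefficients
    makes the general ones no harder. *)
Definition sc j g : int := n0 + (j g : nat)%:Z.
Definition cj j g (i : 'I_d) : R := 2 ^ sc j g * c g i.
Definition AF F j : (X -> R) -> X -> R := Av a b (mpol F (cj j)).
Definition Hg g j : (X -> R) -> X -> R := Hop (c g) (sc j g).

(** Inclusion-exclusion: each g of S is either present in the polynomial or replaced by [Hg g], with
    a minus sign. Read backwards, the recursion recovers [sg S (g |: F)] as [sg (g :: S) F] plus
    [sg S F] after [Hg g], so the full averages are rebuilt from these pieces. *)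
Fixpoint sg S F j f : X -> R :=
 if S is g :: S' then fun x => sg S' (g |: F) j f x - sg S' F j (Hg g j f) x else AF F j f.

Lemma alg_AF F j : alg (AF F j).
by apply: alg_av => //; exact: mp_mpol. Qed.

Lemma markov_AF F j : markov (AF F j).
by apply: Av_markov => //; exact: mp_mpol. Qed.

Lemma alg_Hg g j : alg (Hg g j). Proof. exact: alg_H. Qed.
Lemma markov_Hg g j : markov (Hg g j). Proof. exact: markov_H. Qed.

Lemma alg_sg S F j : alg (sg S F j).
elim: S F => [|g S IH] F /=; first exact: alg_AF.
exact: alg_sub _ (alg_comp _ (alg_Hg g j)).
Qed.

Lemma sg_n2 S F j f : B1 f -> n2 (sg S F j f) <= 2 ^+ size S * n2 f.
elim: S F f => [|g S IH] F f bf /=.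
 by rewrite mul1r; exact: (mk_n2 (markov_AF F j)).
have bH := mk_B1 (markov_Hg g j) bf.
letr (n2B (alg_B1 (alg_sg S _ j) bf) (alg_B1 (alg_sg S F j) bH)).
letr (lerD (IH _ _ bf) (IH _ _ bH)).
rewrite exprS -mulrA [2 * _]mulr_natl lerD2l ler_wpM2l ?exprn_ge0//.
exact: (mk_n2 (markov_Hg g j)).
Qed.

Lemma sg_local S F j j' f : (forall g, (g \in S) || (g \in F) -> j g = j' g) -> sg S F j f = sg S F j' f.
elim: S F f => [|g S IH] F f e /=.
 ext x; apply: av_eq => t _; congr (f (sT _ x)); ext i.
 by apply: eq_bigr => g gF; rewrite /cj /sc e.
have -> : Hg g j f = Hg g j' f by rewrite /Hg /sc e// inE eqxx.
rewrite ?IH// => g' h; apply: e; rewrite inE.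
 by case/orP: h => ->; rewrite ?orbT.
by move: h; rewrite in_setU1 => /or3P[->|/eqP->|->]; rewrite ?eqxx ?orbT.
Qed.

Lemma AF0 j f : AF finset.set0 j f = f.
ext x; rewrite -[RHS](av_cst ab); apply: av_eq => t _; congr f.
by rewrite -[RHS]sT0; congr sT; ext i; rewrite /mpol big_set0.
Qed.

Lemma inv_defect_alg A v f (M : R) : alg A -> B1 f -> (forall h, B1 h -> n2 (A h) <= n2 h) ->
 inv_defect v f <= M -> inv_defect v (A f) <= M.
move=> aA bf cA h; have bD := B1B bf (B1_T v bf).
apply: le_trans (le_trans (cA _ bD) h); apply: le_of_eq; apply: n2_eq => x.
rewrite (algB aA (B1_Bm bf) (B1_Bm (B1_T v bf))); congr (_ - _).
by have /(congr1 (fun q => q x)) /= := alg_com aA (alg_T s v) (B1_Bm bf).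
Qed.

Lemma Hg_inv g j v f (M : R) : B1 f -> inv_defect v f <= M -> inv_defect v (Hg g j f) <= M.
move=> bf; apply: inv_defect_alg => //; first exact: alg_Hg.
by exact: mk_n2 (markov_Hg g j).
Qed.

Hypotheses (a0 : forall l, 0 <= a l) (b2 : forall l, b l <= 2).

(** The factor 2^(k n) bounds every monomial on a box inside [0, 2]^k, hence the displacement that g
    can cause. *)
Definition inv_at g j f (M : R) := forall h, `|h| <= 2 ^+ (k * n) * 2 ^ sc j g -> inv_defect (fun i => h * c g i) f <= M.

Lemma mono_bound g (t : k.-tuple R) : (forall l, 0 <= tnth t l <= 2) -> `|mono g t| <= 2 ^+ (k * n).
move=> ht; rewrite normr_prod.
via (\prod_(l < k) 2 ^+ n); last by rewrite prodr_const card_ord exprM exprAC.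
apply: ler_prod => l _; rewrite normr_ge0/= normrX.
have /andP[t0 t2] := ht l; rewrite ger0_norm//.
via (2 ^+ g l); first by apply: lerXn2r; rewrite ?nnegrE.
by rewrite ler_eXn2l ?ltr1n -ltnS.
Qed.

Lemma sg_add_inv g S F j f M : 0 <= M -> B1 f -> inv_at g j f M ->
 n2 (fun x => sg S (g |: F) j f x - sg S F j f x) <= 2 ^+ size S * M.
move=> M0; elim: S F f => [|g' S IH] F f bf hf /=.
 rewrite mul1r; apply: Av_close => //; try exact: mp_mpol.
 move=> t ht; have ht' l : 0 <= tnth t l <= 2.
  have /andP[h1 h2] := ht l; rewrite (le_trans (a0 l) h1)/=.
  exact: le_trans (ltW h2) (b2 l).
 have [gF|gF] := boolP (g \in F).
  have -> : (g |: F)%SET = F by apply/finset.setP => g'; rewrite in_setU1; case: eqP => [->|].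
  rewrite (_ : (fun i => mpol F (cj j) t i - mpol F (cj j) t i) = fun=> 0); last by ext i; rewrite subrr.
  rewrite (@n2_eq _ _ _ _ (fun x => 0 * f x)); first by rewrite n2Z// normr0 mul0r.
  by move=> x; rewrite sT0 subrr mul0r.
 have -> : (fun i => mpol F (cj j) t i - mpol (g |: F) (cj j) t i) = fun i => (- (mono g t * 2 ^ sc j g)) * c g i.
  ext i; rewrite /mpol big_setU1//= opprD addrCA subrr addr0 /cj.
  by rewrite mulrA mulNr.
 apply: hf; rewrite normrN normrM (ger0_norm (x := 2 ^ _)) ?exprz_ge0//.
 by rewrite ler_wpM2r ?exprz_ge0//; exact: mono_bound.
have bH := mk_B1 (markov_Hg g' j) bf.
have hH : inv_at g j (Hg g' j f) M by move=> h hh; apply: Hg_inv => //; exact: hf.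
have b1 F' f' : B1 f' -> B1 (sg S F' j f') by move=> ?; apply: alg_B1 => //; exact: alg_sg.
rewrite (@n2_eq _ _ _ _ (fun x => (sg S (g |: (g' |: F)) j f x - sg S (g' |: F) j f x) -
  (sg S (g |: F) j (Hg g' j f) x - sg S F j (Hg g' j f) x))); last first.
 by move=> x; rewrite finset.setUCA; ring.
letr (n2B (B1B (b1 _ _ bf) (b1 _ _ bf)) (B1B (b1 _ _ bH) (b1 _ _ bH))).
letr (lerD (IH _ _ bf hf) (IH _ _ bH hH)).
by rewrite exprS -mulrA mulr_natl.
Qed.

Lemma pow_kn_ge1 : 1 <= 2 ^+ (k * n) :> R.
by rewrite exprn_ege1// ler1n. Qed.

Lemma Hg_close g j f M : 0 <= M -> B1 f -> inv_at g j f M -> n2 (fun x => f x - Hg g j f x) <= 2 * M.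
move=> M0 bf hf; have bL := mk_B1 (markov_L s (c g) (sc j g)) bf.
have e0 : 0 <= (2 : R) ^ sc j g by exact: exprz_ge0.
have small (h : R) : 0 <= h <= 2 ^ sc j g -> `|h| <= 2 ^+ (k * n) * 2 ^ sc j g.
 move=> /andP[h0 h1]; rewrite ger0_norm//; letr h1.
 by rewrite ler_peMl// pow_kn_ge1.
have c1 : n2 (fun x => f x - Lop (c g) (sc j g) f x) <= M.
 by apply: L_close => // h hh; apply: hf; exact: small.
have c2 : n2 (fun x => f x - Lop (fun i => - c g i) (sc j g) f x) <= M.
 apply: L_close => // h hh; have -> : (fun i => h * - c g i) = fun i => - h * c g i by ext i; ring.
 by apply: hf; rewrite normrN; exact: small.
have bD := B1B bf bL; set c' := fun i => - c g i in c2 *.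
have bL' := mk_B1 (markov_L s c' (sc j g)) bf.
rewrite (@n2_eq _ _ _ _ (fun x => (f x - Lop c' (sc j g) f x) + Lop c' (sc j g) (fun x => f x - Lop (c g) (sc j g) f x) x)); last first.
 move=> x; rewrite (algB (alg_L s c' _) (B1_Bm bf) (B1_Bm bL)) addrA subrK.
 by [].
letr (n2D (B1B bf bL') (mk_B1 (markov_L s c' _) bD)).
rewrite mulr_natl; apply: lerD => //.
exact: le_trans (mk_n2 (markov_L s c' _) bD) c1.
Qed.

(** If f hardly changes along g at its scale, then inserting g in the polynomial and applying [Hg g]
    both do almost nothing, and the two terms of the recursion cancel. *)
Lemma sg_inv g S F j f M : 0 <= M -> g \in S -> B1 f -> inv_at g j f M -> n2 (sg S F j f) <= 4 ^+ size S * M.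
move=> M0; elim: S F f => // g' S IH F f; rewrite inE => gS bf hf /=.
have bH := mk_B1 (markov_Hg g' j) bf.
have b1 F' f' : B1 f' -> B1 (sg S F' j f') by move=> ?; apply: alg_B1 => //; exact: alg_sg.
have p4 : 0 <= 4 ^+ size S * M by rewrite mulr_ge0.
have [/eqP e|ne] := boolP (g == g').
 subst g'.
 have bD := B1B bf bH.
 rewrite (@n2_eq _ _ _ _ (fun x => (sg S (g |: F) j f x - sg S F j f x) + sg S F j (fun x => f x - Hg g j f x) x)); last first.
  by move=> x; rewrite (algB (alg_sg S F j) (B1_Bm bf) (B1_Bm bH)) addrA subrK.
 letr (n2D (B1B (b1 _ _ bf) (b1 _ _ bf)) (b1 _ _ bD)).
 letr (lerD (sg_add_inv S F M0 bf hf) (sg_n2 S F j bD)).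
 have h24 : 2 ^+ size S <= 4 ^+ size S :> R by apply: lerXn2r; rewrite ?nnegrE// ler_nat.
 have hc := Hg_close M0 bf hf.
 via (4 ^+ size S * M + 4 ^+ size S * (2 * M)).
  by apply: lerD => //; apply: ler_pM; rewrite ?n2_ge0.
 by rewrite exprS; lra.
rewrite (negbTE ne) /= in gS.
have hH : inv_at g j (Hg g' j f) M by move=> h hh; apply: Hg_inv => //; exact: hf.
letr (n2B (b1 _ _ bf) (b1 _ _ bH)).
letr (lerD (IH _ _ gS bf hf) (IH _ _ gS bH hH)).
by rewrite exprS; lra.
Qed.

Lemma L_inv_at g j c' l f : c' = c g \/ c' = (fun i => - c g i) -> B1 f ->
 inv_at g j (Lop c' (sc j g + l%:Z) f) (2 ^+ (k * n) * 2 * 2 ^- l * n2 f).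
move=> hc bf h hh.
have e0 : 0 < (2 : R) ^ sc j g by exact: exprz_gt0.
have key u : `|u| <= 2 ^+ (k * n) * 2 ^ sc j g ->
  inv_defect (fun i => u * c' i) (Lop c' (sc j g + l%:Z) f) <= 2 ^+ (k * n) * 2 * 2 ^- l * n2 f.
 move=> hu; letr (L_lip c' _ u bf); rewrite ler_wpM2r ?n2_ge0//.
 rewrite [2 ^+ _ * 2]mulrC -mulrA ler_wpM2l//.
 rewrite exprzDr ?unitfE// -exprnP ler_pdivrMr ?mulr_gt0 ?exprn_gt0//.
 by rewrite mulrACA mulVf ?mulr1.
case: hc => e; first by rewrite -e; exact: key.
have -> : (fun i => h * c g i) = (fun i => (- h) * c' i) by ext i; rewrite e; ring.
by apply: key; rewrite normrN.
Qed.

Lemma sg_coarse g S F j c' l f : c' = c g \/ c' = (fun i => - c g i) -> g \in S -> B1 f ->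
 n2 (sg S F j (Lop c' (sc j g + l%:Z) f)) <= 4 ^+ size S * (2 ^+ (k * n) * 2) * 2 ^- l * n2 f.
move=> hc gS bf.
have M0 : 0 <= 2 ^+ (k * n) * 2 * 2 ^- l * n2 f by rewrite !mulr_ge0 ?n2_ge0.
have h := sg_inv F M0 gS (mk_B1 (markov_L s c' (sc j g + l%:Z)) bf) (L_inv_at l hc bf).
lra.
Qed.

Lemma sg_fine_gen g S F j U M : 0 <= M -> alg U -> (g \in S) || (g \in F) ->
 (forall F' f, g \in F' -> B1 f -> n2 (AF F' j (U f)) <= M * n2 f) ->
 (forall f, B1 f -> n2 (Hg g j (U f)) <= M * n2 f) ->
 forall f, B1 f -> n2 (sg S F j (U f)) <= 4 ^+ size S * M * n2 f.
move=> M0 aU hS hA hH; elim: S F hS => [|g' S IH] F /=.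
 by move=> gF f bf; rewrite mul1r; exact: hA.
rewrite inE -orbA => hS f bf.
have bU := alg_B1 aU bf.
have bH := mk_B1 (markov_Hg g' j) bf.
have bHU := mk_B1 (markov_Hg g' j) bU.
have b1 F' f' : B1 f' -> B1 (sg S F' j f') by move=> ?; apply: alg_B1 => //; exact: alg_sg.
have nf := n2_ge0 f.
have nM : 0 <= 4 ^+ size S * (M * n2 f) by rewrite !mulr_ge0.
letr (n2B (b1 _ _ bU) (b1 _ _ bHU)).
have h1 : n2 (sg S (g' |: F) j (U f)) <= 4 ^+ size S * M * n2 f.
 apply: IH => //; rewrite in_setU1; by case/or3P: hS => ->; rewrite ?orbT.
have h2 : n2 (sg S F j (Hg g' j (U f))) <= 4 ^+ size S * M * n2 f.
 have [/eqP e|ne] := boolP (g == g').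
  subst g'; letr (sg_n2 S F j bHU).
  have h24 : 2 ^+ size S <= 4 ^+ size S :> R by apply: lerXn2r; rewrite ?nnegrE// ler_nat.
  by rewrite -mulrA; apply: ler_pM; rewrite ?n2_ge0//; exact: hH.
 rewrite (negbTE ne) /= in hS.
 rewrite (alg_com (alg_Hg g' j) aU (B1_Bm bf)); letr (IH F hS _ bH).
 rewrite ler_wpM2l ?mulr_ge0 ?exprn_ge0//; exact: (mk_n2 (markov_Hg g' j)).
letr (lerD h1 h2); rewrite exprS.
lra.
Qed.

Variables (i K : nat) (C : R).
Hypotheses (sd : forall l, 2 ^- i <= b l - a l) (K0 : (0 < K)%N) (C0 : 0 <= C).

(** The opposite regime: every term of [sg] contains either g in its polynomial, where [Dec]
    applies, or [Hg g], which is Lipschitz at the scale of g. Both outputs are nearly invariant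
    under much smaller displacements, so a finer average changes them little. *)
Lemma sg_fine g S F j c' t f0 : Dec g K C -> c' = c g \/ c' = (fun i => - c g i) ->
 (g \in S) || (g \in F) -> B1 f0 ->
 n2 (sg S F j (fun x => f0 x - Lop c' (sc j g - t%:Z) f0 x)) <= 4 ^+ size S * (C + 2) * 2 ^- (t %/ K - i) * n2 f0.
move=> hD hc hS bf0.
set w := 2 ^- (t %/ K - i) : R.
have w0 : 0 <= w by rewrite invr_ge0.
have tw : 2 ^- t <= w.
 by apply: pow2N_le; apply: (leq_trans (leq_subr _ _)); exact: leq_div.
pose U f x := f x - Lop c' (sc j g - t%:Z) f x.
have aL := alg_L s c' (sc j g - t%:Z).
have mL := markov_L s c' (sc j g - t%:Z).
have aU : alg U by exact: (alg_sub (alg_id s)).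
have C20 : 0 <= C + 2 by rewrite addr_ge0.
have e0 : 0 < (2 : R) ^ sc j g by exact: exprz_gt0.
have et : (2 : R) ^ (sc j g - t%:Z) = 2 ^ sc j g * 2 ^- t by rewrite exprzDr ?unitfE// exprnN.
have comm A f : alg A -> B1 f -> A (U f) = fun x => A f x - Lop c' (sc j g - t%:Z) (A f) x.
 move=> aA bf; rewrite (algB aA (B1_Bm bf) (B1_Bm (mk_B1 mL bf))).
 by rewrite (alg_com aA aL (B1_Bm bf)).
have sgn h : 0 <= h <= 2 ^ (sc j g - t%:Z) -> exists2 u, `|u| <= 2 ^- t & (fun i => h * c' i) = (fun i => u * cj j g i).
 move=> /andP[h0 h1]; exists (if asbool (c' = c g) then h / 2 ^ sc j g else - (h / 2 ^ sc j g)).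
  have hb : `|h / 2 ^ sc j g| <= 2 ^- t.
   by rewrite ger0_norm ?divr_ge0 ?(ltW e0)// ler_pdivrMr// mulrC -et.
  by case: ifP => _; rewrite ?normrN.
 have e1 : h / 2 ^ sc j g * 2 ^ sc j g = h by rewrite divfK// gt_eqF.
 ext l; case: asboolP => [->|ne]; rewrite /cj; first by rewrite mulrA e1.
 by case: hc => // ->; rewrite mulrA mulNr e1 mulrN mulNr.
rewrite -[4 ^+ size S * _ * w]mulrA.
apply: (@sg_fine_gen g S F j U ((C + 2) * w) (mulr_ge0 C20 w0) aU hS _ _ f0 bf0).
- move=> F' f gF' bf; have nf := n2_ge0 f.
 have bA := alg_B1 (alg_AF F' j) bf.
 rewrite comm//; last exact: alg_AF.
 have [it|ti] := leqP i (t %/ K); last first.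
  rewrite /w (_ : (t %/ K - i = 0)%N) ?invr1 ?mulr1; last by apply/eqP; rewrite subn_eq0 ltnW.
  letr (n2B bA (mk_B1 mL bA)); via (2 * n2 f).
   rewrite mulr_natl; have hA := mk_n2 (markov_AF F' j) bf; apply: lerD => //.
   exact: le_trans (mk_n2 mL bA) hA.
  by rewrite ler_wpM2r// lerDr.
 via (C * w * n2 f); last by rewrite ler_wpM2r// ler_wpM2r// lerDl.
 apply: L_close => //; first pos.
 move=> h /sgn[u hu ->]; apply: (hD _) => //.
 by rewrite subnK//; letr hu; apply: pow2N_le; rewrite mulnC leq_trunc_div.
- move=> f bf; have nf := n2_ge0 f; rewrite comm//; last exact: alg_Hg.
 have bH := mk_B1 (markov_Hg g j) bf.
 via (2 * 2 ^- t * n2 f); last first.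
  rewrite ler_wpM2r//; apply: ler_pM; rewrite ?exprn_ge0//; by rewrite lerDr.
 apply: L_close => //; first pos.
 move=> h /sgn[u hu ->].
 have bL := mk_B1 (markov_L s (c g) (sc j g)) bf.
 have -> : (fun i => u * cj j g i) = fun i => (- (u * 2 ^ sc j g)) * (- c g i) by ext l; rewrite mulrNN mulrA.
 letr (L_lip _ _ _ bL).
 have nL := mk_n2 (markov_L s (c g) (sc j g)) bf.
 apply: ler_pM; rewrite ?n2_ge0 ?mulr_ge0 ?invr_ge0 ?(ltW e0)//.
 by rewrite normrN normrM (ger0_norm (ltW e0)) mulfK ?gt_eqF// ler_wpM2l.
Qed.

End sigma.

Lemma telescope_le (R : realType) (x y z : R) : x - y + (y - z) <= x - z.
lra. Qed.

(** * Littlewood-Paley pieces and square functions in L^2 *)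

Section dyadic_differences.
Context {R : realType} {d : nat} (s : dsys R d).
Notation X := (sX s).
Implicit Types (f g : X -> R) (c : 'I_d -> R).

Definition Dop c (e : int) f (x : X) : R := Lop c e f x - Lop c (e + 1) f x.

Lemma alg_D c e : alg (Dop c e).
exact: alg_sub (alg_L s c e) (alg_L s c _). Qed.

Lemma n2_Dop c e f : B1 f -> n2 (Dop c e f) <= 2 * n2 f.
move=> bf; letr (n2B (mk_B1 (markov_L s c e) bf) (mk_B1 (markov_L s c _) bf)).
rewrite mulr_natl; apply: lerD; exact: (mk_n2 (markov_L s c _)).
Qed.

(** With T the translation by 2^e c, L_(e+1) = L_e (1 + T)/2, so the difference of consecutive H is
    H_e (2 - T - T^-1)/4, which is D_e followed by its adjoint. The factorisation gives
    orthogonality and decay one factor each. *)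
Lemma Delta_D c e f x : Bm f -> Hop c e f x - Hop c (e + 1) f x = Dop (fun i => - c i) e (Dop c e f) x.
move=> bf; have bL := mk_Bm (markov_L s c e) bf; have bL' := mk_Bm (markov_L s c (e + 1)) bf.
rewrite /Dop (Lop_double _ e x (BmB bL bL')).
have aL := alg_L s (fun i => - c i) e.
rewrite (algB aL bL bL') /Hop (Lop_double _ e x bL').
have E y : Lop (fun i => - c i) e (Lop c (e + 1) f) y =
  2^-1 * (Lop (fun i => - c i) e (Lop c e f) y + Lop (fun i => - c i) e (Lop c e f) (sT (fun i => 2 ^ e * c i) y)).
 have bT := Bm_T (fun i => 2 ^ e * c i) bL.
 rewrite -Lop_T -[in RHS](mkD (markov_L s _ e) bL bT) -[RHS](mkZ (markov_L s _ e) _ (BmD bL bT)).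
 congr (Lop _ _ _ y); ext z; rewrite (Lop_double c e z bf); by rewrite mulrC.
set v := fun i => 2 ^ e * c i in E *; set v' := fun i => 2 ^ e * - c i.
have vv y : sT v (sT v' y) = y :> X.
 by rewrite sTD -[RHS]sT0; congr sT; ext i; rewrite /v /v'; ring.
have v'v y : sT v' (sT v y) = y :> X.
 by rewrite sTD -[RHS]sT0; congr sT; ext i; rewrite /v /v'; ring.
rewrite !E vv; move: (Lop _ _ _ x) (Lop _ _ _ (sT v x)) (Lop _ _ _ (sT v' x)) => p q w.
by field.
Qed.

(** [Lop c (e + 1) f] is the midpoint of [Lop c e f] and a translate of it, so this is the
    integrated parallelogram law; it makes the squared norms of the pieces telescope. *)
Lemma D_sqr c e f : B1 f -> n2 (Dop c e f) ^+ 2 = n2 (Lop c e f) ^+ 2 - n2 (Lop c (e + 1) f) ^+ 2.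
move=> bf; have bL := mk_B1 (markov_L s c e) bf.
pose v := fun i => 2 ^ e * c i; have bT := B1_T v bL.
have bL2 := B1X 1 bL; have bT2 := B1X 1 bT.
have bL' := mk_B1 (markov_L s c (e + 1)) bf.
have e1 : (fun x => Dop c e f x ^+ 2) = fun x => (2^-1 * (Lop c e f x ^+ 2 + Lop c e f (sT v x) ^+ 2)) - Lop c (e + 1) f x ^+ 2.
 ext x; by rewrite /Dop (Lop_double c e x (B1_Bm bf)); field.
refine (etrans (n2_sqr _) (etrans _ (esym (congr2 (fun u w => u - w) (n2_sqr (Lop c e f)) (n2_sqr (Lop c (e + 1) f)))))).
rewrite e1 (IIB (B1Z _ (B1D bL2 bT2)) (B1X 1 bL')) (IIZ _ (B1D bL2 bT2)).
rewrite (IID bL2 bT2) (II_T v bL2); move: (II _) (II _) => u w.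
by field.
Qed.

Lemma D_orth c (e : int) N f : B1 f -> \sum_(u < N) n2 (Dop c (e + (u : nat)%:Z) f) ^+ 2 <= n2 f ^+ 2.
move=> bf; have bL e' := mk_B1 (markov_L s c e') bf.
via (n2 (Lop c e f) ^+ 2 - n2 (Lop c (e + N%:Z) f) ^+ 2).
 elim: N => [|N IH]; first by rewrite big_ord0 addr0 subrr.
 rewrite big_ord_recr/=; apply: le_trans (lerD IH (le_of_eq (D_sqr c _ bf))) _.
 have -> : e + N%:Z + 1 = e + N.+1%:Z by rewrite -addrA -PoszD addn1.
 exact: telescope_le.
via (n2 (Lop c e f) ^+ 2); first by rewrite gerBl sqr_ge0.
by apply: lerXn2r; rewrite ?nnegrE ?n2_ge0//; exact: (mk_n2 (markov_L s c e)).
Qed.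
End dyadic_differences.

Lemma nrm_mem (R : realType) (T : eqType) (r : seq T) (v : T -> R) j : j \in r -> `|v j| <= nrm r v.
move=> jr; rewrite -sqrtr_sqr; apply: ler_wsqrtr; rewrite (big_rem j)//= lerDl.
pos.
Qed.

Section square_functions.
Context {R : realType} {k n d : nat} (s : dsys R d) (c : coef R k n d) (n0 : int) (N : nat) (a b : 'I_k -> R).
Notation X := (sX s).
Notation J := {ffun Ix k n -> 'I_N.+1}.
Implicit Types (f : X -> R) (g : Ix k n) (j : J) (F : {set Ix k n}) (S : seq (Ix k n)) (l : Ix k n -> int).

Definition upj j g (u : 'I_N.+1) : J := [ffun g' => if g' == g then u else j g'].

(** All scale vectors on S, extended by 0. Over the empty set of monomials [sg S] reads no other
    entries, and fixing these avoids repetitions in the square function. *)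
Fixpoint idx S : seq J :=
 if S is g :: S' then [seq upj j g u | u <- index_enum 'I_N.+1, j <- idx S'] else [:: [ffun=> ord0]].

Lemma nrm_idx g S (v : J -> R) :
 nrm (idx (g :: S)) v = nrm [seq (u, j) | u <- index_enum 'I_N.+1, j <- idx S] (fun w => v (upj w.2 g w.1)).
by rewrite /nrm !big_allpairs_dep. Qed.

Lemma sum_idx g S (v : J -> R) :
 \sum_(j <- idx (g :: S)) v j = \sum_(u < N.+1) \sum_(j <- idx S) v (upj j g u).
by rewrite big_allpairs_dep. Qed.

Lemma idx_mem S j : [ffun g => if g \in S then j g else ord0] \in idx S.
elim: S => [|g S IH] /=.
 by rewrite inE.
apply/allpairsP; exists (j g, [ffun g => if g \in S then j g else ord0]); split => //=.
 by rewrite mem_index_enum.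
by apply/ffunP => g'; rewrite !ffunE inE; case: eqP => [->|].
Qed.

(** One Littlewood-Paley difference per monomial of S, at offset l from its scale. It equals [dm]
    after [dp]: [dp] provides orthogonality in j, and [dm] provides decay in l. *)
Definition dd S l j f : X -> R :=
 foldr (fun g h x => Hop (c g) (sc n0 j g + l g) h x - Hop (c g) (sc n0 j g + l g + 1) h x) f S.
Definition dp S l j f : X -> R := foldr (fun g h => Dop (c g) (sc n0 j g + l g) h) f S.
Definition dm S l j f : X -> R := foldr (fun g h => Dop (fun i => - c g i) (sc n0 j g + l g) h) f S.

Lemma dd_cons g S l j f : dd (g :: S) l j f = fun x => Hop (c g) (sc n0 j g + l g) (dd S l j f) x - Hop (c g) (sc n0 j g + l g + 1) (dd S l j f) x.
by []. Qed.
Lemma dp_cons g S l j f : dp (g :: S) l j f = Dop (c g) (sc n0 j g + l g) (dp S l j f).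
by []. Qed.

Lemma alg_dm S l j : alg (dm S l j).
by elim: S => [|g S IH]; [exact: alg_id|exact: (alg_comp (alg_D s _ _))]. Qed.
Lemma alg_dp S l j : alg (dp S l j).
by elim: S => [|g S IH]; [exact: alg_id|exact: (alg_comp (alg_D s _ _))]. Qed.

Lemma dd_dm S l j f : Bm f -> dd S l j f = dm S l j (dp S l j f).
move=> bf; elim: S => //= g S ->; ext x.
have bp := alg_Bm (alg_dp S l j) bf.
rewrite Delta_D; last exact: (alg_Bm (alg_dm S l j)).
by rewrite (alg_com (alg_D s _ _) (alg_dm S l j)).
Qed.

Lemma alg_dd S l j : alg (dd S l j).
elim: S => [|g S IH]; first exact: alg_id.
exact: alg_sub (alg_comp (alg_H s _ _) IH) (alg_comp (alg_H s _ _) IH).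
Qed.

Lemma dm_n2 S l j f : B1 f -> n2 (dm S l j f) <= 2 ^+ size S * n2 f.
move=> bf; elim: S => [|g S IH] /=; first by rewrite mul1r.
letr (n2_Dop _ _ (alg_B1 (alg_dm S l j) bf)).
by rewrite exprS -mulrA ler_wpM2l.
Qed.

Lemma dp_local S l j j' f : (forall g, g \in S -> j g = j' g) -> dp S l j f = dp S l j' f.
elim: S => [//|g S IH] e.
have eS g' : g' \in S -> j g' = j' g' by move=> h; apply: e; rewrite inE h orbT.
have eg : j g = j' g by apply: e; rewrite inE eqxx.
by rewrite !dp_cons (IH eS) /sc eg.
Qed.

Lemma dd_local S l j j' f : (forall g, g \in S -> j g = j' g) -> dd S l j f = dd S l j' f.
elim: S => [//|g S IH] e.
have eS g' : g' \in S -> j g' = j' g' by move=> h; apply: e; rewrite inE h orbT.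
have eg : j g = j' g by apply: e; rewrite inE eqxx.
by rewrite !dd_cons (IH eS) /sc eg.
Qed.

Lemma upj_other S g j u : g \notin S -> forall g', g' \in S -> (upj j g u) g' = j g'.
by move=> gS g' g'S; rewrite ffunE; case: eqP => // e; move: gS; rewrite -e g'S. Qed.

Lemma dp_orth S l f : uniq S -> B1 f -> \sum_(j <- idx S) n2 (dp S l j f) ^+ 2 <= n2 f ^+ 2.
move=> + bf; elim: S => [|g S IH] /=; first by rewrite big_seq1.
move=> /andP[gS uS]; rewrite sum_idx exchange_big/=.
apply: le_trans (IH uS); apply: ler_sum => j _.
have bp := alg_B1 (alg_dp S l j) bf.
apply: le_trans (D_orth (c g) (n0 + l g) _ bp); apply: ler_sum => u _.
rewrite (dp_local l f (upj_other j u gS)) /sc ffunE eqxx.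
by rewrite addrAC.
Qed.

Hypotheses (ab : lt_box a b) (a0 : forall t, 0 <= a t) (b2 : forall t, b t <= 2).
Variables (i K : nat) (C : R).
Hypotheses (sd : forall t, 2 ^- i <= b t - a t) (K0 : (0 < K)%N) (C0 : 0 <= C).

(** The decay in the offset u. The rate 1/K and the loss 2^i stem from [Dec]; the predecessor
    appears because a difference at offset u involves the scales u and u + 1. *)
Definition vl (u : int) : R := 2 ^+ i * 2 ^- (`|u|%N.-1 %/ K).

Lemma vl_gt0 u : 0 < vl u. Proof. pos. Qed.

Definition CD (m : nat) : R := 4 ^+ m * (4 * (2 ^+ (k * n) * 2 + C + 2)).

Lemma CD_ge0 m : 0 <= CD m.
pos. Qed.

Lemma sg_D g S F j c' (u : int) f : Dec g K C -> c' = c g \/ c' = (fun i => - c g i) ->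
 g \in S -> B1 f ->
 n2 (sg c n0 a b S F j (Dop c' (sc n0 j g + u) f)) <= CD (size S) * Num.min 1 (vl u) * n2 f.
move=> hD hc gS bf; have nf := n2_ge0 f.
have aS := alg_sg s c n0 ab S F j.
have p4 : 0 <= 4 ^+ size S :> R by [].
have pk : 0 <= 2 ^+ (k * n) * 2 :> R by [].
have bL e := mk_B1 (markov_L s c' e) bf.
suff [w [A [w1 wv A0 hA]]] : exists w A : R, [/\ w <= 1, w <= vl u, 0 <= A <= 2 ^+ (k * n) * 2 + C + 2 &
  n2 (sg c n0 a b S F j (Dop c' (sc n0 j g + u) f)) <= 4 ^+ size S * A * (4 * w) * n2 f].
 letr hA; rewrite ler_wpM2r//; have /andP[A00 A1] := A0.
 have mw : w <= Num.min 1 (vl u) by rewrite le_min w1.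
 rewrite -!mulrA; apply: (ler_wpM2l p4).
 rewrite mulrCA; apply: (ler_wpM2l (ler0n R 4)).
 have [w0|w0] := leP 0 w; first exact: ler_pM.
 via 0; first by rewrite mulr_ge0_le0// ltW.
 by rewrite mulr_ge0 ?le_min ?ler01 ?(ltW (vl_gt0 u))// (le_trans A00).
case: u => [l|t'].
 exists (2 ^- l), (2 ^+ (k * n) * 2); split.
 - by rewrite invf_le1 ?exprn_gt0// exprn_ege1// ler1n.
 - rewrite /vl /=; via (2 ^- (l.-1 %/ K)).
   by apply: pow2N_le; apply: (leq_trans (leq_div _ _)); exact: leq_pred.
  by rewrite ler_peMl ?exprn_ge0// exprn_ege1// ler1n.
 - by rewrite pk -addrA lerDl addr_ge0.
 rewrite (algB aS (B1_Bm (bL _)) (B1_Bm (bL _))).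
 letr (n2B (alg_B1 aS (bL _)) (alg_B1 aS (bL _))).
 rewrite -[sc n0 j g + l + 1]addrA (_ : (l%:Z + 1) = l.+1%:Z); last by rewrite -addn1.
 letr (lerD (sg_coarse n0 ab a0 b2 F j l hc gS bf) (sg_coarse n0 ab a0 b2 F j _ hc gS bf)).
 rewrite -mulrDl; apply: (ler_wpM2r nf); rewrite -mulrDr; apply: ler_wpM2l => //.
 have h : 2 ^- l.+1 <= 2 ^- l :> R by apply: pow2N_le.
 have h0 : 0 <= 2 ^- l :> R by [].
 lra.
set q := (t' %/ K)%N.
exists (2 ^- (q - i)), (C + 2); split.
- by rewrite invf_le1 ?exprn_gt0// exprn_ege1// ler1n.
- have -> : vl (- t'.+1%:Z) = 2 ^+ i / 2 ^+ q by [].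
 rewrite ler_pdivlMr ?exprn_gt0// mulrC ler_pdivrMr ?exprn_gt0// -exprD.
 by rewrite ler_eXn2l ?ltr1n// -leq_subLR.
- by rewrite addr_ge0// -addrA lerDr.
have e1 : sc n0 j g + - t'.+1%:Z + 1 = sc n0 j g - t'%:Z by rewrite -addrA; rewrite -addn1 PoszD opprD subrK.
pose U t f x := f x - Lop c' (sc n0 j g - t%:Z) f x.
have bU t : B1 (U t f) by exact: B1B.
have -> : Dop c' (sc n0 j g + - t'.+1%:Z) f = fun x => U t' f x - U t'.+1 f x.
 by ext x; rewrite /Dop e1 /U; ring.
rewrite (algB aS (B1_Bm (bU _)) (B1_Bm (bU _))).
letr (n2B (alg_B1 aS (bU _)) (alg_B1 aS (bU _))).
have gSF : (g \in S) || (g \in F) by rewrite gS.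
letr (lerD (sg_fine n0 ab a0 b2 sd C0 j t' hD hc gSF bf) (sg_fine n0 ab a0 b2 sd C0 j _ hD hc gSF bf)).
rewrite -mulrDl; apply: (ler_wpM2r nf); rewrite -mulrDr; apply: ler_wpM2l.
 pos.
have h : 2 ^- (t'.+1 %/ K - i) <= 2 ^- (t' %/ K - i) :> R by apply: pow2N_le; apply: leq_sub2r; exact: leq_div2r.
have h0 : 0 <= 2 ^- (t' %/ K - i) :> R by [].
lra.
Qed.

Definition Tl S l j f : X -> R := sg c n0 a b S finset.set0 j (dd S l j f).

Lemma alg_Tl S l j : alg (Tl S l j).
exact: alg_comp (alg_sg s c n0 ab S _ j) (alg_dd S l j). Qed.

(** Decay is taken from the factor for g alone; the differences met before it commute past [sg], and
    each of the other factors costs at most 2. *)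
Lemma sg_dm g S S' F l j f : Dec g K C -> g \in S -> g \in S' -> B1 f ->
 n2 (sg c n0 a b S F j (dm S' l j f)) <= CD (size S) * Num.min 1 (vl (l g)) * 2 ^+ size S' * n2 f.
move=> hD gS + bf; elim: S' => // g' S' IH; rewrite inE /= => gS'.
have bm := alg_B1 (alg_dm S' l j) bf.
have aS := alg_sg s c n0 ab S F j.
have m0 : 0 <= CD (size S) * Num.min 1 (vl (l g)).
 by rewrite mulr_ge0 ?CD_ge0// le_min ler01 ltW// vl_gt0.
have [/eqP e|ne] := boolP (g == g').
 subst g'; have hc : (fun i => - c g i) = c g \/ (fun i => - c g i) = (fun i => - c g i) by right.
 letr (sg_D F j _ hD hc gS bm).
 rewrite -[leRHS]mulrA; apply: (ler_wpM2l m0); letr (dm_n2 S' l j bf).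
 rewrite exprS -mulrA ler_peMl ?ler1n// mulr_ge0 ?n2_ge0//.
rewrite (negbTE ne) /= in gS'.
rewrite (alg_com aS (alg_D s _ _) (B1_Bm bm)).
letr (n2_Dop _ _ (alg_B1 aS bm)).
letr (ler_wpM2l (ler0n R 2) (IH gS')).
by rewrite exprS; apply: le_of_eq; ring.
Qed.

Lemma Tl_n2 S l j f y : (forall g, g \in S -> Dec g K C) -> (exists2 g, g \in S & Num.min 1 (vl (l g)) <= y) -> B1 f ->
 n2 (Tl S l j f) <= CD (size S) * 2 ^+ size S * y * n2 (dp S l j f).
move=> hD [g gS gy] bf; rewrite /Tl dd_dm; last exact: B1_Bm.
have bp := alg_B1 (alg_dp S l j) bf.
letr (sg_dm _ l j (hD g gS) gS gS bp).
rewrite (mulrAC (CD _)); apply: (ler_wpM2r (n2_ge0 _)).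
by apply: ler_wpM2l => //; rewrite mulr_ge0 ?CD_ge0.
Qed.

Lemma II_nrm2 T r (F : T -> X -> R) : (forall t, B1 (F t)) ->
 (\I x, nrm r (F^~ x) `^ 2) = \sum_(t <- r) n2 (F t) ^+ 2.
move=> bF; rewrite (eq_bigr (fun t => (\I x, F t x ^+ 2))); last by move=> t _; rewrite n2_sqr.
rewrite -II_sum; last by move=> t; exact: B1X.
by congr II; ext x; rewrite powR_mulrn ?nrm_ge0// nrm_sqr.
Qed.

(** The decay holds for each j separately and is applied to [dp S l j f]; these are square summable
    in j by [dp_orth], so the number of scale vectors does not enter. *)
Lemma Tl_sq2 S l (y : R) : uniq S -> (forall g, g \in S -> Dec g K C) -> 0 <= y ->
 (exists2 g, g \in S & Num.min 1 (vl (l g)) <= y) ->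
 sqb (idx S) (Tl S l) 2 ((CD (size S) * 2 ^+ size S * y) ^+ 2).
move=> uS hD y0 hy f bf; rewrite II_nrm2; last by move=> j; apply: alg_B1 => //; exact: alg_Tl.
have A0 : 0 <= CD (size S) * 2 ^+ size S * y by rewrite mulr_ge0// mulr_ge0 ?CD_ge0.
via (\sum_(j <- idx S) (CD (size S) * 2 ^+ size S * y) ^+ 2 * n2 (dp S l j f) ^+ 2).
 apply: ler_sum => j _; rewrite -exprMn; apply: lerXn2r; rewrite ?nnegrE; last exact: Tl_n2.
  exact: n2_ge0.
 exact: mulr_ge0 A0 (n2_ge0 _).
rewrite -mulr_sumr; apply: ler_wpM2l; first pos.
letr (dp_orth l uS bf); apply: le_of_eq; rewrite n2_sqr; congr II; ext x.
by rewrite powR_mulrn// real_normK// num_real.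
Qed.

End square_functions.

(** * L^p bounds for families: sums, limits, Littlewood-Paley pieces *)

Section lp_bounds.
Context {R : realType} {d : nat} (s : dsys R d).
Notation X := (sX s).
Implicit Types (f u v w : X -> R) (p C : R).

Lemma IIp_le p u v : 1 <= p -> B1 u -> B1 v -> (forall x, 0 <= u x <= v x) ->
 (\I x, u x `^ p) <= (\I x, v x `^ p).
move=> p1 bu bv uv; have p0 : 0 <= p by exact: le_trans p1.
have u0 x : 0 <= u x by case/andP: (uv x).
have v0 x : 0 <= v x by case/andP: (uv x) => h1 h2; exact: le_trans h2.
apply: II_le; [exact: B1_pow|exact: B1_pow|] => x.
by case/andP: (uv x) => h1 h2; exact: powR_mono.
Qed.

Lemma IIp_add p u v w : 1 <= p -> B1 u -> B1 v -> B1 w -> (forall x, 0 <= u x) -> (forall x, 0 <= v x) ->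
 (forall x, 0 <= w x <= u x + v x) ->
 (\I x, w x `^ p) <= 2 `^ p * ((\I x, u x `^ p) + (\I x, v x `^ p)).
move=> p1 bu bv bw u0 v0 h; have p0 : 0 <= p by exact: le_trans p1.
have bup := B1_pow p1 u0 bu; have bvp := B1_pow p1 v0 bv.
rewrite -(IID bup bvp) -(IIZ _ (B1D bup bvp)).
apply: II_le; [|exact: B1Z (B1D _ _)|] => [|x].
 by apply: B1_pow => // x; case/andP: (h x).
case/andP: (h x) => h1 h2; letr (powR_mono p0 h1 h2); exact: powR_add.
Qed.

Lemma fsb_comp J r (A B : J -> (X -> R) -> X -> R) p C D :
 (forall j, alg (B j)) -> 0 <= C -> fsb r A p C -> fsb r B p D -> fsb r (fun j f => A j (B j f)) p (C * D).
move=> aB C0 hA hB g bg; letr (hA _ (fun j => alg_B1 (aB j) (bg j))).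
by rewrite -mulrA; apply: ler_wpM2l => //; exact: hB.
Qed.

Lemma fsb_sqb J r (A B : J -> (X -> R) -> X -> R) p C D :
 (forall j, alg (B j)) -> 0 <= C -> fsb r A p C -> sqb r B p D -> sqb r (fun j f => A j (B j f)) p (C * D).
move=> aB C0 hA hB f bf; letr (hA _ (fun j => alg_B1 (aB j) bf)).
by rewrite -mulrA; apply: ler_wpM2l => //; exact: hB.
Qed.

Lemma nrm_subr J r (u v : J -> R) : nrm r (fun j => u j - v j) <= nrm r u + nrm r v.
have -> : nrm r v = nrm r (fun j => - v j) by rewrite /nrm; congr Num.sqrt; apply: eq_bigr => j _; rewrite sqrrN.
exact: nrmD.
Qed.

Lemma IIp_sub J r (U V : J -> X -> R) p C : 1 <= p -> (forall j, B1 (U j)) -> (forall j, B1 (V j)) ->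
 (\I x, nrm r (fun j => U j x - V j x) `^ p) <=
 2 `^ p * ((\I x, nrm r (U^~ x) `^ p) + (\I x, nrm r (V^~ x) `^ p)).
move=> p1 bU bV; have n0 (F : J -> X -> R) x : 0 <= nrm r (F^~ x) by exact: nrm_ge0.
apply: IIp_add => //; [exact: B1_nrm|exact: B1_nrm|by apply: B1_nrm => j; exact: B1B|] => x.
by rewrite nrm_ge0 nrm_subr.
Qed.

Lemma fsb_sub J r (A B : J -> (X -> R) -> X -> R) p C D : 1 <= p ->
 (forall j, alg (A j)) -> (forall j, alg (B j)) -> fsb r A p C -> fsb r B p D ->
 fsb r (fun j f x => A j f x - B j f x) p (2 `^ p * (C + D)).
move=> p1 aA aB hA hB g bg.
letr (IIp_sub r C p1 (fun j => alg_B1 (aA j) (bg j)) (fun j => alg_B1 (aB j) (bg j))).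
by rewrite -mulrA; apply: ler_wpM2l; [by []|rewrite mulrDl; exact: lerD (hA g bg) (hB g bg)].
Qed.

(** A form of Minkowski's inequality for pieces with summable bounds, obtained from convexity with
    the bounds themselves as weights. *)
Lemma IIp_sum I J r' r (U : I -> J -> X -> R) (w : I -> R) p C W : 1 <= p -> 0 <= C -> 0 < W ->
 (forall l j, B1 (U l j)) -> (forall l, 0 < w l) -> \sum_(l <- r') w l <= W ->
 (forall l, (\I x, nrm r ((U l)^~ x) `^ p) <= C * w l `^ p) ->
 (\I x, nrm r (fun j => \sum_(l <- r') U l j x) `^ p) <= C * W `^ p.
move=> p1 C0 W0 bU w0 wW hU; have p0 : 0 <= p by exact: le_trans p1.
have pn : p != 0 by rewrite gt_eqF// (lt_le_trans ltr01).
pose N l x := nrm r ((U l)^~ x).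
have N0 l x : 0 <= N l x by exact: nrm_ge0.
have bN l : B1 (fun x => N l x `^ p) by exact: B1_nrmp.
have bS j : B1 (fun x => \sum_(l <- r') U l j x) by apply: B1_sum => l.
pose z l := w l * (w l)^-1 `^ p.
via (\I x, W `^ (p - 1) * \sum_(l <- r') z l * N l x `^ p).
 apply: II_le; [exact: B1_nrmp|by apply: B1Z; apply: B1_sum => l; exact: B1Z|] => x.
 have h1 : nrm r (fun j => \sum_(l <- r') U l j x) <= \sum_(l <- r') w l * (N l x / w l).
  letr (nrm_sum _ _ _); apply: ler_sum => l _.
  by rewrite mulrCA mulfV ?mulr1// gt_eqF.
 letr (powR_mono p0 (nrm_ge0 _ _) h1).
 have q0 l : 0 <= N l x / w l by rewrite divr_ge0// ltW.
 letr (powR_mean_le p1 W0 (fun l => ltW (w0 l)) q0 wW).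
 apply: ler_wpM2l; first pos.
 apply: ler_sum => l _; rewrite powRM ?invr_ge0 ?(ltW (w0 l))//.
 by rewrite mulrCA mulrA mulrC mulrA [_ * w l]mulrC mulrA.
rewrite IIZ; last by apply: B1_sum => l; exact: B1Z.
rewrite II_sum; last by move=> l; exact: B1Z.
via (W `^ (p - 1) * \sum_(l <- r') C * w l).
 apply: ler_wpM2l; first pos.
 apply: ler_sum => l _; rewrite IIZ//.
 have z0 : 0 <= z l by rewrite mulr_ge0 ?powR_ge0// ltW.
 letr (ler_wpM2l z0 (hU l)); apply: le_of_eq.
 have e1 : (w l)^-1 `^ p * w l `^ p = 1.
  by rewrite -powRM ?invr_ge0 ?ltW// mulVf ?powR1// gt_eqF.
 by rewrite mulrCA -mulrA e1 mulr1.
rewrite -mulr_sumr -(powRp (ltW W0) pn) mulrCA; apply: ler_wpM2l => //.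
by rewrite mulrC; apply: ler_wpM2r => //; pos.
Qed.

Lemma II_nrm_n2 J r (F : J -> X -> R) e : (forall j, B1 (F j)) -> 0 <= e -> (forall j, n2 (F j) <= e) ->
 n2 (fun x => nrm r (F^~ x)) <= ((size r)%:R + 1) * e.
move=> bF e0 h; rewrite -(@ler_pXn2r _ 2); rewrite ?nnegrE ?n2_ge0 ?mulr_ge0 ?addr_ge0//.
have -> : n2 (fun x => nrm r (F^~ x)) ^+ 2 = \sum_(j <- r) n2 (F j) ^+ 2.
 rewrite -II_nrm2// n2_sqr; congr II; ext x.
 by rewrite powR_mulrn// nrm_ge0.
via (\sum_(j <- r) e ^+ 2).
 by apply: ler_sum => j _; apply: lerXn2r; rewrite ?nnegrE ?n2_ge0.
have -> : \sum_(j <- r) e ^+ 2 = (size r)%:R * e ^+ 2.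
 by rewrite big_const_seq iter_addr_0 mulr_natl.
nra.
Qed.

(** The tangent inequality w^p <= v^p + p w^(p-1) (w - v) turns closeness in L^2 into an L^p bound.
    Small values of u are cut off so that w^(p-1) is at most a multiple of u, and Cauchy-Schwarz
    applies. *)
Lemma IIp_limit J r U p B : 1 < p -> (forall j, B1 (U j)) ->
 (forall e : R, 0 < e -> exists V : J -> X -> R, [/\ forall j, B1 (V j), (\I x, nrm r (V^~ x) `^ p) <= B &
  forall j, n2 (fun x => U j x - V j x) <= e]) -> (\I x, nrm r (U^~ x) `^ p) <= B.
move=> p1 bU h; have p1' := ltW p1; have p0 : 0 <= p by exact: le_trans p1'.
have pm0 : 0 < p - 1 by rewrite subr_gt0.
pose u x := nrm r (U^~ x); have bu : B1 u by exact: B1_nrm.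
have u0 x : 0 <= u x by exact: nrm_ge0.
apply/ler_addgt0Pr => e e0.
have e20 : 0 < e / 2 by rewrite divr_gt0.
have [dl dl0 hdl] := cut_pow p1' bu u0 e20.
have [M hM] := (B1_Bm bu).2.
pose w x := if dl <= u x then u x else 0.
have bw : B1 w by apply: B1_cut => //; exact: B1_Bm.
have w0 x : 0 <= w x by rewrite /w; case: ifP.
pose Kc := p * (`|M| `^ (p - 1) / dl).
have Kc0 : 0 <= Kc by rewrite mulr_ge0// divr_ge0 ?powR_ge0// ltW.
pose D := Kc * (n2 u * ((size r)%:R + 1)) + 1.
have D0 : 0 < D by rewrite ltr_wpDl// mulr_ge0// mulr_ge0 ?n2_ge0.
have [V [bV hV nV]] := h (e / 2 / D) (divr_gt0 e20 D0).
have ed0 : 0 <= e / 2 / D by rewrite divr_ge0 ?ltW.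
pose v x := nrm r (V^~ x); pose ex x := nrm r (fun j => U j x - V j x).
have bd j : B1 (fun x => U j x - V j x) by exact: B1B.
have bex : B1 ex by apply: B1_nrm.
have bv : B1 v by exact: B1_nrm.
have v0 x : 0 <= v x by exact: nrm_ge0.
have ex0 x : 0 <= ex x by exact: nrm_ge0.
have bue : B1 (fun x => u x * ex x) by apply: B1M => //; exact: B1_Bm.
have bvp := B1_pow p1' v0 bv.
have key x : w x `^ p <= v x `^ p + Kc * (u x * ex x).
 have := powR_diff p1' (v0 x) (w0 x); rewrite lerBlDl => /le_trans; apply; rewrite lerD2l.
 rewrite /w; case: ifPn => [du|_]; last by rewrite powR0 ?gt_eqF// mul0r mulr0 mulr_ge0// mulr_ge0.
 rewrite -mulrA; apply: ler_wpM2l => //.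
 have uv : u x - v x <= ex x.
  rewrite lerBlDr /u; have -> : U^~ x = fun j => (U j x - V j x) + V j x by ext j; rewrite subrK.
  exact: nrmD.
 letr (ler_wpM2l (powR_ge0 _ _) uv); rewrite mulrA; apply: ler_wpM2r => //.
 via (`|M| `^ (p - 1)).
  apply: powR_mono => //; first pos.
  by letr (ler_norm _); letr (hM x); exact: ler_norm.
 by rewrite -mulrA ler_peMr ?powR_ge0// mulrC ler_pdivlMr// mul1r.
have -> : (\I x, u x `^ p) = (\I x, w x `^ p) + (\I x, (if dl <= u x then 0 else u x) `^ p).
 rewrite -IID; last 2 first.
 - exact: B1_pow.
 - apply: B1_pow => // [x|]; first by case: ifP.
  have hh : B1 (fun x => u x - w x) by exact: B1B.
  by move: hh; congr B1; ext x; rewrite /w; case: ifP; rewrite ?subrr ?subr0.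
 congr II; ext x; rewrite /w; case: ifP => _; rewrite powR0 ?addr0 ?add0r// gt_eqF// (lt_trans ltr01)//.
rewrite [e in leRHS]splitr addrA; apply: lerD => //.
via (\I x, v x `^ p + Kc * (u x * ex x)).
 by apply: II_le => //; [exact: B1_pow|apply: B1D => //; exact: B1Z].
rewrite IID//; last exact: B1Z.
rewrite IIZ//; apply: lerD => //.
have hex : n2 ex <= ((size r)%:R + 1) * (e / 2 / D) by apply: II_nrm_n2.
via (Kc * (n2 u * (((size r)%:R + 1) * (e / 2 / D)))).
 apply: ler_wpM2l => //; letr (II_CS bu bex); apply: ler_wpM2l => //; exact: n2_ge0.
have E (y0 y1 y2 y3 y4 : R) : y0 * (y1 * (y2 * (y3 * y4))) = y3 * (y0 * (y1 * y2) * y4) by clear; ring.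
have -> : Kc * (n2 u * (((size r)%:R + 1) * (e / 2 / D))) = e / 2 * ((D - 1) / D).
 by rewrite addrK.
rewrite ler_piMr ?(ltW e20)// ler_pdivrMr// mul1r gerBl//.
Qed.

End lp_bounds.

Lemma nrm_seq1 (R : realType) J j (v : J -> R) : nrm [:: j] v = `|v j|.
by rewrite /nrm big_seq1 sqrtr_sqr. Qed.

Lemma addz1 (z : int) v : z + v%:Z + 1 = z + v.+1%:Z.
lra. Qed.

(** [H_osc] with blocks of length one, applied monomial by monomial; [minn] only keeps the sequence
    of times below N + 1. *)
Lemma dd_lp (R : realType) p : 1 < p -> exists2 C : R, 0 < C &
 forall k n d s (c : coef R k n d) n0 N S l, uniq S ->
 sqb (idx N S) (dd (s := s) c n0 S l) p (C ^+ size S).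
move=> p1; have [C C0 HC] := @H_osc R p p1; exists C => // k n d s c n0 N S l.
have p1' := ltW p1.
elim: S => [_|g S IH /andP[gS uS]] f bf.
 by rewrite mul1r; apply: le_of_eq; congr II; ext x; rewrite nrm_seq1.
have bS j := alg_B1 (alg_dd s c n0 (N := N) S l j) bf.
have th : {homo (fun u => minn u N.+1) : u v / (u <= v)%N} by move=> u v uv; rewrite leq_min geq_minr (leq_trans (geq_minl _ _)).
have tN u : (minn u N.+1 <= N.+1)%N by exact: geq_minr.
have [G [bG hG IG]] := HC d s (c g) (n0 + l g) N.+1 _ (idx N S) (fun j => dd c n0 S l j f) N.+1 _ bS th tN.
rewrite exprS -mulrA; via (C * (\I x, nrm (idx N S) (fun j => dd c n0 S l j f x) `^ p)); last first.
 by apply: ler_wpM2l; [pos|exact: IH].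
apply: le_trans IG; apply: IIp_le => //.
- by apply: B1_nrm => j; exact: alg_B1 (alg_dd s c n0 _ l j) bf.
- exact: B1_nrm.
move=> x; rewrite nrm_ge0 nrm_idx; apply: nrm_le => -[u j] /=.
have -> : dd c n0 S l (upj j g u) f = dd c n0 S l j f by apply: dd_local; exact: upj_other.
have e1 : sc n0 (upj j g u) g + l g = n0 + l g + u%:Z by rewrite /sc ffunE eqxx addrAC.
rewrite e1 addz1.
have mu : minn u N.+1 = u by apply/minn_idPl; exact: ltnW (ltn_ord u).
have mu1 : minn u.+1 N.+1 = u.+1 by apply/minn_idPl.
have hu : (minn u N.+1 <= u.+1 <= minn u.+1 N.+1)%N by rewrite mu mu1 leqnn leqnSn.
have := hG u j u.+1 x hu.
by rewrite mu => hh; exact: le_trans (le_of_eq (distrC _ _)) hh.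
Qed.

(** * Bootstrapping between maximal, vector-valued and square function bounds *)

Section families.
Context {R : realType} (k n : nat).

Definition thin (a b : 'I_k -> R) (i : nat) :=
 [/\ lt_box a b, forall t, 0 <= a t, forall t, b t <= 2 & forall t, 2 ^- i <= b t - a t].

(** Here and in [FS] and [SQ] the sides may be as short as 2^(-i), at the price of a factor 2^(e i)
    with e arbitrarily small. Real box sides are reached through such thin boxes, where a definite
    gain absorbs the factor. *)
Definition MB (q : R) := forall e : R, 0 < e -> exists2 C : R, 0 < C &
 forall d (s : dsys R d) (c : coef R k n d) n0 N a b i (F : {set Ix k n}), thin a b i ->
 (forall g, g \in F -> (0 < mdeg g)%N) ->
 maxb (fun j : {ffun Ix k n -> 'I_N.+1} => AF (s := s) c n0 a b F j) q (C * 2 `^ (e * i%:R)).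

Definition FS (p : R) := forall e : R, 0 < e -> exists2 C : R, 0 < C &
 forall d (s : dsys R d) (c : coef R k n d) n0 N a b i (F : {set Ix k n}) (r : seq {ffun Ix k n -> 'I_N.+1}), thin a b i ->
 (forall g, g \in F -> (0 < mdeg g)%N) ->
 fsb r (AF (s := s) c n0 a b F) p (C * 2 `^ (e * i%:R)).

Definition FH (p : R) := exists2 C : R, 0 < C &
 forall d (s : dsys R d) (c : coef R k n d) n0 N g (r : seq {ffun Ix k n -> 'I_N.+1}), fsb r (Hg (s := s) c n0 g) p C.

Definition SQ (p : R) := forall e : R, 0 < e -> exists2 C : R, 0 < C &
 forall d (s : dsys R d) (c : coef R k n d) n0 N a b i S, thin a b i -> uniq S ->
 (forall g, g \in S -> (0 < mdeg g)%N) ->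
 sqb (idx N S) (fun j => sg (s := s) c n0 a b S finset.set0 j) p (C * 2 `^ (e * i%:R)).

Lemma maxb_H q : 1 < q -> exists2 C : R, 0 < C &
 forall d s (c : coef R k n d) n0 N g,
 maxb (fun j : {ffun Ix k n -> 'I_N.+1} => Hg (s := s) c n0 g j) q C.
move=> q1; have [C C0 HC] := @H_max R q q1; exists C => // d s c n0 N g f bf f0.
have [G [bG hG IG]] := HC d s (c g) n0 N unit [:: tt] (fun=> f) (fun=> bf).
have G0 x : 0 <= G tt x by apply: le_trans (hG tt 0 x _).
exists (G tt); split; [by []|by []| |].
 move=> j x; letr (ler_norm _); apply: hG; exact: ltn_ord (j g).
apply: le_trans (le_trans IG _); apply: le_of_eq; last congr (_ * _); congr II; ext x;
 by rewrite nrm_seq1 ger0_norm.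
Qed.

Lemma powR2_ge1 (x : R) : 0 <= x -> 1 <= 2 `^ x.
by move=> x0; rewrite -[leLHS](powRr0 2); apply: ler_powR => //; rewrite ler1n. Qed.

Lemma FH_lt2 q : 1 < q -> FH (2 * q / (q + 1)).
move=> q1; have [C C0 HC] := maxb_H q1.
exists (2 `^ (2 * q / (q + 1)) * (C + 1)); first pos.
by move=> d s c n0 N g r; apply: fs_single_lt2 => // j; exact: markov_Hg.
Qed.

Lemma FH_ge4 (p : R) : 4 <= p -> FH p.
move=> p4; have q1 : 1 < p / (p - 2) by rewrite ltr_pdivlMr; lra.
have [C C0 HC] := maxb_H q1; have [K K0 HK] := fs_single_ge4 p4.
exists (K * (C + 1) `^ (p / 2 - 1)); first pos.
move=> d s c n0 N g r; apply: (HK _ _ _ _ _ _ (Hg c n0 g)) => //.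
- lra.
- exact: markov_Hg.
- exact: markov_Hg.
- by move=> j; exact: adjoint_H.
move=> f bf f0; have [G [bG G0 hG IG]] := HC d s c n0 N g f bf f0; exists G; split; [exact: bG|exact: G0|exact: hG|].
letr IG; apply: ler_wpM2r; last by rewrite lerDl.
by apply: II_ge0 => x; pos.
Qed.

Lemma FS_lt2 q : 1 < q -> MB q -> FS (2 * q / (q + 1)).
move=> q1 hM e e0; have [C C0 HC] := hM e e0.
exists (2 `^ (2 * q / (q + 1)) * (C + 1)); first pos.
move=> d s c n0 N a b i F r th Fp.
have [ab _ _ _] := th.
have B1i : 1 <= 2 `^ (e * i%:R) :> R by apply: powR2_ge1; rewrite mulr_ge0// ltW.
have Bp := lt_le_trans ltr01 B1i.
have h := @fs_single_lt2 _ q _ d s _ r (AF c n0 a b F) q1 (mulr_gt0 C0 Bp) (fun j => markov_AF s c n0 ab F j) (HC d s c n0 N a b i F th Fp).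
move=> g bg; letr (h g bg); apply: ler_wpM2r.
 by apply: II_ge0 => x; exact: powR_ge0.
rewrite -[leRHS]mulrA; apply: ler_wpM2l => //.
lra.
Qed.

(** The adjoint of [AF] is [AF] for the opposite coefficients, so the maximal bound at p/(p - 2)
    applies to it. The power p/2 - 1 that falls on the constant is compensated by rescaling e. *)
Lemma FS_ge4 (p : R) : 4 <= p -> MB (p / (p - 2)) -> FS p.
move=> p4 hM e e0; have P0 : 0 < p / 2 - 1 by lra.
have [C C0 HC] := hM (e / (p / 2 - 1)) (divr_gt0 e0 P0); have [K K0 HK] := fs_single_ge4 p4.
exists (K * (C + 1) `^ (p / 2 - 1)); first pos.
move=> d s c n0 N a b i F r th Fp.
have [ab _ _ _] := th.
pose y := 2 `^ (e / (p / 2 - 1) * i%:R) : R.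
have y1 : 1 <= y by apply: powR2_ge1; rewrite mulr_ge0// divr_ge0// ltW.
have yp : y `^ (p / 2 - 1) = 2 `^ (e * i%:R).
 by rewrite -powRrM; congr (_ `^ _); field; lra.
have C1 : 1 <= (C + 1) * y.
 nra.
have h : fsb r (AF (s := s) c n0 a b F) p (K * ((C + 1) * y) `^ (p / 2 - 1)).
 apply: (HK _ _ _ _ r _ (AF (fun g i => - c g i) n0 a b F) C1).
 - exact: markov_AF.
 - exact: markov_AF.
 - move=> j; rewrite /AF.
  have -> : mpol F (cj (fun g i => - c g i) n0 j) = (fun t i => - mpol F (cj c n0 j) t i).
   ext t; ext u; rewrite -sumrN; apply: eq_bigr => g _.
   by rewrite /cj mulrN mulrN.
  by apply: adjoint_av => //; exact: mp_mpol.
 move=> f bf f0; have [G [bG G0 hG IG]] := HC d s (fun g i => - c g i) n0 N a b i F th Fp f bf f0; exists G; split; [exact: bG|exact: G0|exact: hG|].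
 letr IG; apply: ler_wpM2r; first by apply: II_ge0 => x; pos.
 by apply: ler_wpM2r => //; rewrite lerDl.
move=> g bg; letr (h g bg); apply: ler_wpM2r.
 by apply: II_ge0 => x; pos.
by rewrite powRM ?yp ?mulrA// ltW ?addr_gt0// (lt_le_trans ltr01).
Qed.

(** Unfolding [sg] doubles the number of terms once per monomial, each term being an average
    composed with operators H; S has distinct entries, which bounds its length. *)
Lemma fsb_sg p : 1 <= p -> FS p -> FH p -> forall e : R, 0 < e -> exists2 C : R, 0 < C &
 forall d s (c : coef R k n d) n0 N a b i S (F : {set Ix k n}) (r : seq {ffun Ix k n -> 'I_N.+1}), thin a b i ->
 (forall g, (g \in S) || (g \in F) -> (0 < mdeg g)%N) -> uniq S ->
 fsb r (sg (s := s) c n0 a b S F) p (C * 2 `^ (e * i%:R)).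
move=> p1 hF [D D0 HD] e e0; have [C C0 HC] := hF e e0.
pose E := 2 `^ p * (1 + D).
have E1 : 1 <= E.
 rewrite -[leLHS]mulr1; apply: ler_pM => //; last by rewrite lerDl ltW.
 by apply: powR2_ge1; exact: le_trans p1.
have E0 : 0 <= E by exact: le_trans E1.
exists (E ^+ #|{: Ix k n}| * C); first pos.
move=> d s c n0 N a b i S F r th SF uS; have [ab _ _ _] := th.
set Y := 2 `^ (e * i%:R) : R; have Y0 : 0 <= Y by exact: powR_ge0.
have sS : (size S <= #|{: Ix k n}|)%N by rewrite -(card_uniqP uS) max_card.
suff h : fsb r (sg (s := s) c n0 a b S F) p (E ^+ size S * (C * Y)).
 move=> g bg; letr (h g bg); apply: ler_wpM2r.
  by apply: II_ge0 => x; pos.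
 by rewrite -mulrA; apply: ler_wpM2r; [rewrite mulr_ge0// ltW|exact: ler_weXn2l].
have CY : 0 <= C * Y by rewrite mulr_ge0// ltW.
clear sS uS; elim: S F SF => [|g S IH] F SF.
 by rewrite mul1r; apply: HC.
have h1 := IH (g |: F)%SET; have h2 := IH F.
have X0 : 0 <= E ^+ size S * (C * Y) by rewrite mulr_ge0// exprn_ge0.
have -> : E ^+ size (g :: S) * (C * Y) = 2 `^ p * (E ^+ size S * (C * Y) + E ^+ size S * (C * Y) * D).
 by rewrite exprS /E; ring.
apply: fsb_sub => //.
- exact: alg_sg.
- by move=> j; exact: alg_comp (alg_sg s c n0 ab S F j) (alg_Hg s c n0 g j).
- by apply: h1 => g'; rewrite in_setU1 => h; apply: SF; rewrite -orbA orbCA.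
apply: fsb_comp => //; first by move=> j; exact: alg_Hg.
by apply: h2 => g' h; apply: SF; rewrite -orbA h orbT.
Qed.

End families.

Lemma powR_exp_le (R : realType) (y a b : R) : 0 < y <= 1 -> b <= a -> y `^ a <= y `^ b.
move=> /andP[y0 y1] ba; have -> : a = b + (a - b) by rewrite addrC subrK.
rewrite powRD_pos// ler_piMr ?powR_ge0//.
by letr (powR_mono _ (ltW y0) y1); rewrite ?powR1// subr_ge0.
Qed.

Lemma double_gt (R : realType) (p : R) : 2 < p -> 2 < 2 * p /\ p < 2 * p.
lra. Qed.

Lemma n2_0 R d (s : dsys R d) : n2 (s := s) (fun=> 0 : R) = 0.
by rewrite /n2 (_ : (fun x => _) = fun=> 0) ?II0 ?sqrtr0//; rewrite expr0n. Qed.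

Lemma powRN_powR (R : realType) (y a b : R) : (y `^ (- a)) `^ b = y `^ (- (a * b)).
by rewrite -powRrM mulNr. Qed.

Lemma err_arith (R : realType) (m q e u : R) : 0 <= m -> 0 <= q * e * u ->
 m * (q * e * u) + e * (q * u) <= (m + 1) * (2 * q * e * u).
nra.
Qed.

Section square_function.
Context {R : realType} (k n K : nat) (Cd : R).
Hypotheses (K0 : (0 < K)%N) (Cd0 : 0 <= Cd) (hD : forall g : Ix k n, (0 < mdeg g)%N -> Dec g K Cd).
Notation m0 := #|{: Ix k n}|.

Lemma size_Ix (S : seq (Ix k n)) : uniq S -> (size S <= m0)%N.
by move=> uS; rewrite -(card_uniqP uS) max_card. Qed.

Lemma Tl_sq2' d s (c : coef R k n d) n0 N a b i S (l : Ix k n -> int) y : thin a b i -> uniq S ->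
 (forall g, g \in S -> (0 < mdeg g)%N) -> 0 <= y -> (exists2 g, g \in S & Num.min 1 (vl i K (l g)) <= y) ->
 sqb (idx N S) (Tl (s := s) c n0 a b S l) 2 ((CD (k := k) (n := n) Cd m0 * 2 ^+ m0) ^+ 2 * y ^+ 2).
move=> [ab a0 b2 sd] uS Sp y0 hy; have sS := size_Ix uS.
move=> f bf; letr (Tl_sq2 c n0 N ab a0 b2 sd Cd0 uS (fun g gS => hD (Sp g gS)) y0 hy bf).
apply: ler_wpM2r; first exact: II_ge0 => x.
have z0 u : 0 <= CD (k := k) (n := n) Cd u * 2 ^+ u by rewrite mulr_ge0 ?exprn_ge0// CD_ge0.
rewrite exprMn; apply: ler_wpM2r; first pos.
apply: lerXn2r; rewrite ?nnegrE//; apply: ler_pM; rewrite ?CD_ge0 ?exprn_ge0//; last first.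
 by apply: ler_weXn2l => //; rewrite ler1n.
apply: ler_wpM2r; last by apply: ler_weXn2l => //; rewrite ler1n.
pos.
Qed.

Definition TLB (p : R) :=
 exists2 th : R, 0 < th & forall e : R, 0 < e -> exists2 C : R, 0 < C &
 forall d (s : dsys R d) (c : coef R k n d) n0 N a b i S (l : Ix k n -> int) y, thin a b i -> uniq S ->
 (forall g, g \in S -> (0 < mdeg g)%N) -> 0 < y <= 1 -> (exists2 g, g \in S & Num.min 1 (vl i K (l g)) <= y) ->
 sqb (idx N S) (Tl (s := s) c n0 a b S l) p (C * 2 `^ (e * i%:R) * y `^ th).

(** Interpolation between L^2, where y gives decay, and p', where the vector-valued bounds give
    boundedness only. The level [lam] of [marcinkiewicz] is a power of y chosen to keep part of the
    decay. *)
Lemma Tl_interp p p' : 1 < p' -> p' < p /\ p < 2 \/ 2 < p /\ p' = 2 * p -> FS k n p' -> FH k n p' ->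
 TLB p.
move=> p'1 hp hS hH.
have [D D0 HD] := dd_lp p'1.
pose E := (1 + D) ^+ m0; pose Q := (CD (k := k) (n := n) Cd m0 * 2 ^+ m0) ^+ 2.
have E0 : 0 < E by rewrite exprn_gt0// addr_gt0.
have Q0 : 0 <= Q by exact: sqr_ge0.
have [th th0 [CM CM0 HM]] : exists2 th : R, 0 < th & exists2 CM : R, 0 < CM &
  forall d (s : dsys R d) J r (T : J -> (sX s -> R) -> sX s -> R) A0 y,
  (forall j, alg (T j)) -> 0 <= A0 -> 0 < y <= 1 -> sqb r T p' A0 -> sqb r T 2 (Q * y ^+ 2) ->
  sqb r T p (CM * (A0 + Q) * y `^ th).
 have two (y : R) : 0 < y -> y ^+ 2 = y `^ 2 by move=> y0; rewrite powR_mulrn// ltW.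
 case: hp => [[p'p p2]|[p2 p'p]].
  (* With [lam] equal to y the end p' contributes y^(p - p') and the end 2 contributes y^2 y^(p -
     2). *)
  exists (p - p'); first pos.
  have [CM CM0 HM] := marcinkiewicz (ltW p'1) p'p p2; exists CM; first exact: CM0.
  move=> d s J r T A0 y aT A00 /andP[y0 y1] h1 h2 f bf.
  have A1 : 0 <= Q * y ^+ 2 by rewrite mulr_ge0// sqr_ge0.
  letr (HM d s J r T A0 _ y aT A00 A1 y0 h1 h2 f bf); apply: ler_wpM2r.
   exact: II_ge0 => x.
  rewrite -[leRHS]mulrA; apply: ler_wpM2l; first pos.
  rewrite mulrDl lerD2l -mulrA; apply: ler_wpM2l => //.
  rewrite two// -powRD_pos// addrC subrK; apply: powR_exp_le; first by rewrite y0.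
  lra.
 exists 1 => //; have [pp p1] : 2 < p' /\ p < p' by rewrite p'p; exact: double_gt.
 have [CM CM0 HM] := marcinkiewicz (ler1n R 2) p2 p1.
 exists CM; first exact: CM0.
 move=> d s J r T A0 y aT A00 /andP[y0 y1] h1 h2 f bf.
 have A1 : 0 <= Q * y ^+ 2 by rewrite mulr_ge0// sqr_ge0.
 have p20 : 0 < p - 2 by rewrite subr_gt0.
 (* This level gives y^2 y^(-1) at the end 2, and at the end 2 p the power p/(p - 2) of y, which
    exceeds 1. *)
 have lam0 : 0 < y `^ (- (p - 2)^-1) by exact: powR_gt0.
 letr (HM d s J r T _ A0 _ aT A1 A00 lam0 h2 h1 f bf); apply: ler_wpM2r.
  exact: II_ge0 => x.
 rewrite -[leRHS]mulrA; apply: ler_wpM2l; first pos.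
 rewrite !powRN_powR mulVf ?gt_eqF// [in leRHS]mulrDl addrC; apply: lerD; last first.
  by rewrite -mulrA; apply: ler_wpM2l => //; rewrite two// -powRD_pos//; apply: powR_exp_le; lra.
 apply: ler_wpM2l => //; apply: powR_exp_le; rewrite ?y0//.
 have -> : p - p' = - p by rewrite p'p; ring.
 by rewrite mulrN opprK mulrC ler_pdivlMr// mul1r lerBlDr lerDl.
exists th => // e e0.
have [C1 C10 H1] := fsb_sg (ltW p'1) hS hH e0.
exists (CM * (C1 * E + Q)); first by rewrite mulr_gt0// ltr_wpDr// mulr_gt0.
move=> d s c n0 N a b i S l y thn uS Sp y01 hy; have [ab a0 b2 sd] := thn.
have sS := size_Ix uS; have /andP[y0 y1] := y01.
set Y := 2 `^ (e * i%:R) : R.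
have Y1 : 1 <= Y by apply: powR2_ge1; rewrite mulr_ge0// ltW.
have Y0 : 0 <= Y by exact: le_trans Y1.
have A00 : 0 <= C1 * Y * E by rewrite !mulr_ge0 ?(ltW E0)// ltW.
have h1 : sqb (idx N S) (Tl (s := s) c n0 a b S l) p' (C1 * Y * E).
 move=> f bf; have hS' g : (g \in S) || (g \in finset.set0) -> (0 < mdeg g)%N by rewrite finset.in_set0 orbF; exact: Sp.
 have CY : 0 <= C1 * Y by rewrite mulr_ge0// ltW.
 have := fsb_sqb (fun j => alg_dd s c n0 S l j) CY (H1 d s c n0 N a b i S _ _ thn hS' uS) (HD k n d s c n0 N S l uS).
 move=> /(_ f bf) /le_trans; apply; apply: ler_wpM2r; first exact: II_ge0 => x.
 apply: ler_wpM2l => //; via ((1 + D) ^+ size S).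
  by apply: lerXn2r; rewrite ?nnegrE ?addr_ge0 ?(ltW D0)// lerDr.
 by apply: ler_weXn2l => //; rewrite lerDl ltW.
have h2 := Tl_sq2' (s := s) c n0 N thn uS Sp (ltW y0) hy.
move=> f bf; letr (HM d s _ _ _ _ y (fun j => alg_Tl s c n0 ab S l j) A00 y01 h1 h2 f bf).
apply: ler_wpM2r; first exact: II_ge0 => x.
apply: ler_wpM2r; first exact: powR_ge0.
rewrite -[leRHS]mulrA; apply: ler_wpM2l; first pos.
by rewrite mulrDl mulrAC lerD2l ler_peMr.
Qed.

(** The integers from -L to L - 1, as [Negz t] is -(t + 1); consecutive differences over them
    telescope from -L to L. *)
Definition win (L : nat) : seq int := [seq Posz t | t <- iota 0 L] ++ [seq Negz t | t <- iota 0 L].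

Fixpoint lbox (L : nat) (S : seq (Ix k n)) : seq (Ix k n -> int) :=
 if S is g :: S' then [seq (fun g' => if g' == g then u else l g') | u <- win L, l <- lbox L S'] else [:: fun=> 0].

Lemma lbox_prod L S (w : int -> R) : uniq S ->
 \sum_(l <- lbox L S) \prod_(g <- S) w (l g) = (\sum_(u <- win L) w u) ^+ size S.
elim: S => [_|g S IH /andP[gS uS]]; first by rewrite big_seq1 big_nil.
rewrite big_allpairs_dep /= exprS -IH// mulr_suml; apply: eq_bigr => u _.
rewrite mulr_sumr; apply: eq_bigr => l _; rewrite big_cons eqxx; congr (_ * _).
apply: eq_big_seq => g' g'S; case: eqP => // e; by rewrite -e g'S in gS.
Qed.

Lemma dd_locl d s (c : coef R k n d) n0 N S (l l' : Ix k n -> int) (j : {ffun Ix k n -> 'I_N.+1}) f :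
 (forall g, g \in S -> l g = l' g) -> dd (s := s) c n0 S l j f = dd c n0 S l' j f.
elim: S => [//|g S IH] h.
have hS g' : g' \in S -> l g' = l' g' by move=> g'S; apply: h; rewrite inE g'S orbT.
have hg : l g = l' g by apply: h; rewrite inE eqxx.
by rewrite !dd_cons (IH hS) hg.
Qed.

Definition Ww d (s : dsys R d) (c : coef R k n d) n0 N (L : nat) S (j : {ffun Ix k n -> 'I_N.+1}) (f : sX s -> R) : sX s -> R :=
 foldr (fun g h x => Hop (c g) (sc n0 j g - L%:Z) h x - Hop (c g) (sc n0 j g + L%:Z) h x) f S.

Lemma alg_Ww d s (c : coef R k n d) n0 N L S (j : {ffun Ix k n -> 'I_N.+1}) :
 alg (Ww (s := s) c n0 L S j).
elim: S => [|g S IH]; first exact: alg_id.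
exact: alg_sub (alg_comp (alg_H s _ _) IH) (alg_comp (alg_H s _ _) IH).
Qed.

Lemma sum_win (h : int -> R) L (e : int) :
 \sum_(u <- win L) (h (e + u) - h (e + u + 1)) = h (e - L%:Z) - h (e + L%:Z).
rewrite big_cat /= !big_map.
have -> : \sum_(t <- iota 0 L) (h (e + Posz t) - h (e + Posz t + 1)) = h e - h (e + L%:Z).
 elim: L => [|L IH]; first by rewrite big_nil addr0 subrr.
 by rewrite -[in LHS]addn1 iotaD big_cat big_seq1 /= IH addz1 addrA subrK.
have -> : \sum_(t <- iota 0 L) (h (e + Negz t) - h (e + Negz t + 1)) = h (e - L%:Z) - h e.
 elim: L => [|L IH]; first by rewrite big_nil subr0 subrr.
 rewrite -addn1 iotaD big_cat big_seq1 /= IH add0n NegzE.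
 have -> : e - L.+1%:Z + 1 = e - L%:Z by rewrite -addrA; rewrite -addn1 PoszD opprD subrK.
 by rewrite addn1 addrC addrA subrK.
lra.
Qed.

Lemma Ww_dd d s (c : coef R k n d) n0 N L S (j : {ffun Ix k n -> 'I_N.+1}) f : uniq S -> Bm f ->
 Ww (s := s) c n0 L S j f = fun x => \sum_(l <- lbox L S) dd c n0 S l j f x.
move=> + bf; elim: S => [_|g S IH /andP[gS uS]]; first by ext x; rewrite big_seq1.
have bd l : Bm (dd c n0 S l j f) by exact: alg_Bm (alg_dd s c n0 S l j) bf.
ext x; rewrite big_allpairs_dep /=.
rewrite IH// -(sum_win (fun e => Hop (c g) e (fun y => \sum_(l <- _) dd c n0 S l j f y) x)).
apply: eq_bigr => u _; have aH e := alg_H s (c g) e.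
rewrite (alg_sum _ (aH _) bd) (alg_sum _ (aH _) bd) -sumrB; apply: eq_bigr => l _.
rewrite eqxx.
rewrite (@dd_locl _ s c n0 N S (fun g' => if g' == g then u else l g') l)// => g' g'S.
by case: eqP => // e; rewrite -e g'S in gS.
Qed.

Lemma n2_Ww d s (c : coef R k n d) n0 N L S (j : {ffun Ix k n -> 'I_N.+1}) f : B1 f ->
 n2 (Ww (s := s) c n0 L S j f) <= 2 ^+ size S * n2 f.
move=> bf; elim: S => [|g S IH]; first by rewrite mul1r.
have bW := alg_B1 (alg_Ww s c n0 L S j) bf.
have mH e := markov_H s (c g) e.
letr (n2B (mk_B1 (mH _) bW) (mk_B1 (mH _) bW)).
letr (lerD (mk_n2 (mH _) bW) (mk_n2 (mH _) bW)).
by rewrite exprS -[leRHS]mulrA -mulr2n -[leLHS]mulr_natl; apply: ler_wpM2l.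
Qed.

(** Monomial by monomial, f minus its window splits into parts below the scale by a factor 2^L,
    small by [sg_fine], and parts above it by 2^L, small by [sg_coarse]. *)
Lemma Ww_err d s (c : coef R k n d) n0 N a b i L S S' (j : {ffun Ix k n -> 'I_N.+1}) f : thin a b i ->
 (forall g, g \in S -> (0 < mdeg g)%N) -> {subset S' <= S} -> B1 f ->
 n2 (fun x => sg (s := s) c n0 a b S finset.set0 j f x - sg c n0 a b S finset.set0 j (Ww c n0 L S' j f) x) <=
 (size S')%:R * (2 ^+ size S' * (4 ^+ size S * (2 * (Cd + 2) * 2 ^- (L %/ K - i) + 2 ^+ (k * n) * 2 * 2 ^- L)) * n2 f).
move=> [ab a0 b2 sd] Sp + bf; set e := 4 ^+ size S * _.
have e0 : 0 <= e.
 pos.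
pose A := sg (s := s) c n0 a b S finset.set0 j; have aA : alg A by exact: alg_sg.
rewrite -/A; elim: S' => [_|g S' IH sub].
 by rewrite (@n2_eq R d s _ (fun=> 0)) ?n2_0 ?mul0r// => x; rewrite subrr.
have gS : g \in S by apply: sub; rewrite inE eqxx.
have {}IH := IH (fun g' h => sub g' (mem_behead (s := g :: S') h)).
pose W := Ww (s := s) c n0 L S' j f; have bW : B1 W := alg_B1 (alg_Ww s c n0 L S' j) bf.
pose P := Lop (c g) (sc n0 j g - L%:Z) W; have bP : B1 P := mk_B1 (markov_L s _ _) bW.
pose Q := Lop (c g) (sc n0 j g + L%:Z) W; have bQ : B1 Q := mk_B1 (markov_L s _ _) bW.
pose P' := Lop (fun i => - c g i) (sc n0 j g - L%:Z) P; have bP' : B1 P' := mk_B1 (markov_L s _ _) bP.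
pose Q' := Lop (fun i => - c g i) (sc n0 j g + L%:Z) Q; have bQ' : B1 Q' := mk_B1 (markov_L s _ _) bQ.
have -> : Ww (s := s) c n0 L (g :: S') j f = fun x => P' x - Q' x by [].
have hc : c g = c g \/ c g = (fun i => - c g i) by left.
have hc' : (fun i => - c g i) = c g \/ (fun i => - c g i) = (fun i => - c g i) by right.
have gSF : (g \in S) || (g \in finset.set0) by rewrite gS.
have h1 := sg_fine n0 ab a0 b2 sd Cd0 j L (hD (Sp g gS)) hc gSF bW.
have h2 := sg_fine n0 ab a0 b2 sd Cd0 j L (hD (Sp g gS)) hc' gSF bP.
have h3 := sg_coarse n0 ab a0 b2 finset.set0 j L hc' gS bQ.
have nP : n2 P <= n2 W by exact: (mk_n2 (markov_L s _ _)).
have nQ : n2 Q <= n2 W by exact: (mk_n2 (markov_L s _ _)).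
have nW : n2 W <= 2 ^+ size S' * n2 f by exact: n2_Ww.
rewrite -/W in IH; rewrite -/A -/P in h1; rewrite -/A -/P' in h2; rewrite -/A -/Q' in h3.
clearbody P' Q' P Q W.
have -> : n2 (fun x => A f x - A (fun x => P' x - Q' x) x) =
  n2 (fun x => (A f x - A W x) + ((A (fun x => W x - P x) x + A (fun x => P x - P' x) x) + A Q' x)).
 apply: n2_eq => x; rewrite (algB aA (B1_Bm bP') (B1_Bm bQ')) (algB aA (B1_Bm bW) (B1_Bm bP)) (algB aA (B1_Bm bP) (B1_Bm bP')).
 ring.
have b1 : B1 (A (fun x => W x - P x)) by exact: alg_B1 aA (B1B bW bP).
have b2' : B1 (A (fun x => P x - P' x)) by exact: alg_B1 aA (B1B bP _).
have b3 := alg_B1 aA bQ'.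
letr (n2D (B1B (alg_B1 aA bf) (alg_B1 aA bW)) (B1D (B1D b1 b2') b3)).
have hsum : n2 (fun x => (A (fun x => W x - P x) x + A (fun x => P x - P' x) x) + A Q' x) <= e * n2 W.
 letr (n2D (B1D b1 b2') b3); letr (lerD (n2D b1 b2') (lexx _)).
 have w0 : 0 <= 4 ^+ size S * (Cd + 2) / 2 ^+ (L %/ K - i) by rewrite !mulr_ge0 ?exprn_ge0// addr_ge0.
 have w0' : 0 <= 4 ^+ size S * (2 ^+ (k * n) * 2) / 2 ^+ L :> R by [].
 letr (lerD (lerD h1 (le_trans h2 (ler_wpM2l w0 nP))) (le_trans h3 (ler_wpM2l w0' nQ))).
 apply: le_of_eq; rewrite /e; ring.
letr (lerD IH (le_trans hsum (ler_wpM2l e0 nW))).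
have en0 : 0 <= 2 ^+ size S' * e * n2 f by rewrite mulr_ge0 ?n2_ge0// mulr_ge0.
have -> : (size (g :: S'))%:R = (size S')%:R + 1 :> R by rewrite natr1.
rewrite exprS.
exact: err_arith => //.
Qed.

Lemma small_pow2 (A dl : R) : 0 <= A -> 0 < dl -> exists t, A * 2 ^- t <= dl.
move=> A0 dl0; exists (Num.bound (A / dl)).
have := archi_boundP (divr_ge0 A0 (ltW dl0)); move: (Num.bound _) => t h.
rewrite ler_pdivrMr ?exprn_gt0// mulrC -ler_pdivrMr//; apply: ltW; apply: (lt_trans h).
by rewrite -natrX ltr_nat ltn_expl.
Qed.

Lemma powR2X m (x : R) : (2 ^+ m) `^ x = 2 `^ (x * m%:R).
by rewrite -powR_mulrn// -powRrM mulrC. Qed.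

Lemma powR2V m (x : R) : (2 ^- m) `^ x = 2 `^ (- (x * m%:R)).
by rewrite -powR_mulrn// -powRN -powRrM mulNr mulrC. Qed.

Lemma geo_sum (x : R) L : 0 <= x < 1 -> \sum_(t <- iota 0 L) x ^+ t <= (1 - x)^-1.
move=> /andP[x0 x1]; have y0 : 0 < 1 - x by rewrite subr_gt0.
rewrite -(ler_pM2l y0) mulfV ?gt_eqF//.
suff -> : (1 - x) * \sum_(t <- iota 0 L) x ^+ t = 1 - x ^+ L by rewrite gerBl exprn_ge0.
elim: L => [|L IH]; first by rewrite big_nil mulr0 subrr.
rewrite -[in LHS]addn1 iotaD big_cat big_seq1 mulrDr IH add0n exprS mulrBl mul1r.
lra.
Qed.

(** A geometric series of ratio 2^(-h/K) on each side. The loss is 2^(h i), so small powers of the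
    decay remain summable at small cost. *)
Lemma sum_vl (h : R) : 0 < h -> exists2 W : R, 0 < W & forall i L,
 \sum_(u <- win L) (Num.min 1 (vl i K u)) `^ h <= W * 2 `^ (h * i%:R).
move=> h0; pose sgm := 2 `^ (- (h / K%:R)) : R.
have K0' : 0 < K%:R :> R by rewrite ltr0n.
have s1 : sgm < 1.
 have e1 : 1 `^ (h / K%:R) = 1 :> R by rewrite powR1.
 rewrite /sgm powRN invf_lt1 ?powR_gt0// -[ltLHS]e1; apply: gt0_ltr_powR; rewrite ?nnegrE ?ltr1n//.
 pos.
have s0 : 0 <= sgm by exact: powR_ge0.
have sy : 0 < 1 - sgm by rewrite subr_gt0.
exists (2 * 2 `^ h * (1 - sgm)^-1); first pos.
move=> i L.
have key u t : (t.-1 <= `|u|.-1)%N -> (Num.min 1 (vl i K u)) `^ h <= 2 `^ (h * i%:R) * (2 `^ h * sgm ^+ t).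
 move=> tu; set q := (`|u|.-1 %/ K)%N.
 via (vl i K u `^ h).
  apply: powR_mono; [pos|by rewrite le_min ler01 ltW// vl_gt0|by rewrite ge_min lexx orbT].
 rewrite powRM ?exprn_ge0// powR2X; apply: ler_wpM2l => //.
 rewrite -/q powR2V -powR_mulrn// -powRrM -powRD ?pnatr_eq0 ?implybT//.
 apply: ler_powR; first by rewrite ler1n.
 have tq : (t <= q.+1 * K)%N.
  lia.
 have tq' : t%:R <= (q%:R + 1) * K%:R :> R by rewrite natr1 -natrM ler_nat.
 have -> : h + - (h / K%:R) * t%:R = h * (1 - t%:R / K%:R) by field; rewrite gt_eqF.
 rewrite -mulrN; apply: ler_wpM2l; first pos.
 by rewrite lerNl opprB lerBlDr ler_pdivrMr.
have e1 : \sum_(t <- iota 0 L) 2 `^ (h * i%:R) * (2 `^ h * sgm ^+ t) <= 2 `^ (h * i%:R) * (2 `^ h * (1 - sgm)^-1).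
 rewrite -mulr_sumr; apply: ler_wpM2l => //.
 by rewrite -mulr_sumr; apply: ler_wpM2l => //; apply: geo_sum; rewrite s0.
rewrite big_cat !big_map /=.
via (2 `^ (h * i%:R) * (2 `^ h * (1 - sgm)^-1) + 2 `^ (h * i%:R) * (2 `^ h * (1 - sgm)^-1)).
 apply: lerD; apply: le_trans e1; apply: ler_sum => t _; apply: key => //.
 lia.
lra.
Qed.

(** [TLB] is summed over all offset vectors. A bound by the best single coordinate becomes a product
    over the monomials once each of them receives a small share h of the exponent, and the products
    sum to a product of geometric series. [IIp_limit] removes the window. *)
Lemma SQ_TLB p : 1 < p -> TLB p -> SQ k n p.
move=> p1 [th th0 HT] e e0.
have p0 : 0 < p by exact: lt_trans p1.
have e20 : 0 < e / 2 by rewrite divr_gt0.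
have [C1 C10 HC] := HT _ e20.
(* The shares of all monomials together, times p, stay below the available decay th and below e/2,
   the part of the loss left for the geometric series. *)
pose h := Num.min th (e / 2) / ((m0%:R + 1) * p).
have h0 : 0 < h by rewrite divr_gt0 ?mulr_gt0// lt_min th0.
have hm (S : seq (Ix k n)) : uniq S -> h * (size S)%:R * p <= Num.min th (e / 2).
 move=> uS; have -> : h * (size S)%:R * p = Num.min th (e / 2) * ((size S)%:R / (m0%:R + 1)).
  rewrite /h; move: (Num.min th _) (size S)%:R => y1 y2.
  by field; rewrite !gt_eqF.
 rewrite ler_piMr ?le_min ?(ltW th0) ?(ltW e20)// ler_pdivrMr// mul1r.
 by rewrite (@le_trans _ _ m0%:R) ?lerDl// ler_nat size_Ix.
have [W W0 HW] := sum_vl h0.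
pose Cf := C1 * ((W + 1) ^+ m0) `^ p.
have Cf0 : 0 < Cf by rewrite mulr_gt0// powR_gt0// exprn_gt0// addr_gt0.
exists (Cf + 1); first pos.
move=> d s c n0 N a b i S thn uS Sp f bf; have [ab a0 b2 sd] := thn.
have If0 : 0 <= (\I x, `|f x| `^ p) by apply: II_ge0 => x.
have Y1 (z : R) : 0 < z -> 1 <= 2 `^ (z * i%:R) by move=> z0; apply: powR2_ge1; rewrite mulr_ge0// ltW.
have [S0|[g0 g0S]] : S = [::] \/ exists g, g \in S by case: (S) => [|g S1]; [left|right; exists g; rewrite inE eqxx].
 rewrite S0 /=; via (1 * (\I x, `|f x| `^ p)).
  by rewrite mul1r; apply: le_of_eq; congr II; ext x; rewrite nrm_seq1 AF0.
 apply: ler_wpM2r => //; rewrite -[leLHS]mulr1; apply: ler_pM => //; last exact: Y1.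
 lra.
pose m u := Num.min 1 (vl i K u) : R.
have mp u : 0 < m u by rewrite lt_min ltr01 vl_gt0.
have mle u : m u <= 1 by rewrite ge_min lexx.
pose w (l : Ix k n -> int) := \prod_(g <- S) m (l g) `^ h.
have w0 l : 0 < w l by rewrite /w; pos.
pose Ws := (W * 2 `^ (h * i%:R)) ^+ size S.
have Ws0 : 0 < Ws by rewrite exprn_gt0// mulr_gt0.
have wW L : \sum_(l <- lbox L S) w l <= Ws.
 letr (le_of_eq (lbox_prod L (fun u => m u `^ h) uS)); apply: lerXn2r; rewrite ?nnegrE; last exact: HW.
  pos.
 pos.
pose B := C1 * 2 `^ (e / 2 * i%:R) * (\I x, `|f x| `^ p).
have B0 : 0 <= B by rewrite !mulr_ge0 ?powR_ge0// ltW.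
have bT l j : B1 (Tl c n0 a b S l j f) by exact: alg_B1 (alg_Tl s c n0 ab S l j) bf.
have hU l : (\I x, nrm (idx N S) (fun j => Tl c n0 a b S l j f x) `^ p) <= B * w l `^ p.
 case: (Order.TotalTheory.arg_minP (P := [in S]) (fun g => m (l g)) g0S) => g gS gm.
 have hy : exists2 g', g' \in S & Num.min 1 (vl i K (l g')) <= m (l g) by exists g.
 have y01 : 0 < m (l g) <= 1 by rewrite mp mle.
 have HH := HC d s c n0 N a b i S l (m _) thn uS Sp y01 hy f bf.
 letr HH.
 rewrite mulrAC; apply: ler_wpM2l => //.
 via (((m (l g) `^ h) ^+ size S) `^ p).
  rewrite -[X in X `^ p]powR_mulrn ?powR_ge0// -!powRrM; apply: powR_exp_le => //.
  by rewrite mulrA; letr (hm _ uS); rewrite ge_min lexx.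
 apply: powR_mono; [pos|pos|].
 have -> : (m (l g) `^ h) ^+ size S = \prod_(g' <- S) m (l g) `^ h.
  by rewrite big_const_seq iter_mulr_1.
 rewrite big_seq [leRHS]big_seq; apply: ler_prod => g' g'S; rewrite powR_ge0 /=.
 by apply: powR_mono; [pos|pos|exact: gm].
have main : (\I x, nrm (idx N S) (fun j => sg (s := s) c n0 a b S finset.set0 j f x) `^ p) <= B * Ws `^ p.
 apply: IIp_limit => //; first by move=> j; exact: alg_B1 (alg_sg s c n0 ab S _ j) bf.
 move=> dl dl0.
 pose A := (size S)%:R * (2 ^+ size S * (4 ^+ size S * (2 * (Cd + 2) + 2 ^+ (k * n) * 2)) * n2 f).
 have A0 : 0 <= A.
  by rewrite mulr_ge0// mulr_ge0 ?n2_ge0// mulr_ge0 ?exprn_ge0// mulr_ge0 ?exprn_ge0// addr_ge0// mulr_ge0 ?addr_ge0.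
 (* L = K (i + t) makes [L %/ K - i] equal to t, so both error terms are at most a constant times
    2^(-t). *)
 have [t ht] := small_pow2 A0 dl0; pose L := (K * (i + t))%N.
 exists (fun j x => \sum_(l <- lbox L S) Tl c n0 a b S l j f x); split.
 - by move=> j; apply: B1_sum => l.
 - apply: IIp_sum => //; pos.
 move=> j; have aA := alg_sg s c n0 ab S finset.set0 j.
 have bd l : Bm (dd c n0 S l j f) by exact: alg_Bm (alg_dd s c n0 S l j) (B1_Bm bf).
 have -> : (fun x => sg c n0 a b S finset.set0 j f x - \sum_(l <- lbox L S) Tl c n0 a b S l j f x) =
   fun x => sg c n0 a b S finset.set0 j f x - sg c n0 a b S finset.set0 j (Ww c n0 L S j f) x.
  by rewrite (Ww_dd c n0 L j uS (B1_Bm bf)) alg_sum.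
 letr (Ww_err c n0 L j thn Sp (fun g h => h) bf); apply: le_trans ht.
 rewrite -!mulrA; apply: ler_wpM2l => //; apply: ler_wpM2l => //.
 apply: ler_wpM2l => //.
 rewrite [n2 f / _]mulrC [leRHS]mulrA; apply: ler_wpM2r; first exact: n2_ge0.
 have hL : 2 ^- L <= 2 ^- t :> R by apply: pow2N_le; rewrite (leq_trans (leq_addl i t))// leq_pmull.
 rewrite mulKn// addKn [leRHS]mulrDl; apply: lerD; first by rewrite mulrA.
 by rewrite mulrA; apply: ler_wpM2l => //.
letr main; rewrite mulrAC; apply: ler_wpM2r => //.
via (Cf * 2 `^ (e * i%:R)); last by apply: ler_wpM2r => //; rewrite lerDl.
have -> : e * i%:R = e / 2 * i%:R + e / 2 * i%:R by rewrite -mulrDl -splitr.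
rewrite powRD ?pnatr_eq0 ?implybT// /Cf; set Yh := 2 `^ (e / 2 * i%:R).
have hW : Ws `^ p <= ((W + 1) ^+ m0) `^ p * Yh.
 rewrite /Ws exprMn powRM ?exprn_ge0 ?(ltW W0)//.
 apply: ler_pM; rewrite ?powR_ge0//.
  apply: powR_mono; rewrite ?exprn_ge0 ?(ltW p0) ?(ltW W0)//.
  via ((W + 1) ^+ size S).
   by apply: lerXn2r; rewrite ?nnegrE ?addr_ge0 ?(ltW W0)// lerDl.
  by apply: ler_weXn2l; [rewrite lerDr ltW|exact: size_Ix].
 rewrite -[X in X `^ p]powR_mulrn ?powR_ge0// -!powRrM; apply: ler_powR; first by rewrite ler1n.
 have E (y1 y2 y3 y4 : R) : y1 * y2 * (y3 * y4) = y1 * y3 * y4 * y2 by clear; ring.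
 rewrite E; apply: ler_wpM2r => //.
 by letr (hm _ uS); rewrite ge_min lexx orbT.
have C1Y : 0 <= C1 * Yh by rewrite mulr_ge0 ?powR_ge0// ltW.
letr (ler_wpM2l C1Y hW); apply: le_of_eq.
ring.
Qed.

Lemma TLB_2 : TLB 2.
exists 2 => // e e0; exists ((CD (k := k) (n := n) Cd m0 * 2 ^+ m0) ^+ 2 + 1).
 by rewrite ltr_wpDl// sqr_ge0.
move=> d s c n0 N a b i S l y thn uS Sp /andP[y0 y1] hy f bf.
letr (Tl_sq2' c n0 N thn uS Sp (ltW y0) hy bf).
apply: ler_wpM2r; first exact: II_ge0 => x.
have -> : y `^ 2 = y ^+ 2 by rewrite powR_mulrn// ltW.
apply: ler_wpM2r; first pos.
via ((CD (k := k) (n := n) Cd m0 * 2 ^+ m0) ^+ 2 + 1); first by rewrite lerDl.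
by rewrite ler_peMr ?addr_ge0 ?sqr_ge0//; apply: powR2_ge1; rewrite mulr_ge0// ltW.
Qed.

(** Monomials are moved from F to S one at a time. Each move leaves a piece with larger S and a term
    to which the positive operator [Hg g] is applied, whose maximal function is bounded. Once F is
    exhausted, the supremum over j is at most the l^2 norm over j. *)
Lemma SQ_MB (p : R) : 1 < p -> SQ k n p -> MB k n p.
move=> p1 hSQ e e0; have [C C0 HC] := hSQ e e0; have [D D0 HD] := maxb_H k n p1.
have p1' := ltW p1.
pose sl (L : seq (Ix k n)) := foldr (fun g F => (g |: F)%SET) finset.set0 L.
have in_sl g L : (g \in sl L) = (g \in L).
 by elim: L => [|g' L IH] /=; rewrite ?finset.in_set0// in_setU1 IH.
pose E := 2 `^ p * (1 + D).
have E1 : 1 <= E.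
 rewrite -[leLHS]mulr1; apply: ler_pM => //; last by rewrite lerDl ltW.
 by apply: powR2_ge1; exact: le_trans p1'.
have E0 : 0 <= E by exact: le_trans E1.
exists (E ^+ m0 * C); first pos.
move=> d s c n0 N a b i F thn Fp; have [ab _ _ _] := thn.
set Y := 2 `^ (e * i%:R); have Y0 : 0 <= Y by exact: powR_ge0.
have If0 f : 0 <= II (fun x : sX s => `|f x| `^ p) by apply: II_ge0 => x; pos.
have H L : forall S, uniq (L ++ S) -> (forall g, g \in L ++ S -> (0 < mdeg g)%N) -> forall f, B1 f ->
  exists G : sX s -> R, [/\ B1 G, forall x, 0 <= G x,
   forall (j : {ffun Ix k n -> 'I_N.+1}) x, `|sg c n0 a b S (sl L) j f x| <= G x &
   (\I x, G x `^ p) <= E ^+ size L * (C * Y) * (\I x, `|f x| `^ p)].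
 elim: L => [|g L IH] S uS Sp f bf.
  exists (fun x => nrm (idx N S) (fun j => sg c n0 a b S finset.set0 j f x)); split.
  - by apply: B1_nrm => j; exact: alg_B1 (alg_sg s c n0 ab S _ j) bf.
  - by move=> x; pos.
  - move=> j x; rewrite (@sg_local _ _ _ _ s c n0 N a b S _ j [ffun g => if g \in S then j g else ord0]).
    by apply: (nrm_mem (fun j => sg c n0 a b S finset.set0 j f x)); exact: idx_mem.
   by move=> g; rewrite finset.in_set0 orbF ffunE => ->.
  by rewrite mul1r; exact: HC.
 have uS1 : uniq (L ++ g :: S) by move: uS; rewrite /= !cat_uniq /= negb_or mem_cat negb_or -andbA => /and5P[-> -> -> -> ->].
 have Sp1 g' : g' \in L ++ g :: S -> (0 < mdeg g')%N.
  by move=> h; apply: Sp; move: h; rewrite !mem_cat -orbA orbCA.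
 have [G1 [bG1 G10 hG1 I1]] := IH (g :: S) uS1 Sp1 f bf.
 have uS2 : uniq (L ++ S) by case/andP: uS.
 have Sp2 g' : g' \in L ++ S -> (0 < mdeg g')%N by move=> h; apply: Sp; rewrite inE h orbT.
 have [G2 [bG2 G20 hG2 I2]] := IH S uS2 Sp2 f bf.
 have [G3 [bG3 G30 hG3 I3]] := HD d s c n0 N g G2 bG2 G20.
 exists (fun x => G1 x + G3 x); split.
 - exact: B1D.
 - by move=> x; rewrite addr_ge0.
 - move=> j x; have aS := alg_sg s c n0 ab S (sl L) j; have bS := alg_Bm aS (B1_Bm bf).
  have -> : sg c n0 a b S (sl (g :: L)) j f x = sg c n0 a b (g :: S) (sl L) j f x + sg c n0 a b S (sl L) j (Hg c n0 g j f) x.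
   by rewrite subrK.
  rewrite (alg_com aS (alg_Hg s c n0 g j) (B1_Bm bf)).
  letr (ler_normD _ _); apply: lerD => //.
  have mH := markov_Hg s c n0 g j.
  letr (mk_abs mH x bS); apply: le_trans (hG3 j x).
  by apply: mk_le => //; [exact: Bm_norm|exact: B1_Bm].
 letr (IIp_add p1' bG1 bG3 (B1D bG1 bG3) G10 G30 _).
  by move=> x; rewrite lexx addr_ge0.
 letr (ler_wpM2l (powR_ge0 _ _) (lerD I1 (le_trans I3 (ler_wpM2l (ltW D0) I2)))).
 rewrite exprS /E; move: (2 `^ p) (_ ^+ _) (II _) (C * Y) => y1 y2 y3 y4.
 by apply: le_of_eq; ring.
move=> f bf f0.
have Fe : sl (enum F) = F by apply/finset.setP => g; rewrite in_sl mem_enum.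
have uF : uniq (enum F ++ [::]) by rewrite cats0 enum_uniq.
have FF g : g \in enum F ++ [::] -> (0 < mdeg g)%N by rewrite cats0 mem_enum; exact: Fp.
have [G [bG G0 hG IG]] := H (enum F) [::] uF FF f bf.
exists G; split; [exact: bG|exact: G0| |].
 by move=> j x; have := hG j x; rewrite Fe; apply: le_trans; exact: ler_norm.
have -> : (fun x => f x `^ p) = fun x => `|f x| `^ p by ext x; rewrite ger0_norm.
letr IG; apply: ler_wpM2r => //.
rewrite -mulrA; apply: ler_wpM2r; first pos.
by apply: ler_weXn2l => //; apply: size_Ix; exact: enum_uniq.
Qed.

(* Square function bounds for exponents down to [1 + x] give maximal, hence vector-valued, bounds that extend them
  to exponents above [2 q / (q + 1)], [q = 1 + x]. *)
Lemma SQ_le2 m (p : R) : 1 + (3 / 4) ^+ m <= p <= 2 -> SQ k n p.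
have S2 : SQ k n (2 : R) by apply: SQ_TLB TLB_2; rewrite ltr1n.
elim: m p => [|m IH] p /andP[hp p2].
 have -> : p = 2 by apply/eqP; rewrite eq_le p2.
 exact: S2.
have [->//|pn] := eqVneq p 2.
have p2' : p < 2 by rewrite lt_neqAle pn.
move: hp; rewrite exprS; set x := (3 / 4) ^+ m => hp.
have x0 : 0 < x by rewrite exprn_gt0.
have x1 : x <= 1 by rewrite exprn_ile1// ler_pdivrMr// mul1r ler_nat.
have q1 : 1 < 1 + x by rewrite ltrDl.
have hM : MB k n (1 + x) by apply: SQ_MB => //; apply: IH; rewrite lexx; lra.
have p'1 : 1 < 2 * (1 + x) / (1 + x + 1) by rewrite ltr_pdivlMr; lra.
apply: SQ_TLB; first by apply: lt_le_trans hp; rewrite ltrDl mulr_gt0.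
apply: (Tl_interp p'1 _ (FS_lt2 q1 hM) (FH_lt2 k n q1)); left; split => //.
apply: lt_le_trans hp; rewrite ltr_pdivrMr; last by lra.
nra.
Qed.

(** For p > 2 one interpolates between 2 and 2 p >= 4. The vector-valued bound there needs a maximal
    bound only at 2 p / (2 p - 2) <= 2, which the first case provides. *)
Lemma SQ_all (p : R) : 1 < p -> SQ k n p.
have H (q : R) : 1 < q -> q <= 2 -> SQ k n q.
 move=> q1 q2; have q0 : 0 < q - 1 by rewrite subr_gt0.
 have [t ht] := small_pow2 ler01 q0; apply: (@SQ_le2 (3 * t)); rewrite q2 andbT -lerBrDl.
 apply: le_trans ht; rewrite mul1r exprM -exprVn; apply: lerXn2r; rewrite ?nnegrE ?invr_ge0//.
 lra.
move=> p1; have [p2|p2] := leP p 2; first exact: H.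
have p4 : 4 <= 2 * p by lra.
have q1 : 1 < 2 * p / (2 * p - 2) by rewrite ltr_pdivlMr; lra.
have q2 : 2 * p / (2 * p - 2) <= 2 by rewrite ler_pdivrMr; lra.
have hM := SQ_MB q1 (H _ q1 q2).
apply: SQ_TLB => //; apply: (Tl_interp _ _ (FS_ge4 p4 hM) (FH_ge4 k n p4)); first by lra.
by right.
Qed.

End square_function.

Theorem square_function_bound (R : realType) k n (p : R) : 1 < p -> SQ k n p.
move=> p1; have [K [C C0 HC]] := @decay R k n.
(* K + 1 in place of K, since K serves as a divisor. *)
apply: (@SQ_all _ k n K.+1 C) => // g g0 d s F c a b m i h f gF ab a0 b2 sd bf hh.
apply: HC => //; letr hh; apply: pow2N_le; exact: leq_mul.
Qed.

Lemma mk_dom R d (s : dsys R d) A (f g : sX s -> R) x : markov A -> B1 f -> B1 g -> (forall y, `|f y| <= g y) -> `|A f x| <= A g x.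
move=> mA bf bg h; letr (mk_abs mA x (B1_Bm bf)).
by apply: mk_le => //; [exact/Bm_norm/B1_Bm|exact: B1_Bm].
Qed.

Lemma telescope_eq (R : realType) (x y z : R) : x - z = (x - y) + (y - z).
lra. Qed.

Lemma comm_diff R d (s : dsys R d) A A' B B' (f : sX s -> R) x :
 alg A -> alg A' -> alg B -> alg B' -> Bm f ->
 A (B f) x - A' (B' f) x = A (fun y => B f y - B' f y) x + B' (fun y => A f y - A' f y) x.
move=> aA aA' aB aB' bf; rewrite (algB aA (alg_Bm aB bf) (alg_Bm aB' bf)) (algB aB' (alg_Bm aA bf) (alg_Bm aA' bf)).
by rewrite (alg_com aB' aA bf) (alg_com aB' aA' bf) -telescope_eq.
Qed.

Lemma sqr_sum_le (R : realType) (x y : R) : 0 <= x -> 0 <= y -> x ^+ 2 + 9 * y ^+ 2 <= (x + 3 * y) ^+ 2.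
nra. Qed.

(** * Oscillation along chains of grid points *)

Section grid.
Context (k n : nat) (r0 N nb : nat).
Implicit Types (m : 'I_k -> nat) (g : Ix k n).

Definition lem m m' := forall l, (m l <= m' l)%N.
(** A coordinate [m l] stands for the side 2^q (1 + s 2^(-r0)), with q and s its quotient and
    remainder by 2^r0; [ex] is the power of 2 by which the monomial g is dilated. It is monotone in
    m, so chains of boxes give chains of scales. *)
Definition ex g m : nat := (\sum_l g l * (m l %/ 2 ^ r0))%N.
Definition dom m := forall g, (ex g m <= N)%N.

Lemma ex_mono g m m' : lem m m' -> (ex g m <= ex g m')%N.
by move=> h; apply: leq_sum => l _; rewrite leq_mul2l leq_div2r ?orbT. Qed.

Lemma dom_le m m' : lem m m' -> dom m' -> dom m.
by move=> h h' g; apply: leq_trans (h' g); exact: ex_mono. Qed.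

Lemma lem_trans m1 m2 m3 : lem m1 m2 -> lem m2 m3 -> lem m1 m3.
by move=> h1 h2 l; exact: leq_trans (h2 l). Qed.

Context {R : realType} {d : nat}.
Notation PT := ('I_k -> nat).

(** A majorant per block instead of a supremum over the block: majorants can be added and survive
    limits. *)
Definition oscb (s : dsys R d) (ch : nat -> PT) (Y : PT -> sX s -> R) (p B : R) :=
 exists G : 'I_nb -> sX s -> R, [/\ forall t, B1 (G t),
  forall (t : 'I_nb) m x, lem (ch t) m -> lem m (ch t.+1) -> `|Y m x - Y (ch t) x| <= G t x &
  (\I x, nrm (index_enum 'I_nb) (G^~ x) `^ p) <= B].

Definition chain (ch : nat -> PT) := (forall t, lem (ch t) (ch t.+1)) /\ forall t, dom (ch t).

Definition PH (s : dsys R d) (c : coef R k n d) P m (f : sX s -> R) : sX s -> R :=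
 foldr (fun g h => Hop (c g) (0 + (ex g m)%:Z) h) f P.

Lemma PH_cons s c g P m (f : sX s -> R) : PH c (g :: P) m f = Hop (c g) (0 + (ex g m)%:Z) (PH c P m f).
by []. Qed.

Lemma alg_PH s c P m : alg (PH (s := s) c P m).
by elim: P => [|g P IH]; [exact: alg_id|exact: alg_comp (alg_H s _ _) IH]. Qed.

Lemma markov_PH s c P m : markov (PH (s := s) c P m).
by elim: P => [|g P IH] => //; exact: markov_comp (markov_H s _ _) IH. Qed.

End grid.

Lemma chain_mono k n r0 N ch : chain (k := k) n r0 N ch -> forall t u, (t <= u)%N -> lem (ch t) (ch u).
move=> [h _] t u; elim: u => [|u IH]; first by rewrite leqn0 => /eqP->.
rewrite leq_eqVlt => /orP[/eqP->//|]; rewrite ltnS => /IH h' l; exact: leq_trans (h u l).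
Qed.

Lemma PH_max (R : realType) k n p P : 1 < p -> exists2 C : R, 0 < C &
 forall r0 N d s (c : coef R k n d) J r f, (forall j, B1 (f j)) ->
 exists G : J -> sX s -> R, [/\ forall j, B1 (G j), forall j m x, dom n r0 N m -> `|PH r0 c P m (f j) x| <= G j x &
  (\I x, nrm r (G^~ x) `^ p) <= C * (\I x, nrm r (f^~ x) `^ p)].
move=> p1; have [C C0 HC] := @H_max R p p1; elim: P => [|g P [D D0 HD]].
 exists 1 => // r0 N d s c J r f bf; exists (fun j x => `|f j x|); split => //.
  by move=> j; exact: B1_norm.
 by rewrite mul1r; apply: le_of_eq; congr II; ext x; rewrite nrm_abs.
exists (C * D); first pos.
move=> r0 N d s c J r f bf; have [G [bG hG IG]] := HD r0 N d s c J r f bf.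
have [G' [bG' hG' IG']] := HC d s (c g) 0 N J r G bG; exists G'; split; [by []| |].
 2: by letr IG'; rewrite -mulrA; apply: ler_wpM2l; [pos|exact: IG].
move=> j m x dm; apply: le_trans (hG' j _ x (dm g)); apply: le_trans (ler_norm _).
rewrite PH_cons; have bP := alg_B1 (alg_PH r0 s c P m) (bf j).
exact: mk_dom x (markov_H s _ _) bP (bG j) (fun y => hG j m y dm).
Qed.

(** Product rule: two products of H differ by changing one factor at a time, while the other factors
    are positive operators with bounded maximal functions. *)
Lemma PH_osc (R : realType) k n p P : 1 < p -> exists2 C : R, 0 < C &
 forall r0 N nb d s (c : coef R k n d) J r f ch,
 (forall j, B1 (f j)) -> chain n r0 N ch ->
 exists G : 'I_nb * J -> sX s -> R, [/\ forall u, B1 (G u),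
  forall (t : 'I_nb) j m x, lem (ch t) m -> lem m (ch t.+1) -> `|PH r0 c P m (f j) x - PH r0 c P (ch t) (f j) x| <= G (t, j) x &
  (\I x, nrm [seq (t, j) | t <- index_enum 'I_nb, j <- r] (G^~ x) `^ p) <= C * (\I x, nrm r (f^~ x) `^ p)].
move=> p1; have p1' := ltW p1; have [C C0 HC] := @H_max R p p1; have [E E0 HE] := @H_osc R p p1.
elim: P => [|g P [D D0 HD]].
 exists 1 => // r0 N nb d s c J r f ch bf _; exists (fun _ _ => 0); split.
 - by move=> u; exact: B1_0.
 - by move=> t j m x _ _; rewrite subrr normr0.
 rewrite mul1r (_ : (fun x => _) = fun=> 0) ?II0; first by apply: II_ge0 => x; pos.
 by rewrite nrm0 powR0// gt_eqF// (lt_trans ltr01).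
have [M M0 HM] := PH_max P p1.
exists (2 `^ p * (C * D + M * E)); first pos.
move=> r0 N nb d s c J r f ch bf hch; set r2 := [seq (t, j) | t <- _, j <- r].
have [G1 [bG1 hG1 IG1]] := HD r0 N nb d s c J r f ch bf hch.
have [G2 [bG2 hG2 IG2]] := HC d s (c g) 0 N _ r2 G1 bG1.
have th : {homo (fun t => ex r0 g (ch t)) : t u / (t <= u)%N}.
 by move=> t u tu; apply: ex_mono; exact: (chain_mono hch).
have tN t : (ex r0 g (ch t) <= N)%N by case: hch => _ h; exact: h.
have [G3 [bG3 hG3 IG3]] := HE d s (c g) 0 N J r f nb (fun t => ex r0 g (ch t)) bf th tN.
have [G4 [bG4 hG4 IG4]] := HM r0 N d s c _ r2 G3 bG3.
exists (fun u x => G2 u x + G4 u x); split.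
- by move=> u; exact: B1D.
- move=> t j m x h1 h2.
 have dm : dom n r0 N m by apply: (dom_le h2); case: hch.
 have dt : dom n r0 N (ch t) by case: hch.
 have aP m' := alg_PH r0 s c P m'.
 have bP m' := alg_B1 (aP m') (bf j).
 have aH e := alg_H s (c g) e.
 have -> : PH r0 c (g :: P) m (f j) x - PH r0 c (g :: P) (ch t) (f j) x =
   Hop (c g) (0 + (ex r0 g m)%:Z) (fun y => PH r0 c P m (f j) y - PH r0 c P (ch t) (f j) y) x +
   PH r0 c P (ch t) (fun y => Hop (c g) (0 + (ex r0 g m)%:Z) (f j) y - Hop (c g) (0 + (ex r0 g (ch t))%:Z) (f j) y) x.
  by exact: comm_diff x (aH _) (aH _) (aP m) (aP _) (B1_Bm _).
 letr (ler_normD _ _); apply: lerD.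
  apply: le_trans (hG2 _ _ x (dm g)); apply: le_trans (ler_norm _).
  by apply: mk_dom; [exact: markov_H|exact: B1B (bP _) (bP _)|by []|move=> y; exact: hG1].
 apply: le_trans (hG4 _ _ x dt); apply: le_trans (ler_norm _).
 apply: mk_dom; [exact: markov_PH|by apply: B1B; exact: alg_B1 (aH _) (bf j)|by []|].
 by move=> y; apply: hG3; apply/andP; split; exact: ex_mono.
have n0 (F : 'I_nb * J -> sX s -> R) x : 0 <= nrm r2 (F^~ x) by exact: nrm_ge0.
letr (IIp_add p1' (B1_nrm r2 bG2) (B1_nrm r2 bG4) (B1_nrm r2 (fun u => B1D (bG2 u) (bG4 u))) (n0 _) (n0 _) _).
 by move=> x; rewrite nrm_ge0 nrmD.
rewrite -[leRHS]mulrA; apply: ler_wpM2l; first pos.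
rewrite mulrDl; apply: lerD.
 by letr IG2; rewrite -mulrA; exact: (ler_wpM2l (ltW C0) IG1).
by letr IG4; rewrite -mulrA; exact: (ler_wpM2l (ltW M0) IG3).
Qed.

(** If both ends of a block have the same key, so has the whole block; then only the factor [PH]
    varies, and [PH_osc] applies. Otherwise the oscillation is at most twice the l^2 norm of the
    maximal values over all keys met in the block. The fibres of [ky] are order-convex, so each key
    is met in at most two such blocks. *)
Lemma key_osc (R : realType) k n p P : 1 < p -> exists2 C : R, 0 < C &
 forall r0 N nb d s (c : coef R k n d) (J : eqType) (r : seq J) (u : J -> sX s -> R) ch ky Y,
 (forall j, B1 (u j)) -> chain n r0 N ch -> (forall m, dom n r0 N m -> ky m \in r) ->
 (forall m1 m2 m3, dom n r0 N m3 -> lem m1 m2 -> lem m2 m3 -> ky m1 = ky m3 -> ky m2 = ky m1) ->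
 (forall m, dom n r0 N m -> Y m = PH r0 c P m (u (ky m))) ->
 oscb nb ch Y p (C * (\I x, nrm r (u^~ x) `^ p)).
move=> p1; have p1' := ltW p1; have p0 : 0 <= p by exact: le_trans p1'.
have [C1 C10 H1] := PH_max P p1; have [C2 C20 H2] := PH_osc P p1.
exists (2 `^ p * (C2 + 3 `^ p * C1)); first pos.
move=> r0 N nb d s c J r u ch ky Y bu hch kr kc kY.
have cm := chain_mono hch; have cd t : dom n r0 N (ch t) by case: hch.
have [G1 [bG1 hG1 IG1]] := H1 r0 N d s c J r u bu.
have [G2 [bG2 hG2 IG2]] := H2 r0 N nb d s c J r u ch bu hch.
pose vis t j := `[< exists m, [/\ lem (ch t) m, lem m (ch t.+1) & ky m = j] >].
pose ta t := ky (ch t) == ky (ch t.+1).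
pose G (t : 'I_nb) x := if ta t then G2 (t, ky (ch t)) x else 2 * nrm [seq j <- r | vis t j] (G1^~ x).
have bG t : B1 (G t) by rewrite /G; case: (ta t) => //; apply: B1Z; exact: B1_nrm.
have cS t : lem (ch t) (ch t.+1) by apply: cm.
have vism t m x : dom n r0 N m -> lem (ch t) m -> lem m (ch t.+1) ->
  `|PH r0 c P m (u (ky m)) x| <= nrm [seq j <- r | vis t j] (G1^~ x).
 move=> dm h1 h2; letr (hG1 _ _ x dm); letr (ler_norm _).
 apply: nrm_mem; rewrite mem_filter kr// andbT.
 by apply/asboolP; exists m.
exists G; split => //.
 move=> t m x h1 h2; have dm : dom n r0 N m by exact: dom_le.
 rewrite !kY// /G; case: ifPn => [/eqP e|_].
  have -> : ky m = ky (ch t) by exact: kc.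
  exact: hG2.
 rewrite mulr_natl; letr (ler_normB _ _); apply: lerD; first exact: vism.
 exact: vism.
(* The squared factor 2^2 and two blocks per key give 8, which is below 3^2. *)
have key x : nrm (index_enum 'I_nb) (G^~ x) <= nrm [seq (t, j) | t <- index_enum 'I_nb, j <- r] (G2^~ x) + 3 * nrm r (G1^~ x).
 rewrite -(@ler_pXn2r _ 2) ?nnegrE ?addr_ge0 ?mulr_ge0 ?nrm_ge0//.
 apply: le_trans (sqr_sum_le (nrm_ge0 _ _) (nrm_ge0 _ _)).
 rewrite !nrm_sqr big_allpairs_dep /=.
 via (\sum_(t < nb) (\sum_(j <- r) G2 (t, j) x ^+ 2 + 2 ^+ 2 * \sum_(j <- r) (if ~~ ta t && vis t j then G1 j x ^+ 2 else 0))).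
  apply: ler_sum => t _; rewrite /G; case: ifPn => [_|h] /=.
   rewrite big1_eq mulr0 addr0 -nrm_sqr.
   have := nrm_mem (fun j => G2 (t, j) x) (kr _ (cd t)) => hh.
   by rewrite -[leLHS]real_normK ?num_real//; apply: lerXn2r; rewrite ?nnegrE ?nrm_ge0.
  rewrite exprMn nrm_sqr big_filter big_mkcond /=.
  by rewrite lerDr; pos.
 rewrite big_split lerD2l -mulr_sumr exchange_big /=.
 via (2 ^+ 2 * \sum_(j <- r) 2 * G1 j x ^+ 2); last first.
  rewrite -mulr_sumr mulrA; apply: ler_wpM2r; last by rewrite -natrX -natrM ler_nat.
  pos.
 apply: ler_wpM2l => //; apply: ler_sum => j _.
 rewrite -big_mkcond sumr_const -[leLHS]mulr_natl; apply: ler_wpM2r; first pos.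
 pose S : pred 'I_nb := fun t => ~~ ta t && vis t j.
 suff : (#|S| <= 2)%N by rewrite -(ler_nat R).
 (* Between two visits of the fibre of [j] all points of the chain lie in that fibre. *)
 have btw (t1 t2 t3 : 'I_nb) : S t1 -> S t3 -> (t1 < t2)%N -> (t2 < t3)%N -> ta t2.
  move=> /andP[_ /asboolP[m1 [h1 h2 e1]]] /andP[_ /asboolP[m3 [h3 h4 e3]]] t12 t23.
  have dm : dom n r0 N m3 by exact: dom_le.
  have K u' : (t1 < u')%N -> (u' <= t3)%N -> ky (ch u') = j.
   move=> q1 q2; rewrite -e1; apply: (kc _ _ m3) => //; last by rewrite e1.
    exact: lem_trans h2 (cm _ _ q1).
   exact: lem_trans (cm _ _ q2) h3.
  by rewrite /ta K ?(ltnW t23)// K// (leq_trans t12).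
 have [t0 St0|S0] := pickP S; last by rewrite eq_card0.
 case: (arg_minnP (fun t : 'I_nb => t : nat) St0) => t1 S1 min1.
 case: (arg_maxnP (fun t : 'I_nb => t : nat) St0) => t3 S3 max3.
 apply: (@leq_trans #|[set t1; t3]%SET|); last by rewrite cards2; case: eqP.
 apply: subset_leq_card; apply/fintype.subsetP => t2 S2; rewrite in_set2.
 have := min1 t2 S2; rewrite leq_eqVlt => /orP[/eqP e|t12]; first by apply/orP; left; apply/eqP/val_inj.
 have := max3 t2 S2; rewrite /= leq_eqVlt => /orP[/eqP e|t23]; first by apply/orP; right; apply/eqP/val_inj.
 by have := btw t1 t2 t3 S1 S3 t12 t23; move: S2 => /andP[/negbTE-> _].
letr (IIp_add p1' (B1_nrm [seq (t, j) | t <- index_enum 'I_nb, j <- r] bG2) (B1Z 3 (B1_nrm r bG1)) (B1_nrm _ bG) _ _ _).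
- by move=> x; pos.
- by move=> x; rewrite mulr_ge0// nrm_ge0.
- by move=> x; rewrite nrm_ge0 key.
rewrite -[leRHS]mulrA; apply: ler_wpM2l; first pos.
rewrite mulrDl; apply: lerD => //.
have -> : (fun x => (3 * nrm r (G1^~ x)) `^ p) = fun x => 3 `^ p * nrm r (G1^~ x) `^ p.
 by ext x; rewrite powRM ?nrm_ge0.
by rewrite IIZ; [rewrite -mulrA; apply: ler_wpM2l => //; pos|exact: B1_nrmp].
Qed.

(** * From dyadic to finer boxes: differences in the binary digits *)

Section dyadic_points.
Context {R : realType}.
Implicit Types (i q : nat).

Definition pt i q : R := 1 + q%:R / 2 ^+ i.

Lemma pt_ge1 i q : 1 <= pt i q :> R. Proof. by rewrite lerDl. Qed.

Lemma pt_lt2 i q : (q < 2 ^ i)%N -> pt i q < 2 :> R.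
by rewrite ltrD2l ltr_pdivrMr ?exprn_gt0// mul1r -natrX ltr_nat. Qed.

Lemma pt_half i q : pt i.+1 q = pt i q./2 + (odd q)%:R * 2 ^- i.+1 :> R.
rewrite /pt -[in LHS](odd_double_half q) natrD -muln2 natrM exprS invfM.
lra.
Qed.

Lemma pt0 i : pt i 0 = 1 :> R. Proof. by rewrite /pt mul0r addr0. Qed.

End dyadic_points.

Section boxes.
Context {R : realType} {k n d : nat} (s : dsys R d) (c : coef R k n d) (N : nat).
Notation X := (sX s).
Notation J := {ffun Ix k n -> 'I_N.+1}.
Implicit Types (f : X -> R) (S : seq (Ix k n)) (F : {set Ix k n}) (j : J) (a b : 'I_k -> R) (ps : seq 'I_k) (q i : 'I_k -> nat).

Lemma sg_split S F j a b l z f x : lt_box a b -> a l < z < b l -> Bm f ->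
 (b l - a l) * sg c 0 a b S F j f x = (z - a l) * sg c 0 a (upd b l z) S F j f x + (b l - z) * sg c 0 (upd a l z) b S F j f x.
move=> ab hz bf; elim: S F f bf => [|g S IH] F f bf.
 by apply: av_split => //; apply: Bt_slice => //; exact: mp_mpol.
rewrite mulrBr IH// IH; last exact: alg_Bm (alg_Hg s c 0 g j) bf.
by rewrite !mulrBr addrACA opprD.
Qed.

(* A box average does not depend on the sides of the box in the directions that do not occur in the monomials. *)
Lemma sg_indep (P : pred 'I_k) S F j b f x : lt_box (fun=> 0) b -> (forall g l, (g \in S) || (g \in F) -> (0 < g l)%N -> P l) -> Bm f ->
 sg c 0 (fun=> 0) b S F j f x = sg c 0 (fun=> 0) (fun l => if P l then b l else 1) S F j f x.
move=> ab + bf; elim: S F f bf => [|g S IH] F f bf hP.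
 pose al l := if P l then 1 else (b l)^-1.
 have al0 l : 0 < al l by rewrite /al; case: ifP => // _; rewrite invr_gt0.
 have bF : Bt (fun t => f (sT (mpol F (cj c 0 j) t) x)) by apply: Bt_slice => //; exact: mp_mpol.
 have := av_affine ab (fun=> 0) al0 bF; rewrite /sg /AF /Av => h.
 transitivity (av (fun=> 0) b (fun t => f (sT (mpol F (cj c 0 j) (affmap al (fun=> 0) t)) x))).
  apply: av_eq => t _; congr (f (sT _ x)); ext u; apply: eq_bigr => g gF; congr (_ * _).
  apply: eq_bigr => l _; rewrite tnth_mktuple addr0.
  have [->|gl] := posnP (g l) => //.
  by rewrite /al (hP g) ?orbT// mul1r.
 rewrite h; congr av; ext l; rewrite /al; first by rewrite mulr0 addr0.
 by rewrite addr0; case: ifP => _; rewrite ?mul1r ?mulVf// gt_eqF.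
rewrite /= IH//; last first.
 move=> g' l h; apply: hP; move: h; rewrite in_setU1 inE => /or3P[->|->|->]; rewrite ?orbT//.
rewrite IH//; first exact: alg_Bm (alg_Hg s c 0 g j) bf.
by move=> g' l h; apply: hP; move: h; rewrite inE => /orP[->|->]; rewrite ?orbT.
Qed.

(** A mixed difference: in each direction of [ps] the side with [i l] binary digits is compared with
    the side with one digit less, whose numerator is half of q. At level 0 nothing is subtracted, so
    the sum over the levels telescopes to the full side. *)
Fixpoint Kz S ps i q a b j f (x : X) : R :=
 if ps is l :: ps' then
  Kz S ps' i q a (upd b l (pt (i l) (q l))) j f x -
  (if i l is i'.+1 then Kz S ps' i q a (upd b l (pt i' (q l)./2)) j f x else 0)
 else sg c 0 a b S finset.set0 j f x.

Lemma lt_box_pt a b l (i' q' : nat) : lt_box a b -> a l < 1 -> lt_box a (upd b l (pt i' q')).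
by move=> ab al; apply: lt_box_updr => //; pos. Qed.

Lemma alg_Kz S ps i q a b j : lt_box a b -> (forall l, l \in ps -> a l < 1) -> alg (Kz S ps i q a b j).
elim: ps b => [|l ps IH] b ab h; first exact: alg_sg.
have al : a l < 1 by apply: h; rewrite inE eqxx.
have hp l' : l' \in ps -> a l' < 1 by move=> h'; apply: h; rewrite inE h' orbT.
rewrite /=; case: (i l) => [|i'].
 apply: alg_sub; first by apply: IH => //; exact: lt_box_pt.
 have : alg (fun f : X -> R => fun x => f x - f x) by apply: alg_sub; exact: alg_id.
 by congr alg; ext f; ext x; rewrite subrr.
by apply: alg_sub; apply: IH => //; exact: lt_box_pt.
Qed.

Lemma upd_upd b l z l' z' : l != l' -> upd (upd b l z) l' z' = upd (upd b l' z') l z.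
by move=> h; ext u; rewrite /upd; case: eqP => // ->; rewrite eq_sym (negbTE h). Qed.

Lemma Kz_split S ps i q a b j l z f x : lt_box a b -> (forall l', l' \in ps -> a l' < 1) -> l \notin ps -> a l < z < b l -> Bm f ->
 (b l - a l) * Kz S ps i q a b j f x = (z - a l) * Kz S ps i q a (upd b l z) j f x + (b l - z) * Kz S ps i q (upd a l z) b j f x.
elim: ps b => [|l' ps IH] b ab h lp hz bf; first exact: sg_split.
have al : a l' < 1 by apply: h; rewrite inE eqxx.
have hp u : u \in ps -> a u < 1 by move=> h'; apply: h; rewrite inE h' orbT.
move: lp; rewrite inE negb_or => /andP[ll lp].
have st (i' q' : nat) : (b l - a l) * Kz S ps i q a (upd b l' (pt i' q')) j f x =
  (z - a l) * Kz S ps i q a (upd (upd b l z) l' (pt i' q')) j f x + (b l - z) * Kz S ps i q (upd a l z) (upd b l' (pt i' q')) j f x.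
 have e : upd b l' (pt i' q') l = b l by rewrite upd_neq.
 by have := IH (upd b l' _) (lt_box_pt i' q' ab al) hp lp; rewrite e upd_upd 1?eq_sym//; apply.
rewrite [Kz _ _ _ _ a b]/= [Kz _ _ _ _ a (upd b l z)]/= [Kz _ _ _ _ (upd a l z) b]/=.
case: (i l') => [|i']; first by rewrite !subr0.
by rewrite !mulrBr !st opprD addrACA.
Qed.

Lemma Kz_ext S ps i q i' q' a b b' j j' f x :
 (forall l, l \in ps -> i l = i' l /\ q l = q' l) -> (forall l, l \notin ps -> b l = b' l) -> (forall g, g \in S -> j g = j' g) ->
 Kz S ps i q a b j f x = Kz S ps i' q' a b' j' f x.
move=> + + hj; elim: ps b b' => [|l ps IH] b b' hi hb /=.
 have -> : b = b' by ext l; exact: hb.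
 by congr (_ x); apply: sg_local => g; rewrite finset.in_set0 orbF; exact: hj.
have [-> ->] := hi l (mem_head _ _).
have hi' u : u \in ps -> i u = i' u /\ q u = q' u by move=> h; apply: hi; rewrite inE h orbT.
have hb' z u : u \notin ps -> upd b l z u = upd b' l z u.
 by rewrite /upd; case: eqP => // /eqP ul h; apply: hb; rewrite negb_or ul.
by congr (_ - _); [|case: (i' l) => // i0]; exact: IH _ _ hi' (hb' _).
Qed.

(** Lengthening [0, z] to [0, y] changes the average by the fraction (y - z)/y <= 2^(-i) of the
    difference between the averages over [z, y] and [0, z]. Every direction thus gains 2^(-p i); the
    slab [z, y] is the thin box that [SQ] has to admit. *)
Lemma Kz_sqb (p B : R) I S i q : 1 <= p -> 0 <= B ->
 (forall a b, thin a b I -> sqb (s := s) (idx N S) (fun j => sg c 0 a b S finset.set0 j) p B) ->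
 (forall l, (i l <= I)%N) -> (forall l, (q l < 2 ^ i l)%N) -> forall ps a b, uniq ps ->
 (forall l, 0 <= a l) -> (forall l, b l <= 2) -> lt_box a b -> (forall l, l \notin ps -> 2 ^- I <= b l - a l) -> (forall l, l \in ps -> a l = 0) ->
 sqb (idx N S) (Kz S ps i q a b) p (B * \prod_(l <- ps) (2 `^ (p + 1) * 2 `^ (- (p * (i l)%:R)))).
move=> p1 B0 hB iI q2; elim => [|l ps IH] a b; first by move=> _ a0 b2 ab sd _; rewrite big_nil mulr1; apply: hB; split => // l; exact: sd.
move=> /andP[lp up] a0 b2 ab sd ap f bf.
have p0 : 0 <= p by exact: le_trans p1.
have al : a l = 0 by apply: ap; rewrite inE eqxx.
have ap' u : u \in ps -> a u = 0 by move=> h; apply: ap; rewrite inE h orbT.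
have ap1 u : u \in ps -> a u < 1 by move=> h; rewrite ap'.
have al1 : a l < 1 by rewrite al.
set Q := B * \prod_(u <- ps) _ in IH *.
have Q0 : 0 <= Q by rewrite mulr_ge0//; pos.
have If0 : 0 <= (\I x, `|f x| `^ p) by apply: II_ge0 => x.
have sd2 e : (e <= I)%N -> 2 ^- I <= 2 ^- e :> R by exact: pow2N_le.
have sd1 : 2 ^- I <= 1 :> R by have := sd2 0 (leq0n _); rewrite invr1.
have ub z : z <= 2 -> forall u, upd b l z u <= 2 by move=> z2 u; rewrite /upd; case: eqP.
have upper (i' q' : nat) : (q' < 2 ^ i')%N -> sqb (idx N S) (Kz S ps i q a (upd b l (pt i' q'))) p Q.
 move=> h; apply: IH => //; [by apply: ub; exact/ltW/pt_lt2|exact: lt_box_pt|].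
 move=> u us; rewrite /upd; case: eqP => [->|/eqP ul]; last by apply: sd; rewrite negb_or ul.
 by rewrite al subr0 (le_trans sd1)// pt_ge1.
rewrite big_cons mulrCA -/Q.
have bK (i' q' : nat) j := alg_B1 (alg_Kz S i q j (lt_box_pt i' q' ab al1) ap1) bf.
case il: i => [|i'].
 have -> : (fun x => nrm (idx N S) (fun j => Kz S (l :: ps) i q a b j f x) `^ p) =
   fun x => nrm (idx N S) (fun j => Kz S ps i q a (upd b l (pt (i l) (q l))) j f x) `^ p.
  by ext x; congr (nrm _ _ `^ p); ext j; rewrite /= il subr0.
 letr (upper _ _ (q2 l) f bf); apply: ler_wpM2r => //.
 by rewrite ler_peMl// mulr0 oppr0 powRr0 mulr1 powR2_ge1// addr_ge0.
have KE x j : Kz S (l :: ps) i q a b j f x = Kz S ps i q a (upd b l (pt i'.+1 (q l))) j f x - Kz S ps i q a (upd b l (pt i' (q l)./2)) j f x.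
 by rewrite /= il.
have q2' : (q l < 2 ^ i'.+1)%N by rewrite -il.
set z := pt i' (q l)./2 in KE; set y := pt i'.+1 (q l) in KE.
have zy : y = z + (odd (q l))%:R * 2 ^- i'.+1 by exact: pt_half.
(* An even numerator adds no digit, and the difference vanishes. *)
have [oq|eq] := boolP (odd (q l)); last first.
 have -> : (fun x => nrm (idx N S) (fun j => Kz S (l :: ps) i q a b j f x) `^ p) = fun=> 0.
  ext x; rewrite (_ : (fun j => _) = fun=> 0) ?nrm0 ?powR0 ?gt_eqF ?(lt_le_trans ltr01)//.
  by ext j; rewrite KE zy (negbTE eq) mul0r addr0 subrr.
 by rewrite II0 mulr_ge0// mulr_ge0.
rewrite oq mul1r in zy.
have z1 : 1 <= z by exact: pt_ge1.
have y2 : y <= 2 by exact/ltW/pt_lt2.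
have y0 : 0 < y by rewrite zy addr_gt0// (lt_le_trans ltr01).
pose w := 2 ^- i'.+1 / y.
have w0 : 0 <= w by rewrite divr_ge0// ltW.
have wle : w <= 2 ^- i'.+1 by rewrite ler_pdivrMr// ler_peMr ?(ltW h0)// zy (le_trans z1)// lerDl.
have uby : lt_box a (upd b l y) by exact: lt_box_pt.
have zlt : z < y by rewrite zy ltrDl.
have uby2 : lt_box (upd a l z) (upd b l y) by apply: lt_box_updl => //; rewrite updE.
have ap2 u : u \in ps -> upd a l z u = 0.
 by move=> us; rewrite upd_neq; [exact: ap'|apply: contraNneq lp => <-].
have ap3 u : u \in ps -> upd a l z u < 1 by move=> us; rewrite ap2.
have mid : sqb (idx N S) (Kz S ps i q (upd a l z) (upd b l y)) p Q.
 apply: IH => //; [by move=> u; rewrite /upd; case: eqP => // _; rewrite (le_trans _ z1)|exact: ub|].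
 move=> u us; rewrite /upd; case: eqP => [ul|/eqP ul]; last by apply: sd; rewrite negb_or ul.
 by rewrite zy addrAC subrr add0r; apply: sd2; rewrite -il.
have bU j := alg_B1 (alg_Kz S i q j uby2 ap3) bf.
have bV := bK i' (q l)./2.
have -> : (fun x => nrm (idx N S) (fun j => Kz S (l :: ps) i q a b j f x) `^ p) =
  fun x => w `^ p * nrm (idx N S) (fun j => Kz S ps i q (upd a l z) (upd b l y) j f x - Kz S ps i q a (upd b l z) j f x) `^ p.
 ext x; rewrite -powRM ?nrm_ge0// -[X in X * nrm _ _](ger0_norm w0) -nrmZ; congr (nrm _ _ `^ p).
 ext j; rewrite KE.
 have := @Kz_split S ps i q a (upd b l y) j l z f x uby ap1 lp; rewrite updE al !subr0 zlt (lt_le_trans ltr01 z1) => /(_ isT (B1_Bm bf)).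
 have -> : upd (upd b l y) l z = upd b l z by ext u; rewrite /upd; case: eqP.
 move: (Kz _ _ _ _ a _ j f x) (Kz _ _ _ _ (upd a l z) _ j f x) (Kz _ _ _ _ a (upd b l z) j f x) => k1 k2 k3 e.
 have -> : k1 = (z * k3 + (y - z) * k2) / y by rewrite -e mulrC mulKf// gt_eqF.
 rewrite /w; have -> : 2 ^- i'.+1 = y - z by rewrite zy addrAC subrr add0r.
 by field; rewrite gt_eqF.
rewrite IIZ; last by apply: B1_nrmp => // j; exact: B1B.
have q3 : ((q l)./2 < 2 ^ i')%N by rewrite -divn2 ltn_divLR// -expnSr.
letr (ler_wpM2l (powR_ge0 _ _) (IIp_sub _ 0 p1 bU bV)).
letr (ler_wpM2l (powR_ge0 _ _) (ler_wpM2l (powR_ge0 _ _) (lerD (mid f bf) (upper i' _ q3 f bf)))).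
have wp : w `^ p <= 2 `^ (- (p * i'.+1%:R)).
 by rewrite -powR2V; apply: powR_mono.
letr (ler_wpM2r _ wp); first pos.
rewrite [2 `^ (p + 1)]powRD ?pnatr_eq0 ?implybT// powRr1//; apply: le_of_eq.
ring.
Qed.

End boxes.

Lemma powR_subadd (R : realType) (t x y : R) : 0 < t <= 1 -> 0 <= x -> 0 <= y -> (x + y) `^ t <= x `^ t + y `^ t.
move=> /andP[t0 t1] x0 y0; have tn : t != 0 by rewrite gt_eqF.
have [->|xn] := eqVneq x 0; first by rewrite add0r powR0// add0r.
have [->|yn] := eqVneq y 0; first by rewrite addr0 powR0// addr0.
have xp : 0 < x by rewrite lt_def xn.
have yp : 0 < y by rewrite lt_def yn.
have t10 : t - 1 <= 0 by rewrite subr_le0.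
rewrite -(powRp (addr_ge0 x0 y0) tn) -(powRp x0 tn) -(powRp y0 tn) mulrDl.
by apply: lerD; apply: ler_wpM2l => //; apply: powR_anti => //; rewrite ?lerDl ?lerDr.
Qed.

Lemma sum_powR_le (R : realType) I r (x : I -> R) (t : R) : 0 < t -> (forall i, 0 <= x i) ->
 (\sum_(i <- r) x i) `^ t <= (size r)%:R `^ (Num.max 1 t - 1) * \sum_(i <- r) x i `^ t.
move=> t0 x0; have tn : t != 0 by rewrite gt_eqF.
have [t1|t1] := leP t 1.
 rewrite subrr powRr0 mul1r; elim: r => [|i r IH]; first by rewrite !big_nil powR0.
 rewrite !big_cons; letr (powR_subadd _ (x0 i) _); first by rewrite t0.
  pos.
 lra.
case: r => [|i r]; first by rewrite !big_nil powR0.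
have s0 : 0 < (size (i :: r))%:R :> R by [].
have := powR_mean_le (r := i :: r) (w := fun=> 1) (ltW t1) s0 (fun=> ler01) x0.
rewrite big_const_seq iter_addr_0 => /(_ (lexx _)).
by under eq_bigr do rewrite mul1r; under [in X in _ <= X -> _]eq_bigr do rewrite mul1r.
Qed.

(** Square summation over r' costs its size to the power max(1, p/2): by subadditivity of the power
    p/2 when p <= 2, by convexity otherwise. *)
Lemma IIp_pairs R d (s : dsys R d) I J r' r (v : I -> J -> sX s -> R) (p B : R) :
 1 <= p -> (forall q j, B1 (v q j)) -> (forall q, (\I x, nrm r ((v q)^~ x) `^ p) <= B) ->
 (\I x, nrm [seq (q, j) | q <- r', j <- r] (fun w => v w.1 w.2 x) `^ p) <= (size r')%:R `^ (Num.max 1 (p / 2) - 1) * ((size r')%:R * B).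
move=> p1 bv hB; have p0 : 0 < p by exact: lt_le_trans p1.
have bN q : B1 (fun x => nrm r ((v q)^~ x) `^ p) by exact: B1_nrmp.
have sq2 (x : R) : 0 <= x -> (x ^+ 2) `^ (p / 2) = x `^ p :> R.
 move=> x0; rewrite -powR_mulrn// -powRrM; rewrite mulrC divfK//.
via (\I x, (size r')%:R `^ (Num.max 1 (p / 2) - 1) * \sum_(q <- r') nrm r ((v q)^~ x) `^ p).
 apply: II_le; [by apply: B1_nrmp|by apply: B1Z; exact: B1_sum|] => x.
 rewrite -sq2 ?nrm_ge0// nrm_sqr big_allpairs_dep /=.
 under eq_bigr do rewrite -nrm_sqr.
 apply: (le_trans (sum_powR_le _ _ _)) => [|q|]; [pos|pos|].
 by rewrite (eq_bigr (fun q => nrm r ((v q)^~ x) `^ p))// => q _; rewrite sq2 ?nrm_ge0.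
rewrite IIZ; last exact: B1_sum.
apply: ler_wpM2l => //.
rewrite II_sum//; via (\sum_(q <- r') B); first exact: ler_sum => q _.
by rewrite big_const_seq iter_addr_0 mulr_natl.
Qed.

(** With I digits in all there are 2^I positions, costing 2^(I max(1, p/2)), and the differences
    gain 2^(-p I). Half of the surplus pays for the thin boxes, and half remains as decay. *)
Lemma Kz_bound (R : realType) k n p : 1 < p -> exists2 dl : R, 0 < dl & exists2 C : R, 0 < C &
 forall d s (c : coef R k n d) N (S : seq (Ix k n)) i ps f, uniq ps -> (forall l, l \in ps) ->
 uniq S -> (forall g, g \in S -> (0 < mdeg g)%N) -> B1 f ->
 (\I x, nrm [seq (q, j) | q <- index_enum {dffun forall l : 'I_k, 'I_(2 ^ i l)}, j <- idx N S]
  (fun w => Kz (s := s) c S ps i (fun l => w.1 l) (fun=> 0) (fun=> 1) w.2 f x) `^ p) <=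
 C * 2 `^ (- (dl * (\sum_(l <- ps) i l)%:R)) * (\I x, `|f x| `^ p).
move=> p1; have p1' := ltW p1; have p0 : 0 < p by exact: lt_trans p1.
pose e := (p - Num.max 1 (p / 2)) / 2.
have e0 : 0 < e by rewrite divr_gt0// subr_gt0 gt_max; lra.
have [C C0 HC] := square_function_bound k n p1 e0.
exists e => //; exists (C * (2 `^ (p + 1)) ^+ k); first pos.
move=> d s c N S i ps f up ap uS Sp bf; set I := (\sum_(l <- ps) i l)%N.
have If0 : 0 <= II (fun x : sX s => `|f x| `^ p) by apply: II_ge0 => x.
have sps : size ps = k.
 by rewrite -(card_uniqP up) -[RHS]card_ord; apply: eq_card => l; rewrite ap.
have iI l : (i l <= I)%N by rewrite /I (big_rem l) ?ap//= leq_addr.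
set Y := 2 `^ (e * I%:R); have Y0 : 0 <= Y by exact: powR_ge0.
have CY : 0 <= C * Y by rewrite mulr_ge0// ltW.
pose W := (2 `^ (p + 1)) ^+ k * 2 `^ (- (p * I%:R)).
have prodE : \prod_(l <- ps) (2 `^ (p + 1) * 2 `^ (- (p * (i l)%:R))) = W.
 rewrite big_split /= big_const_seq count_predT iter_mulr_1 sps; congr (_ * _).
 rewrite /I; elim: (ps) => [|l r IH]; first by rewrite !big_nil mulr0 oppr0 powRr0.
 by rewrite !big_cons IH natrD mulrDr opprD powRD ?pnatr_eq0 ?implybT.
have hK (q : {dffun forall l : 'I_k, 'I_(2 ^ i l)}) : (\I x, nrm (idx N S) (fun j => Kz c S ps i (fun l => q l) (fun=> 0) (fun=> 1) j f x) `^ p) <=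
  C * Y * W * (\I x, `|f x| `^ p).
 rewrite -prodE; apply: Kz_sqb => //.
 - move=> a b th; exact: HC.
 - by rewrite ler1n.
 - by move=> l; rewrite ap.
have bK (q : {dffun forall l : 'I_k, 'I_(2 ^ i l)}) j : B1 (Kz (s := s) c S ps i (fun l => q l) (fun=> 0) (fun=> 1) (j : {ffun Ix k n -> 'I_N.+1}) f).
 by apply: alg_B1 => //; apply: alg_Kz => // l.
letr (IIp_pairs _ p1' bK hK).
have -> : size (index_enum {dffun forall l : 'I_k, 'I_(2 ^ i l)}) = (2 ^ I)%N.
 transitivity #|{dffun forall l : 'I_k, 'I_(2 ^ i l)}|; first by rewrite -sum1_size -sum1_card.
 rewrite card_dep_ffun foldrE big_image /= /I (big_uniq _ up) expn_sum.
 by apply: eq_big => [l|l _]; rewrite ?ap// card_ord.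
have s0 : 0 < (2 ^ I)%:R :> R by [].
rewrite mulrA -{2}[(2 ^ I)%:R]powRr1 ?(ltW s0)// -powRD ?(gt_eqF s0) ?implybT// subrK mulrA; apply: ler_wpM2r => //.
rewrite natrX powR2X /W /Y.
apply: le_of_eq; set Z := Num.max 1 (p / 2).
have -> : - (e * I%:R) = Z * I%:R + e * I%:R + - (p * I%:R).
 by rewrite /e -/Z; field.
rewrite !powRD ?pnatr_eq0 ?implybT//.
lra.
Qed.

(** * Chaining over digits and over monomials *)

Section chaining.
Context {R : realType} {k n : nat} (r0 N nb : nat).
Notation J := {ffun Ix k n -> 'I_N.+1}.
Implicit Types (m i : 'I_k -> nat) (P : pred 'I_k) (ps : seq 'I_k).

Lemma oscb_sum d (s : dsys R d) ch Y (Yt : nat -> ('I_k -> nat) -> sX s -> R) T (w : nat -> R) (p B W : R) : 1 <= p -> 0 <= B -> 0 < W ->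
 (forall t, 0 < w t) -> \sum_(t < T) w t <= W -> (forall t, (t < T)%N -> oscb nb ch (Yt t) p (B * w t `^ p)) ->
 (forall m, Y m = fun x => \sum_(t < T) Yt t m x) -> oscb nb ch Y p (B * W `^ p).
move=> p1 B0 W0 w0 wW hY YE.
have /boolp.choice [G hG] : forall t : 'I_T, exists G : 'I_nb -> sX s -> R, [/\ forall t, B1 (G t),
  forall (u : 'I_nb) m x, lem (ch u) m -> lem m (ch u.+1) -> `|Yt t m x - Yt t (ch u) x| <= G u x &
  (\I x, nrm (index_enum 'I_nb) (G^~ x) `^ p) <= B * w t `^ p] by move=> t; exact: hY.
have bG t u : B1 (G t u) by case: (hG t).
exists (fun u x => \sum_(t < T) G t u x); split.
- by move=> u; apply: B1_sum => t.
- move=> u m x h1 h2; rewrite !YE -sumrB; letr (ler_norm_sum _ _ _); apply: ler_sum => t _.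
 by have [_ h _] := hG t; exact: h.
by apply: (IIp_sum (w := fun t : 'I_T => w t)) => // t; case: (hG t).
Qed.

Lemma oscbD d (s : dsys R d) ch (Y Y1 Y2 : ('I_k -> nat) -> sX s -> R) (p A B : R) : 1 <= p ->
 oscb nb ch Y1 p A -> oscb nb ch Y2 p B -> (forall m x, Y m x = Y1 m x + Y2 m x) -> oscb nb ch Y p (2 `^ p * (A + B)).
move=> p1 [G1 [b1 h1 I1]] [G2 [b2 h2 I2]] YE; exists (fun u x => G1 u x + G2 u x); split.
- by move=> u; exact: B1D.
- move=> u m x l1 l2; rewrite !YE opprD addrACA; letr (ler_normD _ _).
 by apply: lerD; [exact: h1|exact: h2].
have n0 (F : 'I_nb -> sX s -> R) x : 0 <= nrm (index_enum 'I_nb) (F^~ x) by exact: nrm_ge0.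
letr (IIp_add p1 (B1_nrm _ b1) (B1_nrm _ b2) (B1_nrm (index_enum 'I_nb) (fun u => B1D (b1 u) (b2 u))) (n0 _) (n0 _) _).
 by move=> x; rewrite nrm_ge0 nrmD.
by apply: ler_wpM2l => //; exact: lerD.
Qed.

Lemma oscb_le d (s : dsys R d) ch (Y Y' : ('I_k -> nat) -> sX s -> R) (p A B : R) : (forall m, dom n r0 N m -> Y m = Y' m) -> (forall t, dom n r0 N (ch t)) ->
 A <= B -> oscb nb ch Y p A -> oscb nb ch Y' p B.
move=> e hd AB [G [b h I]]; exists G; split => //; last exact: le_trans AB.
move=> t m x h1 h2; rewrite -!e ?hd//; [exact: h|exact: dom_le h2 (hd _)].
Qed.

(* The first [i l] binary digits of the position of [m l] inside its dyadic scale. *)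
Definition qn P i m (l : 'I_k) : nat := if P l then ((m l %/ 2 ^ (r0 - i l)) %% 2 ^ i l)%N else 0%N.
Definition bm P m (l : 'I_k) : R := pt r0 (qn P (fun=> r0) m l).
Definition jm m : J := [ffun g => inord (ex r0 g m)].

Lemma qn_lt P i m l : (qn P i m l < 2 ^ i l)%N.
by rewrite /qn; case: ifP => _; rewrite ?ltn_pmod ?expn_gt0. Qed.

Lemma qn_half P i i' m l t : i l = t.+1 -> i' l = t -> (t < r0)%N -> (qn P i m l)./2 = qn P i' m l.
move=> il i'l tr; rewrite /qn il i'l; case: ifP => // _.
rewrite -divn2 expnS mulnC -modn_divl -divnMA -expnSr; congr (m l %/ 2 ^ _ %% _)%N.
lia.
Qed.

Definition updn i (l : 'I_k) (t : nat) : 'I_k -> nat := fun u => if u == l then t else i u.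

Definition Yk d (s : dsys R d) (c : coef R k n d) S P ps i m (f : sX s -> R) : sX s -> R :=
 Kz c S ps i (qn P i m) (fun=> 0) (bm P m) (jm m) f.

(** By [qn_half] the side subtracted at level t + 1 is the one added at level t, so the sum over
    levels telescopes to the side with all r0 digits. *)
Lemma Yk_sum d s (c : coef R k n d) S P ps i l m (f : sX s -> R) x : l \notin ps ->
 Yk c S P ps i m f x = \sum_(t < r0.+1) Yk c S P (l :: ps) (updn i l t) m f x.
move=> lp; pose u t := Kz c S ps i (qn P i m) (fun=> 0) (upd (bm P m) l (pt t (qn P (updn i l t) m l))) (jm m) f x.
have agree t l' : l' \in ps -> updn i l t l' = i l' /\ qn P (updn i l t) m l' = qn P i m l'.
 move=> l'p; have ne : l' == l = false by apply: contraNF lp => /eqP<-.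
 by rewrite /qn /updn ne.
have uE t : (t <= r0)%N -> Yk c S P (l :: ps) (updn i l t) m f x = u t - (if t is t'.+1 then u t' else 0).
 have ul : updn i l t l = t by rewrite /updn eqxx.
 move=> tr; rewrite /Yk /= ul; congr (_ - _); first by apply: Kz_ext => //; exact: agree.
 case: t ul tr => // t ul tr; rewrite (@qn_half P _ (updn i l t) _ _ t) ?/updn ?eqxx//.
 by apply: Kz_ext => //; exact: agree.
have -> : \sum_(t < r0.+1) Yk c S P (l :: ps) (updn i l t) m f x = \sum_(t < r0.+1) (u t - (if (t : nat) is t'.+1 then u t' else 0)).
 by apply: eq_bigr => t _; apply: uE; rewrite -ltnS.
have -> : \sum_(t < r0.+1) (u t - (if (t : nat) is t'.+1 then u t' else 0)) = u r0.
 by elim: (r0) => [|a IH]; [rewrite big_ord1 subr0|rewrite big_ord_recr IH /= addrC subrK].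
apply: Kz_ext => // l' _; rewrite /upd; case: eqP => // ->.
by rewrite /qn /updn eqxx.
Qed.

Definition supp (S : seq (Ix k n)) : pred 'I_k := fun l => has (fun g : Ix k n => (0 < g l)%N) S.

Lemma geo_lt (x : R) T : 0 <= x < 1 -> \sum_(t < T) x ^+ t <= (1 - x)^-1.
by rewrite -(big_mkord xpredT); exact: geo_sum. Qed.

(** Equal values of [ex g] at both ends force equal quotients by 2^r0 in the variables of g, a sum
    of monotone terms being constant only if each term is. With equal leading digits the quotients
    by 2^(r0 - i) agree too, and monotonicity pins the point in between. In variables off [supp S]
    the scales determine nothing, hence [qn] puts 0 there. *)
Lemma key_convex S i m1 m2 m3 : (forall l, (i l <= r0)%N) -> lem m1 m2 -> lem m2 m3 ->
 (forall g, g \in S -> ex r0 g m1 = ex r0 g m3) -> (forall l, qn (supp S) i m1 l = qn (supp S) i m3 l) ->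
 (forall g, g \in S -> ex r0 g m2 = ex r0 g m1) /\ (forall l, qn (supp S) i m2 l = qn (supp S) i m1 l).
move=> ir h12 h23 he hq; split.
 by move=> g gS; apply/eqP; rewrite eqn_leq {1}(he g gS) !ex_mono.
move=> l; have := hq l; rewrite /qn; case: ifP => // /hasP[g gS gl].
set w := (2 ^ (r0 - i l))%N; set v := (2 ^ i l)%N.
have wv : (w * v = 2 ^ r0)%N by rewrite -expnD subnK.
have nu13 : (m1 l %/ 2 ^ r0 = m3 l %/ 2 ^ r0)%N.
 have := he g gS; rewrite /ex (bigD1 l)//= [RHS](bigD1 l)//=.
 set A := \sum_(_ | _) _; set B := \sum_(_ | _) _ => e.
 have AB : (A <= B)%N by apply: leq_sum => u _; rewrite leq_mul2l leq_div2r ?orbT// (leq_trans (h12 u)).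
 have ml : (m1 l %/ 2 ^ r0 <= m3 l %/ 2 ^ r0)%N by apply: leq_div2r; exact: leq_trans (h23 l).
 apply/eqP; rewrite eqn_leq ml /= -(leq_pmul2l gl) -(leq_add2r A) e.
 lia.
move=> e; have e13 : (m1 l %/ w = m3 l %/ w)%N.
 by rewrite (divn_eq (m1 l %/ w) v) (divn_eq (m3 l %/ w) v) e -!divnMA wv nu13.
have -> // : (m2 l %/ w = m1 l %/ w)%N.
by apply/eqP; rewrite eqn_leq {1}e13 !leq_div2r.
Qed.

End chaining.

(** Every direction is expanded into digit levels. For fixed levels, digits and scales together form
    a key to which [key_osc] applies with the bound of [Kz_bound], and its decay makes the sums over
    levels converge. *)
Lemma Yk_osc (R : realType) k n p (Q S : seq (Ix k n)) : 1 < p -> uniq S -> (forall g, g \in S -> (0 < mdeg g)%N) -> exists2 C : R, 0 < C &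
 forall r0 N nb d s (c : coef R k n d) ch f, chain n r0 N ch -> B1 f ->
 oscb (s := s) nb ch (fun m => Yk r0 N c S (supp S) [::] (fun=> 0%N) m (PH r0 c Q m f)) p (C * (\I x, `|f x| `^ p)).
move=> p1 uS Sp; have p1' := ltW p1; have p0 : 0 < p by exact: lt_trans p1.
have [dl dl0 [C C0 HC]] := @Kz_bound R k n p p1.
have [D D0 HD] := key_osc Q p1.
pose sg1 := 2 `^ (- (dl / p)) : R.
have s1 : sg1 < 1.
 have e1 : 1 `^ (dl / p) = 1 :> R by rewrite powR1.
 rewrite /sg1 powRN invf_lt1 ?powR_gt0// -[ltLHS]e1; apply: gt0_ltr_powR; rewrite ?nnegrE ?ltr1n// divr_gt0//.
have s0 : 0 < sg1 by exact: powR_gt0.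
pose W := (1 - sg1)^-1; have W0 : 0 < W by rewrite invr_gt0 subr_gt0.
have sgX t : (sg1 ^+ t) `^ p = 2 `^ (- (dl * t%:R)).
 rewrite -powR_mulrn ?ltW// -!powRrM; congr (_ `^ _); field; pos.
exists (D * C * (W `^ p) ^+ k); first pos.
move=> r0 N nb d s c ch f hch bf; set P := supp S.
have If0 : 0 <= (\I x, `|f x| `^ p) by apply: II_ge0 => x.
set If := II _ in If0 *.
suff H ls : forall ps i, uniq (ls ++ ps) -> (forall l, l \in ls ++ ps) -> (forall l, (i l <= r0)%N) ->
  oscb (s := s) nb ch (fun m => Yk r0 N c S P ps i m (PH r0 c Q m f)) p (D * C * If * 2 `^ (- (dl * (\sum_(l <- ps) i l)%:R)) * (W `^ p) ^+ size ls).
 have := H (enum 'I_k) [::] (fun=> 0%N); rewrite cats0 enum_uniq size_enum_ord big_nil mulr0 oppr0 powRr0 mulr1 mulrAC.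
 by apply => // l; rewrite mem_enum.
elim: ls => [|l ls IH] ps i up ap ir; last first.
 have lp : l \notin ps by move: up; rewrite /= mem_cat negb_or => /andP[/andP[]].
 have -> : D * C * If * 2 `^ (- (dl * (\sum_(u <- ps) i u)%:R)) * (W `^ p) ^+ size (l :: ls) =
   D * C * If * 2 `^ (- (dl * (\sum_(u <- ps) i u)%:R)) * (W `^ p) ^+ size ls * W `^ p by rewrite exprSr !mulrA.
 apply: (oscb_sum p1' _ W0 (w := fun t => sg1 ^+ t) (T := r0.+1) (Yt := fun t m => Yk r0 N c S P (l :: ps) (updn i l t) m (PH r0 c Q m f))).
 - pos.
 - by move=> t; pos.
 - by apply: geo_lt; rewrite ltW.
 - move=> t tr; have := IH (l :: ps) (updn i l t) _ _ _.
  have -> : (\sum_(u <- l :: ps) updn i l t u = t + \sum_(u <- ps) i u)%N.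
   rewrite big_cons /updn eqxx; congr addn; apply: eq_big_seq => u us; case: eqP => // e; by rewrite -e us in lp.
  rewrite natrD mulrDr opprD powRD ?pnatr_eq0 ?implybT// sgX.
  have -> : D * C * If * (2 `^ (- (dl * t%:R)) * 2 `^ (- (dl * (\sum_(u <- ps) i u)%:R))) * (W `^ p) ^+ size ls =
   D * C * If * 2 `^ (- (dl * (\sum_(u <- ps) i u)%:R)) * (W `^ p) ^+ size ls * 2 `^ (- (dl * t%:R)) by ring.
  apply.
  + by have := up; rewrite -cat1s -catA uniq_catCA.
  + by move=> u; have := ap u; rewrite inE !mem_cat orbCA.
  + by move=> u; rewrite /updn; case: eqP.
 - by move=> m; ext x; exact: Yk_sum.
rewrite mulr1; set r := [seq (q, j) | q <- index_enum {dffun forall l : 'I_k, 'I_(2 ^ i l)}, j <- idx N S].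
pose u (w : {dffun forall l : 'I_k, 'I_(2 ^ i l)} * {ffun Ix k n -> 'I_N.+1}) := Kz (s := s) c S ps i (fun l => w.1 l) (fun=> 0) (fun=> 1) w.2 f.
pose qd m : {dffun forall l : 'I_k, 'I_(2 ^ i l)} := [ffun l => Ordinal (qn_lt r0 P i m l)].
pose jS m : {ffun Ix k n -> 'I_N.+1} := [ffun g => if g \in S then jm r0 N m g else ord0].
have aK q j : alg (Kz (s := s) c S ps i q (fun=> 0) (fun=> 1) (j : {ffun Ix k n -> 'I_N.+1})) by exact: alg_Kz.
have bu w : B1 (u w) by exact: alg_B1 (aK _ _) bf.
have KyY m : dom n r0 N m -> Yk r0 N c S P ps i m (PH r0 c Q m f) = PH r0 c Q m (u (qd m, jS m)).
 move=> dm; rewrite -(alg_com (aK _ _) (alg_PH r0 s c Q m) (B1_Bm bf)); ext x.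
 apply: Kz_ext => [l _|l|g gS]; [by rewrite ffunE|by rewrite ap|by rewrite [RHS]ffunE gS].
have hr m : dom n r0 N m -> (qd m, jS m) \in r.
 by move=> _; apply/allpairsP; exists (qd m, jS m); split => //=; [rewrite mem_index_enum|exact: idx_mem].
have hk m1 m2 m3 : dom n r0 N m3 -> lem m1 m2 -> lem m2 m3 -> (qd m1, jS m1) = (qd m3, jS m3) -> (qd m2, jS m2) = (qd m1, jS m1).
 move=> d3 h12 h23 [e1 e2].
 have d2 := dom_le h23 d3; have d1 := dom_le h12 d2.
 have he g : g \in S -> ex r0 g m1 = ex r0 g m3.
  move=> gS; move/ffunP: e2 => /(_ g); rewrite !ffunE gS => /(congr1 (fun o : 'I_N.+1 => o : nat)).
  by rewrite !inordK// ltnS.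
 have hq l : qn r0 P i m1 l = qn r0 P i m3 l.
  by move/ffunP: e1 => /(_ l); rewrite !ffunE => /(congr1 val).
 have [H1 H2] := key_convex ir h12 h23 he hq.
 congr pair; apply/ffunP => z; rewrite !ffunE; first by apply/val_inj; exact: H2.
 by case: ifP => // zS; rewrite H1.
have hh := HD r0 N nb d s c _ r u ch (fun m => (qd m, jS m)) _ bu hch hr hk KyY.
apply: oscb_le hh => [m _||//]; [by []|by case: hch|].
rewrite -!mulrA; apply: ler_wpM2l; first pos.
rewrite [If * _]mulrC mulrA.
have up' : uniq ps by [].
exact: HC d s c N S i ps f up' ap uS Sp bf.
Qed.

(** The recursion of [sg] read backwards: L lists the monomials still to be treated, S those taken
    in differences, Q those replaced by H and collected in [PH]. *)
Lemma sg_osc (R : realType) k n p (L S Q : seq (Ix k n)) : 1 < p -> uniq (L ++ S) -> (forall g, g \in L ++ S -> (0 < mdeg g)%N) -> exists2 C : R, 0 < C &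
 forall r0 N nb d s (c : coef R k n d) ch f, chain n r0 N ch -> B1 f ->
 oscb (s := s) nb ch (fun m => sg c 0 (fun=> 0) (bm r0 predT m) S (foldr (fun g F => (g |: F)%SET) finset.set0 L) (jm r0 N m) (PH r0 c Q m f)) p
  (C * (\I x, `|f x| `^ p)).
move=> p1; have p1' := ltW p1.
have lb r0 P m : lt_box (fun=> 0) (bm (R := R) r0 P m) by move=> l; exact: lt_le_trans (pt_ge1 _ _).
elim: L S Q => [|g L IH] S Q uS Sp.
 have [C C0 HC] := Yk_osc Q p1 uS Sp; exists C => // r0 N nb d s c ch f hch bf.
 apply: oscb_le (HC r0 N nb d s c ch f _ bf) => // [m _|]; last by case: hch.
 ext x; rewrite [RHS](@sg_indep _ _ _ _ s c N (supp S)) //.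
 - rewrite /=; congr sg; ext l.
  by rewrite /bm /qn; case: ifP => // _; rewrite pt0.
 - by move=> g l; rewrite finset.in_set0 orbF => gS gl; apply/hasP; exists g.
 - exact: alg_Bm (alg_PH _ _ _ _ _) (B1_Bm bf).
have u1 : uniq (L ++ g :: S) by have := uS; rewrite -cat1s -catA uniq_catCA.
have p1S g' : g' \in L ++ g :: S -> (0 < mdeg g')%N.
 by move=> h; apply: Sp; move: h; rewrite !mem_cat -orbA orbCA.
have u2 : uniq (L ++ S) by case/andP: uS.
have p2S g' : g' \in L ++ S -> (0 < mdeg g')%N by move=> h; apply: Sp; rewrite inE h orbT.
have [C1 C10 H1] := IH (g :: S) Q u1 p1S; have [C2 C20 H2] := IH S (g :: Q) u2 p2S.
exists (2 `^ p * (C1 + C2)); first pos.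
move=> r0 N nb d s c ch f hch bf; rewrite -mulrA mulrDl.
have hd t : dom n r0 N (ch t) by case: hch.
pose F := foldr (fun g F => (g |: F)%SET) finset.set0 L.
have hh := oscbD p1' (H1 r0 N nb d s c ch f hch bf) (H2 r0 N nb d s c ch f hch bf) (fun m x => erefl _).
apply: oscb_le hh => // m dm; apply/funext => x /=; rewrite -/F.
have -> : Hop (c g) (0 + ex r0 g m) (PH r0 c Q m f) = Hg c 0 g (jm r0 N m) (PH r0 c Q m f).
 by rewrite /Hg /sc ffunE inordK// ltnS.
lra.
Qed.

Theorem grid_oscillation (R : realType) k n p : 1 < p -> exists2 C : R, 0 < C &
 forall r0 N nb d s (c : coef R k n d) ch f, chain n r0 N ch -> B1 f ->
 oscb (s := s) nb ch (fun m => AF c 0 (fun=> 0) (bm r0 predT m) [set g : Ix k n | (0 < mdeg g)%N]%SET (jm r0 N m) f) p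
  (C * (\I x, `|f x| `^ p)).
move=> p1; set F := [set g | _]%SET.
have uF : uniq (enum F ++ [::]) by rewrite cats0 enum_uniq.
have Fp g : g \in enum F ++ [::] -> (0 < mdeg g)%N by rewrite cats0 mem_enum inE.
have [C C0 HC] := sg_osc [::] p1 uF Fp; exists C => // r0 N nb d s c ch f hch bf.
have := HC r0 N nb d s c ch f hch bf; congr oscb; ext m.
have -> // : foldr (fun g F => (g |: F)%SET) finset.set0 (enum F) = F.
apply/finset.setP => g; rewrite -[RHS]mem_enum; elim: (enum F) => [|g' L IH] /=; rewrite ?finset.in_set0// in_setU1 IH inE//.
Qed.

(** * Rounding real sides to the grid *)

Section rounding.
Context {R : realType}.
Implicit Types (r m : nat) (y : R).

(** An increasing enumeration of a grid with 2^r equally spaced points in each dyadic interval;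
    consecutive points have ratio at most 1 + 2^(-r). *)
Definition val r m : R := 2 ^+ (m %/ 2 ^ r) * pt r (m %% 2 ^ r).

Lemma val0 r : val r 0 = 1. Proof. by rewrite /val div0n mod0n mul1r pt0. Qed.

Lemma valS r m : val r m.+1 <= val r m * (1 + 2 ^- r).
have q0 : (0 < 2 ^ r)%N by rewrite expn_gt0.
set q := (m %/ 2 ^ r)%N; set h := (m %% 2 ^ r)%N.
have -> : val r m.+1 = 2 ^+ q * (1 + h.+1%:R / 2 ^+ r).
 have mE : m.+1 = (q * 2 ^ r + h.+1)%N by rewrite addnS -divn_eq.
 have : (h < 2 ^ r)%N by exact: ltn_pmod.
 rewrite leq_eqVlt => /orP[/eqP hE|hl]; rewrite /val mE.
  rewrite hE -mulSnr mulnK// modnMl pt0 mulr1 natrX divff ?pnatr_eq0//.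
  by rewrite exprSr.
 by rewrite divnMDl// divn_small// addn0 modnMDl modn_small.
rewrite /val -/h -mulrA; apply: ler_wpM2l => //.
rewrite -natr1 mulrDl mul1r mulrDr mulr1 addrA lerD2l ler_peMl// lerDl//.
Qed.

Lemma val_unbounded r y : exists m, y < val r m.
exists (2 ^ r * Num.bound `|y|)%N; rewrite /val mulKn ?expn_gt0// modnMr pt0 mulr1.
apply: (le_lt_trans (ler_norm _)); apply: (lt_trans (archi_boundP (normr_ge0 y))).
by rewrite -natrX ltr_nat ltn_expl.
Qed.

(** The inequality [y < val r m] is strict so that the half-open grid box contains the closed box it
    approximates. *)
Definition mr r y : nat := ex_minn (val_unbounded r y).

Lemma mr_mono r y y' : y <= y' -> (mr r y <= mr r y')%N.
move=> yy; rewrite /mr; case: ex_minnP => m _ mn; case: ex_minnP => m' hm' _.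
by apply: mn; exact: le_lt_trans hm'.
Qed.

Lemma mr_bounds r y : 1 <= y -> y < val r (mr r y) <= y * (1 + 2 ^- r).
move=> y1; rewrite /mr; case: ex_minnP => -[|m] hm mn; first by move: hm; rewrite val0 ltNge y1.
rewrite hm; letr (valS r m); apply: ler_wpM2r => //.
by rewrite leNgt; apply/negP => /mn; rewrite ltnn.
Qed.

Definition rho k (y0 : R) r (M : 'I_k -> R) (l : 'I_k) : R := y0 * val r (mr r (M l / y0)).

Lemma rho_bounds k y0 r (M : 'I_k -> R) l : 0 < y0 -> y0 <= M l -> M l < rho y0 r M l <= M l * (1 + 2 ^- r).
move=> y00 yM; have h1 : 1 <= M l / y0 by rewrite ler_pdivlMr// mul1r.
have /andP[h2 h3] := mr_bounds r h1; rewrite /rho mulrC -ltr_pdivrMr// h2 /=.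
by rewrite -ler_pdivlMr// mulrAC.
Qed.

End rounding.

Section level.
Context {R : realType} {k n d : nat} (s : dsys R d) (c : coef R k n d).
Notation X := (sX s).
Notation Pv := (mpolT c).

Definition Vav (u : X -> R) (M : 'I_k -> R) : X -> R := Av (fun=> 0) M Pv u.

(* The constant coefficients of the polynomials only translate the function. *)
Definition ctr (u : X -> R) (x : X) : R := u (sT (fun i => \sum_(g | mdeg g == 0%N) c g i) x).

(** The dilation by [la] moves all powers of y0 and 2 into the coefficients: y0^(mdeg g) changes c,
    which is harmless because the bounds are uniform in c, and 2^(ex g m) is the scale of g. *)
Lemma Vav_AF (y0 : R) r N u m : 0 < y0 -> Bm u -> dom n r N m ->
 Vav u (fun l => y0 * val r (m l)) =
 AF (fun g i => y0 ^+ mdeg g * c g i) 0 (fun=> 0) (bm r predT m) [set g : Ix k n | (0 < mdeg g)%N]%SET (jm r N m) (ctr u).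
move=> y00 bu dm; ext x; pose la l : R := y0 * 2 ^+ (m l %/ 2 ^ r).
have la0 l : 0 < la l by rewrite mulr_gt0.
have lb : lt_box (fun=> 0) (bm (R := R) r predT m) by move=> l; exact: lt_le_trans (pt_ge1 _ _).
have bF : Bt (fun t => u (sT (Pv t) x)) by apply: Bt_slice => //; exact: mp_mpol.
have := av_affine lb (fun=> 0) la0 bF; rewrite /Vav /Av.
have -> : (fun l => la l * bm r predT m l + 0) = fun l => y0 * val r (m l).
 ext l; rewrite addr0 /bm /qn /= subnn divn1 -mulrA.
 by [].
have -> : (fun l => la l * 0 + 0) = fun=> 0 by ext l; rewrite mulr0 addr0.
move=> <-; apply: av_eq => t _; rewrite /ctr sTD; congr (u (sT _ x)); ext i.
rewrite /mpol (bigID (fun g => 0 < mdeg g)%N) /= addrC; congr (_ + _).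
 apply: eq_big => [g|g]; first by rewrite finset.in_setT lt0n negbK.
 rewrite finset.in_setT lt0n negbK sum_nat_eq0 => /forallP h.
 by rewrite /mono big1 ?mul1r// => l _; have /= /eqP -> := h l.
apply: eq_big => [g|g _]; first by rewrite finset.in_setT inE.
rewrite /cj /sc add0r ffunE inordK ?ltnS ?dm// [in RHS]mulrA mulrA; congr (_ * _).
rewrite /mono (eq_bigr (fun l => tnth t l ^+ g l * (y0 ^+ g l * 2 ^+ (g l * (m l %/ 2 ^ r))))); last first.
 by move=> l _; rewrite tnth_mktuple addr0 mulrC exprMn exprMn -exprM [(_ * g l)%N]mulnC.
rewrite big_split big_split /= -[RHS]mulrA; congr (_ * _); rewrite mulrC; congr (_ * _).
 by rewrite -exprnP expr_sum.
by rewrite expr_sum.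
Qed.

Lemma B1_ctr u : B1 u -> B1 (ctr u). Proof. exact: B1_T. Qed.

Lemma lem_mr (y0 : R) r (M M' : 'I_k -> R) : 0 < y0 -> (forall l, M l <= M' l) -> lem (fun l => mr r (M l / y0)) (fun l => mr r (M' l / y0)).
by move=> y00 h l; apply: mr_mono; apply: ler_wpM2r => //; rewrite invr_ge0 ltW. Qed.

End level.

(** The constant depends neither on the fineness r of the grid nor on y0 nor on the length of the
    chain; the first of these permits refining the grid indefinitely. *)
Lemma level_maj (R : realType) k n p : 1 < p -> exists2 C : R, 0 < C &
 forall d s (c : coef R k n d) (y0 : R) r u J I, 0 < y0 -> B1 u ->
 (forall t l, I t l <= I t.+1 l) -> (forall t l, I t l <= I J l) ->
 exists G : 'I_J -> sX s -> R, [/\ forall t, B1 (G t),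
  forall (t : 'I_J) M x, (forall l, I t l <= M l) -> (forall l, M l <= I t.+1 l) ->
   `|Vav c u (rho y0 r M) x - Vav c u (rho y0 r (I t)) x| <= G t x &
  (\I x, nrm (index_enum 'I_J) (G^~ x) `^ p) <= C * (\I x, `|u x| `^ p)].
move=> p1; have [C C0 HC] := @grid_oscillation R k n p p1; exists C => // d s c y0 r u J I y00 bu mI bI.
pose ch t l := mr r (I t l / y0).
pose N := (\sum_(g : Ix k n) ex r g (ch J))%N.
have dJ : dom n r N (ch J) by move=> g; rewrite /N (bigD1 g)//= leq_addr.
have hch : chain n r N ch.
 by split => t; [exact: lem_mr|apply: (dom_le _ dJ); exact: lem_mr].
have [G [bG hG IG]] := HC r N J d s (fun g i => y0 ^+ mdeg g * c g i) ch (ctr c u) hch (B1_ctr c bu).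
exists G; split; [by []| |].
 move=> t M x h1 h2; have l1 := lem_mr r y00 h1; have l2 := lem_mr r y00 h2.
 have dM : dom n r N (fun l => mr r (M l / y0)) := dom_le l2 (hch.2 _).
 have bm := B1_Bm bu.
 by have := hG t _ x l1 l2; rewrite -(Vav_AF c y00 bm dM) -(Vav_AF c _ bm (hch.2 t)).
letr IG; apply: ler_wpM2l; first pos.
have bp : B1 (fun x => `|u x| `^ p) by apply: B1_pow => //; [pos|exact: B1_norm].
by rewrite (II_T _ bp).
Qed.

(** * Lower limits and majorants *)

Section liminf.
Import HBNNSimple.
Context {R : realType}.
Local Open Scope ereal_scope.

Lemma einfE (u : nat -> \bar R) : limn_einf u = ereal_sup (range (einfs u)).
by rewrite limn_einf_lim; apply/cvg_lim => //; exact: cvg_einfs_sup. Qed.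

Lemma einf_ge (u : nat -> \bar R) l N : (forall i, (N <= i)%N -> l <= u i) -> l <= limn_einf u.
move=> h; rewrite einfE; via (einfs u N); last exact: ereal_sup_ubound.
by apply: le_ereal_inf_tmp => _ [i /= Ni <-]; exact: h.
Qed.

Lemma einf_le (u : nat -> \bar R) l N : (forall i, (N <= i)%N -> u i <= l) -> limn_einf u <= l.
move=> h; rewrite einfE; apply: ge_ereal_sup => _ [N' _ <-].
by apply: le_trans (h _ (leq_maxr N' N)); apply: ereal_inf_lbound; exists (maxn N' N) => //=; exact: leq_maxl.
Qed.

Lemma einf_cvg a u (l : R) : a i @[i --> \oo] --> l -> (forall i, (a i)%:E <= u i) -> l%:E <= limn_einf u.
move=> al h; have al' : (a i)%:E @[i --> \oo] --> l%:E by apply: cvg_EFin => //; exact: nearW.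
have [<- _] := cvg_limn_einf_sup al'.
rewrite !einfE; apply: ge_ereal_sup => _ [N _ <-]; via (einfs u N); last exact: ereal_sup_ubound.
apply: le_ereal_inf_tmp => _ [i /= Ni <-]; apply: le_trans (h i).
by apply: ereal_inf_lbound; exists i.
Qed.

Lemma einf_add (a b : nat -> \bar R) : (forall i, 0 <= a i) -> (forall i, 0 <= b i) ->
 limn_einf a + limn_einf b <= limn_einf (fun i => a i + b i).
move=> a0 b0; have la : 0 <= limn_einf a by apply: (@einf_ge _ _ 0).
have lb : 0 <= limn_einf b by apply: (@einf_ge _ _ 0).
rewrite !limn_einf_lim in la lb *; rewrite -limeD; [|exact: is_cvg_einfs|exact: is_cvg_einfs|exact: ge0_adde_def].
apply: lee_lim; [|exact: is_cvg_einfs|apply: nearW => N].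
 by apply: is_cvgeD; [exact: ge0_adde_def|exact: is_cvg_einfs|exact: is_cvg_einfs].
apply: le_ereal_inf_tmp => _ [i /= Ni <-].
by apply: leeD; apply: ereal_inf_lbound; exists i.
Qed.

Lemma einf_sum J (u : 'I_J -> nat -> \bar R) : (forall t i, 0 <= u t i) ->
 \sum_t limn_einf (u t) <= limn_einf (fun i => \sum_t u t i).
elim: J u => [|J IH] u u0; first by apply: (@einf_ge _ _ 0) => i _; rewrite !big_ord0.
have -> : (fun i => \sum_t u t i) = fun i => \sum_(t < J) u (widen_ord (leqnSn J) t) i + u ord_max i.
 by ext i; rewrite big_ord_recr.
rewrite big_ord_recr; apply: (le_trans (leeD (IH _ _) _)) => //.
by apply: einf_add => // i; exact: sume_ge0.
Qed.

Lemma measurable_einf d (X : measurableType d) (g : nat -> X -> \bar R) : (forall i, mfunT (g i)) ->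
 mfunT (fun x => limn_einf (g^~ x)).
move=> mg; have -> : (fun x => limn_einf (g^~ x)) = fun x => - limn_esup ((fun i x => - g i x)^~ x) by [].
apply: measurableT_comp => //; apply: measurable_fun_limn_esup => i.
exact: measurableT_comp.
Qed.

(* The library integral of a non-measurable nonnegative function is its lower integral. *)
Lemma lower_integral_le d (X : measurableType d) (mu : {measure set X -> \bar R}) h W :
 (forall x, 0 <= h x) -> (forall x, 0 <= W x) -> mfunT W -> {ae mu, forall x, h x <= W x} ->
 \int[mu]_x h x <= \int[mu]_x W x.
move=> h0 W0 mW hW; rewrite ge0_integralTE//; apply: ge_ereal_sup => _ [g /= gh <-].
have := integral_nnsfun mu measurableT g; rewrite patch_setT => <-.
apply: ae_ge0_le_integral => //.
- by move=> x _; exact/fun_ge0.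
- exact/measurable_EFinP.
- by apply: filterS hW => x hx _; exact: le_trans (gh x) hx.
Qed.
End liminf.

(** * Averages of unbounded functions over real boxes *)

Section averages.
Context {R : realType} {k d : nat} (s : dsys R d) (q : k.-tuple R -> 'I_d -> R) (hq : mp q).
Notation X := (sX s).
Notation mu := (smu s).
Notation leb := (lebesgue_tuple R k).
Implicit Types (u : X -> R) (M : 'I_k -> R).

Definition cb M : set (k.-tuple R) := [set t | forall l, 0 <= tnth t l <= M l].
Notation nb := (fun N : nat => hb (fun=> 0) (fun _ : 'I_k => N%:R)).

Lemma measurable_cb M : measurable (cb M).
have -> : cb M = \bigcap_(l in [set: 'I_k]) ((@tnth k R)^~ l @^-1` `[0, M l]).
 apply/seteqP; split => t /=; first by move=> h l _; exact: h.
 by move=> h l; have := h l I.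
apply: fin_bigcap_measurable => // l _; rewrite -[X in measurable X]setTI.
exact: measurable_tnth.
Qed.

Definition ag u M (x : X) : R := (\prod_l M l)^-1 * \int[leb]_(t in cb M) u (sT (q t) x).

Lemma measurable_orbit x : mfunT (fun t => sT (q t) x : X).
exact: measurableT_comp (sT_joint hq) (@measurable_pair1 _ _ X (k.-tuple R) x). Qed.

Lemma slice_joint (D : set (k.-tuple R)) (w : X -> \bar R) : measurable D -> mfunT w ->
 mfunT (fun xt : X * k.-tuple R => w (sT (q xt.2) xt.1) * (\1_D xt.2)%:E)%E.
move=> mD mw; apply: emeasurable_funM; first exact: measurableT_comp mw (sT_joint hq).
by apply/measurable_EFinP; apply: measurableT_comp.
Qed.

Lemma slice_mkcond (D : set (k.-tuple R)) (w : X -> \bar R) x :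
 (\int[leb]_(t in D) w (sT (q t) x) = \int[leb]_t (w (sT (q t) x) * (\1_D t)%:E))%E.
rewrite integral_mkcond; apply: eq_integral => t _; rewrite patchE indicE.
by case: ifP => _; rewrite ?mule1 ?mule0.
Qed.

Lemma slice_tonelli N (w : X -> \bar R) : mfunT w -> (forall x, 0 <= w x)%E ->
 (\int[mu]_x \int[leb]_(t in nb N) w (sT (q t) x) = (N%:R ^+ k)%:E * \int[mu]_x w x)%E.
move=> mw w0; have mN := measurable_hb (R := R) (fun=> 0) (fun _ : 'I_k => N%:R).
have h0 (u : X * k.-tuple R) : (0 <= w (sT (q u.2) u.1) * (\1_(nb N) u.2)%:E)%E by rewrite mule_ge0.
under eq_integral do rewrite slice_mkcond.
have := fubini_tonelli (m1 := mu) (m2 := leb) _ (slice_joint mN mw) h0 => /= ->.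
under eq_integral => t _.
 rewrite ge0_integralZr//=; last exact: measurableT_comp mw (measurable_sT _).
 rewrite (ge0_int_T _ mw w0); over.
rewrite ge0_integralZl//; last 2 first.
- by apply/measurable_EFinP.
- exact: integral_ge0.
rewrite integral_indic// setIT muleC; congr (_ * _)%E.
apply: etrans (lebesgue_hb (fun l => ler0n R N)) _.
by rewrite (eq_bigr (fun=> N%:R)) ?prodr_const ?card_ord// => l _; rewrite subr0.
Qed.

(** Integrability over the countably many cubes [0, N)^k covers all boxes, so that one null set
    serves for uncountably many M. *)
Definition good u (x : X) := forall N : nat, leb.-integrable (nb N) (fun t => (u (sT (q t) x))%:E).

Lemma measurable_slice_int (D : set (k.-tuple R)) (w : X -> \bar R) : measurable D -> mfunT w -> (forall x, 0 <= w x)%E ->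
 mfunT (fun x => \int[leb]_(t in D) w (sT (q t) x))%E.
move=> mD mw w0.
have -> : (fun x => \int[leb]_(t in D) w (sT (q t) x))%E = fun x => (\int[leb]_t (w (sT (q t) x) * (\1_D t)%:E))%E.
 by ext x; exact: slice_mkcond.
apply: (measurable_fun_fubini_tonelli_F _ (slice_joint mD mw)) => u.
by rewrite mule_ge0.
Qed.

Lemma measurable_ag u M : mfunT u -> mfunT (ag u M).
move=> mU; apply: measurable_funM => //; apply: measurableT_comp => //.
have mu' : mfunT (fun x => (u x)%:E) by exact/measurable_EFinP.
under eq_fun do rewrite integralE; apply: emeasurable_funB.
 rewrite (_ : (fun x => _) = fun x => (\int[leb]_(t in cb M) (fun y => (u y)%:E)^\+ (sT (q t) x))%E).
  by apply: measurable_slice_int; [exact: measurable_cb|exact: measurable_funepos|].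
 by ext x; apply: eq_integral => t _; rewrite !funeposE.
rewrite (_ : (fun x => _) = fun x => (\int[leb]_(t in cb M) (fun y => (u y)%:E)^\- (sT (q t) x))%E).
 by apply: measurable_slice_int; [exact: measurable_cb|exact: measurable_funeneg|].
by ext x; apply: eq_integral => t _; rewrite !funenegE.
Qed.

(** Tonelli's theorem makes |u|^p integrable over each cube along almost every orbit, and |u| <= 1 +
    |u|^p there. *)
Lemma good_ae u p : 1 <= p -> mfunT u -> (\int[mu]_x (`|u x| `^ p)%:E < +oo)%E -> {ae mu, forall x, good u x}.
move=> p1 mU fu; apply: ae_foralln => N; have mN := measurable_hb (R := R) (fun=> 0) (fun _ : 'I_k => N%:R).
pose w x := (`|u x| `^ p)%:E.
have mw : mfunT w.
 by apply/measurable_EFinP; apply: (measurableT_comp (measurable_powR p)); exact: measurableT_comp.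
have w0 x : (0 <= w x)%E by rewrite lee_fin.
have iw : mu.-integrable setT (fun x => \int[leb]_(t in nb N) w (sT (q t) x))%E.
 apply/integrableP; split; first exact: measurable_slice_int.
 under eq_integral do rewrite gee0_abs ?integral_ge0//.
 by rewrite slice_tonelli// lte_mul_pinfty.
apply: filterS (integrable_ae measurableT iw) => x /(_ I) hx.
have iN : leb.-integrable (nb N) (fun t => 1%:E + w (sT (q t) x))%E.
 apply: integrableD => //.
  apply/integrableP; split => //.
  under eq_integral do rewrite gee0_abs ?lee01//.
  have hN : leb (nb N) = _ := lebesgue_hb (fun l => ler0n R N).
  by rewrite integral_cst// mul1e [X in (X < _)%E]hN ltry.
 apply/integrableP; split; first exact: measurable_funTS (measurableT_comp mw (measurable_orbit x)).
 under eq_integral do rewrite gee0_abs//.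
 by rewrite -ge0_fin_numE// integral_ge0.
apply: (le_integrable mN _ _ iN); first by apply/measurable_funTS/measurable_EFinP; exact: measurableT_comp mU (measurable_orbit x).
move=> t _; rewrite [leRHS]gee0_abs ?adde_ge0 ?lee01// lee_fin.
have [h|h] := leP `|u (sT (q t) x)| 1; first by rewrite (le_trans h)// lerDl.
rewrite -[leLHS]powRr1//; via (`|u (sT (q t) x)| `^ p); last by rewrite lerDr.
by apply: ler_powR => //; pos.
Qed.

(** Dominated convergence in t. The half-open boxes contain the closed box and shrink to it, so
    their indicators converge at every t, the boundary included. *)
Lemma ag_cvg u x M b (U : nat -> X -> R) : mfunT u -> good u x -> (forall l, 0 < M l) ->
 (forall i, mfunT (U i)) -> (forall i y, `|U i y| <= `|u y|) -> (forall y, U i y @[i --> \oo] --> u y) ->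
 (forall i l, M l < b i l <= 2 * M l) -> (forall l, b i l @[i --> \oo] --> M l) ->
 Av (fun=> 0) (b i) q (U i) x @[i --> \oo] --> ag u M x.
move=> mu' gx M0 mU Uu cU bM cb'; apply: cvgM.
 apply: cvgV; first pos.
 have -> : (fun i => vol (fun=> 0) (b i)) = fun i => \prod_l b i l.
  by ext i; apply: eq_bigr => l _; rewrite subr0.
 exact: (@cvg_big R _ _ _ predT (@mul_continuous R)) => l _.
pose N := Num.bound (\sum_l 2 * M l).
have MN l : 2 * M l < N%:R.
 apply: (@le_lt_trans _ _ (\sum_l 2 * M l)); last by apply: archi_boundP; pos.
 by rewrite (bigD1 l)//= lerDl; pos.
have mN := measurable_hb (R := R) (fun=> 0) (fun _ : 'I_k => N%:R).
pose D : set (k.-tuple R) := hb (fun=> 0) (fun _ : 'I_k => N%:R).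
have restr (B : set (k.-tuple R)) v : B `<=` D ->
  \int[leb]_(t in B) v (sT (q t) x) = fine (\int[leb]_(t in D) (v (sT (q t) x) * \1_B t)%:E).
 move=> BD; congr fine; rewrite integral_mkcond [RHS]integral_mkcond; apply: eq_integral => t _.
 rewrite !patchE indicE; case: ifPn => tB; last by rewrite mulr0; case: ifP.
 by rewrite (mem_set (BD _ (set_mem tB))) mulr1.
have bD i : hb (fun=> 0) (b i) `<=` D.
 move=> t h l; have /andP[-> h2] := h l; rewrite (lt_trans h2)//.
 by have /andP[_ h3] := bM i l; exact: le_lt_trans (MN l).
have cD : cb M `<=` D.
 move=> t h l; have /andP[-> h2] := h l; rewrite (le_lt_trans h2)//=; apply: lt_trans (MN l).
 by rewrite ltr_pMl// ltr1n.
rewrite (restr _ _ cD).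
have -> : (fun i => \int[leb]_(t in hb (fun=> 0) (b i)) U i (sT (q t) x)) =
  fine \o (fun i => (\int[leb]_(t in D) (U i (sT (q t) x) * \1_(hb (fun=> 0) (b i)) t)%:E)%E).
 by apply/funext => i /=; rewrite restr.
apply: fine_cvg.
have im B (v : X -> R) : measurable B -> mfunT v -> measurable_fun D (fun t => (v (sT (q t) x) * \1_B t)%:E).
 move=> mB mv; apply/measurable_funTS/measurable_EFinP; apply: measurable_funM => //.
 exact: measurableT_comp mv (measurable_orbit x).
have i1 B t : `|\1_B t : R| <= 1 by rewrite indicE; case: (t \in B); rewrite ?normr1 ?normr0.
have iu : leb.-integrable D (fun t => (`|u (sT (q t) x)|)%:E) by have := integrable_abse (gx N).
have fi : (\int[leb]_(t in D) (u (sT (q t) x) * \1_(cb M) t)%:E)%E \is a fin_num.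
 apply: integrable_fin_num => //; apply: (le_integrable mN _ _ iu); first exact: (im _ _ (measurable_cb M)).
 by move=> t _; rewrite lee_fin normr_id normrM ler_piMr.
rewrite fineK//; apply: (dominated_cvg (mu := leb) mN (f := fun t => (u (sT _ x) * \1_(cb M) t)%:E) _ _ _ iu).
- by move=> i; apply: im => //; exact: measurable_hb.
- move=> t _; apply: cvg_EFin; first exact: nearW.
 apply: cvgM => //.
 have [tM|tM] := pselect (cb M t).
  rewrite [X in _ --> X](_ : _ = 1); last by rewrite indicE mem_set.
  apply: cvg_near_cst; apply: nearW => i; rewrite indicE mem_set// => l.
  by have /andP[-> h] := tM l; have /andP[h' _] := bM i l; exact: le_lt_trans h'.
 rewrite [X in _ --> X](_ : _ = 0); last by rewrite indicE memNset.
 have /existsNP[l /negP] : ~ forall l, 0 <= tnth t l <= M l by [].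
 rewrite negb_and -!ltNge => /orP[tl|tl]; apply: cvg_near_cst.
  apply: nearW => i; rewrite indicE memNset// => /(_ l) /andP[h _].
  lra.
 have := cb' l; move/cvgr_lt => /(_ _ tl); apply: filterS => i h; rewrite indicE memNset// => /(_ l) /andP[_ h'].
 lra.
- by [].
by move=> i t _; rewrite lee_fin normrM -[leRHS]mulr1; apply: ler_pM.
Qed.

Lemma trunc_ex u : mfunT u -> exists U, [/\ forall i, B1 (U i), forall i y, `|U i y| <= `|u y| &
 forall y, U i y @[i --> \oo] --> u y].
move=> mU; have /sigma_finiteP[F [TF ndF Foo]] := sigma_finiteT mu.
pose U i y := if `|u y| <= i%:R then u y * \1_(F i) y else 0.
have Ule i y : `|U i y| <= `|u y|.
 rewrite /U; case: ifP => _; rewrite ?normr0// normrM ler_piMr// indicE.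
 by case: (y \in F i); rewrite ?normr1 ?normr0.
exists U; split => //.
 move=> i; have [mF Fi] := Foo i.
 have mUi : mfunT (U i).
  apply: measurable_fun_ifT => //; last exact: measurable_funM => //.
  by apply: measurable_fun_ler => //; exact: measurableT_comp.
 have bUi y : `|U i y| <= i%:R * \1_(F i) y.
  rewrite /U; case: ifP => h; last by rewrite normr0.
  by rewrite normrM [X in _ * X]ger0_norm ?indicE//; apply: ler_wpM2r.
 split; first by split => //; exists i%:R => y; letr (bUi y); rewrite ler_piMr.
 have iF : mu.-integrable setT (fun y => (i%:R * \1_(F i) y)%:E).
  under eq_fun do rewrite EFinM; apply: integrableZl => //; apply/integrableP; split.
   by apply/measurable_EFinP.
  by under eq_integral do rewrite gee0_abs ?lee_fin//; rewrite integral_indic// setIT.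
 apply: (le_integrable measurableT _ _ iF); first exact/measurable_EFinP.
 move=> y _; rewrite lee_fin (le_trans (bUi y))//; exact: ler_norm.
move=> y; apply: cvg_near_cst.
have [j _ Fj] : (\bigcup_i F i) y by rewrite -TF.
near=> i; rewrite /U indicE mem_set ?mulr1 ?ifT//.
 by apply: ltW; apply: (lt_le_trans (archi_boundP (normr_ge0 _))); rewrite ler_nat; near: i; exact: nbhs_infty_ge.
have ji : (j <= i)%N by near: i; exact: nbhs_infty_ge.
by have /subsetPset := ndF _ _ ji; exact.
Unshelve. all: by end_near.
Qed.

End averages.

Section convergence.
Context {R : realType}.

Lemma powR_cvg a (l p : R) : 0 < l -> a i @[i --> \oo] --> l -> a i `^ p @[i --> \oo] --> l `^ p.
move=> l0 al; have h : expR (p * ln (a i)) @[i --> \oo] --> expR (p * ln l).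
 apply: continuous_cvg; first exact: continuous_expR.
 apply: cvgMr; apply: continuous_cvg => //; exact: continuous_ln.
rewrite {2}/powR gt_eqF//; apply: cvg_trans h; apply: near_eq_cvg.
by have := al; move/cvgr_gt => /(_ _ l0); apply: filterS => i ai; rewrite /powR gt_eqF.
Qed.

Lemma einf_powR (a h : nat -> R) (l p : R) : 0 < p -> 0 <= l -> a i @[i --> \oo] --> l -> (forall i, 0 <= a i <= h i) ->
 ((l `^ p)%:E <= limn_einf (fun i => (h i `^ p)%:E))%E.
move=> p0 l0 al ah; have [->|ln0] := eqVneq l 0.
 by rewrite powR0 ?gt_eqF//; apply: (@einf_ge _ _ _ 0) => i _; rewrite lee_fin powR_ge0.
apply: (einf_cvg (a := fun i => a i `^ p)); first by apply: powR_cvg => //; rewrite lt_neqAle eq_sym ln0.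
by move=> i; have /andP[a0 h1] := ah i; rewrite lee_fin powR_mono// ltW.
Qed.

Lemma rho_cvg k (y0 : R) (M : 'I_k -> R) l : 0 < y0 -> y0 <= M l -> rho y0 i M l @[i --> \oo] --> M l.
move=> y00 yM; apply: (@squeeze_cvgr _ _ _ _ (fun=> M l) (fun i => M l * (1 + 2 ^- i))).
- by apply: nearW => i; have /andP[/ltW -> ->] := rho_bounds i y00 yM.
- exact: cvg_cst.
have h : (2^-1 : R) ^+ i @[i --> \oo] --> 0 by apply: cvg_expr; rewrite ger0_norm ?invr_ge0// invf_lt1 ?ltr1n.
rewrite -[X in _ --> X]mulr1; apply: cvgM; first exact: cvg_cst.
rewrite -[X in _ --> X]addr0; apply: cvgD; first exact: cvg_cst.
by under eq_fun do rewrite -exprVn.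
Qed.

End convergence.

(** * Majorants for chains of real boxes *)

Section transfer.
Context {R : realType} {k n d : nat} (s : dsys R d) (c : coef R k n d).
Notation X := (sX s).
Notation mu := (smu s).
Notation q := (mpolT c).
Implicit Types (u : X -> R) (M : 'I_k -> R).

Lemma Vav_cvg u M (y0 : R) U x : mfunT u -> good q u x -> 0 < y0 -> (forall l, y0 <= M l) ->
 (forall i, B1 (U i)) -> (forall i y, `|U i y| <= `|u y|) -> (forall y, U i y @[i --> \oo] --> u y) ->
 Vav c (U i) (rho y0 i M) x @[i --> \oo] --> ag q u M x.
move=> mU gx y00 yM bU Uu cU; apply: (ag_cvg (mp_mpol _ c)) => //.
- by move=> l; exact: lt_le_trans (yM l).
- by move=> i; have [[]] := bU i.
- move=> i l; have /andP[-> h] := rho_bounds i y00 (yM l); rewrite (le_trans h)//= mulrC ler_wpM2r//.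
  exact: le_trans (ltW _) (yM l).
 by rewrite lerD2l invf_le1 ?exprn_gt0// exprn_ege1// ler1n.
- by move=> l; exact: rho_cvg.
Qed.

Lemma integral_mono (f g : X -> R) : mfunT f -> mfunT g -> (forall x, 0 <= f x <= g x) ->
 (\int[mu]_x (f x)%:E <= \int[mu]_x (g x)%:E)%E.
move=> mf mg fg; apply: ge0_le_integral; [exact: measurableT| |exact/measurable_EFinP|exact/measurable_EFinP|];
 by move=> x _; have /andP[f0 fgx] := fg x => //.
Qed.

Lemma trunc_II u U (p F : R) : mfunT u -> B1 U -> (forall y, `|U y| <= `|u y|) -> 1 <= p ->
 (\int[mu]_x (`|u x| `^ p)%:E <= F%:E)%E -> (\I x, `|U x| `^ p) <= F.
move=> mU bU Uu p1 uF; have bp : B1 (fun x => `|U x| `^ p) by apply: B1_pow => //; exact: B1_norm.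
rewrite -lee_fin (II_fin bp); apply: le_trans uF; apply: integral_mono; first by have [[]] := bp.
 by apply: (measurableT_comp (measurable_powR p)); exact: measurableT_comp.
by move=> x; rewrite powR_ge0 powR_mono// (le_trans ler01).
Qed.

Lemma einf_integral g B : (forall i, B1 (g i)) -> (forall i x, 0 <= g i x) -> (forall i, II (g i) <= B) ->
 [/\ mfunT (fun x => limn_einf (fun i => (g i x)%:E)), (forall x, 0 <= limn_einf (fun i => (g i x)%:E))%E &
  (\int[mu]_x limn_einf (fun i => (g i x)%:E) <= B%:E)%E].
move=> bg g0 gB.
have mg i : mfunT (fun x => (g i x)%:E) by apply/measurable_EFinP; have [[]] := bg i.
split; first exact: measurable_einf.
 by move=> x; apply: (@einf_ge _ _ _ 0) => i _; rewrite lee_fin.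
apply: le_trans (fatou mu measurableT mg _) _; first by move=> i x _; rewrite lee_fin.
by apply: (@einf_le _ _ _ 0) => i _; rewrite -II_fin// lee_fin.
Qed.

End transfer.

(** The grid is refined while u is truncated, both with index i. The functions h depend on i, but
    their bound does not; for every M the increment is a limit of quantities below [h i t], so lower
    limits of h dominate all M simultaneously. *)
Lemma chain_limit (R : realType) k n p : 1 < p -> exists2 C : R, 0 < C &
 forall d s (c : coef R k n d) (u : sX s -> R) (F y0 : R) J I,
 mfunT u -> (\int[smu s]_x (`|u x| `^ p)%:E <= F%:E)%E -> 0 < y0 -> (forall l, y0 <= I 0%N l) ->
 (forall t l, I t l <= I t.+1 l) -> (forall t l, I t l <= I J l) ->
 exists h, [/\ forall i t, B1 (h i t),
  forall i, (\I x, nrm (index_enum 'I_J) ((h i)^~ x) `^ p) <= C * F &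
  forall x, good (mpolT c) u x -> forall (t : 'I_J) M, (forall l, I t l <= M l) -> (forall l, M l <= I t.+1 l) ->
   exists2 a, a i @[i --> \oo] --> `|ag (mpolT c) u M x - ag (mpolT c) u (I t) x| &
    forall i, 0 <= a i <= h i t x].
move=> p1; have [C C0 HC] := level_maj (R := R) k n p1; exists C => // d s c u F y0 J I mU uF y00 yI mI bI.
have [U [bU Uu cU]] := trunc_ex mU.
have HG i := HC d s c y0 i (U i) J I y00 (bU i) mI bI.
have [G hG] := choice HG.
exists (fun i t => G i t); split => [i t|i|x gx t M h1 h2]; first by have [h _ _] := hG i.
 have [_ _ h] := hG i; letr h; apply: ler_wpM2l; first pos.
 exact: trunc_II mU (bU i) (Uu i) (ltW p1) uF.
have yt t' l : y0 <= I t' l.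
 by elim: t' => [|t' IH] => //; exact: le_trans (mI _ _).
exists (fun i => `|Vav c (U i) (rho y0 i M) x - Vav c (U i) (rho y0 i (I t)) x|).
 apply: cvg_norm; apply: cvgB; apply: Vav_cvg => //.
 by move=> l; exact: le_trans (yt t l) (h1 l).
by move=> i; rewrite normr_ge0; have [_ h _] := hG i; exact: h.
Qed.

Definition chain_cond (R : realType) k (y0 : R) (I : nat -> 'I_k -> R) J :=
 [/\ 0 < y0, forall l, y0 <= I 0%N l, forall t l, I t l <= I t.+1 l & forall t l, I t l <= I J l].

Definition between (R : realType) k (I : nat -> 'I_k -> R) (t : nat) (M : 'I_k -> R) :=
 (forall l, I t l <= M l) /\ (forall l, M l <= I t.+1 l).

Section real_majorants.
Context {R : realType} {d : nat}.

(** Measurable majorants with controlled integral stand in for suprema over uncountably many M, so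
    that the measurability of the latter is never at issue. *)
Definition Wfun (s : dsys R d) (B : R) (W : sX s -> \bar R) :=
 [/\ mfunT W, forall x, (0 <= W x)%E & (\int[smu s]_x W x <= B%:E)%E].

End real_majorants.

(** M selects one point in each block, and W does not depend on the selection. *)
Lemma chain_osc (R : realType) k n p : 1 < p -> exists2 C : R, 0 < C &
 forall d s (c : coef R k n d) (u : sX s -> R) F y0 J I,
 mfunT u -> (\int[smu s]_x (`|u x| `^ p)%:E <= F%:E)%E -> chain_cond y0 I J ->
 exists2 W, Wfun (C * F) W &
  forall x, good (mpolT c) u x -> forall M, (forall t : 'I_J, between I t (M t)) ->
  ((nrm (index_enum 'I_J) (fun t => ag (mpolT c) u (M t) x - ag (mpolT c) u (I t) x) `^ p)%:E <= W x)%E.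
move=> p1; have [C C0 HC] := chain_limit (R := R) k n p1; exists C => // d s c u F y0 J I mU uF [y00 yI mI bI].
have p0 := lt_trans ltr01 p1.
have [h [bh hF hx]] := HC d s c u F y0 J I mU uF y00 yI mI bI.
exists (fun x => limn_einf (fun i => (nrm (index_enum 'I_J) ((h i)^~ x) `^ p)%:E)).
 apply: einf_integral => // [i|i x]; last pos.
 by apply: B1_pow; [pos|move=> y; pos|exact: B1_nrm].
move=> x gx M hM.
have /choice[a ha] t : exists b : nat -> R,
  b i @[i --> \oo] --> `|ag (mpolT c) u (M t) x - ag (mpolT c) u (I t) x| /\ forall i, 0 <= b i <= h i t x.
 by have [h1 h2] := hM t; have [b e1 e2] := hx x gx t (M t) h1 h2; exists b.
rewrite -nrm_abs; apply: (einf_powR (a := fun i => nrm (index_enum 'I_J) (fun t => a t i))) => //.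
- pos.
- apply: continuous_cvg; first exact: sqrt_continuous.
 apply: (@cvg_big R _ +%R 0 predT); first exact: add_continuous.
 move=> t _; rewrite expr2; under eq_fun do rewrite expr2.
 by apply: cvgM; exact: (ha t).1.
move=> i; rewrite nrm_ge0; apply: nrm_le => t; have /andP[a0 ah] := (ha t).2 i.
by rewrite ger0_norm.
Qed.

(** For p < 2 the l^p sum over the blocks is bounded through the l^2 sum at the cost of J^(1 - p/2),
    for p >= 2 at no cost. As the exponent is below 1, long chains cannot have a fixed amount of
    oscillation in every block. *)
Lemma chain_sum (R : realType) k n p : 1 < p -> exists kappa C : R, [/\ kappa < 1, 0 < C &
 forall d s (c : coef R k n d) (u : sX s -> R) F y0 J I,
 mfunT u -> (\int[smu s]_x (`|u x| `^ p)%:E <= F%:E)%E -> chain_cond y0 I J ->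
 exists W : 'I_J -> sX s -> \bar R, [/\ forall t, mfunT (W t), forall t x, (0 <= W t x)%E,
  (\sum_t \int[smu s]_x W t x <= (J%:R `^ kappa * (C * F))%:E)%E &
  forall x, good (mpolT c) u x -> forall (t : 'I_J) M, between I t M ->
  ((`|ag (mpolT c) u M x - ag (mpolT c) u (I t) x| `^ p)%:E <= W t x)%E]].
move=> p1; have [C C0 HC] := chain_limit (R := R) k n p1.
have p0 := lt_trans ltr01 p1.
exists ((Num.max 1 (2 / p) - 1) * (p / 2)), C; split => //.
 have [h|h] := leP 1 (2 / p); last by rewrite subrr mul0r.
 rewrite mulrBl mul1r mulrA divfK ?gt_eqF// divff ?pnatr_eq0// ltrBlDr ltrDl divr_gt0//.
move=> d s c u F y0 J I mU uF [y00 yI mI bI].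
have [h [bh hF hx]] := HC d s c u F y0 J I mU uF y00 yI mI bI.
have bhp i t : B1 (fun x => `|h i t x| `^ p) by apply: B1_pow => //; [pos|exact: B1_norm].
have mh i t : mfunT (fun x => (`|h i t x| `^ p)%:E) by apply/measurable_EFinP; have [[]] := bhp i t.
have h0 i t x : (0 <= (`|h i t x| `^ p)%:E)%E by [].
have W0 t x : (0 <= limn_einf (fun i => (`|h i t x| `^ p)%:E))%E by apply: (@einf_ge _ _ _ 0).
have mW t : mfunT (fun x => limn_einf (fun i => (`|h i t x| `^ p)%:E)) by exact: measurable_einf.
exists (fun t x => limn_einf (fun i => (`|h i t x| `^ p)%:E)); split => //.
 rewrite -ge0_integral_sum//.
 apply: (@le_trans _ _ (\int[smu s]_x limn_einf (fun i => (\sum_t `|h i t x| `^ p)%:E))%E).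
  apply: ge0_le_integral; [by []| | | |].
  - by move=> x _; apply: sume_ge0 => t _.
  - exact: emeasurable_sum.
  - apply: measurable_einf => i; apply/measurable_EFinP.
   by apply: measurable_sum => t; have [[]] := bhp i t.
  - move=> x _; have := einf_sum (u := fun t i => (`|h i t x| `^ p)%:E) (fun t i => h0 i t x).
   by under [in X in (_ <= X)%E -> _]eq_fun do rewrite sumEFin.
 have bs i : B1 (fun x => \sum_t `|h i t x| `^ p) by apply: B1_sum => t.
 suff hI i : (\I x, \sum_t `|h i t x| `^ p) <= J%:R `^ ((Num.max 1 (2 / p) - 1) * (p / 2)) * (C * F).
  by have [] := einf_integral bs (fun i x => sumr_ge0 _ (fun t _ => powR_ge0 `|h i t x| p)) hI.
 have bn : B1 (fun x => nrm (index_enum 'I_J) ((h i)^~ x) `^ p) by apply: B1_pow; [pos|move=> y; pos|exact: B1_nrm].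
 apply: le_trans (ler_wpM2l (powR_ge0 _ _) (hF i)); rewrite -IIZ//.
 apply: II_le => // [|x]; first exact: B1Z.
 have e t : `|h i t x| `^ p = (h i t x ^+ 2) `^ (p / 2).
  by rewrite -real_normK ?num_real// -powR_mulrn// -powRrM mulrCA divff ?mulr1.
 under eq_bigr do rewrite e.
 have y0' t : 0 <= (h i t x ^+ 2) `^ (p / 2) by exact: powR_ge0.
 have := sum_powR_le (index_enum 'I_J) (divr_gt0 (ltr0n R 2) p0) y0'.
 have pp z : (z `^ (p / 2)) `^ (2 / p) = z `^ 1 by rewrite -powRrM mulrA divfK ?divff// gt_eqF.
 under [in X in _ <= X -> _]eq_bigr do rewrite pp powRr1 ?sqr_ge0//.
 have -> : size (index_enum 'I_J) = J by rewrite [index_enum _]unlock -enumT size_enum_ord.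
 move=> /(powR_mono (p := p / 2)) -/(_ (ltW (divr_gt0 p0 (ltr0n R 2))) (powR_ge0 _ _)).
 have h2 : 2 / p * (p / 2) = 1 by rewrite mulrA divfK ?divff ?pnatr_eq0// gt_eqF.
 have s0 : 0 <= \sum_t h i t x ^+ 2 by apply: sumr_ge0 => t _; pos.
 rewrite -powRrM h2 (powRM _ (powR_ge0 _ _) s0) -powRrM nrm_powR powRr1//.
 pos.
move=> x gx t M [h1 h2]; have [a al ah] := hx x gx t M h1 h2.
apply: (einf_powR p0 _ al) => // i; have /andP[-> h3] := ah i.
exact: le_trans h3 (ler_norm _).
Qed.

Section Wfun_theory.
Context {R : realType} {d : nat} (s : dsys R d).
Notation mu := (smu s).

Lemma Wfun_einf (W : nat -> sX s -> \bar R) B : (forall j, Wfun B (W j)) -> Wfun B (fun x => limn_einf (W^~ x)).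
move=> h; have mW j : mfunT (W j) by have [] := h j.
have W0 j x : (0 <= W j x)%E by have [_ + _] := h j.
split; [exact: measurable_einf|by move=> x; apply: (@einf_ge _ _ _ 0)|].
apply: le_trans (fatou mu _ mW _) _ => //.
by apply: (@einf_le _ _ _ 0) => j _; have [] := h j.
Qed.

Lemma Wfun_comb (a B B' : R) (W W' : sX s -> \bar R) : 0 <= a -> Wfun B W -> Wfun B' W' ->
 Wfun (a * (B + B')) (fun x => a%:E * (W x + W' x))%E.
move=> a0 [mW W0 IW] [mW' W0' IW']; have mS := emeasurable_funD mW mW'; split.
- exact: emeasurable_funM.
- by move=> x; rewrite mule_ge0 ?adde_ge0.
rewrite ge0_integralZl//; last by move=> x _; exact: adde_ge0.
rewrite ge0_integralD// EFinM; apply: lee_wpmul2l => //.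
by rewrite EFinD; exact: leeD.
Qed.

End Wfun_theory.

(** * Maximal majorants and small tails *)

Section real_bounds.
Context {R : realType} {k n : nat}.

Lemma lp_avg p d s (c : coef R k n d) (u : sX s -> R) (F y0 : R) M : 1 <= p ->
 mfunT u -> (\int[smu s]_x (`|u x| `^ p)%:E <= F%:E)%E -> 0 < y0 -> (forall l, y0 <= M l) ->
 exists2 W, Wfun F W &
  forall x, good (mpolT c) u x -> ((`|ag (mpolT c) u M x| `^ p)%:E <= W x)%E.
move=> p1 mU uF y00 yM; have p0 := lt_le_trans ltr01 p1.
have [U [bU Uu cU]] := trunc_ex mU.
have lb i : lt_box (fun=> 0) (rho y0 i M).
 by move=> l; have /andP[h _] := rho_bounds i y00 (yM l); exact: lt_trans (lt_le_trans _ (yM l)) h.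
have mA i := Av_markov s (lb i) (mp_mpol finset.setT c).
have bV i : B1 (fun x => `|Vav c (U i) (rho y0 i M) x| `^ p).
 by apply: B1_pow => //; apply: B1_norm; exact: mk_B1.
exists (fun x => limn_einf (fun i => (`|Vav c (U i) (rho y0 i M) x| `^ p)%:E)).
 apply: einf_integral => // i.
 have bn := B1_norm (bU i).
 have bp : B1 (fun x => `|U i x| `^ p) by exact: B1_pow.
 via (II _); last exact: trunc_II mU (bU i) (Uu i) p1 uF.
 rewrite -(mkI (mA i) bp); apply: II_le => //; first exact: mk_B1.
 move=> x; apply: le_trans (mk_pow (mA i) x p1 (B1_Bm bn) (fun y => normr_ge0 (U i y))).
 by apply: powR_mono; [pos|by []|apply: mk_dom].
move=> x gx; apply: (einf_powR (a := fun i => `|Vav c (U i) (rho y0 i M) x|)) => //.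
 by apply: cvg_norm; exact: Vav_cvg.
by move=> i; rewrite normr_ge0 /=.
Qed.

(** A chain with a single block, from 2^(-j) to 2^j in all coordinates, together with the average at
    its lower corner. Every M lies in the block for large j, and the lower limit over j keeps the
    bound. *)
Lemma maximal_bound p : 1 < p -> exists2 C : R, 0 < C &
 forall d s (c : coef R k n d) (u : sX s -> R) F,
 mfunT u -> (\int[smu s]_x (`|u x| `^ p)%:E <= F%:E)%E ->
 exists2 W, Wfun (C * F) W &
  forall x, good (mpolT c) u x -> forall M, (forall l, 0 < M l) -> ((`|ag (mpolT c) u M x| `^ p)%:E <= W x)%E.
move=> p1; have [ka [C [_ C0 HC]]] := chain_sum (R := R) k n p1; have p0 := lt_trans ltr01 p1.
exists (2 `^ p * (C + 1)); first pos.
move=> d s c u F mU uF; set q := mpol finset.setT c.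
pose I j t : 'I_k -> R := fun=> if t is 0 then 2 ^- j else 2 ^+ j.
have y0 j : 0 < 2 ^- j :> R by [].
have y1 j : 2 ^- j <= 2 ^+ j :> R.
 by via 1; [rewrite invf_le1 ?exprn_gt0//|]; rewrite exprn_ege1// ler1n.
have hW j : exists2 W : sX s -> \bar R, Wfun (2 `^ p * (C + 1) * F) W &
  forall x, good q u x -> forall M, between (I j) 0 M -> ((`|ag q u M x| `^ p)%:E <= W x)%E.
 have cI : chain_cond (2 ^- j) (I j) 1 by split => //; move=> [|t] l /=.
 have [W [mW W0 IW hW]] := HC d s c u F (2 ^- j) 1%N (I j) mU uF cI.
 have [V wV hV] := lp_avg (M := I j 0%N) c (ltW p1) mU uF (y0 j) (fun l => lexx _).
 have wW : Wfun (C * F) (W ord0) by split => //; move: IW; rewrite big_ord1 powR1 mul1r.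
 exists (fun x => (2 `^ p)%:E * (W ord0 x + V x))%E.
  by rewrite -mulrA mulrDl mul1r; apply: Wfun_comb => //.
 move=> x gx M bM; apply: (@le_trans _ _ (2 `^ p * (`|ag q u M x - ag q u (I j 0%N) x| `^ p + `|ag q u (I j 0%N) x| `^ p))%:E).
  apply: le_trans (powR_add (ltW p0) (normr_ge0 _) (normr_ge0 _)).
  apply: powR_mono; [pos|by []|].
  by rewrite -{1}(subrK (ag q u (I j 0) x) (ag q u M x)) ler_normD.
 rewrite EFinM EFinD; apply: lee_wpmul2l => //.
 by apply: leeD; [exact: (hW x gx ord0)|exact: hV].
have /choice[W wW'] j : exists W : sX s -> \bar R, Wfun (2 `^ p * (C + 1) * F) W /\
  forall x, good q u x -> forall M, between (I j) 0 M -> ((`|ag q u M x| `^ p)%:E <= W x)%E.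
 by have [W h1 h2] := hW j; exists W.
exists (fun x => limn_einf (W^~ x)); first by apply: Wfun_einf => j; exact: (wW' j).1.
move=> x gx M M0; pose N := Num.bound (\sum_l (M l + (M l)^-1)).
have hN l : M l <= N%:R /\ (M l)^-1 <= N%:R.
 have p1' l' : 0 <= M l' + (M l')^-1 by rewrite addr_ge0 ?invr_ge0// ltW.
 have : M l + (M l)^-1 <= N%:R.
  via (\sum_l (M l + (M l)^-1)); last by apply/ltW/archi_boundP/sumr_ge0 => l' _.
  by rewrite (bigD1 l)//= lerDl sumr_ge0.
 by move=> h; split; apply: le_trans h; [rewrite lerDl invr_ge0 ltW|rewrite lerDr ltW].
apply: (@einf_ge _ _ _ N) => j Nj; apply: (wW' j).2 => //.
have N2 : N%:R <= 2 ^+ j :> R.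
 by rewrite -natrX ler_nat; apply: leq_trans Nj _; exact: ltnW (ltn_expl _ _).
split => l /=; last exact: le_trans (hN l).1 N2.
by rewrite -[leRHS]invrK lef_pV2 ?posrE ?invr_gt0//; exact: le_trans (hN l).2 N2.
Qed.

(** By contradiction: if no corner A had a small tail, bad intervals chosen one after the other
    would form chains of J blocks, each contributing at least dl, against the bound J^kappa with
    kappa < 1 of [chain_sum]. *)
Lemma tail_maj p d s (c : coef R k n d) (u : sX s -> R) (F dl : R) : 1 < p -> 0 < dl ->
 mfunT u -> (\int[smu s]_x (`|u x| `^ p)%:E <= F%:E)%E ->
 exists A : R, 0 < A /\ exists2 W, Wfun dl W &
  forall x, good (mpolT c) u x -> forall M, (forall l, A <= M l) ->
   ((`|ag (mpolT c) u M x - ag (mpolT c) u (fun=> A) x| `^ p)%:E <= W x)%E.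
move=> p1 dl0 mU uF; set q := mpol finset.setT c.
have [ka [C [ka1 C0 HC]]] := chain_sum (R := R) k n p1; have p0 := lt_trans ltr01 p1.
(* Bounded ranges come first, because a block of a chain needs an upper end; L is removed afterwards
   by a lower limit. *)
pose S A L := exists2 W : sX s -> \bar R, Wfun dl W & forall x, good q u x -> forall M : 'I_k -> R,
 (forall l, A <= M l) -> (forall l, M l <= L) -> ((`|ag q u M x - ag q u (fun=> A) x| `^ p)%:E <= W x)%E.
have [A [A0 hA]] : exists A, 0 < A /\ forall L, A <= L -> S A L.
 apply: contrapT => /forallNP nS.
 have /choice[L hL] (A : R) : exists L, 0 < A -> A <= L /\ ~ S A L.
  have [A0|A0] := pselect (0 < A); last by exists 0.
  apply: contrapT => /forallNP h; apply: (nS A); split => // L AL.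
  by apply: contrapT => nL; apply: (h L) => _.
 pose a t := iter t L 1.
 have a0 t : 0 < a t.
  by elim: t => [|t IH] /= => //; have [h _] := hL _ IH; exact: lt_le_trans h.
 have aS t : a t <= a t.+1 := (hL _ (a0 t)).1.
 have am t t' : (t <= t')%N -> a t <= a t' by move=> h; apply: (homo_leq _ (fun y x z => @le_trans _ _ y x z)).
 pose B := C * F / dl.
 (* For such J the total J dl exceeds J^ka C F. *)
 have [J J0 hJ] : exists2 J : nat, (0 < J)%N & B < J%:R `^ (1 - ka).
  have k0 : 0 < 1 - ka by rewrite subr_gt0.
  pose B' := `|B| + 1; have B0 : 0 < B' by rewrite ltr_wpDl.
  exists (Num.bound (B' `^ (1 - ka)^-1)) => //.
  apply: (@lt_le_trans _ _ B'); first by rewrite (le_lt_trans (ler_norm _))// ltrDl.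
  have e : (B' `^ (1 - ka)^-1) `^ (1 - ka) = B' by rewrite -powRrM mulVf ?gt_eqF// powRr1// ltW.
  rewrite -[leLHS]e.
  by apply: powR_mono; [pos|pos|exact/ltW/archi_boundP/powR_ge0].
 pose I t : 'I_k -> R := fun=> a (minn t J).
 have cI : chain_cond 1 I J.
  split => [|l|t l|t l]; [pos|by rewrite /I min0n| |]; apply: am; first by rewrite leq_min geq_minr (leq_trans (geq_minl _ _)).
  by rewrite minnn geq_minr.
 have [W [mW W0 IW hW]] := HC d s c u F 1 J I mU uF cI.
 have dW t : (dl%:E <= \int[smu s]_x W t x)%E.
  rewrite leNgt; apply/negP => h; have [_] := hL (a t) (a0 t); apply.
  exists (W t); first by split => //; pos.
  have e1 : I t = fun=> a t by rewrite /I (minn_idPl (ltnW _)).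
  have e2 : I t.+1 = fun=> a t.+1 by rewrite /I (minn_idPl _).
  by move=> x gx M h1 h2; rewrite -e1; apply: hW => //; split => l; rewrite ?e1 ?e2.
 have : (\sum_(t < J) dl%:E <= (J%:R `^ ka * (C * F))%:E)%E by apply: le_trans IW; apply: lee_sum => t _.
 rewrite sumEFin lee_fin sumr_const card_ord leNgt => /negP; apply.
 have Jr : 0 < J%:R :> R by rewrite ltr0n.
 have -> : C * F = B * dl by rewrite divfK// gt_eqF.
 have e : J%:R `^ ka * J%:R `^ (1 - ka) = J%:R :> R.
  by rewrite -powRD ?subrKC ?powRr1 ?ltW//; rewrite gt_eqF.
 by rewrite mulrA -[ltRHS]mulr_natl ltr_pM2r// -[ltRHS]e ltr_pM2l// powR_gt0.
exists A; split => //.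
have /choice[W hW] j : exists W : sX s -> \bar R, Wfun dl W /\ forall x, good q u x -> forall M : 'I_k -> R,
 (forall l, A <= M l) -> (forall l, M l <= A + j%:R) -> ((`|ag q u M x - ag q u (fun=> A) x| `^ p)%:E <= W x)%E.
 have [|W h1 h2] := hA (A + j%:R); first by rewrite lerDl.
 by exists W.
exists (fun x => limn_einf (W^~ x)); first by apply: Wfun_einf => j; exact: (hW j).1.
move=> x gx M AM; have M0 l : 0 <= M l by exact: le_trans (ltW A0) (AM l).
apply: (@einf_ge _ _ _ (Num.bound (\sum_l M l))) => j Nj; apply: (hW j).2 => // l.
via (\sum_l M l); first by rewrite (bigD1 l)//= lerDl sumr_ge0.
letr (ltW (archi_boundP (sumr_ge0 _ (fun l _ => M0 l)))).
by apply: (@le_trans _ _ j%:R); [rewrite ler_nat|rewrite lerDr ltW].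
Qed.

End real_bounds.

(** * From pointwise majorants to L^p norms *)

Section suprema.
Context {R : realType}.
Local Open Scope ereal_scope.

Lemma einf_lt (u : nat -> \bar R) l : limn_einf u < l -> exists i, u i < l.
move=> h; apply: contrapT => /forallNP n; move: h; rewrite ltNge => /negP; apply.
by apply: (@einf_ge _ _ _ 0) => i _; rewrite leNgt; exact/negP.
Qed.

Lemma powR_sup (S : set R) w (p : R) : (0 < p)%R -> S !=set0 -> (forall y, S y -> (0 <= y)%R) ->
 0 <= w -> (forall y, S y -> (y `^ p)%:E <= w) -> `|ereal_sup (EFin @` S)| `^ p <= w.
move=> p0 [y0 Sy0] S0 w0 h; case: w w0 h => [w|_ _|//]; last by rewrite leey.
rewrite lee_fin => w0 h; have pn : p != 0%R by rewrite gt_eqF.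
have s0 : 0 <= ereal_sup (EFin @` S).
 by via y0%:E; [rewrite lee_fin S0|apply: ereal_sup_ubound; exists y0].
have sw : ereal_sup (EFin @` S) <= (w `^ p^-1)%:E.
 apply: ge_ereal_sup => _ [y Sy <-]; rewrite lee_fin -[leLHS](powRr1 (S0 y Sy)) -(divff pn) powRrM.
 by apply: powR_mono; [rewrite invr_ge0 ltW|pos|rewrite -lee_fin; exact: h].
rewrite gee0_abs//.
via (((w `^ p^-1)%:E) `^ p).
 by apply: gt0_ler_poweR => //; [pos|rewrite in_itv /= s0 leey|rewrite in_itv /= lee_fin powR_ge0 leey].
by rewrite lee_fin -powRrM mulVf// powRr1.
Qed.

(** The suprema are attained at unrelated points for different t, so bounding every selection of one
    point per index is enough: near-maximisers with error e/(J + 1) form a selection. *)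
Lemma sum_sup_le J Y D (g : 'I_J -> Y -> R) (b : R) : (forall t, D t !=set0) -> (forall t y, (0 <= g t y)%R) ->
 (forall y : 'I_J -> Y, (forall t, D t (y t)) -> (\sum_t g t (y t) <= b)%R) ->
 \sum_t ereal_sup [set (g t y)%:E | y in D t] <= b%:E.
move=> Dn g0 h; have /choice[z Dz] t : exists y, D t y by exact: Dn.
have fS t : ereal_sup [set (g t y)%:E | y in D t] \is a fin_num.
 apply/andP; split.
  rewrite gt_eqF// (@lt_le_trans _ _ (g t (z t))%:E) ?ltNyr//.
  by apply: ereal_sup_ubound; exists (z t).
 rewrite lt_eqF// (@le_lt_trans _ _ b%:E) ?ltry//; apply: ge_ereal_sup => _ [y Dy <-]; rewrite lee_fin.
 pose y' t' := if t' == t then y else z t'.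
 have Dy' t' : D t' (y' t') by rewrite /y'; case: eqP => [->|].
 apply: le_trans (h y' Dy'); rewrite (bigD1 t)//= {1}/y' eqxx lerDl.
 pos.
apply/lee_addgt0Pr => e e0.
have e1 : (0 < e / J.+1%:R)%R by rewrite divr_gt0.
have /choice[y hy] t : exists y, D t y /\ ereal_sup [set (g t y)%:E | y in D t] <= (g t y + e / J.+1%:R)%:E.
 have [_ [y Dy <-] hy] := ub_ereal_sup_adherent e1 (fS t); exists y; split => //.
 by rewrite EFinD -leeBlDr//; pos.
via (\sum_t (g t (y t) + e / J.+1%:R)%:E); first by apply: lee_sum => t _; exact: (hy t).2.
rewrite sumEFin big_split /=; apply: lerD; first by apply: h => t; exact: (hy t).1.
rewrite sumr_const card_ord -[leLHS]mulr_natl mulrCA ger_pMr// ler_pdivrMr// mul1r ler_nat.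
by [].
Qed.

End suprema.

Section lp.
Context {R : realType} {d : nat} (s : dsys R d).
Notation X := (sX s).
Notation mu := (smu s).

Lemma Wfun_ge0 B (W : X -> \bar R) : Wfun B W -> 0 <= B.
by move=> [mW W0 IW]; rewrite -lee_fin; apply: le_trans IW; exact: integral_ge0. Qed.

Lemma Wfun_Lnorm (p B : R) (h W : X -> \bar R) : 0 < p -> Wfun B W -> {ae mu, forall x, (`|h x| `^ p <= W x)%E} ->
 ('N[mu]_p%:E[h] <= (B `^ p^-1)%:E)%E.
move=> p0 wW hW; have [mW W0 IW] := wW; rewrite unlock.
have hI : (\int[mu]_x (`|h x| `^ p) <= B%:E)%E.
 by apply: le_trans IW; apply: lower_integral_le => // x; exact: poweR_ge0.
have I0 : (0 <= \int[mu]_x (`|h x| `^ p))%E by apply: integral_ge0 => x _; exact: poweR_ge0.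
rewrite -poweR_EFin; apply: gt0_ler_poweR => //; first pos.
 by rewrite in_itv /= I0 leey.
by rewrite in_itv /= lee_fin (Wfun_ge0 wW) leey.
Qed.

End lp.

Lemma powR_shift (R : realType) (p a b : R) w : 0 < p -> (0 <= w)%E ->
 ((forall b', ((b' `^ p)%:E = w) -> 0 <= b' -> `|a - b| <= 2 * b') -> ((`|a - b| `^ p)%:E <= (2 `^ p)%:E * w)%E).
move=> p0; case: w => [w|_ _|//]; last by rewrite gt0_muley ?leey.
rewrite lee_fin => w0 h; have e : (w `^ p^-1) `^ p = w by rewrite -powRrM mulVf ?powRr1// gt_eqF.
rewrite -[in leRHS]e -EFinM -powRM ?powR_ge0//; apply: powR_mono; [pos|by []|].
by apply: h; [rewrite e|pos].
Qed.

(** * Existence of the limit *)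

Section limits.
Context {R : realType} {k n d : nat} (s : dsys R d) (c : coef R k n d) (p : R) (p1 : 1 < p).
Context (u : sX s -> R) (F : R) (mU : mfunT u) (uF : (\int[smu s]_x (`|u x| `^ p)%:E <= F%:E)%E).
Notation X := (sX s).
Notation mu := (smu s).
Notation q := (mpolT c).
Let p0 : 0 < p := lt_trans ltr01 p1.
Let hq : mp q := mp_mpol finset.setT c.

(** A lower limit over countably many diagonal boxes, hence measurable by construction; by
    [tail_maj] all averages with large sides are close to it. [fine] gives 0 where the lower limit
    is infinite. *)
Definition glim (x : X) : R := fine (limn_einf (fun i : nat => (ag q u (fun=> i%:R) x)%:E)).

Lemma measurable_glim : mfunT glim.
apply: measurableT_comp => //; apply: measurable_einf => i.
by apply/measurable_EFinP; exact: measurable_ag.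
Qed.

Lemma glim_itv x A (a b : R) : (forall M, (forall l, A <= M l) -> a <= ag q u M x <= b) -> a <= glim x <= b.
move=> h; pose N := Num.bound `|A|.
have hi i : (N <= i)%N -> a <= ag q u (fun=> i%:R) x <= b.
 move=> Ni; apply: h => _; letr (ler_norm _); apply: ltW; apply: (lt_le_trans (archi_boundP (normr_ge0 A))).
 by rewrite ler_nat.
have h1 : (a%:E <= limn_einf (fun i : nat => (ag q u (fun=> i%:R) x)%:E))%E.
 by apply: (@einf_ge _ _ _ N) => i /hi /andP[h1 _].
have h2 : (limn_einf (fun i : nat => (ag q u (fun=> i%:R) x)%:E) <= b%:E)%E.
 by apply: (@einf_le _ _ _ N) => i /hi /andP[_ h2].
have fl : limn_einf (fun i : nat => (ag q u (fun=> i%:R) x)%:E) \is a fin_num.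
 by rewrite fin_numE gt_eqF ?lt_eqF//; [exact: le_lt_trans h2 (ltry _)|exact: lt_le_trans (ltNyr _) h1].
by rewrite -!lee_fin fineK// h1.
Qed.

Lemma glim_close x (A A' b : R) : (forall M, (forall l, A <= M l) -> `|ag q u M x - ag q u (fun=> A') x| <= b) ->
 forall M, (forall l, A <= M l) -> `|ag q u M x - glim x| <= 2 * b.
move=> h M AM; set y := ag q u (fun=> A') x in h *.
have : y - b <= glim x <= y + b by apply: (@glim_itv x A) => M' h'; rewrite -ler_distl; exact: h.
rewrite -ler_distl distrC => h'.
have -> : ag q u M x - glim x = (ag q u M x - y) + (y - glim x) by rewrite addrA subrK.
by rewrite mulr_natl; apply: le_trans (ler_normD _ _) (lerD (h M AM) h').
Qed.

Lemma tail_glim (dl : R) : 0 < dl -> exists A, exists2 W, Wfun dl W &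
  forall x, good q u x -> forall M, (forall l, A <= M l) -> ((`|ag q u M x - glim x| `^ p)%:E <= W x)%E.
move=> dl0; have t0 : 0 < 2 `^ p :> R by [].
have [A [A0 [W [mW W0 IW] hW]]] := tail_maj c p1 (divr_gt0 dl0 t0) mU uF; exists A.
exists (fun x => ((2 `^ p)%:E * W x)%E); first split.
- exact: emeasurable_funM.
- by move=> x; rewrite mule_ge0.
- rewrite ge0_integralZl//.
 apply: le_trans (lee_wpmul2l _ IW) _ => //.
 by rewrite -EFinM mulrCA divff ?mulr1.
move=> x gx M AM; apply: powR_shift => // b hb b0; apply: (@glim_close x A A) => // M' AM'.
have := hW x gx M' AM'; rewrite -hb lee_fin => h.
rewrite leNgt; apply/negP => h'; move: h; rewrite leNgt => /negP; apply.
exact: gt0_ltr_powR.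
Qed.

Lemma glim_lp : (\int[mu]_x (`|glim x| `^ p)%:E < +oo)%E.
have [C C0 HC] := @maximal_bound R k n p p1.
have [W [mW W0 IW] hW] := HC d s c u F mU uF.
apply: (@le_lt_trans _ _ (C * F)%:E); last exact: ltry.
apply: le_trans IW; apply: lower_integral_le => //.
apply: filterS (good_ae hq (ltW p1) mU (le_lt_trans uF (ltry _))) => x gx.
move: (W0 x); case E : W => [w| |] w0 //; last by rewrite leey.
rewrite lee_fin in w0; have e : (w `^ p^-1) `^ p = w by rewrite -powRrM mulVf ?powRr1// gt_eqF.
rewrite lee_fin -[leRHS]e; apply: powR_mono; [pos|by []|].
rewrite ler_norml; apply: (@glim_itv x 1) => M M1; rewrite -ler_norml.
have := hW x gx M (fun l => lt_le_trans ltr01 (M1 l)); rewrite E lee_fin -[leRHS]e => h.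
rewrite leNgt; apply/negP => h'; move: h; rewrite leNgt => /negP; apply.
by apply: gt0_ltr_powR; rewrite // nnegrE ?powR_ge0.
Qed.

(** The tail majorants have integrals at most 1/(j + 1), so by Fatou's lemma their lower limit
    vanishes almost everywhere; at such a point some majorant is below e^p. *)
Lemma glim_ae : {ae mu, forall x, forall e, 0 < e -> exists A, forall M, (forall l, A <= M l) -> `|ag q u M x - glim x| <= e}.
have d0 j : 0 < j.+1%:R^-1 :> R by [].
have /choice[A /choice[W hW]] j : exists A, exists W : X -> \bar R, Wfun (j.+1%:R^-1) W /\
  forall x, good q u x -> forall M, (forall l, A <= M l) -> ((`|ag q u M x - glim x| `^ p)%:E <= W x)%E.
 by have [A [W h1 h2]] := tail_glim (d0 j); exists A, W.
have mW j : mfunT (W j) by have [[]] := hW j.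
have W0 j x : (0 <= W j x)%E by have [[_ + _] _] := hW j.
pose V x := limn_einf (W^~ x).
have V0 x : (0 <= V x)%E by apply: (@einf_ge _ _ _ 0).
have mV : mfunT V by exact: measurable_einf.
have IV : (\int[mu]_x `|V x| = 0)%E.
 apply/eqP; rewrite eq_le; apply/andP; split; last exact: integral_ge0.
 under eq_integral do rewrite gee0_abs//.
 apply: le_trans (fatou mu _ mW _) _ => //.
 apply/lee_addgt0Pr => e e0; rewrite add0e; apply: (@einf_le _ _ _ (Num.bound e^-1)) => j Nj.
 have [[_ _ IW] _] := hW j; letr IW; rewrite lee_fin -[leRHS]invrK lef_pV2 ?posrE ?invr_gt0//.
 apply: ltW; apply: lt_le_trans (archi_boundP _) _; first pos.
 by rewrite ler_nat leqW.
have /(ae_eq_integral_abs mu measurableT mV) V_0 := IV.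
apply: filterS2 (good_ae hq (ltW p1) mU (le_lt_trans uF (ltry _))) V_0 => x gx /(_ I) Vx e e0.
have [|j Wj] := @einf_lt _ (W^~ x) (e `^ p)%:E; first by rewrite -/(V x) Vx lte_fin powR_gt0.
exists (A j) => M AM; have := (hW j).2 x gx M AM => h.
rewrite leNgt; apply/negP => h'.
have : ((`|ag q u M x - glim x| `^ p)%:E < (e `^ p)%:E)%E by exact: le_lt_trans h Wj.
by rewrite lte_fin ltNge powR_mono// ltW.
Qed.

End limits.

Local Open Scope complex_scope.

(** * The endpoint of essentially bounded functions *)

Section essential_bound.
Context {R : realType} {k d : nat} (s : dsys R d) (q : k.-tuple R -> 'I_d -> R) (hq : mp q).
Notation X := (sX s).
Notation mu := (smu s).
Notation leb := (lebesgue_tuple R k).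
Implicit Types (u : X -> R) (x : X).

Lemma ag_bounded u (B : R) (M : 'I_k -> R) x : mfunT u -> (forall y, `|u y| <= B) -> (forall l, 0 < M l) -> `|ag q u M x| <= B.
move=> mU uB M0; have bu : Bm u by split => //; exists B.
pose b i l := M l * (1 + 2 ^- i).
have Mb i l : M l < b i l by rewrite ltr_pMr// ltrDl.
have lb i : lt_box (fun=> 0) (b i) by move=> l; pos.
have gx : good q u x.
 move=> N; have [->|N0] := posnP N; last first.
  by apply: Bt_integrable; [move=> l; rewrite ltr0n|exact: Bt_slice].
 have lt1 : lt_box (fun=> 0) (fun _ : 'I_k => 1 : R) by [].
 apply: (integrableS (measurable_hb _ _) (measurable_hb _ _) _ (Bt_integrable lt1 (Bt_slice x hq bu))).
 by move=> t h l; have /andP[h1 h2] := h l; rewrite h1 (lt_trans h2).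
have : Av (fun=> 0) (b i) q u x @[i --> \oo] --> ag q u M x.
 apply: ag_cvg => //.
 - by move=> y; exact: cvg_cst.
 - move=> i l; rewrite Mb /b mulrC ler_wpM2r ?(ltW (M0 l))//.
  by rewrite lerD2l invf_le1 ?exprn_gt0// exprn_ege1// ler1n.
 move=> l; rewrite -[X in _ --> X]mulr1; apply: cvgM; first exact: cvg_cst.
 rewrite -[X in _ --> X]addr0; apply: cvgD; first exact: cvg_cst.
 under eq_fun do rewrite -exprVn.
 by apply: cvg_expr; rewrite ger0_norm ?invr_ge0// invf_lt1 ?ltr1n.
move=> /cvg_norm cn; apply: (closed_cvg (fun y => y <= B) _ _ _ cn) => //.
apply: nearW => i; have mA := Av_markov s (lb i) hq.
rewrite -(mk_cst mA B x); apply: le_trans (mk_abs mA x bu) _.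
exact: (mk_le mA x (Bm_norm bu) (Bm_cst s B)).
Qed.

(** By Tonelli's theorem almost every orbit meets the null set E, where |u| > B, in parameters of
    measure zero within every cube, hence within every box; on such orbits u may be replaced by a
    function bounded everywhere. *)
Lemma ag_ae_bounded u (B : R) : mfunT u -> 0 <= B -> {ae mu, forall x, `|u x| <= B} ->
 {ae mu, forall x, forall M, (forall l, 0 < M l) -> `|ag q u M x| <= B}.
move=> mU B0 uB; pose E := [set y | B < `|u y|].
have mE : measurable E.
 rewrite -[E]setTI; apply: (measurable_fun_bool true (f := fun y => B < `|u y|)) => //.
 by apply: measurable_fun_ltr => //; exact: measurableT_comp.
have E0 : mu E = 0.
 apply/eqP; rewrite eq_le measure_ge0 andbT; have [A [mA A0 hA]] := uB; rewrite -A0.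
 by apply: le_measure; rewrite ?inE// => y Ey; apply: hA => /= h; move: Ey; rewrite /E /= ltNge h.
pose w y : \bar R := (\1_E y)%:E.
have mw : mfunT w by apply/measurable_EFinP.
have w0 y : (0 <= w y)%E by rewrite lee_fin.
have mN N := measurable_hb (R := R) (fun=> 0) (fun _ : 'I_k => N%:R).
have hN N : {ae mu, forall x, (\int[leb]_(t in hb (fun=> 0%R) (fun _ : 'I_k => N%:R)) w (sT (q t) x) = 0)%E}.
 have mS := measurable_slice_int hq (mN N) mw w0.
 have : (\int[mu]_x `|\int[leb]_(t in hb (fun=> 0%R) (fun _ : 'I_k => N%:R)) w (sT (q t) x)| = 0)%E.
  under eq_integral do rewrite gee0_abs ?integral_ge0//.
  have Iw : (\int[mu]_y w y = 0)%E by rewrite integral_indic// setIT.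
  by rewrite (slice_tonelli hq N mw w0) Iw mule0.
 by move/(ae_eq_integral_abs mu measurableT mS); apply: filterS => x /(_ I).
apply: filterS (ae_foralln hN) => x hx M M0.
pose u' y := u y * \1_(~` E) y.
have mU' : mfunT u' by apply: measurable_funM => //; apply: measurable_indic; exact: measurableC.
have uB' y : `|u' y| <= B.
 rewrite /u' indicE; have [h|h] := boolP (y \in ~` E); last by rewrite mulr0 normr0.
 by rewrite mulr1 leNgt; apply/negP; exact: set_mem h.
suff -> : ag q u M x = ag q u' M x by exact: ag_bounded.
congr (_ * fine _).
pose N := Num.bound (\sum_l M l).
have cN : cb M `<=` hb (fun=> 0) (fun _ : 'I_k => N%:R).
 move=> t h l; have /andP[-> h2] := h l; rewrite (le_lt_trans h2)//=.
 apply: (@le_lt_trans _ _ (\sum_l M l)); last by apply/archi_boundP/sumr_ge0 => l' _; pos.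
 by rewrite (bigD1 l)//= lerDl; pos.
have mo v : mfunT v -> measurable_fun (cb M) (fun t => (v (sT (q t) x))%:E).
 by move=> mv; apply/measurable_funTS/measurable_EFinP; exact: measurableT_comp mv (measurable_orbit hq x).
apply: ae_eq_integral; [exact: measurable_cb|exact: mo|exact: mo|].
have mwx : measurable_fun (hb (fun=> 0) (fun _ : 'I_k => N%:R)) (fun t => w (sT (q t) x)).
 by apply/measurable_funTS; exact: measurableT_comp mw (measurable_orbit hq x).
have : (\int[leb]_(t in hb (fun=> 0%R) (fun _ : 'I_k => N%:R)) `|w (sT (q t) x)| = 0)%E.
 by rewrite -[RHS](hx N); apply: eq_integral => t _; rewrite gee0_abs.
move/(ae_eq_integral_abs _ (mN N) mwx); apply: filterS => t h /cN /h.
rewrite /w /u' !indicE in_setC; case: (_ \in E) => /= e; last by rewrite mulr1.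
by case: e => /eqP; rewrite oner_eq0.
Qed.

End essential_bound.

(** * The given flows and polynomials as an abstract system *)

Section flow_system.
Context {R : realType} {d : nat} {disp : measure_display} {X : measurableType disp}.
Context (mu : {sigma_finite_measure set X -> \bar R}) (T : 'I_d -> R -> X -> X) (hT : commuting_flows mu T).

Lemma flow_comp_preserving v : measure_preserving mu (flow_comp T v).
have [hf _ _] := hT; rewrite /flow_comp; elim/big_ind: _ => [|f g [mf ff] [mg gg]|i _].
- by [].
- split; first exact: measurableT_comp.
 move=> E mE; rewrite comp_preimage gg ?ff//.
 by rewrite -[X in measurable X]setTI; exact: mf.
- by have [h _ _] := hf i.
Qed.

Lemma flow_compD v w x : flow_comp T v (flow_comp T w x) = flow_comp T (fun i => v i + w i) x.
have [hf hc _] := hT; rewrite /flow_comp.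
have cm r i t z : T i t \o \big[(fun f g => f \o g)/id]_(j <- r) T j (z j) = \big[(fun f g => f \o g)/id]_(j <- r) T j (z j) \o T i t.
 elim: r => [|j r IH]; first by rewrite !big_nil.
 by rewrite big_cons compA hc -compA IH.
suff h r : \big[(fun f g => f \o g)/id]_(i <- r) T i (v i) \o \big[(fun f g => f \o g)/id]_(i <- r) T i (w i) =
  \big[(fun f g => f \o g)/id]_(i <- r) T i (v i + w i) by have := congr1 (fun g => g x) (h (index_enum _)).
elim: r => [|j r IH]; first by rewrite !big_nil.
rewrite !big_cons -IH; have [_ hD _] := hf j; rewrite -hD.
apply/funext => y /=; congr T; exact/esym/(congr1 (fun g => g _) (cm r j _ v)).
Qed.

Lemma flow_comp0 x : flow_comp T (fun=> 0) x = x.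
have [hf _ _] := hT; rewrite /flow_comp; suff -> : \big[(fun f g => f \o g)/id]_(i < d) T i 0 = id by [].
by elim/big_ind: _ => [|f g -> ->|i _] //; have [_ _ ->] := hf i.
Qed.

Definition flow_sys : dsys R d := @DSys R d disp X mu (flow_comp T) (let: And3 _ _ h := hT in h)
 (fun v E mE => (flow_comp_preserving v).2 E mE) flow_compD flow_comp0.

End flow_system.

Section coefficients.
Context {R : realType} {d k : nat} (P : 'I_d -> mpoly.mpoly k R).
Notation n := (family_deg P).

(** Written as a sum over the support so that no multinomial has to be built from g; at most one
    term is present, since exponents determine a multinomial. *)
Definition coefs (g : Ix k n) (i : 'I_d) : R :=
 \sum_(m <- mpoly.msupp (P i) | [forall l, mpoly.fun_of_multinom m l == g l :> nat]) mpoly.mcoeff m (P i).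

Lemma mpol_coefs t i : mpol finset.setT coefs t i = mpoly.meval (tnth t) (P i).
rewrite mpoly.mevalE /mpol /coefs [RHS]big_tnth; under eq_bigr do rewrite big_tnth big_distrr /=.
rewrite (exchange_big_dep xpredT)//=; apply: eq_bigr => j _; set m := tnth _ j.
have mn l : (mpoly.fun_of_multinom m l <= n)%N.
 apply: (@leq_trans (mpoly.mdeg m)); first by rewrite mpoly.mdegE (bigD1 l)//= leq_addr.
 apply: leq_trans (leq_bigmax i).
 by rewrite big_tnth; apply: (leq_bigmax (F := fun j => mpoly.mdeg (tnth _ j))).
pose g : Ix k n := [ffun l => inord (mpoly.fun_of_multinom m l)].
have gE l : g l = mpoly.fun_of_multinom m l :> nat by rewrite ffunE inordK// ltnS.
rewrite (big_pred1 g) => [|h].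
 by rewrite mulrC; congr (_ * _); apply: eq_bigr => l _; rewrite gE.
rewrite finset.in_setT; apply/forallP/eqP => [h'|-> l]; last by rewrite gE.
by apply/ffunP => l; apply/val_inj; rewrite /= gE; apply/esym/eqP.
Qed.

End coefficients.
Arguments coefs {R d k} P.

Local Open Scope complex_scope.

(** * Complex functions and assembly of the four statements *)

Section modulus.
Context {R : realType}.
Implicit Types z : R[i].

Lemma Re_le_normc z : `|complex.Re z| <= Normc.normc z.
by case: z => a b /=; rewrite -sqrtr_sqr ler_wsqrtr// lerDl sqr_ge0. Qed.

Lemma Im_le_normc z : `|complex.Im z| <= Normc.normc z.
by case: z => a b /=; rewrite -sqrtr_sqr ler_wsqrtr// lerDr sqr_ge0. Qed.

Lemma normc_ge0 z : 0 <= Normc.normc z.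
by case: z => a b; exact: sqrtr_ge0. Qed.

Lemma normc_le z : Normc.normc z <= `|complex.Re z| + `|complex.Im z|.
case: z => a b /=.
rewrite -[leRHS](ger0_norm (addr_ge0 (normr_ge0 a) (normr_ge0 b))) -sqrtr_sqr; apply: ler_wsqrtr.
by rewrite sqrrD !real_normK ?num_real// addrAC lerDl.
Qed.

Lemma sqrte_le S (B : R) : 0 <= B -> (S <= (B ^+ 2)%:E)%E -> (sqrte S <= B%:E)%E.
by move=> B0; case: S => [y| |] //=; rewrite !lee_fin => /ler_wsqrtr; rewrite sqrtr_sqr ger0_norm.
Qed.

Lemma powR_normc z (p : R) : 0 <= p -> Normc.normc z `^ p <= 2 `^ p * (`|complex.Re z| `^ p + `|complex.Im z| `^ p).
move=> p0; apply: le_trans (powR_add p0 (normr_ge0 _) (normr_ge0 _)).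
by apply: powR_mono => //; [exact: normc_ge0|exact: normc_le].
Qed.

Lemma measurable_normc d (X : measurableType d) (f : X -> R[i]) : mfunT (fun x => complex.Re (f x)) ->
 mfunT (fun x => complex.Im (f x)) -> mfunT (fun x => Normc.normc (f x)).
move=> mr mi; rewrite (_ : (fun x => _) = fun x => Num.sqrt (complex.Re (f x) ^+ 2 + complex.Im (f x) ^+ 2)).
 apply: measurableT_comp; first by apply: continuous_measurable_fun; exact: sqrt_continuous.
 by apply: measurable_funD; exact: measurable_funX.
by ext x; case: (f x).
Qed.

End modulus.

Section averages.
Context {R : realType} {d k : nat} {disp : measure_display} {X : measurableType disp}.
Context (mu : {sigma_finite_measure set X -> \bar R}) (T : 'I_d -> R -> X -> X) (hT : commuting_flows mu T).
Context (P : 'I_d -> mpoly.mpoly k R) (f : X -> R[i]).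
Notation s := (flow_sys hT).
Notation q := (mpolT (coefs P)).
Notation u := (fun x : sX s => complex.Re (f x) : R).
Notation v := (fun x : sX s => complex.Im (f x) : R).
Notation A := (ergodic_avg T P f).

Lemma ergodic_avgE M x : A M x = ag q u (tnth M) x +i* ag q v (tnth M) x.
have E : (fun t => f (flow_comp T (fun i => mpoly.meval (tnth t) (P i)) x)) = (fun t => f (@sT R d s (q t) x)).
 by ext t; congr (f (flow_comp T _ x)); ext i; rewrite mpol_coefs.
rewrite /ergodic_avg E /ag; apply/eqP; rewrite eq_complex /=.
by rewrite !mul0r subr0 addr0 !eqxx.
Qed.

Lemma ReA M x : complex.Re (A M x) = ag q u (tnth M) x. Proof. by rewrite ergodic_avgE. Qed.
Lemma ImA M x : complex.Im (A M x) = ag q v (tnth M) x. Proof. by rewrite ergodic_avgE. Qed.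

Section finite_exponent.
Context (r : R) (r1 : 1 < r) (hf : cLfun mu r%:E f).
Let r0 : 0 < r := lt_trans ltr01 r1.
Let rn : r != 0 := lt0r_neq0 r0.

Definition nf : R := fine (cLnorm mu r%:E f).

Lemma nfE : cLnorm mu r%:E f = nf%:E.
by have [_ _ h] := hf; rewrite fineK// ge0_fin_numE// Lnorm_ge0. Qed.

Lemma nf_ge0 : 0 <= nf. Proof. by apply: fine_ge0; exact: Lnorm_ge0. Qed.

Lemma mRe : mfunT u. Proof. by have [] := hf. Qed.
Lemma mIm : mfunT v. Proof. by have [] := hf. Qed.

Lemma normc_int : (\int[mu]_x (Normc.normc (f x) `^ r)%:E = (nf `^ r)%:E)%E.
rewrite -poweR_EFin -nfE /cLnorm (poweR_Lnorm _ _ rn); apply: eq_integral => x _.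
by rewrite gee0_abs ?lee_fin ?normc_ge0.
Qed.

Lemma Re_int : (\int[smu s]_x (`|u x| `^ r)%:E <= (nf `^ r)%:E)%E.
rewrite -normc_int; apply: integral_mono.
- by apply: (measurableT_comp (measurable_powR r)); apply: measurableT_comp => //; exact: mRe.
- by apply: (measurableT_comp (measurable_powR r)); apply: measurable_normc; [exact: mRe|exact: mIm].
by move=> x; rewrite powR_ge0 powR_mono ?Re_le_normc// ltW.
Qed.

Lemma Im_int : (\int[smu s]_x (`|v x| `^ r)%:E <= (nf `^ r)%:E)%E.
rewrite -normc_int; apply: integral_mono.
- by apply: (measurableT_comp (measurable_powR r)); apply: measurableT_comp => //; exact: mIm.
- by apply: (measurableT_comp (measurable_powR r)); apply: measurable_normc; [exact: mRe|exact: mIm].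
by move=> x; rewrite powR_ge0 powR_mono ?Im_le_normc// ltW.
Qed.

Lemma goods : {ae mu, forall x, good q u x /\ good q v x}.
have h1 := good_ae (mp_mpol finset.setT (coefs P)) (ltW r1) mRe (le_lt_trans Re_int (ltry _)).
have h2 := good_ae (mp_mpol finset.setT (coefs P)) (ltW r1) mIm (le_lt_trans Im_int (ltry _)).
exact: filterS2 h1 h2.
Qed.

(** Real and imaginary parts have separate majorants, both measured by the norm of f itself; [2 ^ r]
    is the cost of recombining them. *)
Lemma Lnorm_bound (C : R) (h : X -> \bar R) (W W' : X -> \bar R) : 0 <= C ->
 @Wfun R d s (C * nf `^ r) W -> @Wfun R d s (C * nf `^ r) W' ->
 {ae mu, forall x, (`|h x| `^ r <= (2 `^ r)%:E * (W x + W' x))%E} ->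
 ('N[mu]_r%:E[h] <= ((2 `^ r * (C + C)) `^ r^-1)%:E * cLnorm mu r%:E f)%E.
move=> C0 wW wW' hW; have := Wfun_Lnorm r0 (Wfun_comb (powR_ge0 2 r) wW wW') hW.
congr (_ <= _)%E; rewrite nfE; congr EFin.
by rewrite -mulrDl mulrA powRM ?mulr_ge0 ?addr_ge0 ?powR_ge0// -powRrM mulfV// powRr1// nf_ge0.
Qed.

Lemma ae_cvg : {ae mu, forall x, cvg ((ergodic_avg T P f M x : R[i]^o) @[M --> min_pinfty R k])}.
have h1 := glim_ae (coefs P) r1 mRe Re_int; have h2 := glim_ae (coefs P) r1 mIm Im_int.
apply: filterS2 h1 h2 => x h1 h2; apply/cvg_ex; exists (glim (coefs P) u x +i* glim (coefs P) v x).
apply/cvgrPdist_le => e e0.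
have [eR e0'] : e = (complex.Re e)%:C /\ 0 < complex.Re e.
 by move: e0; rewrite ltcE => /andP[/eqP e1 e2]; split => //; case: e e1 e2 => a b /= -> _.
have e2 : 0 < complex.Re e / 2 by rewrite divr_gt0.
have [A1 hA1] := h1 _ e2; have [A2 hA2] := h2 _ e2.
exists (Num.max A1 A2) => M hM.
have [hM1 hM2] : (forall l, A1 <= tnth M l) /\ (forall l, A2 <= tnth M l).
 by split => l; have := hM l; rewrite gt_max => /andP[a b]; pos.
rewrite eR lecR; apply: le_trans (normc_le _) _; rewrite ergodic_avgE /=.
by rewrite [leRHS]splitr; apply: lerD; rewrite distrC; [exact: hA1|exact: hA2].
Qed.

Lemma lp_cvg : exists2 g, cLfun mu r%:E g &
     cLnorm mu r%:E (fun x => ergodic_avg T P f M x - g x)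
      @[M --> min_pinfty R k] --> 0%E.
pose gu : sX s -> R := glim (coefs P) u; pose gv : sX s -> R := glim (coefs P) v.
pose g (x : X) : R[i] := gu x +i* gv x.
have mgu : mfunT gu := measurable_glim (coefs P) mRe.
have mgv : mfunT gv := measurable_glim (coefs P) mIm.
have bnd h B B' (W W' : X -> \bar R) : @Wfun R d s B W -> @Wfun R d s B' W' ->
  {ae mu, forall x, ((`|complex.Re (h x)| `^ r)%:E <= W x)%E /\ ((`|complex.Im (h x)| `^ r)%:E <= W' x)%E} ->
  (cLnorm mu r%:E h <= ((2 `^ r * (B + B')) `^ r^-1)%:E)%E.
 move=> wW wW' hW; apply: (Wfun_Lnorm r0 (Wfun_comb (powR_ge0 2 r) wW wW')).
 apply: filterS hW => x [h1 h2]; rewrite gee0_abs ?lee_fin ?normc_ge0// poweR_EFin.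
 apply: (@le_trans _ _ (2 `^ r * (`|complex.Re (h x)| `^ r + `|complex.Im (h x)| `^ r))%:E).
  by rewrite lee_fin powR_normc// ltW.
 by rewrite EFinM EFinD; apply: lee_wpmul2l => //; exact: leeD.
exists g.
 split; [exact: mgu|exact: mgv|]; pose Wt (w : sX s -> R) (x : sX s) := (`|w x| `^ r)%:E.
 have hWt (w : sX s -> R) : mfunT w -> (\int[smu s]_x (`|w x| `^ r)%:E < +oo)%E ->
   @Wfun R d s (fine (\int[smu s]_x (`|w x| `^ r)%:E)) (Wt w).
  move=> mw Iw; split; [|by move=> x; rewrite lee_fin|].
   by apply/measurable_EFinP; apply: (measurableT_comp (measurable_powR r)); exact: measurableT_comp.
  by rewrite fineK// ge0_fin_numE// integral_ge0// => x _.
 apply: le_lt_trans (bnd _ _ _ _ _ (hWt gu mgu (glim_lp _ r1 mRe Re_int)) (hWt gv mgv (glim_lp _ r1 mIm Im_int)) _) (ltry _).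
 exact: aeW.
have key (e : R) : 0 < e -> exists A0 : R, forall M : k.-tuple R, (forall l, A0 < tnth M l) ->
  (cLnorm mu r%:E (fun x => (ergodic_avg T P f M x - g x)%R) <= e%:E)%E.
 move=> e0; pose dl := e `^ r / 2 `^ r / 2.
 have dl0 : 0 < dl by rewrite !divr_gt0 ?powR_gt0.
 have [A1 [W1 wW1 hW1]] := tail_glim (coefs P) r1 mRe Re_int dl0.
 have [A2 [W2 wW2 hW2]] := tail_glim (coefs P) r1 mIm Im_int dl0.
 exists (Num.max A1 A2) => M hM.
 have [hM1 hM2] : (forall l, A1 <= tnth M l) /\ (forall l, A2 <= tnth M l).
  by split => l; have := hM l; rewrite gt_max => /andP[a b]; pos.
 have -> : e = (2 `^ r * (dl + dl)) `^ r^-1.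
  by rewrite -splitr mulrC divfK ?powR_gt0// -powRrM mulfV// powRr1// ltW.
 apply: bnd wW1 wW2 _; apply: filterS goods => x [gx1 gx2]; rewrite ergodic_avgE /=.
 by split; [exact: hW1|exact: hW2].
apply/fine_cvgP; split.
 have [A0 hA0] := key 1 ltr01; exists A0 => M /hA0 h.
 by rewrite ge0_fin_numE ?Lnorm_ge0// (le_lt_trans h)// ltry.
apply/cvgrPdist_le => e e0; have [A0 hA0] := key e e0; exists A0 => M /hA0 h /=.
rewrite sub0r normrN ger0_norm ?fine_ge0 ?Lnorm_ge0// -lee_fin fineK//.
by rewrite ge0_fin_numE ?Lnorm_ge0// (le_lt_trans h)// ltry.
Qed.

End finite_exponent.

Lemma maximal_infty : cLfun mu +oo f ->
  ('N[mu]_+oo[(fun x => ereal_sup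
      [set (Normc.normc (ergodic_avg T P f M x))%:E | M in pos_orthant R k])]
     <= 2%:E * cLnorm mu +oo f)%E.
move=> [mr mi hf]; have n0 : (0 <= cLnorm mu +oo f)%E := Lnorm_ge0 _ _ _.
have [B BE] : exists B : R, cLnorm mu +oo f = B%:E by exists (fine (cLnorm mu +oo f)); rewrite fineK// ge0_fin_numE.
have B0 : 0 <= B by rewrite -lee_fin -BE.
(* On a space of measure zero the norm for [+oo] is 0; otherwise it is an essential supremum. *)
rewrite BE unlock /=; case: ifPn => [m0|_]; last pos.
have fB : {ae mu, forall x, Normc.normc (f x) <= B}.
 have : (ess_sup mu (abse \o (fun x => (Normc.normc (f x))%:E)) <= B%:E)%E.
  by rewrite -BE /cLnorm unlock m0.
 by move/ess_supP; apply: filterS => x /=; rewrite ger0_norm// normc_ge0.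
have h1 : {ae smu s, forall x, forall M, (forall l, 0 < M l) -> `|ag q u M x| <= B}.
 apply: (ag_ae_bounded (mp_mpol _ _)) => //.
 by apply: filterS fB => x; apply: le_trans; exact: Re_le_normc.
have h2 : {ae smu s, forall x, forall M, (forall l, 0 < M l) -> `|ag q v M x| <= B}.
 apply: (ag_ae_bounded (mp_mpol _ _)) => //.
 by apply: filterS fB => x; apply: le_trans; exact: Im_le_normc.
apply/ess_supP; apply: filterS2 h1 h2 => x h1 h2 /=.
have hM M : pos_orthant R k M -> (Normc.normc (ergodic_avg T P f M x) <= 2 * B).
 move=> M0; apply: le_trans (normc_le _) _; rewrite ReA ImA mulr_natl mulr2n.
 by apply: lerD; [exact: h1|exact: h2].
rewrite gee0_abs; first by apply: ge_ereal_sup => _ [M M0 <-]; exact: hM.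
have p1 : pos_orthant R k [tuple 1 | j < k] by move=> j; rewrite tnth_mktuple.
apply: (@le_trans _ _ (Normc.normc (ergodic_avg T P f [tuple 1 | j < k] x))%:E); first by rewrite lee_fin normc_ge0.
by apply: ereal_sup_ubound; exists [tuple 1 | j < k].
Qed.

End averages.

(** The constant is chosen from k, the degree n and r, before the flows and the coefficients. The
    condition [1 < r] stands after it so that a single choice can be made for all r. *)
Lemma maximal_finite R k n r : exists C, forall d disp (X : measurableType disp)
 (mu : {sigma_finite_measure set X -> \bar R}) T (P : 'I_d -> mpoly.mpoly k R) f,
 1 < r -> family_deg P = n -> commuting_flows mu T -> cLfun mu r%:E f ->
 ('N[mu]_r%:E[(fun x => ereal_sup [set (Normc.normc (ergodic_avg T P f M x))%:E | M in pos_orthant R k])]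
     <= C%:E * cLnorm mu r%:E f)%E.
have [r1|r1] := boolP (1 < r); last by exists 0.
have [C C0 HC] := @maximal_bound R k n r r1; have r0 := lt_trans ltr01 r1.
exists ((2 `^ r * (C + C)) `^ r^-1) => d disp X mu T P f _ nE hT hf; subst n.
have [W wW hW] := HC d (flow_sys hT) (coefs P) _ _ (mRe hf) (Re_int hT r1 hf).
have [V wV hV] := HC d (flow_sys hT) (coefs P) _ _ (mIm hf) (Im_int hT r1 hf).
apply: (Lnorm_bound r1 hf (ltW C0) wW wV); apply: filterS (goods hT P r1 hf) => x [g1 g2].
have -> : [set (Normc.normc (ergodic_avg T P f M x))%:E | M in pos_orthant R k] =
  EFin @` [set Normc.normc (ergodic_avg T P f M x) | M in pos_orthant R k] by rewrite image_comp.
have [_ W0 _] := wW; have [_ V0 _] := wV.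
apply: powR_sup => //.
- by exists (Normc.normc (ergodic_avg T P f [tuple 1 | j < k] x)), [tuple 1 | j < k] => // j; rewrite tnth_mktuple.
- by move=> _ [M _ <-]; exact: normc_ge0.
- by rewrite mule_ge0 ?powR_ge0// adde_ge0.
move=> _ [M M0 <-]; apply: le_trans (_ : _ <= (2 `^ r * (`|complex.Re (ergodic_avg T P f M x)| `^ r + `|complex.Im (ergodic_avg T P f M x)| `^ r))%:E)%E _.
 by rewrite lee_fin powR_normc// ltW.
rewrite EFinM EFinD (ReA hT) (ImA hT); apply: lee_wpmul2l => //.
by apply: leeD; [exact: hW|exact: hV].
Qed.

(** A point with infinite majorant is trivial; elsewhere [sum_sup_le] reduces the seminorm to
    selections of one box per block, which the majorants of [chain_osc] for the two parts
    dominate. *)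
Lemma oscillation_finite R k n r : exists C, forall d disp (X : measurableType disp)
 (mu : {sigma_finite_measure set X -> \bar R}) T (P : 'I_d -> mpoly.mpoly k R) f J I,
 1 < r -> family_deg P = n -> commuting_flows mu T -> cLfun mu r%:E f -> osc_seq R J k I ->
 ('N[mu]_r%:E[(fun x => osc2 I (fun M => ergodic_avg T P f M x))] <= C%:E * cLnorm mu r%:E f)%E.
have [r1|r1] := boolP (1 < r); last by exists 0.
have [C C0 HC] := @chain_osc R k n r r1; have r0 := lt_trans ltr01 r1.
exists ((2 `^ r * (C + C)) `^ r^-1) => d disp X mu T P f J I _ nE hT hf [I0 IS]; subst n.
(* The finite sequence is continued by its last entry, so that blocks are indexed by all natural
   numbers. *)
pose I' t : 'I_k -> R := tnth (I (inord (minn t J))).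
(* A positive lower bound for all coordinates of the first box, since the sum contains the inverse
   of each of them. *)
pose y0 : R := (1 + \sum_l (I' 0%N l)^-1)^-1.
have ip l : 0 < (I' 0%N l)^-1 by rewrite invr_gt0; exact: I0.
have IE1 (t : 'I_J) : I' t = tnth (I (widen_ord (leqnSn J) t)).
 by congr (tnth (I _)); apply/val_inj; rewrite /= inordK ?(minn_idPl (ltnW _))// ltnS ltnW.
have IE2 (t : 'I_J) : I' t.+1 = tnth (I (lift ord0 t)).
 by congr (tnth (I _)); apply/val_inj; rewrite /= inordK ?(minn_idPl _)// ltnS.
have mI t l : I' t l <= I' t.+1 l.
 have [tJ|tJ] := ltnP t J; last by rewrite /I' (minn_idPr tJ) (minn_idPr (leqW tJ)).
 by have := IS (Ordinal tJ) l; rewrite -IE1 -IE2 => /ltW.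
have cI : chain_cond y0 I' J.
 have s0 : 0 <= \sum_l (I' 0%N l)^-1 by apply: sumr_ge0 => l _; pos.
 split => [|l|//|t l]; first by rewrite invr_gt0 ltr_wpDr.
  rewrite -[leRHS]invrK lef_pV2 ?posrE ?ltr_wpDr//.
  by rewrite (bigD1 l)//= addrCA lerDl addr_ge0// sumr_ge0// => l' _; pos.
 have [tJ|tJ] := leqP t J; last by rewrite /I' (minn_idPr (ltnW tJ)) minnn.
 exact: (homo_leq (f := fun t => I' t l) _ (fun y x z => @le_trans _ _ y x z)).
have [W wW hW] := HC d (flow_sys hT) (coefs P) _ _ y0 J I' (mRe hf) (Re_int hT r1 hf) cI.
have [V wV hV] := HC d (flow_sys hT) (coefs P) _ _ y0 J I' (mIm hf) (Im_int hT r1 hf) cI.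
apply: (Lnorm_bound r1 hf (ltW C0) wW wV); apply: filterS (goods hT P r1 hf) => x [g1 g2].
have [_ W0 _] := wW; have [_ V0 _] := wV.
have : (0 <= (2 `^ r)%:E * (W x + V x))%E by rewrite mule_ge0 ?powR_ge0// adde_ge0.
case E : ((2 `^ r)%:E * (W x + V x))%E => [w| |] // w0; last by rewrite leey.
rewrite lee_fin in w0; pose B := w `^ r^-1; have B0 : 0 <= B by exact: powR_ge0.
have Br : B `^ r = w by rewrite -powRrM mulVf ?gt_eqF// powRr1.
pose dif t M := ergodic_avg T P f M x - ergodic_avg T P f (I (widen_ord (leqnSn J) t)) x.
have hS : (\sum_(t < J) ereal_sup [set ((Normc.normc (dif t M)) ^+ 2)%:E | M in hobox (I (widen_ord (leqnSn J) t)) (I (lift ord0 t))] <= (B ^+ 2)%:E)%E.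
 apply: (sum_sup_le (g := fun t M => (Normc.normc _) ^+ 2)) => [t|t M|M hM].
 - exists (I (widen_ord (leqnSn J) t)) => l; rewrite lexx; exact: IS.
 - nra.
 rewrite -nrm_sqr ler_pXn2r ?nnegrE ?nrm_ge0//.
 rewrite leNgt; apply/negP => h.
 have : w < nrm (index_enum 'I_J) (fun t => Normc.normc (dif t (M t))) `^ r.
  by rewrite -Br; apply: gt0_ltr_powR; rewrite ?nnegrE ?nrm_ge0.
 rewrite -lte_fin ltNge => /negP; apply; rewrite -E.
 have bt (t : 'I_J) : between I' t (tnth (M t)).
  by split => l; have /andP[h1 h2] := hM t l; [rewrite IE1|rewrite IE2 ltW].
 have h1 : ((nrm (index_enum 'I_J) (fun t => complex.Re (dif t (M t))) `^ r)%:E <= W x)%E.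
  rewrite (_ : (fun t => _) = fun t => complex.Re (ergodic_avg T P f (M t) x) - complex.Re (ergodic_avg T P f (I (widen_ord (leqnSn J) t)) x)).
   under eq_fun do rewrite !(ReA hT) -IE1; exact: (hW x g1 (fun t => tnth (M t)) bt).
  by ext t; rewrite raddfB.
 have h2 : ((nrm (index_enum 'I_J) (fun t => complex.Im (dif t (M t))) `^ r)%:E <= V x)%E.
  rewrite (_ : (fun t => _) = fun t => complex.Im (ergodic_avg T P f (M t) x) - complex.Im (ergodic_avg T P f (I (widen_ord (leqnSn J) t)) x)).
   under eq_fun do rewrite !(ImA hT) -IE1; exact: (hV x g2 (fun t => tnth (M t)) bt).
  by ext t; rewrite raddfB.
 apply: le_trans (lee_wpmul2l _ (leeD h1 h2)) => //.
 apply: le_trans (powR_add (ltW r0) (nrm_ge0 _ _) (nrm_ge0 _ _)).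
 apply: powR_mono; [pos|pos|].
 rewrite -(nrm_abs _ (fun t => complex.Re _)) -(nrm_abs _ (fun t => complex.Im _)).
 apply: le_trans (nrmD _ _ _); apply: nrm_le => t; rewrite ger0_norm ?normc_ge0//; exact: normc_le.
have s0 : (0 <= osc2 I (fun M => ergodic_avg T P f M x))%E by exact: sqrte_ge0.
rewrite gee0_abs// -Br -poweR_EFin; apply: gt0_ler_poweR; [pos|by rewrite in_itv /= s0 leey|by rewrite in_itv /= lee_fin B0 leey|].
exact: sqrte_le B0 hS.
Qed.

Theorem theorem1p5 (R : realType) (d k : nat) (hd : (0 < d)%N) (hk : (0 < k)%N) :
  exists C_max C_osc : \bar R -> nat -> R,
  forall (disp : measure_display) (X : measurableType disp)
    (mu : {sigma_finite_measure set X -> \bar R})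
    (T : 'I_d -> R -> X -> X) (P : 'I_d -> mpoly.mpoly k R)
    (p : \bar R) (f : X -> R[i]),
  commuting_flows mu T -> (1 <= p)%E -> cLfun mu p f ->
  [/\ ((1 < p < +oo)%E ->
        exists2 g : X -> R[i], cLfun mu p g &
          cLnorm mu p (fun x => ergodic_avg T P f M x - g x)
            @[M --> min_pinfty R k] --> 0%E),
      ((1 < p < +oo)%E ->
        {ae mu, forall x,
          cvg ((ergodic_avg T P f M x : R[i]^o) @[M --> min_pinfty R k])}),
      ((1 < p)%E ->
        ('N[mu]_p[(fun x => ereal_sup
            [set (Normc.normc (ergodic_avg T P f M x))%:E | M in pos_orthant R k])]
         <= (C_max p (family_deg P))%:E * cLnorm mu p f)%E) &
      ((1 < p < +oo)%E ->
        (ereal_sup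
          [set ereal_sup
            [set 'N[mu]_p[(fun x => osc2 I (fun M => ergodic_avg T P f M x))]
            | I in osc_seq R J k]
          | J in [set J | (0 < J)%N]]
         <= (C_osc p (family_deg P))%:E * cLnorm mu p f)%E)].
Proof.
have [K hK] := choice (fun rn : R * nat => @maximal_finite R k rn.2 rn.1).
have [L hL] := choice (fun rn : R * nat => @oscillation_finite R k rn.2 rn.1).
(* At [+oo] the constant 2 adds the bounds for the real and the imaginary part. *)
exists (fun p n => if p is r%:E then K (r, n) else 2), (fun p n => if p is r%:E then L (r, n) else 2).
move=> disp X mu T P [r| |] f hT p1 hf; [|split => //; [..|by move=> _; exact: maximal_infty|]|by []].
have r1 : (1 < r%:E)%E -> 1 < r by [].
split.
- by move=> /andP[/r1 h _]; exact: lp_cvg.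
- by move=> /andP[/r1 h _]; exact: (ae_cvg hT P h).
- by move=> /r1 h; exact: hK (r, _) d disp X mu T P f h erefl hT hf.
move=> /andP[/r1 h _]; apply: ge_ereal_sup => _ [J _ <-]; apply: ge_ereal_sup => _ [I hI <-].
exact: hL (r, _) d disp X mu T P f J I h erefl hT hf hI.
- by rewrite andbF.
- by rewrite andbF.
- by rewrite andbF.
Qed.
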